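(* Let $\mathcal{A}$ be a unital separable Fréchet locally $C^*$-algebra whose topology is given by the family of $C^*$-seminorms $\Gamma=\{p_m\}_{m\ge 1}$, and let $\mathcal{S}\subseteq\mathcal{A}$ be a local operator system which generates $\mathcal{A}$. Let $Ch_\Gamma(\mathcal{S})$ be the collection of all $\Gamma$-boundary representations for $\mathcal{S}$. Then $$\mathcal{J}:=\bigcap_{\pi\in Ch_\Gamma(\mathcal{S})}\ker\pi$$ is the Shilov boundary ideal for $\mathcal{S}$.
   Context: **Locally $C^*$-algebras.** All algebras are unital over $\mathbb{C}$. A $C^*$-seminorm on a unital $*$-algebra $\mathcal{A}$ is a seminorm $p$ with $p(1_{\mathcal{A}})=1$, $p(ab)\le p(a)p(b)$ and $p(a^*a)=p(a)^2$. A Fréchet locally $C^*$-algebra is a complete Hausdorff topological $*$-algebra whose topology is determined by a countable family $\{p_m\}_{m\ge1}$ of continuous $C^*$-seminorms; the family is taken to be upward filtered, i.e. $p_1\le p_2\le\cdots$. It is separable if it has a countable dense subset. $M_n(\mathcal{A})$ is again a Fréchet locally $C^*$-algebra with the associated seminorms $p_m^n$: $p_m^n([a_{ij}])$ is the norm of $[a_{ij}+\ker p_m]$ in $M_n(\mathcal{A}_m)$, where $\mathcal{A}_m=\mathcal{A}/\ker p_m$ is the $C^*$-algebra with norm induced by $p_m$. **Local operator systems.** A local operator system is a self-adjoint linear subspace $\mathcal{S}$ of $\mathcal{A}$ containing $1_{\mathcal{A}}$. It generates $\mathcal{A}$ if $\mathcal{A}$ is the smallest closed $*$-subalgebra of $\mathcal{A}$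 containing $\mathcal{S}$. **Boundary ideals.** For a closed two-sided $*$-ideal $\mathcal{I}$ of $\mathcal{A}$, the quotient $\mathcal{A}/\mathcal{I}$ is a Fréchet locally $C^*$-algebra with the seminorms $\widehat{p}_m(a+\mathcal{I})=\inf\{p_m(a+b): b\in\mathcal{I}\}$. $\mathcal{I}$ is a boundary ideal for $\mathcal{S}$ if the canonical map $\sigma_{\mathcal{I}}:\mathcal{A}\to\mathcal{A}/\mathcal{I}$ is local completely isometric on $\mathcal{S}$, i.e. $\widehat{p}_m^{\,n}([\sigma_{\mathcal{I}}(s_{ij})])=p_m^n([s_{ij}])$ for all $[s_{ij}]\in M_n(\mathcal{S})$, $n\ge1$, $m\ge1$. The Shilov boundary ideal for $\mathcal{S}$ is a boundary ideal for $\mathcal{S}$ that contains every other boundary ideal for $\mathcal{S}$. **$m$-positivity and $p_m$-boundary representations.** An element $a\in M_n(\mathcal{A})$ is $m$-positive if $a=b^*b+c$ with $b,c\in M_n(\mathcal{A})$ and $p_m^n(c)=0$; write $a=_m0$ if $p_m^n(a)=0$. Let $\mathcal{T}$ be a local operator system in $\mathcal{A}$ (possibly $\mathcal{A}$ itself) and $\mathcal{H}$ a Hilbert space. A linear map $\varphi:\mathcal{T}\to B(\mathcal{H})$ is an $m$-$\mathcal{CP}$ map if for all $n\ge1$, $[\varphi(a_{ij})]$ is positive in $B(\mathcal{H}^{\oplus n})$ whenever $[a_{ij}]\in M_n(\mathcal{T})$ is $m$-positive, and $[\varphi(a_{ij})]=0$ whenever $[a_{ij}]=_m0$. A linear map $\pi:\mathcal{A}\to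 B(\mathcal{H})$ is a $p_m$-boundary representation for $\mathcal{S}$ if (1) $\pi$ is an irreducible representation and (2) $\pi$ is the unique unital $m$-$\mathcal{CP}$ map on $\mathcal{A}$ that extends $\pi|_{\mathcal{S}}$. **Quantized domains.** A Fréchet quantized domain in a Hilbert space $\mathcal{H}$ is a triple $\{\mathcal{H};\mathcal{E};\mathcal{D}\}$, where $\mathcal{E}=\{\mathcal{H}_m\}_{m\ge1}$ is an increasing sequence of closed subspaces of $\mathcal{H}$ and $\mathcal{D}=\bigcup_m\mathcal{H}_m$ is dense in $\mathcal{H}$. $C^*_{\mathcal{E}}(\mathcal{D})$ is the set of linear operators $T:\mathcal{D}\to\mathcal{D}$ such that for all $m$: $T(\mathcal{H}_m)\subseteq\mathcal{H}_m$, $T(\mathcal{H}_m^\perp\cap\mathcal{D})\subseteq\mathcal{H}_m^\perp\cap\mathcal{D}$ and $T|_{\mathcal{H}_m}\in B(\mathcal{H}_m)$. It is a locally $C^*$-algebra with involution the restriction to $\mathcal{D}$ of the Hilbert space adjoint, and seminorms $\|T\|_m=\|T|_{\mathcal{H}_m}\|$. A local representation of $\mathcal{A}$ is a $*$-homomorphism $\pi:\mathcal{A}\to C^*_{\mathcal{E}}(\mathcal{D})$ such that for each $l$ there is $m$ with $\|\pi(a)\|_l\le p_m(a)$ for all $a\in\mathcal{A}$. Put $\mathcal{K}_1=\mathcal{H}_1$ and $\mathcal{K}_m=\mathcal{H}_{m-1}^\perp\cap\mathcal{H}_m$ for $m\ge2$, and let $\pi_m:\mathcal{A}\to B(\mathcal{K}_m)$,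 $\pi_m(a)=\pi(a)|_{\mathcal{K}_m}$. **$\Gamma$-boundary representations.** A local representation $\pi:\mathcal{A}\to C^*_{\mathcal{E}}(\mathcal{D})$ on some Fréchet quantized domain is a $\Gamma$-boundary representation for $\mathcal{S}$ if for each $m\ge1$, $\pi_m$ is a $p_m$-boundary representation for $\mathcal{S}$. *)

(* Defs.v *)
From HB Require Import structures.
From mathcomp Require Import all_boot all_order all_algebra.
From mathcomp Require Import sesquilinear complex.
From mathcomp Require Import all_classical all_reals all_analysis.

Set Implicit Arguments.
Unset Strict Implicit.
Unset Printing Implicit Defensive.

Import Order.TTheory GRing.Theory Num.Theory.
Import numFieldNormedType.Exports.

Local Open Scope classical_set_scope.
Local Open Scope ring_scope.
Local Open Scope complex_scope.

(* The scalars are R[i] with R : realType. Sequences indexed by m >= 1 in the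
   mathematics are indexed by nat here, index m standing for m + 1; likewise
   the matrix sizes n >= 1 are written n.+1. *)

Definition linear_subspace (K : pzRingType) (V : lmodType K) (L : set V) :=
  L 0 /\ forall (c : K) (x y : V), L x -> L y -> L (c *: x + y).

(* The operations are explicit because 'M[A]_n is not registered as an
   R[i]-module; unitality p 1 = 1 is required separately. *)
Definition is_cstar_seminorm (R : realType) (V : zmodType)
    (scale : R[i] -> V -> V) (mul : V -> V -> V) (star : V -> V)
    (q : V -> R) :=
  [/\ forall x y, q (x + y) <= q x + q y,
      forall c x, (q (scale c x))%:C = `|c| * (q x)%:C,
      forall x y, q (mul x y) <= q x * q y
    & forall x, q (mul (star x) x) = q x ^+ 2].

HB.mixin Record Algebra_hasStar (R : realType) A of GRing.Algebra R[i] A := {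
  star : A -> A ;
  starK : involutive star ;
  starD : forall a b : A, star (a + b) = star a + star b ;
  starZ : forall (c : R[i]) (a : A), star (c *: a) = Num.conj c *: star a ;
  starM : forall a b : A, star (a * b) = star b * star a
}.

#[short(type="starAlgType")]
HB.structure Definition StarAlgebra (R : realType) :=
  {A of GRing.Algebra R[i] A & Algebra_hasStar R A}.

(* One index in cssn_entourage suffices since the family is increasing. *)
HB.mixin Record StarAlgebra_isFrechetLocCStar (R : realType) A
    of StarAlgebra R A & Uniform A := {
  cssn : nat -> A -> R ;
  cssn_cstar : forall m, is_cstar_seminorm
    (fun (c : R[i]) (a : A) => c *: a) (fun a b : A => a * b) star (cssn m) ;
  cssn1 : forall m, cssn m 1 = 1 ;
  cssn_nondecreasing : forall m (a : A), cssn m a <= cssn m.+1 a ;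
  cssn_entourage : forall E : set (A * A), entourage E <->
    exists m (e : R), 0 < e /\ [set ab | cssn m (ab.1 - ab.2) < e] `<=` E ;
  cssn_complete : forall F : set_system A,
    ProperFilter F -> cauchy F -> exists a : A, F --> a ;
  cssn_hausdorff : hausdorff_space A
}.

#[short(type="frechetLocCStarType")]
HB.structure Definition FrechetLocCStar (R : realType) :=
  {A of StarAlgebra R A & Uniform A & StarAlgebra_isFrechetLocCStar R A}.

HB.mixin Record CompleteNormedModule_isHilbert (R : realType) H
    of CompleteNormedModule R[i] H := {
  inner : {dot H for (@Num.conj R[i])} ;
  normr_inner : forall x : H, `|x| ^+ 2 = inner x x
}.

#[short(type="hilbertType")]
HB.structure Definition Hilbert (R : realType) :=
  {H of CompleteNormedModule R[i] H & CompleteNormedModule_isHilbert R H}.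

Section Algebra.
Variables (R : realType) (A : frechetLocCStarType R).
Implicit Types (p : A -> R) (S B I : set A).

Definition separable := exists2 D : set A, countable D & dense D.

Definition mxstar n (x : 'M[A]_n) : 'M[A]_n := map_mx star x^T.

(* For a C*-seminorm p on A, the norm of the class of x in M_n(A / ker p),
   i.e. the unique C*-norm of that *-algebra, pulled back to M_n(A). *)
Definition mxcsn p n : 'M[A]_n -> R := xget (fun=> 0)
  [set q : 'M[A]_n -> R |
    is_cstar_seminorm (fun c x => map_mx (fun a => c *: a) x)
      (fun x y => x *m y) (@mxstar n) q
    /\ forall x, q x = 0 <-> forall i j, p (x i j) = 0].

Definition local_operator_system S :=
  [/\ linear_subspace S, forall a, S a -> S (star a) & S 1].

Definition closed_star_subalgebra B :=
  [/\ linear_subspace B, forall a b, B a -> B b -> B (a * b),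
      forall a, B a -> B (star a) & closed B].

Definition generates S :=
  forall B, closed_star_subalgebra B -> S `<=` B -> B = setT.

Definition closed_star_ideal I :=
  [/\ linear_subspace I, forall a b, I b -> I (a * b) /\ I (b * a),
      forall b, I b -> I (star b) & closed I].

(* The C*-seminorm on A / I induced by p, pulled back to A along the quotient
   map; accordingly mxcsn (quot_csn p I) is the associated seminorm on
   M_n(A / I), pulled back to M_n(A). *)
Definition quot_csn p I (a : A) : R := inf [set p (a + b) | b in I].

Definition boundary_ideal S I := closed_star_ideal I /\
  forall m n (s : 'M[A]_n.+1), (forall i j, S (s i j)) ->
    mxcsn (quot_csn (cssn m) I) s = mxcsn (cssn m) s.

Definition shilov_boundary_ideal S I :=
  boundary_ideal S I /\ forall I', boundary_ideal S I' -> I' `<=` I.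

Definition mx_pos p n (a : 'M[A]_n) :=
  exists b c : 'M[A]_n, a = mxstar b *m b + c /\ mxcsn p c = 0.

End Algebra.

(* Operators on a subspace K of H are represented by functions H -> H of which
   only the values on K matter. In particular B(K), for K a closed subspace, is
   used as the algebra of bounded operators of the Hilbert space K, and the
   restriction of an operator to a smaller subspace is the same function. *)
Section Operators.
Variables (R : realType) (A : frechetLocCStarType R) (H : hilbertType R).
Implicit Types (K L : set H) (T : H -> H) (f : A -> H -> H) (S : set A).

Definition closed_subspace K := linear_subspace K /\ closed K.

Definition orthogonal K : set H :=
  [set x | forall y, K y -> inner x y = 0].

Definition linear_op K T :=
  (forall x, K x -> K (T x)) /\
  forall (c : R[i]) x y, K x -> K y -> T (c *: x + y) = c *: T x + T y.

Definition bounded_op K T := linear_op K T /\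
  exists M : R[i], forall x, K x -> `|T x| <= M * `|x|.

Definition opnorm K T : R :=
  sup [set complex.Re `|T x| | x in [set x | K x /\ `|x| <= 1]].

Definition linear_map K f := forall (c : R[i]) (a b : A) x, K x ->
  f (c *: a + b) x = c *: f a x + f b x.

Definition star_hom K f :=
  [/\ linear_map K f,
      forall (a b : A) x, K x -> f (a * b) x = f a (f b x)
    & forall (a : A) x y, K x -> K y ->
        inner (f a x) y = inner x (f (star a) y)].

Definition unital K f := forall x, K x -> f 1 x = x.

Definition mx_psd K f n (a : 'M[A]_n) :=
  forall h : 'I_n -> H, (forall i, K (h i)) ->
    0 <= \sum_(i < n) \sum_(j < n)
           inner (f (a i j) (h j)) (h i).

Definition m_CP m K f :=
  [/\ forall a, bounded_op K (f a), linear_map K f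
    & forall n (a : 'M[A]_n.+1),
        (mx_pos (cssn m) a -> mx_psd K f a) /\
        (mxcsn (cssn m) a = 0 -> forall i j x, K x -> f (a i j) x = 0)].

Definition irreducible_rep K f :=
  [/\ forall a, bounded_op K (f a), star_hom K f, K <> [set 0]
    & forall L, closed_subspace L -> L `<=` K ->
        (forall a x, L x -> L (f a x)) -> L = [set 0] \/ L = K].

Definition m_boundary_rep m S K f :=
  [/\ irreducible_rep K f, m_CP m K f, unital K f
    & forall g : A -> H -> H, m_CP m K g -> unital K g ->
        (forall s x, S s -> K x -> g s x = f s x) ->
        forall a x, K x -> g a x = f a x].

Implicit Type E : nat -> set H.

Definition domain E : set H := \bigcup_m E m.

Definition quantized_domain E :=
  [/\ forall m, closed_subspace (E m), forall m, E m `<=` E m.+1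
    & dense (domain E)].

Definition CstarE E T := linear_op (domain E) T /\
  forall m, bounded_op (E m) T /\
    forall x, (orthogonal (E m) `&` domain E) x ->
              (orthogonal (E m) `&` domain E) (T x).

Definition local_rep E f :=
  [/\ forall a, CstarE E (f a), star_hom (domain E) f
    & forall l, exists m, forall a : A, opnorm (E l) (f a) <= cssn m a].

Definition layer E m : set H :=
  if m is m'.+1 then orthogonal (E m') `&` E m else E 0%N.

Definition Gamma_boundary_rep S E f :=
  [/\ quantized_domain E, local_rep E f
    & forall m, m_boundary_rep m S (layer E m) f].

Definition rep_ker E f : set A := [set a | forall x, domain E x -> f a x = 0].

End Operators.

Definition Ch_ker_inter (R : realType) (A : frechetLocCStarType R)
    (S : set A) : set A :=
  [set a | forall (H : hilbertType R) (E : nat -> set H) (f : A -> H -> H),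
    Gamma_boundary_rep S E f -> rep_ker E f a].

(* Main.v *)
(* A boundary ideal I is contained in the kernel of every boundary
   representation f: on a layer, the map that f induces from the image of S in
   A/I is completely positive because the quotient map is completely isometric
   on S, so by Arveson's extension theorem it extends to a completely positive
   map on A that vanishes on I; the uniqueness in the definition of a boundary
   representation identifies this map with f.

   Conversely, the intersection of the kernels is a boundary ideal as soon as
   every norm p_m(s), s in M_n(S), is attained by the layer m of a boundary
   representation. Representations are handled through vector states:
   with T two disjoint copies of {1..n} and s placed in the upper right corner of
   a T by T matrix, p_m(s) is twice the maximum over the states phi of M_T(A) of
   the value of Re phi at that matrix. Among the maximizing states there is one
   that is pure and has no nontrivial dilation relative to S: maximality of
   dilations replaces the usual transfinite constructions by one application of
   Zorn's lemma, to the sublinear functionals whose dominated states form a set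
   closed under convex components and under dilations. Such a state has an
   irreducible GNS representation, and it is a p_m-boundary representation; the
   orthogonal sum over m of the ones obtained at all levels is the required
   boundary representation. Since S generates A, a dilation that is trivial on S
   is trivial.

   The C*-theory behind this (positivity of b*b, completeness and uniqueness of
   the norms on A / ker p_m and A / I, existence of states) only uses the
   seminorm axioms and polynomials in one self-adjoint element. *)

From HB Require Import structures.
From mathcomp Require Import all_boot all_order all_algebra.
From mathcomp Require Import sesquilinear complex.
From mathcomp Require Import all_classical all_reals all_analysis.
From mathcomp Require Import ring lra.
From Stdlib Require Ncring Ncring_tac.
Require Import Defs.

Set Implicit Arguments.
Unset Strict Implicit.
Unset Printing Implicit Defensive.

Import Order.TTheory GRing.Theory Num.Theory.
Import numFieldNormedType.Exports.

Local Open Scope classical_set_scope.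
Local Open Scope ring_scope.
Local Open Scope complex_scope.

(** Two obstacles shape the development. The seminorm [mxcsn] is known only through its
    characterization, so inequalities between matrix norms come from comparing C*-seminorms whose
    kernels are comparable; this needs square roots in A / ker p_m, hence its completeness.
    Completeness is obtained by lifting: Im exp(ih) is a contraction for all seminorms at once and
    differs from h only to second order, so a class modulo ker p_m has a representative that is
    bounded by a multiple of its p_m-norm in every seminorm.

    Dilations have to be exhausted without iterating. Cutting a set of states down to its face at a
    matrix v keeps the set closed under dilations if no dilation decreases the value at v. For
    suitable v built from r in S this is the Schwarz inequality star (g r) * g r <= g (star r * r)
    for a completely positive extension g, and its equality case says that g multiplies by r as the
    representation does. In a minimal set every such cut is vacuous, so equality holds, and it
    propagates along products of elements of S. *)

#[local] Instance nc_ops (A : nzRingType) : @Ncring.Ring_ops A 0 1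
  (@GRing.add A) (@GRing.mul A) (fun x y => x - y) (@GRing.opp A) (@eq A) := {}.

Lemma nc_ring (A : nzRingType) : @Ncring.Ring _ _ _ _ _ _ _ _ (nc_ops A).
Proof.
split; try exact: RelationClasses.eq_equivalence;
  try (by move=> x y -> z t ->); try (by move=> x y ->).
- exact: add0r.
- exact: addrC.
- exact: addrA.
- exact: mul1r.
- exact: mulr1.
- exact: mulrA.
- exact: mulrDl.
- by move=> x y z; exact: mulrDr.
- by [].
- exact: subrr.
Qed.

(* Carrier projections of the two structures over which noncommutative ring
   identities are proved; the reification does not unify them with [nc_ops]. *)
#[local] Instance nc_ops_star (R : realType) (A : starAlgType R) :
  @Ncring.Ring_ops A 0 1 (@GRing.add A) (@GRing.mul A) (fun x y => x - y)
    (@GRing.opp A) (@eq A) := {}.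
#[local] Instance nc_ring_star (R : realType) (A : starAlgType R) :
  @Ncring.Ring _ _ _ _ _ _ _ _ (nc_ops_star A) := nc_ring A.
#[local] Instance nc_ops_f (R : realType) (A : frechetLocCStarType R) :
  @Ncring.Ring_ops A 0 1 (@GRing.add A) (@GRing.mul A) (fun x y => x - y)
    (@GRing.opp A) (@eq A) := {}.
#[local] Instance nc_ring_f (R : realType) (A : frechetLocCStarType R) :
  @Ncring.Ring _ _ _ _ _ _ _ _ (nc_ops_f A) := nc_ring A.

Ltac ncring := Ncring_tac.non_commutative_ring.
Ltac pring := rewrite -?mul_polyC; ring.

(** * C*-seminorms and positivity *)

Section RealFacts.
Context (R : realType).
Implicit Types (x y d C : R).

Lemma bernoulli_le d n : 0 <= d -> 1 + n%:R * d <= (1 + d) ^+ n.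
Proof.
move=> d0; elim: n => [|n IHn]; first by rewrite mul0r addr0 expr0.
rewrite exprS -natr1 mulrDl mul1r.
apply: (@le_trans _ _ ((1 + d) * (1 + n%:R * d))).
  have := mulr_ge0 (ler0n R n) (mulr_ge0 d0 d0); nra.
by apply: ler_wpM2l => //; lra.
Qed.

(** If x exceeded y, Bernoulli's inequality for the square of (x/y)^(2^k) would give growth of order
    (2^k)^2, which a linear factor cannot absorb. The factor 2^k is allowed because [iter_swap]
    produces it. *)
Lemma le_of_pow C x y : 0 <= x -> 0 <= y ->
  (forall k, x ^+ (2 ^ k) <= C * (2 ^ k)%:R * y ^+ (2 ^ k)) -> x <= y.
Proof.
move=> x0 y0 H; have [y0e|yn0] := eqVneq y 0.
  by move: (H 0%N); rewrite y0e /= !expr1 mulr0.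
have yp : 0 < y by rewrite lt_def yn0.
rewrite leNgt; apply/negP => xy.
have d0 : 0 < x / y - 1 by rewrite subr_gt0 ltr_pdivlMr // mul1r.
set d := x / y - 1 in d0.
have K k : (1 + d) ^+ (2 ^ k) <= C * (2 ^ k)%:R.
  rewrite /d addrC subrK expr_div_n ler_pdivrMr; first exact: H.
  by rewrite exprn_gt0.
have K2 k : (2 ^ k)%:R * d ^+ 2 <= 2 * C.
  have := K k.+1; rewrite expnS mulnC exprM natrM => K3.
  have B := bernoulli_le (2 ^ k) (ltW d0).
  have N0 : 0 < (2 ^ k)%:R :> R by rewrite ltr0n expn_gt0.
  set N := (2 ^ k)%:R in K3 B N0 *.
  have : (N * d) ^+ 2 <= C * (N * 2).
    apply: le_trans K3; rewrite lerXn2r ?nnegrE ?exprn_ge0 ?mulr_ge0 //;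
      try lra.
  rewrite exprMn expr2 => K4.
  rewrite -(ler_pM2l N0); lra.
have d2 : 0 < d ^+ 2 by rewrite exprn_gt0.
pose B := Num.bound (2 * C / d ^+ 2).
have := upper_nthrootP (leqnn B); rewrite ltr_pdivrMr // => K5.
by have := K2 B; rewrite natrX; lra.
Qed.

(** The scalar majorant of the square root iteration [ysq]; its values increase inside [0, 1], so
    the increments become small. *)
Fixpoint eta n : R := if n is n'.+1 then 2^-1 * (1 + eta n' ^+ 2) else 0.

Lemma etaS n : eta n.+1 = 2^-1 * (1 + eta n ^+ 2). Proof. by []. Qed.

Lemma eta_bnd n : 0 <= eta n <= 1.
Proof. by elim: n => [|n /andP[h1 h2]] /=; [lra|apply/andP; split; nra]. Qed.

Lemma eta_le n : eta n <= eta n.+1.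
Proof. by rewrite /=; have := sqr_ge0 (1 - eta n); rewrite !expr2; lra. Qed.

Lemma eta_small e : 0 < e -> exists n, eta n.+1 - eta n <= e.
Proof.
move=> e0; apply: contrapT => /forallNP H.
have K n : n%:R * e <= eta n.
  elim: n => [|n IHn]; first by rewrite mul0r.
  by have := H n => /negP; rewrite -ltNge -natr1 mulrDl mul1r; lra.
have := archi_boundP (ltW (divr_gt0 (@ltr01 R) e0)).
rewrite ltr_pdivrMr // => h.
by have := K (Num.bound (1 / e)); have := eta_bnd (Num.bound (1 / e)); lra.
Qed.

Lemma normcR x : `|x%:C| = `|x|%:C.
Proof. by rewrite normc_def /= expr0n /= addr0 sqrtr_sqr. Qed.

Lemma Num_conjE (z : R[i]) : Num.conj z = z^*. Proof. by []. Qed.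

Lemma sqr_eq1_le (x : R) : 0 <= x -> x = x ^+ 2 -> x <= 1.
Proof. by move=> x0 h; rewrite leNgt; apply/negP => x1; nra. Qed.

End RealFacts.

(* C*-seminorms on 'M[A]_n come with explicit operations instead of a *-algebra
   structure; this is what both cases share. *)
Definition star_ops (R : realType) (V : zmodType) (scale : R[i] -> V -> V)
    (mul : V -> V -> V) (st : V -> V) :=
  [/\ forall x, scale 0 x = 0, forall x, scale (-1) x = - x, involutive st
    & forall x y, st (mul x y) = mul (st y) (st x)].

Section Csn.
Context (R : realType) (V : zmodType) (scale : R[i] -> V -> V).
Context (mul : V -> V -> V) (st : V -> V) (q : V -> R).
Hypotheses (ops : star_ops scale mul st).
Hypothesis (hq : is_cstar_seminorm scale mul st q).

Lemma csnD x y : q (x + y) <= q x + q y. Proof. by case: hq. Qed.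

Lemma csnM x y : q (mul x y) <= q x * q y. Proof. by case: hq. Qed.

Lemma csnSM x : q (mul (st x) x) = q x ^+ 2. Proof. by case: hq. Qed.

Lemma csnZ t x : q (scale t%:C x) = `|t| * q x.
Proof. by apply: complexI; case: hq => _ -> _ _; rewrite normcR rmorphM. Qed.

Lemma csnZn c x : q (scale c x) = complex.Re `|c| * q x.
Proof.
by apply: complexI; case: hq => _ -> _ _; rewrite rmorphM.
Qed.

Lemma csn0 : q 0 = 0.
Proof. by case: ops => s0 _ _ _; rewrite -(s0 0) (csnZ 0) normr0 mul0r. Qed.

Lemma csnN x : q (- x) = q x.
Proof.
case: ops => _ sN _ _; rewrite -sN.
by rewrite -(rmorphN1 (@real_complex R)) csnZ normrN1 mul1r.
Qed.

Lemma csn_ge0 x : 0 <= q x.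
Proof. by have := csnD x (- x); rewrite subrr csn0 csnN; lra. Qed.

Lemma csnB x y : q (x - y) <= q x + q y.
Proof. by rewrite -(csnN y) csnD. Qed.

Lemma csn_dist x y : q x <= q y + q (x - y).
Proof. by have := csnD y (x - y); rewrite addrC subrK. Qed.

Lemma csnBC x y : q (x - y) = q (y - x).
Proof. by rewrite -csnN opprB. Qed.

Lemma csn_star x : q (st x) = q x.
Proof.
case: ops => _ _ sK _.
have K z : q z <= q (st z).
  have := csnM (st z) z; rewrite csnSM.
  by have := csn_ge0 z; have := csn_ge0 (st z); nra.
by apply/eqP; rewrite eq_le K andbT; have := K (st x); rewrite sK.
Qed.

Lemma csn_sqr x : st x = x -> q (mul x x) = q x ^+ 2.
Proof. by move=> h; rewrite -csnSM h. Qed.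

Lemma csn_iter x k : st x = x ->
  st (iter k (fun y => mul y y) x) = iter k (fun y => mul y y) x /\
  q (iter k (fun y => mul y y) x) = q x ^+ (2 ^ k).
Proof.
case: ops => _ _ _ sM hx; elim: k => [|k [IH1 IH2]] /=; first by rewrite expr1.
by rewrite sM IH1 csn_sqr // IH2 -exprM expnSr.
Qed.

Lemma csn_eq x y : q (x - y) = 0 -> q x = q y.
Proof.
move=> h; apply/eqP; rewrite eq_le.
have := csn_dist x y; have := csn_dist y x; rewrite csnBC h !addr0 => -> ->.
by [].
Qed.

Lemma csn_sum I (r : seq I) (P : pred I) (F : I -> V) :
  q (\sum_(i <- r | P i) F i) <= \sum_(i <- r | P i) q (F i).
Proof.
elim/big_ind2 : _ => //; first by rewrite csn0.
by move=> x1 x2 y1 y2 h1 h2; apply: le_trans (csnD _ _) _; apply: lerD.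
Qed.

End Csn.

(* Equivalent C*-seminorms are equal, because of q(h^2) = q(h)^2. *)
Lemma csn_le_of_equiv (R : realType) (V : zmodType) (scale : R[i] -> V -> V)
    (mul : V -> V -> V) (st : V -> V) (q q' : V -> R) (C : R) :
  star_ops scale mul st ->
  is_cstar_seminorm scale mul st q -> is_cstar_seminorm scale mul st q' ->
  (forall x, q x <= C * q' x) -> forall x, q x <= q' x.
Proof.
move=> ops hq hq' H x.
suff K h : st h = h -> q h <= q' h.
  have sxx : st (mul (st x) x) = mul (st x) x by case: ops => _ _ sK ->; rewrite sK.
  have := K _ sxx; rewrite !(csnSM hq, csnSM hq').
  by rewrite ler_sqr ?nnegrE ?(csn_ge0 ops hq) ?(csn_ge0 ops hq').
move=> hs; apply: (@le_of_pow _ C); rewrite ?(csn_ge0 ops hq) ?(csn_ge0 ops hq') //.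
move=> k; have [_ <-] := csn_iter ops hq k hs.
have [_ <-] := csn_iter ops hq' k hs.
apply: le_trans (H _) _; rewrite -mulrA.
set y := q' _; have y0 : 0 <= y by exact: (csn_ge0 ops hq').
have := csn_ge0 ops hq (iter k (fun y : V => mul y y) h).
have := H (iter k (fun y : V => mul y y) h); rewrite -/y => h1 h2.
have N1 : 1 <= (2 ^ k)%:R :> R by rewrite ler1n expn_gt0.
rewrite mulrCA -[leLHS]mul1r; apply: ler_wpM2r => //; exact: le_trans h1.
Qed.

Section PolyStar.
Context (R : realType).
Local Notation C := R[i].

(** Conjugating coefficients makes 'X self-adjoint, so that evaluation at a self-adjoint h is a
    star-homomorphism ([horner_alg_star]). A C*-seminorm pulled back along it ([csn_poly]) lives on
    a commutative algebra, where [ring] applies; this stands in for functional calculus. *)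
Definition pstar (P : {poly C}) : {poly C} := map_poly Num.conj P.

Lemma pstarK : involutive pstar.
Proof.
by move=> P; rewrite /pstar -map_poly_comp map_poly_id // => x _ /=; rewrite conjCK.
Qed.

Lemma pstarD P Q : pstar (P + Q) = pstar P + pstar Q.
Proof. exact: rmorphD. Qed.

Lemma pstarZ c P : pstar (c *: P) = Num.conj c *: pstar P.
Proof. exact: map_polyZ. Qed.

Lemma pstarM P Q : pstar (P * Q) = pstar Q * pstar P.
Proof. by rewrite mulrC; exact: rmorphM. Qed.

HB.instance Definition _ := Algebra_hasStar.Build R {poly C}
  pstarK pstarD pstarZ pstarM.

End PolyStar.

Section StarAlg.
Context (R : realType).
Local Notation C := R[i].
Implicit Types A : starAlgType R.

Definition csn (A : starAlgType R) (p : A -> R) :=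
  is_cstar_seminorm (fun (c : C) (a : A) => c *: a) (fun a b => a * b) star p.

Lemma alg_ops A : star_ops (fun (c : C) (a : A) => c *: a) (fun a b => a * b) star.
Proof. by split; [exact: scale0r|exact: scaleN1r|exact: starK|exact: starM]. Qed.

Lemma star0 A : star (0 : A) = 0.
Proof. by apply: (addIr (star 0)); rewrite -starD !add0r. Qed.

Lemma starN A (a : A) : star (- a) = - star a.
Proof. by apply: (addIr (star a)); rewrite -starD !addNr star0. Qed.

Lemma starB A (a b : A) : star (a - b) = star a - star b.
Proof. by rewrite starD starN. Qed.

Lemma star1 A : star (1 : A) = 1.
Proof. by rewrite -[LHS]mul1r -{1}(starK (1 : A)) -starM mul1r starK. Qed.

Lemma starZR A (t : R) (a : A) : star (t%:C *: a) = t%:C *: star a.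
Proof. by rewrite starZ Num_conjE conjc_real. Qed.

Lemma starX A (a : A) n : star (a ^+ n) = star a ^+ n.
Proof. by elim: n => [|n IH]; rewrite ?expr0 ?star1 // exprS exprSr starM IH. Qed.

Lemma star_sum A I (r : seq I) (P : pred I) (F : I -> A) :
  star (\sum_(i <- r | P i) F i) = \sum_(i <- r | P i) star (F i).
Proof. by elim/big_rec2: _ => [|i x y _ <-]; rewrite ?star0 ?starD. Qed.

Lemma sa_SM A (a : A) : star (star a * a) = star a * a.
Proof. by rewrite starM starK. Qed.

Section OneSeminorm.
Context (A : starAlgType R) (p : A -> R) (hp : csn p).
Let ops := alg_ops A.

Lemma scD x y : p (x + y) <= p x + p y. Proof. exact: (csnD hp). Qed.
Lemma scB x y : p (x - y) <= p x + p y. Proof. exact: (csnB ops hp). Qed.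
Lemma scM x y : p (x * y) <= p x * p y. Proof. exact: (csnM hp). Qed.
Lemma scSM x : p (star x * x) = p x ^+ 2. Proof. exact: (csnSM hp). Qed.
Lemma scZ t x : p (t%:C *: x) = `|t| * p x. Proof. exact: (csnZ hp). Qed.
Lemma scZp t x : 0 <= t -> p (t%:C *: x) = t * p x.
Proof. by move=> t0; rewrite scZ ger0_norm. Qed.
Lemma sc0 : p 0 = 0. Proof. exact: (csn0 ops hp). Qed.
Lemma scN x : p (- x) = p x. Proof. exact: (csnN ops hp). Qed.
Lemma sc_ge0 x : 0 <= p x. Proof. exact: (csn_ge0 ops hp). Qed.
Lemma sc_dist x y : p x <= p y + p (x - y). Proof. exact: (csn_dist hp). Qed.
Lemma scBC x y : p (x - y) = p (y - x). Proof. exact: (csnBC ops hp). Qed.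
Lemma sc_star x : p (star x) = p x. Proof. exact: (csn_star ops hp). Qed.
Lemma sc_sqr x : star x = x -> p (x * x) = p x ^+ 2.
Proof. exact: (csn_sqr hp). Qed.
Lemma sc1 : p 1 <= 1.
Proof. by apply: sqr_eq1_le; rewrite ?sc_ge0 // -scSM star1 mul1r. Qed.
Lemma sc_i x : p ('i%C *: x) = p x.
Proof. by rewrite (csnZn hp) normc_def /= expr0n expr1n /= add0r sqrtr1 mul1r. Qed.

Lemma sc_pow2 x k : star x = x -> p (x ^+ (2 ^ k)) = p x ^+ (2 ^ k).
Proof.
move=> hx; rewrite -(csn_iter ops hp k hx).2; congr p.
by elim: k => [|k IH] /=; rewrite ?expr1 // -IH expnSr exprM expr2.
Qed.

(* [up h t] expresses that the spectrum of [h] is bounded above by [t]. *)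
Definition up (h : A) (t : R) :=
  forall e, 0 < e -> exists2 M : R, 0 <= M & p (M%:C%:A + h) <= M + t + e.

Lemma p_cst (t : R) : p (t%:C%:A) <= `|t|.
Proof. by rewrite scZ ler_piMr // sc1. Qed.

Lemma up_large h t M M' : M <= M' -> p (M%:C%:A + h) <= M + t ->
  p (M'%:C%:A + h) <= M' + t.
Proof.
move=> MM H; have -> : M'%:C%:A + h = (M' - M)%:C%:A + (M%:C%:A + h).
  by rewrite rmorphB /= scalerBl addrA subrK.
apply: le_trans (scD _ _) _; have := p_cst (M' - M).
by rewrite ger0_norm ?subr_ge0 //; lra.
Qed.

Lemma upD h k s t : up h s -> up k t -> up (h + k) (s + t).
Proof.
move=> H K e e0; have e2 : 0 < e / 2 by lra.
have [M M0 HM] := H _ e2; have [N N0 HN] := K _ e2.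
exists (M + N); first exact: addr_ge0.
have -> : (M + N)%:C%:A + (h + k) = (M%:C%:A + h) + (N%:C%:A + k).
  by rewrite rmorphD /= scalerDl addrACA.
by apply: le_trans (scD _ _) _; lra.
Qed.

Lemma upZ h s t : 0 <= t -> up h s -> up (t%:C *: h) (t * s).
Proof.
rewrite le_eqVlt => /predU1P[<- _|t0 H] e e0.
  by exists 0 => //; rewrite !scale0r addr0 sc0; lra.
have [M M0 HM] := H _ (divr_gt0 e0 t0).
exists (t * M); first by rewrite mulr_ge0 // ltW.
have -> : (t * M)%:C%:A + t%:C *: h = t%:C *: (M%:C%:A + h).
  by rewrite scalerDr scalerA rmorphM.
rewrite scZp ?(ltW t0) //; move: HM; rewrite -(ler_pM2l t0) !mulrDr.
by rewrite [t * (e / t)]mulrC divfK ?gt_eqF.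
Qed.

Lemma up_norm h : up h (p h).
Proof. by move=> e e0; exists 0 => //; rewrite scale0r !add0r; lra. Qed.

Lemma up_le h s t : s <= t -> up h s -> up h t.
Proof. by move=> st H e /H[M M0 HM]; exists M => //; lra. Qed.

Lemma up_closed h t : (forall e, 0 < e -> up h (t + e)) -> up h t.
Proof.
move=> H e e0; have e2 : 0 < e / 2 by lra.
by have [M M0 HM] := H _ e2 _ e2; exists M => //; lra.
Qed.

Lemma up_cst t : up (t%:C%:A) t.
Proof.
move=> e e0; exists `|t| => //; rewrite -scalerDl -rmorphD.
apply: le_trans (p_cst _) _; rewrite ger0_norm; first lra.
by have := ler_norm (- t); rewrite normrN; lra.
Qed.

Lemma up_ge h t : p 1 = 1 -> up h t -> - p h <= t.
Proof.
move=> p1 H; apply/ler_addgt0Pr => e e0; have [M M0] := H _ e0.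
have := sc_dist (M%:C%:A) (- h); rewrite opprK scN scZp // p1 mulr1.
lra.
Qed.

End OneSeminorm.
End StarAlg.

(** * Square roots and positivity in one self-adjoint variable *)

Section Poly.
Context (R : realType) (p : {poly R[i]} -> R).
Hypothesis hp : csn (A := {poly R[i]}) p.
Local Notation C := R[i].
Local Notation W := ({poly C} : starAlgType R).
Implicit Types (c h k : {poly C}).
Local Notation sa x := (star (x : W) = x).

Lemma sa_real (t : R) h : sa h -> sa (t%:C *: h).
Proof. by move=> hh; rewrite starZR hh. Qed.

Lemma sa_D h k : sa h -> sa k -> sa (h + k).
Proof. by move=> hh hk; rewrite starD hh hk. Qed.

Lemma sa_B h k : sa h -> sa k -> sa (h - k).
Proof. by move=> hh hk; rewrite starB hh hk. Qed.

Lemma sa_M h k : sa h -> sa k -> sa (h * k).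
Proof. by move=> hh hk; rewrite starM hh hk mulrC. Qed.

Lemma sa_1 : sa 1. Proof. exact: star1. Qed.

(* The iteration y |-> (c + y^2)/2 converges to 1 - sqrt(1 - c); its
   increments are dominated by those for c = 1. *)
Fixpoint ysq c n : {poly C} :=
  if n is n'.+1 then (2^-1 : R)%:C *: (c + ysq c n' ^+ 2) else 0.

Lemma ysqS c n : ysq c n.+1 = (2^-1 : R)%:C *: (c + ysq c n ^+ 2).
Proof. by []. Qed.

Lemma ysq_sa c n : sa c -> sa (ysq c n).
Proof.
move=> hc; elim: n => [|n IH] /=; first by rewrite star0.
by apply: sa_real; apply: sa_D => //; rewrite expr2; apply: sa_M.
Qed.

Lemma ysq_bnd c n : p c <= 1 -> p (ysq c n) <= eta R n.
Proof.
move=> c1; elim: n => [|n IH] /=; first by rewrite (sc0 hp).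
rewrite (scZp hp); last lra.
apply: ler_wpM2l; first lra.
apply: le_trans (scD hp _ _) _; apply: lerD => //.
rewrite expr2; apply: le_trans (scM hp _ _) _; rewrite expr2.
by apply: ler_pM => //; apply: (sc_ge0 hp).
Qed.

Lemma ysq_inc c n : p c <= 1 ->
  p (ysq c n.+1 - ysq c n) <= eta R n.+1 - eta R n.
Proof.
move=> c1; elim: n => [|n IH].
  rewrite /= !subr0 expr0n /= !addr0 (scZp hp); last lra.
  by apply: ler_wpM2l => //; lra.
have -> : ysq c n.+2 - ysq c n.+1 = (2^-1 : R)%:C *:
    ((ysq c n.+1 + ysq c n) * (ysq c n.+1 - ysq c n)).
  rewrite (ysqS c n.+1); have := ysqS c n.
  set a := ysq c n.+1; set b := ysq c n => e.
  by rewrite {2}e -scalerBr; congr (_ *: _); ring.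
have -> : eta R n.+2 - eta R n.+1 =
    2^-1 * ((eta R n.+1 + eta R n) * (eta R n.+1 - eta R n)).
  rewrite (etaS R n.+1); have := etaS R n.
  set a := eta R n.+1; set b := eta R n => e.
  by rewrite {2}e; ring.
rewrite (scZp hp); last lra.
apply: ler_wpM2l; first lra.
apply: le_trans (scM hp _ _) _; apply: ler_pM; rewrite ?(sc_ge0 hp) //.
by apply: le_trans (scD hp _ _) _; apply: lerD; apply: ysq_bnd.
Qed.

Lemma ysq_half c n : 1 - c - (1 - ysq c n) ^+ 2 =
  2%:R *: (ysq c n - ysq c n.+1).
Proof.
rewrite ysqS scalerBr scalerA.
have -> : 2%:R * (2^-1 : R)%:C = 1 :> C.
  by rewrite -(rmorph_nat (@real_complex R)) -rmorphM /= divff ?pnatr_eq0.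
by pring.
Qed.

Lemma approx_sqrt c e : sa c -> p c <= 1 -> 0 < e ->
  exists k, [/\ sa k, p k <= 2 & p (1 - c - k ^+ 2) <= e].
Proof.
move=> hc c1 e0; have [n hn] := eta_small (divr_gt0 e0 (@ltr0n R 2)).
exists (1 - ysq c n); split.
- by apply: sa_B; [exact: sa_1|exact: ysq_sa].
- apply: le_trans (scB hp _ _) _; have := sc1 hp; have := ysq_bnd n c1.
  by have := eta_bnd R n; lra.
- rewrite ysq_half -(rmorph_nat (@real_complex R)) (scZp hp); last lra.
  by rewrite (scBC hp); have := ysq_inc n c1; rewrite ler_pdivlMr in hn; lra.
Qed.

Lemma sqr_i_scale (h k : {poly C}) :
  (h - 'i%C *: k) * (h + 'i%C *: k) = h ^+ 2 + k ^+ 2.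
Proof.
have key (z : C) : (h - z *: k) * (h + z *: k) = h ^+ 2 - (z ^+ 2) *: k ^+ 2.
  by pring.
by rewrite key sqr_i scaleN1r opprK.
Qed.

Lemma star_i h k : sa h -> sa k -> star (h + 'i%C *: k : W) = h - 'i%C *: k.
Proof.
move=> hh hk; rewrite starD starZ hh hk -scaleNr; congr (_ + _ *: _).
by apply/eqP; rewrite eq_complex /= oppr0 !eqxx.
Qed.

(** For u = h + i k one has h^2 + k^2 = [star u * u], because h and k commute, and h is the real
    part of u. *)
Lemma sqr_le_sqrD h k : sa h -> sa k -> p h ^+ 2 <= p (h ^+ 2 + k ^+ 2).
Proof.
move=> hh hk; set u := h + 'i%C *: k.
have -> : h ^+ 2 + k ^+ 2 = star (u : W) * u by rewrite star_i // sqr_i_scale.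
rewrite (scSM hp) ler_sqr ?nnegrE ?(sc_ge0 hp) //.
have : p (2%:C *: h) <= p u + p (star (u : W)).
  apply: le_trans (scD hp _ _); rewrite star_i // /u le_eqVlt; apply/orP; left.
  by apply/eqP; congr p; rewrite rmorph_nat; pring.
by rewrite (sc_star hp) (scZp hp) //; lra.
Qed.

(** With k an approximate square root of 1 - h^2, the element u = h + i k is nearly unitary and 2
    h^2 - 1 is nearly the real part of u^2. *)
Lemma sqr_pos1 h : sa h -> p h <= 1 -> p (2%:R *: h ^+ 2 - 1) <= 1.
Proof.
move=> hh h1; apply/ler_addgt0Pr => e e0.
have c1 : p (h ^+ 2) <= 1.
  rewrite expr2; apply: le_trans (scM hp _ _) _.
  by have := sc_ge0 hp h; nra.
have hc : sa (h ^+ 2) by rewrite expr2; apply: sa_M.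
have [k [hk _ he]] := approx_sqrt hc c1 (divr_gt0 e0 (@ltr0n R 3)).
set E := 1 - h ^+ 2 - k ^+ 2 in he; set u := h + 'i%C *: k.
have uu : p u ^+ 2 <= 1 + e / 3%:R.
  rewrite -(scSM hp) star_i // sqr_i_scale.
  have -> : h ^+ 2 + k ^+ 2 = 1 - E by rewrite /E; ring.
  by apply: le_trans (scB hp _ _) _; have := sc1 hp; lra.
have H : 2%:C *: (2%:R *: h ^+ 2 - 1 + E) = u * u + star (u : W) * star (u : W).
  rewrite star_i // /u /E rmorph_nat.
  have key (z : C) : (h + z *: k) * (h + z *: k) + (h - z *: k) * (h - z *: k)
    = 2%:R *: (h ^+ 2 + (z ^+ 2) *: k ^+ 2) by pring.
  by rewrite key sqr_i scaleN1r; pring.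
have H2 : 2 * p (2%:R *: h ^+ 2 - 1 + E) <= 2 * p u ^+ 2.
  rewrite -(scZp hp) // H; apply: le_trans (scD hp _ _) _.
  have := scM hp u u; have := scM hp (star (u : W)) (star (u : W)).
  by rewrite (sc_star hp) -expr2; lra.
have := scB hp (2%:R *: h ^+ 2 - 1 + E) E; rewrite addrK; lra.
Qed.

(** For s = sqrt t, 2 (h/s)^2 - 1 equals 1 - (2/t)(t - h^2), so [sqr_pos1] bounds (2/t)(t - h^2) by
    2. *)
Lemma sqr_pos h t : sa h -> p h ^+ 2 <= t -> p (t%:C *: 1 - h ^+ 2) <= t.
Proof.
move=> hh ht; have ph0 := sqr_ge0 (p h).
have : 0 <= t by exact: le_trans ht.
rewrite le_eqVlt => /predU1P[t0|t0].
  have hz : p h = 0 by apply/eqP; rewrite -sqrf_eq0; apply/eqP; lra.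
  rewrite -t0 scale0r sub0r (scN hp) expr2 (le_trans (scM hp _ _)) //.
  by rewrite hz mul0r.
set s := Num.sqrt t; have s0 : 0 < s by rewrite sqrtr_gt0.
have st : s ^+ 2 = t by rewrite sqr_sqrtr // ltW.
have h1 : p ((s^-1)%:C *: h) <= 1.
  rewrite (scZp hp) ?invr_ge0 ?(ltW s0) // mulrC ler_pdivrMr // mul1r.
  by rewrite -ler_sqr ?nnegrE ?(sc_ge0 hp) ?(ltW s0) // st.
have := sqr_pos1 (sa_real s^-1 hh) h1.
have -> : 2%:R *: ((s^-1)%:C *: h) ^+ 2 - 1 = 
  1 - (2 / t)%:C *: (t%:C *: 1 - h ^+ 2).
  rewrite scalerBr scalerA -rmorphM /= divfK ?gt_eqF // exprZn scalerA.
  rewrite -rmorphXn /= exprVn st rmorph_nat rmorphM /= rmorph_nat.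
  by rewrite scaler_nat; ring.
move=> H; have : p ((2 / t)%:C *: (t%:C *: 1 - h ^+ 2)) <= 2.
  rewrite -[X in p X](subKr 1); apply: le_trans (scB hp _ _) _.
  by have := sc1 hp; lra.
rewrite (scZp hp) ?divr_ge0 ?(ltW t0) // mulrAC ler_pdivrMr //; lra.
Qed.

Lemma up_sqr h : sa h -> up p (- h ^+ 2) 0.
Proof.
move=> hh e e0; exists (p h ^+ 2); first exact: sqr_ge0.
by have := sqr_pos hh (lexx _); rewrite addr0; lra.
Qed.

(** After division by L, put T = (t + e)/L and h' = h/L. The two bounds provide approximate square
    roots k1 and k2 of T + h' and T - h', so h'^2 + (k1 k2)^2 is close to T^2, and [sqr_le_sqrD]
    bounds p h' by T up to the error. *)
Lemma up_two_sided h t : sa h -> 0 <= t -> up (A := W) p h t ->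
  up (A := W) p (- h) t -> p h <= t.
Proof.
move=> hh t0 H1 H2; apply/ler_addgt0Pr => e e0.
have [M1 M10 HM1] := H1 _ e0; have [M2 M20 HM2] := H2 _ e0.
set M := M1 + M2 + 1; set L := M + t + e.
have L0 : 0 < L by rewrite /L /M; lra.
have M1M : M1 <= M by rewrite /M; lra.
have M2M : M2 <= M by rewrite /M; lra.
have pc2 : p ((L^-1)%:C *: (M%:C *: 1 + h)) <= 1.
  rewrite (scZp hp) ?invr_ge0 ?(ltW L0) // mulrC ler_pdivrMr // mul1r.
  by rewrite /L -addrA; apply: (up_large hp M1M); rewrite addrA.
have pc1 : p ((L^-1)%:C *: (M%:C *: 1 - h)) <= 1.
  rewrite (scZp hp) ?invr_ge0 ?(ltW L0) // mulrC ler_pdivrMr // mul1r.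
  by rewrite /L -addrA; apply: (up_large hp M2M); rewrite addrA.
set c1 := _ *: (_ - h) in pc1; set c2 := _ *: (_ + h) in pc2.
have sac1 : sa c1 by apply: sa_real; apply: sa_B => //; apply: sa_real; exact: sa_1.
have sac2 : sa c2 by apply: sa_real; apply: sa_D => //; apply: sa_real; exact: sa_1.
have Lh : h = L%:C *: ((L^-1)%:C *: h).
  by rewrite scalerA -rmorphM /= divff ?gt_eqF // scale1r.
set h' := (L^-1)%:C *: h in Lh.
have sh' : sa h' by apply: sa_real.
suff K d : 0 < d -> d <= 1 -> p h' ^+ 2 <= ((t + e) / L) ^+ 2 + 9%:R * d.
  have : p h' <= (t + e) / L.
    rewrite -ler_sqr ?nnegrE ?(sc_ge0 hp) ?divr_ge0 ?(ltW L0) //; try lra.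
    apply/ler_addgt0Pr => d d0; set d' := Num.min 1 (d / 9%:R).
    have [d'1 d'd] : d' <= 1 /\ d' <= d / 9%:R by rewrite /d' !ge_min !lexx orbT.
    have d'0 : 0 < d' by rewrite /d' lt_min ltr01 /=; lra.
    by have := K _ d'0 d'1; lra.
  by rewrite ler_pdivlMr // mulrC -(scZp hp) ?(ltW L0) // -Lh.
move=> d0 d1.
have [k1 [hk1 k12 e1]] := approx_sqrt sac1 pc1 d0.
have [k2 [hk2 k22 e2]] := approx_sqrt sac2 pc2 d0.
set E1 := 1 - c1 - _ in e1; set E2 := 1 - c2 - _ in e2.
have w1 : 1 - c1 = ((t + e) / L)%:C *: 1 + h'.
  have -> : (t + e) / L = 1 - L^-1 * M.
    have -> : t + e = L - M by rewrite /L; ring.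
    by rewrite mulrBl divff ?gt_eqF // mulrC.
  rewrite rmorphB rmorph1 scalerBl scale1r /c1 scalerBr scalerA -rmorphM -/h'.
  by rewrite opprB addrA addrAC.
have w2 : 1 - c2 = ((t + e) / L)%:C *: 1 - h'.
  have -> : (t + e) / L = 1 - L^-1 * M.
    have -> : t + e = L - M by rewrite /L; ring.
    by rewrite mulrBl divff ?gt_eqF // mulrC.
  rewrite rmorphB rmorph1 scalerBl scale1r /c2 scalerDr scalerA -rmorphM -/h'.
  by rewrite opprD addrA.
have := sqr_le_sqrD sh' (sa_M hk1 hk2).
set T := (t + e) / L in w1 w2 *.
have -> : h' ^+ 2 + (k1 * k2) ^+ 2 = (T ^+ 2)%:C *: 1 -
    ((1 - c1) * E2 + E1 * (1 - c2) - E1 * E2).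
  have key (z : C) (x F1 F2 : {poly C}) :
      x ^+ 2 + (z *: 1 + x - F1) * (z *: 1 - x - F2) =
      z ^+ 2 *: 1 - ((z *: 1 + x) * F2 + F1 * (z *: 1 - x) - F1 * F2) by pring.
  have k1E : k1 ^+ 2 = 1 - c1 - E1 by rewrite /E1 subKr.
  have k2E : k2 ^+ 2 = 1 - c2 - E2 by rewrite /E2 subKr.
  by rewrite exprMn k1E k2E w1 w2 rmorphXn key.
have pw c : p c <= 1 -> p (1 - c) <= 2.
  by move=> ?; apply: le_trans (scB hp _ _) _; have := sc1 hp; lra.
move=> H; apply: le_trans H _; apply: le_trans (scB hp _ _) _.
apply: lerD.
  rewrite (scZp hp) ?sqr_ge0 // ler_piMr ?sqr_ge0 //; exact: sc1 hp.
apply: le_trans (scB hp _ _) _.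
have := scD hp ((1 - c1) * E2) (E1 * (1 - c2)).
have := scM hp (1 - c1) E2; have := scM hp E1 (1 - c2).
have := scM hp E1 E2; have := pw _ pc1; have := pw _ pc2.
have := sc_ge0 hp E1; have := sc_ge0 hp E2; have := sc_ge0 hp (1 - c1).
have := sc_ge0 hp (1 - c2); nra.
Qed.

End Poly.

(** * From one variable to the algebra: positivity of [star b * b] *)

Section Kaplansky.
Context (R : realType) (A : starAlgType R) (p : A -> R) (hp : csn p).
Local Notation C := R[i].

Lemma horner_alg_star (h : A) (P : {poly C}) : star h = h ->
  star (horner_alg h P) = horner_alg h (star (P : ({poly C} : starAlgType R))).
Proof.
move=> hh; elim/poly_ind: P => [|P c IH]; first by rewrite !(star0, rmorph0).
rewrite starD starM rmorphD rmorphM /= horner_algX horner_algC starD starM hh.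
rewrite rmorphD rmorphM /= -IH.
have -> : star ('X : ({poly C} : starAlgType R)) = 'X by exact: map_polyX.
have -> : star (c%:P : ({poly C} : starAlgType R)) = (Num.conj c)%:P by exact: map_polyC.
by rewrite horner_algX horner_algC starZ star1; congr (_ + _).
Qed.

Lemma horner_algZ (h : A) c (P : {poly C}) :
  horner_alg h (c *: P) = c *: horner_alg h P.
Proof. by rewrite -mul_polyC rmorphM /= horner_algC -scalerAl mul1r. Qed.

Section OneElement.
Variable (h : A) (hh : star h = h).
Let ph (P : {poly C}) := p (horner_alg h P).

Lemma csn_poly : csn (A := {poly C}) ph.
Proof.
split=> [x y|c x|x y|x]; rewrite /ph.
- by rewrite rmorphD; exact: scD.
- by rewrite horner_algZ; case: hp.
- by rewrite rmorphM; exact: scM.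
- by rewrite rmorphM /= -horner_alg_star // scSM.
Qed.

Lemma up_poly P t : up (A := {poly C}) ph P t <-> up p (horner_alg h P) t.
Proof.
by split=> H e /H[M M0 HM]; exists M => //; move: HM;
  rewrite /ph rmorphD /= alg_polyC horner_algC.
Qed.

End OneElement.

Lemma up_two_sidedA h t : star h = h -> 0 <= t -> up p h t -> up p (- h) t -> p h <= t.
Proof.
move=> hh t0 H1 H2; have := @up_two_sided _ _ (csn_poly hh) 'X t.
rewrite horner_algX; apply => //; first exact: map_polyX.
- by apply: (up_poly h 'X t).2; rewrite horner_algX.
- by apply: (up_poly h (- 'X) t).2; rewrite rmorphN /= horner_algX.
Qed.

Lemma up_sqrA h : star h = h -> up p (- (h * h)) 0.
Proof.
move=> hh; have := @up_sqr _ _ (csn_poly hh) 'X (map_polyX _).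
by move=> /(up_poly h _ _).1; rewrite rmorphN rmorphXn /= horner_algX expr2.
Qed.

Lemma sqr_posA h t : star h = h -> p h ^+ 2 <= t -> p (t%:C%:A - h * h) <= t.
Proof.
move=> hh; have := @sqr_pos _ _ (csn_poly hh) 'X t (map_polyX _).
by rewrite rmorphB /= alg_polyC horner_algC rmorphXn /= horner_algX expr2.
Qed.

(** r is the sum of M^i (M + star a * a)^j over i + j = n - 1; the identity comes from (M + a * star
    a) a = a (M + star a * a). It carries norm bounds for powers from [star a * a] to [a * star a]
    at a cost linear in n. *)
Lemma iter_swap (a : A) (M : R) n :
  exists r : A, (M%:C%:A + a * star a) ^+ n = (M ^+ n)%:C%:A + a * r * star a /\
   forall y, 1 <= y -> M <= y -> 0 <= M -> p (M%:C%:A + star a * a) <= y ->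
     p r <= n%:R * y ^+ n.
Proof.
elim: n => [|n [r [IH1 IH2]]].
  exists 0; rewrite !expr0 scale1r mulr0 mul0r addr0; split=> // y _ _ _ _.
  by rewrite (sc0 hp) mul0r.
exists ((M ^+ n)%:C%:A + r * (M%:C%:A + star a * a)); split.
  rewrite exprSr IH1 exprSr rmorphM /= -scalerA.
  rewrite !mulrDl !mulrDr -!scalerAl !mul1r -!scalerAr !mulr1 !scalerA.
  by rewrite !mulrDl !mulrA -!scalerAl -!addrA.
move=> y y1 My M0 hy; have y0 : 0 <= y by lra.
apply: le_trans (scD hp _ _) _.
rewrite -natr1 mulrDl mul1r addrC; apply: lerD.
  apply: le_trans (scM hp _ _) _; rewrite exprSr mulrA.
  by apply: ler_pM; rewrite ?(sc_ge0 hp) // IH2.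
apply: le_trans (p_cst hp _) _; rewrite ger0_norm ?exprn_ge0 //.
apply: (@le_trans _ _ (y ^+ n)); first by rewrite lerXn2r ?nnegrE.
by rewrite exprS ler_peMl // exprn_ge0.
Qed.

(** For self-adjoint elements the norm is read off from powers of exponent 2^k ([sc_pow2]), and
    [le_of_pow] removes the factor 2^k left by [iter_swap]. Passing from M to M + 1 ensures y >=
    1. *)
Lemma up_swap a t : 0 <= t -> up p (star a * a) t -> up p (a * star a) t.
Proof.
move=> t0 H e e0; have [M M0 HM] := H _ e0; set M' := M + 1; set y := M' + t + e.
have HM' : p (M'%:C%:A + star a * a) <= y.
  rewrite /y -addrA; apply: (up_large hp) (_ : p (M%:C%:A + _) <= _).
    by rewrite /M'; lra.
  by rewrite addrA.
exists M'; first by rewrite /M'; lra.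
have y1 : 1 <= y by rewrite /y /M'; lra.
have y0 : 0 <= y by lra.
apply: (@le_of_pow _ (1 + p a ^+ 2)) => //; first exact: (sc_ge0 hp).
move=> k; have sx : star (M'%:C%:A + a * star a) = M'%:C%:A + a * star a.
  by rewrite starD starZR star1 starM starK.
rewrite -(sc_pow2 hp _ sx); have [r [-> hr]] := iter_swap a M' (2 ^ k).
have M'y : M' <= y by rewrite /y; lra.
have M'0 : 0 <= M' by rewrite /M'; lra.
have {}hr := hr y y1 M'y M'0 HM'.
apply: le_trans (scD hp _ _) _; rewrite mulrDl mulrDl; apply: lerD.
  apply: le_trans (p_cst hp _) _; rewrite ger0_norm ?exprn_ge0 // mul1r.
  apply: (@le_trans _ _ (y ^+ (2 ^ k))); first by rewrite lerXn2r ?nnegrE.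
  by rewrite ler_peMl ?exprn_ge0 // ler1n expn_gt0.
apply: le_trans (scM hp _ _) _; rewrite (sc_star hp).
have := scM hp a r; have := sc_ge0 hp a; have := sc_ge0 hp (a * r).
move=> h1 h2 h3.
have h4 : p a ^+ 2 * p r <= p a ^+ 2 * ((2 ^ k)%:R * y ^+ (2 ^ k)).
  by apply: ler_wpM2l => //; exact: sqr_ge0.
rewrite -mulrA; apply: le_trans h4; rewrite expr2; nra.
Qed.

End Kaplansky.

Section Kaplansky2.
Context (R : realType) (A : starAlgType R) (p : A -> R) (hp : csn p).
Local Notation C := R[i].

Lemma conj_i : Num.conj ('i%C : C) = - 'i%C.
Proof. by apply/eqP; rewrite eq_complex /= oppr0 !eqxx. Qed.

Lemma ii_N1 : 'i%C * 'i%C = -1 :> C.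
Proof. by rewrite -expr2 sqr_i. Qed.

Lemma sa_parts (a : A) : exists x y : A, [/\ star x = x, star y = y &
  a = x + 'i%C *: y].
Proof.
exists ((2^-1 : R)%:C *: (a + star a)), ((2^-1 : R)%:C *: ('i%C *: (star a - a))).
split.
- by rewrite starZR starD starK addrC.
- by rewrite starZR starZ starB starK conj_i scaleNr -scalerN opprB.
- rewrite (scalerA 'i%C) mulrC -scalerA (scalerA 'i%C) -expr2 sqr_i scaleN1r.
  rewrite opprB -scalerDr.
  have -> : a + star a + (a - star a) = 2%:R *: a.
    by rewrite scaler_nat mulr2n; ncring.
  rewrite scalerA.
  rewrite -(rmorph_nat (@real_complex R)) -rmorphM /= mulVf ?pnatr_eq0 //.
  by rewrite scale1r.
Qed.

(** An upper bound for [star a * a] also bounds its negative: for a = x + i y,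
    [star a * a + a * star a] is 2 x^2 + 2 y^2, so - star a * a is [a * star a] minus squares, and
    [up_swap] bounds [a * star a]. *)
Lemma up_starM_norm a t : 0 <= t -> up p (star a * a) t -> p a ^+ 2 <= t.
Proof.
move=> t0 H; rewrite -(scSM hp); apply: (up_two_sidedA hp) => //.
  exact: sa_SM.
have [x [y [sx sy e]]] := sa_parts a.
have sxy : star a * a + a * star a = x * x + x * x + (y * y + y * y).
  have -> : star a = x - 'i%C *: y.
    by rewrite e starD starZ sx sy conj_i scaleNr.
  rewrite e !mulrDl !mulrDr !mulNr !mulrN -!scalerAl -!scalerAr !scalerA.
  by rewrite ii_N1 !scaleN1r !opprK; ncring.
have -> : - (star a * a) = a * star a + (- (x * x) + - (x * x) + (- (y * y) + - (y * y))).
  apply: (addrI (star a * a)); rewrite subrr addrA sxy; ncring.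
rewrite -[t]addr0; apply: (upD hp); first exact: up_swap.
rewrite -[0](addr0 0); apply: (upD hp); rewrite -[0](addr0 0);
  by apply: (upD hp); apply: up_sqrA.
Qed.

(** 4 - 27 x (1 - x)^2 = (3 x - 1)^2 (4 - 3 x), and 4 - 3 x = 4 (1 - c) for c = 3 x / 4, where 1 - c
    is a square up to the error E. The tolerance e/64 pays for 4 times the bound 16 on the norm of
    (3 x - 1)^2. *)
Lemma cubic_up h : star h = h -> p h <= 1 ->
  up p ((27%:R : R)%:C *: (h * ((1 - h) * (1 - h)))) 4.
Proof.
move=> hh h1; have pp := csn_poly hp hh; set ph := fun P => _ in pp.
suff : up (A := {poly C}) ph ((27%:R : R)%:C *: ('X * ((1 - 'X) * (1 - 'X)))) 4.
  move=> /(up_poly p h _ _).1.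
  by rewrite horner_algZ !rmorphM /= !rmorphB !rmorph1 /= horner_algX.
have sX : star ('X : ({poly C} : starAlgType R)) = 'X by exact: map_polyX.
set c : {poly C} := (3%:R / 4%:R : R)%:C *: 'X.
have sc : star (c : ({poly C} : starAlgType R)) = c by apply: sa_real.
have pX : ph 'X <= 1 by rewrite /ph horner_algX.
have pc : ph c <= 1 by rewrite (scZp pp); lra.
apply: up_closed => e e0.
have [k [sk _ hk]] := approx_sqrt pp sc pc (divr_gt0 e0 (@ltr0n R 64)).
set E := 1 - c - k ^+ 2 in hk.
have c4 : 4%:R *: c = 3%:R *: 'X.
  rewrite scalerA -(rmorph_nat (@real_complex R)) -rmorphM.
  by rewrite mulrC divfK ?pnatr_eq0 // rmorph_nat.
set g := 3%:R *: 'X - 1 : {poly C}.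
have -> : (27%:R : R)%:C *: ('X * ((1 - 'X) * (1 - 'X))) =
    ((4 : R)%:C *: 1 + (4 : R)%:C *: (- (g * k) ^+ 2)) - (4 : R)%:C *: (g ^+ 2 * E).
  have kE : k ^+ 2 = 1 - c - E by rewrite /E subKr.
  rewrite exprMn kE !rmorph_nat.
  have key (F : {poly C}) : 27%:R *: ('X * ((1 - 'X) * (1 - 'X))) =
    4%:R *: 1 + 4%:R *: (- (g ^+ 2 * (1 - c - F))) - 4%:R *: (g ^+ 2 * F).
    rewrite -addrA -scalerBr.
    have -> : - (g ^+ 2 * (1 - c - F)) - g ^+ 2 * F = - (g ^+ 2 * (1 - c)) by ring.
    rewrite scalerN [4%:R *: (g ^+ 2 * _)]scalerAr scalerBr c4 /g.
    by pring.
  by rewrite -key.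
have sg : star (g : ({poly C} : starAlgType R)) = g.
  apply: sa_B; last exact: sa_1.
  by rewrite -(rmorph_nat (@real_complex R)); apply: sa_real.
have gb : ph g <= 4.
  apply: le_trans (scB pp _ _) _; rewrite -(rmorph_nat (@real_complex R)).
  by rewrite (scZp pp) //; have := sc1 pp; lra.
apply: (upD pp).
  rewrite -[X in up _ _ X](addr0 4).
  apply: (upD pp); first exact: up_cst pp 4.
  by rewrite -[0](mulr0 4); apply: (upZ pp) => //; apply: up_sqr => //; apply: sa_M.
apply: (@up_le _ _ ph _ (ph (- ((4 : R)%:C *: (g ^+ 2 * E))))); last exact: up_norm.
rewrite (scN pp) (scZp pp) //.
have := scM pp (g ^+ 2) E; have := scM pp g g; rewrite -expr2.
have := sc_ge0 pp g; have := sc_ge0 pp E; have := sc_ge0 pp (g ^+ 2).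
move=> a1 a2 a3 a4 a5; have a6 : ph (g ^+ 2) <= 16 by nra.
by nra.
Qed.

(** x - x (1 - x)^2 = 2 x^2 (1 - x/2), and 1 - x/2 has an approximate square root when x has norm at
    most 1. *)
Lemma up_neg_of_cubic h s : star h = h -> p h <= 1 ->
  up p (- (h * ((1 - h) * (1 - h)))) s -> up p (- h) s.
Proof.
move=> hh h1; have pp := csn_poly hp hh; set ph := fun P => _ in pp.
move=> H; suff : up (A := {poly C}) ph (- 'X) s.
  by move=> /(up_poly p h _ _).1; rewrite rmorphN /= horner_algX.
have {}H : up (A := {poly C}) ph (- ('X * ((1 - 'X) * (1 - 'X)))) s.
  apply: (up_poly p h _ _).2.
  by rewrite rmorphN !rmorphM /= !rmorphB !rmorph1 /= horner_algX.
have sX : star ('X : ({poly C} : starAlgType R)) = 'X by exact: map_polyX.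
set c : {poly C} := (2^-1 : R)%:C *: 'X.
have sc : star (c : ({poly C} : starAlgType R)) = c by apply: sa_real.
have pX : ph 'X <= 1 by rewrite /ph horner_algX.
have pc : ph c <= 1 by rewrite (scZp pp); lra.
apply: up_closed => e e0.
have [k [sk _ hk]] := approx_sqrt pp sc pc (divr_gt0 e0 (@ltr0n R 2)).
set E := 1 - c - k ^+ 2 in hk.
have c2 : 2%:R *: c = 'X.
  rewrite scalerA -(rmorph_nat (@real_complex R)) -rmorphM.
  by rewrite divff ?pnatr_eq0 // rmorph1 scale1r.
have -> : - 'X = - ('X * ((1 - 'X) * (1 - 'X))) +
    ((2 : R)%:C *: (- ('X * k) ^+ 2) - (2 : R)%:C *: ('X ^+ 2 * E)) :> {poly C}.
  have kE : k ^+ 2 = 1 - c - E by rewrite /E subKr.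
  rewrite exprMn kE rmorph_nat.
  have key (F : {poly C}) : - 'X = - ('X * ((1 - 'X) * (1 - 'X))) +
    (2%:R *: (- ('X ^+ 2 * (1 - c - F))) - 2%:R *: ('X ^+ 2 * F)).
    rewrite -scalerBr.
    have -> : - ('X ^+ 2 * (1 - c - F)) - 'X ^+ 2 * F = - ('X ^+ 2 * (1 - c)) by ring.
    rewrite scalerN scalerAr scalerBr c2.
    by pring.
  by rewrite -key.
apply: (upD pp) => //.
rewrite -[e]add0r; apply: (upD pp).
  by rewrite -[0](mulr0 2); apply: (upZ pp) => //; apply: up_sqr => //; apply: sa_M.
apply: (@up_le _ _ ph _ (ph (- ((2 : R)%:C *: ('X ^+ 2 * E))))); last exact: up_norm.
rewrite (scN pp) (scZp pp) //.
have := scM pp ('X ^+ 2) E; have := scM pp 'X 'X; rewrite -expr2.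
have := sc_ge0 pp 'X; have := sc_ge0 pp E; have := sc_ge0 pp ('X ^+ 2).
move=> a1 a2 a3 a4 a5; have a6 : ph ('X ^+ 2) <= 1 by nra.
by nra.
Qed.

(* If every -b*b with p b <= 1 is bounded above by beta, then applying this to
   2 b (1 - b*b), whose norm is still at most 1, improves beta to beta/4. *)
Lemma up_starM_step beta : (forall b, p b <= 1 -> up p (- (star b * b)) beta) ->
  forall b, p b <= 1 -> up p (- (star b * b)) (beta / 4).
Proof.
move=> H b b1; set h := star b * b.
have hh : star h = h by exact: sa_SM.
have h1 : p h <= 1.
  by rewrite /h (scSM hp) expr_le1 // (sc_ge0 hp).
set c := b * (1 - h).
have cc : star c * c = h * ((1 - h) * (1 - h)).
  rewrite /c starM starB star1 hh mulrA -(mulrA (1 - h)) -/h.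
  by ncring.
have pc : p ((2 : R)%:C *: c) <= 1.
  rewrite (scZp hp) //.
  (* 4/27 is the maximum of x (1 - x)^2 on [0, 1]; four times it is below 1, so 2 c stays in the
     unit ball. *)
  have : p c ^+ 2 <= 4 / 27.
    apply: up_starM_norm; first lra.
    rewrite cc; have := upZ hp (_ : 0 <= 27^-1) (cubic_up hh h1).
    rewrite scalerA -rmorphM /= mulVf ?pnatr_eq0 // rmorph1 scale1r mulrC.
    by apply; rewrite invr_ge0.
  by have := sc_ge0 hp c; nra.
apply: up_neg_of_cubic => //; rewrite -cc.
have := upZ hp (_ : 0 <= 4^-1) (H _ pc).
rewrite starZR -scalerAl -scalerAr !scalerA -rmorphM scalerN scalerA -rmorphM.
have -> : 4^-1 * (2 * 2) = 1 :> R by lra.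
by rewrite rmorph1 scale1r mulrC; apply; rewrite invr_ge0.
Qed.

Theorem starM_pos b : up p (- (star b * b)) 0.
Proof.
have K b0 : p b0 <= 1 -> up p (- (star b0 * b0)) 0.
  move=> b1; apply: up_closed => e e0; rewrite add0r.
  have P n : forall b0, p b0 <= 1 -> up p (- (star b0 * b0)) (1 / 4 ^+ n).
    elim: n => [|n IH]; last first.
      by move=> b2 b21; rewrite exprSr invfM mulrA; apply: up_starM_step.
    move=> b2 b21; rewrite expr0 divr1.
    apply: (@up_le _ _ _ _ (p (- (star b2 * b2)))); last exact: up_norm.
    by rewrite (scN hp) (scSM hp) expr_le1 // (sc_ge0 hp).
  pose n := Num.bound (1 / e).
  apply: (@up_le _ _ _ _ (1 / 4 ^+ n)); last exact: P.
  rewrite ler_pdivrMr ?exprn_gt0 //.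
  have := upper_nthrootP (leqnn n); rewrite ltr_pdivrMr // mulrC => /ltW h.
  apply: le_trans h _; rewrite ler_wpM2l ?(ltW e0) //.
  by rewrite lerXn2r ?nnegrE //; lra.
set t := p b + 1; have t0 : 0 < t by have := sc_ge0 hp b; rewrite /t; lra.
have := K ((t^-1)%:C *: b); rewrite (scZp hp) ?invr_ge0 ?(ltW t0) // mulrC.
rewrite ler_pdivrMr // mul1r {1}/t => /(_ ltac:(lra)) H.
have := upZ hp (sqr_ge0 t) H.
rewrite mulr0 starZR -scalerAl -scalerAr scalerN !scalerA -!rmorphM.
have -> : t ^+ 2 / t / t = 1 by rewrite expr2 mulfK ?gt_eqF // divff ?gt_eqF.
by rewrite rmorph1 scale1r.
Qed.

End Kaplansky2.

(** * Sublinear functionals and states *)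

Section Sublinear.
Context (R : realType) (V : lmodType R[i]) (D : set V).
Hypothesis hD : linear_subspace D.
Implicit Types (N M f : V -> R) (x y v : V).

Definition sublin N := (forall x y, D x -> D y -> N (x + y) <= N x + N y) /\
  (forall (t : R) x, 0 <= t -> D x -> N (t%:C *: x) = t * N x).

Definition rlin f := (forall x y, D x -> D y -> f (x + y) = f x + f y) /\
  (forall (t : R) x, D x -> f (t%:C *: x) = t * f x).

Definition le_on f N := forall x, D x -> f x <= N x.

Lemma subsp0 : D 0. Proof. by case: hD. Qed.
Lemma subspD x y : D x -> D y -> D (x + y).
Proof. by case: hD => _ H hx hy; rewrite -[x]scale1r; apply: H. Qed.
Lemma subspZ c x : D x -> D (c *: x).
Proof. by case: hD => D0 H hx; rewrite -[_ *: _]addr0; apply: H. Qed.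
Lemma subspN x : D x -> D (- x).
Proof. by move=> hx; rewrite -scaleN1r; apply: subspZ. Qed.
Lemma subspB x y : D x -> D y -> D (x - y).
Proof. by move=> hx hy; apply: subspD => //; apply: subspN. Qed.

Lemma sublin0 N : sublin N -> N 0 = 0.
Proof. by case=> _ H; rewrite -(scale0r 0) (H 0) ?mul0r //; exact: subsp0. Qed.

Lemma sublin_ge N x : sublin N -> D x -> - N (- x) <= N x.
Proof.
move=> hN hx; have := hN.1 x (- x) hx (subspN hx).
by rewrite subrr sublin0 //; lra.
Qed.

Lemma rlinN f x : rlin f -> D x -> f (- x) = - f x.
Proof.
move=> hf hx; rewrite -scaleN1r -(rmorphN1 (@real_complex R)).
by rewrite hf.2 // mulN1r.
Qed.

Lemma rlin0 f : rlin f -> f 0 = 0.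
Proof.
move=> hf; rewrite -(scale0r 0) -(rmorph0 (@real_complex R)) hf.2 ?mul0r //.
exact: subsp0.
Qed.

Lemma rlinB f x y : rlin f -> D x -> D y -> f (x - y) = f x - f y.
Proof. by move=> hf hx hy; rewrite hf.1 ?rlinN //; apply: subspN. Qed.

(** The sublinear functional of a face: the linear functionals below it are exactly those below N
    that attain N v at v ([rlin_le_shave], [rlin_shave_eq]). *)
Definition shave N v x := inf [set N (x + t%:C *: v) - t * N v | t in [set t : R | 0 <= t]].

Lemma shave_lb N v : sublin N -> D v -> forall x, D x ->
  lbound [set N (x + t%:C *: v) - t * N v | t in [set t : R | 0 <= t]] (- N (- x)).
Proof.
move=> hN hv x hx _ [t t0 <-].
have := hN.1 (x + t%:C *: v) (- x).
rewrite addrAC subrr add0r hN.2 // => H.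
by have := H (subspD hx (subspZ _ hv)) (subspN hx); lra.
Qed.

Lemma shave_le N v x t : sublin N -> D v -> D x -> 0 <= t ->
  shave N v x <= N (x + t%:C *: v) - t * N v.
Proof.
move=> hN hv hx t0; apply: ge_inf; last by exists t.
by exists (- N (- x)); exact: shave_lb.
Qed.

Lemma le_shave N v x (z : R) :
  (forall t, 0 <= t -> z <= N (x + t%:C *: v) - t * N v) -> z <= shave N v x.
Proof.
move=> H; apply: lb_le_inf; last by move=> _ [t t0 <-]; exact: H.
by exists (N (x + 0%:C *: v) - 0 * N v); exists 0 => //=.
Qed.

Lemma shave_le_self N v : sublin N -> D v -> le_on (shave N v) N.
Proof.
move=> hN hv x hx; have := shave_le hN hv hx (lexx 0).
by rewrite scale0r addr0 mul0r subr0.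
Qed.

Lemma shaveN N v : sublin N -> D v -> shave N v (- v) <= - N v.
Proof.
move=> hN hv; have := shave_le hN hv (subspN hv) (@ler01 R).
by rewrite scale1r addNr sublin0 // mul1r sub0r.
Qed.

Lemma shave_sublin N v : sublin N -> D v -> sublin (shave N v).
Proof.
move=> hN hv; split=> [x y hx hy|t x].
  rewrite -lerBlDr; apply: le_shave => s s0; rewrite lerBlDr -lerBlDl.
  apply: le_shave => r r0; rewrite lerBlDl.
  apply: le_trans (shave_le hN hv (subspD hx hy) (addr_ge0 s0 r0)) _.
  have := hN.1 _ _ (subspD hx (subspZ s%:C hv)) (subspD hy (subspZ r%:C hv)).
  by rewrite addrACA -scalerDl -rmorphD mulrDl; lra.
rewrite le_eqVlt => /predU1P[<- hx|t0 hx].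
  rewrite scale0r mul0r; apply/eqP; rewrite eq_le; apply/andP; split.
    by have := shave_le_self hN hv subsp0; rewrite (sublin0 hN).
  by apply: le_shave => s s0; rewrite add0r hN.2 // subrr.
have K s y : 0 < s -> D y -> shave N v (s%:C *: y) <= s * shave N v y.
  move=> s0 hy; rewrite -ler_pdivrMl //; apply: le_shave => r r0.
  rewrite ler_pdivrMl //; have sr : 0 <= s * r by rewrite mulr_ge0 // ltW.
  apply: le_trans (shave_le hN hv (subspZ _ hy) sr) _.
  rewrite rmorphM -scalerA -scalerDr hN.2 ?(ltW s0) //; last first.
    by apply: subspD => //; apply: subspZ.
  by rewrite mulrBr mulrA.
apply/eqP; rewrite eq_le K //= -ler_pdivlMl //.
have := K t^-1 (t%:C *: x); rewrite invr_gt0 scalerA -rmorphM mulVf ?gt_eqF //.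
by rewrite rmorph1 scale1r; apply => //; apply: subspZ.
Qed.

Lemma rlin_le_shave N f v : sublin N -> D v -> rlin f -> le_on f N ->
  f v = N v -> le_on f (shave N v).
Proof.
move=> hN hv hf fN fv x hx; apply: le_shave => t t0.
have := fN (x + t%:C *: v) (subspD hx (subspZ _ hv)).
by rewrite hf.1 ?hf.2 // ?fv; [lra|apply: subspZ].
Qed.

Lemma rlin_shave_eq N f v : sublin N -> D v -> rlin f ->
  le_on f (shave N v) -> le_on f N /\ f v = N v.
Proof.
move=> hN hv hf fs; have fN : le_on f N.
  by move=> x hx; apply: le_trans (fs x hx) _; exact: shave_le_self.
split=> //; apply/eqP; rewrite eq_le fN //=.
have := le_trans (fs _ (subspN hv)) (shaveN hN hv).
by rewrite rlinN //; lra.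
Qed.

(* Sublinear functionals [N] stand for the convex sets of the real-linear
   functionals below them; [good N] says that this set is stable under [Rel]. *)
Variable Rel : (V -> R) -> (V -> R) -> Prop.

Definition good N := forall f f', rlin f -> le_on f N -> Rel f f' -> le_on f' N.

(** Zorn's lemma with pointwise infima of chains. The infimum is subadditive because of two members
    of a chain one lies below the other, it is good because a functional below it lies below each
    member, and [sublin_ge] keeps it finite. *)
Lemma good_min N0 : sublin N0 -> good N0 -> exists N, [/\ sublin N, good N,
  le_on N N0 & forall M, sublin M -> good M -> le_on M N -> le_on N M].
Proof.
move=> hN0 gN0.
pose T := {N : V -> R | [/\ sublin N, good N & le_on N N0]}.
(* [ZL_preorder] yields maximal elements, so the order is reversed. *)
pose rT (N M : T) := `[< le_on (sval M) (sval N) >].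
have t0 : T by exists N0; split=> // x _; exact: lexx.
have [|||[N [hN gN NN0]] hmax] := @ZL_preorder T t0 rT.
- by move=> N; apply/asboolP => x _.
- move=> N M K /asboolP h1 /asboolP h2; apply/asboolP => x hx.
  by apply: le_trans (h2 x hx) (h1 x hx).
- move=> A tA; have [A0|/set0P/negP/negPn/eqP A0] := pselect (A !=set0); last first.
    by exists t0 => s; rewrite A0.
  pose I x := [set sval N x | N in A].
  have Ilb x : D x -> lbound (I x) (- N0 (- x)).
    move=> hx _ [[N [hN gN NN0]] AN <-] /=.
    have := sublin_ge hN hx; have := NN0 _ (subspN hx); lra.
  have I0 x : (I x) !=set0 by case: A0 => N AN; exists (sval N x), N.
  have Ile (N : T) x : A N -> D x -> inf (I x) <= sval N x.
    move=> AN hx; apply: ge_inf; first by exists (- N0 (- x)); exact: Ilb.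
    by exists N.
  have leI x z : (forall N : T, A N -> z <= sval N x) -> z <= inf (I x).
    by move=> H; apply: lb_le_inf => // _ [N AN <-]; exact: H.
  have hI : sublin (fun x => inf (I x)).
    split=> [x y hx hy|t x].
      rewrite -lerBlDr; apply: (leI _ _) => N AN; rewrite lerBlDr -lerBlDl.
      apply: (leI _ _) => M AM; rewrite lerBlDl.
      have [/asboolP h|/asboolP h] := tA _ _ AN AM.
        apply: le_trans (Ile _ _ AM (subspD hx hy)) _.
        case: (svalP M) => hM _ _; apply: le_trans (hM.1 _ _ hx hy) _.
        by rewrite lerD2r; exact: h.
      apply: le_trans (Ile _ _ AN (subspD hx hy)) _.
      case: (svalP N) => hM _ _; apply: le_trans (hM.1 _ _ hx hy) _.
      by rewrite lerD2l; exact: h.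
    rewrite le_eqVlt => /predU1P[<- hx|t0' hx].
      rewrite scale0r mul0r; apply/eqP; rewrite eq_le; apply/andP; split.
        case: A0 => N AN; apply: le_trans (Ile N _ AN subsp0) _.
        by case: (svalP N) => hN _ _; rewrite sublin0.
      by apply: (leI _ _) => N AN; case: (svalP N) => hN _ _; rewrite sublin0.
    have K s y : 0 < s -> D y -> inf (I (s%:C *: y)) <= s * inf (I y).
      move=> s0 hy; rewrite -ler_pdivrMl //; apply: (leI _ _) => N AN.
      rewrite ler_pdivrMl //; case: (svalP N) => hN _ _; rewrite -hN.2 ?(ltW s0) //.
      by apply: Ile => //; apply: subspZ.
    apply/eqP; rewrite eq_le K //= -ler_pdivlMl //.
    have := K t^-1 (t%:C *: x); rewrite invr_gt0 scalerA -rmorphM mulVf ?gt_eqF //.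
    by rewrite rmorph1 scale1r; apply => //; apply: subspZ.
  have hT : [/\ sublin (fun x => inf (I x)), good (fun x => inf (I x)) &
      le_on (fun x => inf (I x)) N0].
    split=> //; last first.
      move=> x hx; case: A0 => N AN; apply: le_trans (Ile N _ AN hx) _.
      by case: (svalP N) => _ _; exact.
    move=> f f' hf fI ff' x hx; apply: (leI _ _) => N AN.
    case: (svalP N) => _ gN _; apply: (gN _ _ hf _ ff') => // y hy.
    by apply: le_trans (fI y hy) _; exact: Ile.
  pose P N := [/\ sublin N, good N & le_on N N0].
  by exists (exist P _ hT) => N AN; apply/asboolP => x hx; exact: Ile.
- exists N; split=> // M hM gM MN.
  have MN0 : le_on M N0 by move=> x hx; apply: le_trans (MN x hx) (NN0 x hx).
  pose P N := [/\ sublin N, good N & le_on N N0].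
  have := hmax (exist P M (And3 hM gM MN0)) => /= H.
  by have /asboolP := H (asboolT MN).
Qed.

End Sublinear.

Section HahnBanach.
Context (R : realType) (V : lmodType R[i]) (D : set V).
Hypothesis hD : linear_subspace D.

(** For the empty relation every functional is good. A minimal one is not lowered by [shave], and
    the shaving inequality at parameter 1 is then superadditivity. *)
Lemma hahn_banach_le (N : V -> R) : sublin D N ->
  exists2 f, rlin D f & le_on D f N.
Proof.
move=> hN; have gF M : good D (fun _ _ => False) M by [].
have [f [hf _ fN fmin]] := good_min hD hN (gF N).
have add x y : D x -> D y -> f x + f y <= f (x + y).
  move=> hx hy; have := fmin _ (shave_sublin hD hf hy) (gF _)
    (shave_le_self hD hf hy) x hx.
  have := shave_le hD hf hy hx (@ler01 R).
  by rewrite scale1r mul1r; lra.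
have fD x y : D x -> D y -> f (x + y) = f x + f y.
  by move=> hx hy; apply/eqP; rewrite eq_le add // andbT; exact: hf.1.
have fNe x : D x -> f (- x) = - f x.
  move=> hx; have := fD x (- x) hx (subspN hD hx).
  by rewrite subrr (sublin0 hD hf); lra.
exists f => //; split=> // t x hx; have [t0|/ltW t0] := leP 0 t; first exact: hf.2.
have := hf.2 (- t) x; rewrite oppr_ge0 rmorphN scaleNr fNe; last exact: subspZ.
by rewrite mulNr => H; apply: oppr_inj; exact: H.
Qed.

Theorem hahn_banach (N : V -> R) v : sublin D N -> D v ->
  exists f, [/\ rlin D f, le_on D f N & f v = N v].
Proof.
move=> hN hv; have [f hf fs] := hahn_banach_le (shave_sublin hD hN hv).
by have [fN fv] := rlin_shave_eq hD hN hv hf fs; exists f.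
Qed.

End HahnBanach.

Lemma half_double (R : realType) (V : lmodType R[i]) (v : V) :
  (2^-1 : R)%:C *: (v + v) = v.
Proof.
rewrite -{1}[v]scale1r -{2}[v]scale1r -scalerDl scalerA -{1 2}(rmorph1 (@real_complex R)).
rewrite -rmorphD -rmorphM; have -> : 2^-1 * (1 + 1) = 1 :> R by lra.
by rewrite rmorph1 scale1r.
Qed.

Section States.
Context (R : realType) (A : starAlgType R).
Local Notation C := R[i].

(* The real part of a state determines it. *)
Definition state (p phi : A -> R) := [/\ rlin setT phi, forall a, phi a <= p a,
  forall b, 0 <= phi (star b * b), forall a, phi (star a) = phi a & phi 1 = 1].

Lemma subspT (V : lmodType C) : linear_subspace [set: V]. Proof. by []. Qed.

(** N v is the top of the spectrum of the real part of v. A linear functional below N vanishes on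
    skew-adjoint elements and is nonnegative on [star b * b] by [starM_pos]; at [star a * a] the
    functional N takes the value p a ^+ 2 by [up_starM_norm], and Hahn-Banach attains it. *)
Lemma state_exists (p : A -> R) (a : A) : csn p -> p 1 = 1 ->
  exists2 phi, state p phi & phi (star a * a) = p a ^+ 2.
Proof.
move=> hp p1; pose re (v : A) := (2^-1 : R)%:C *: (v + star v).
pose N v := inf [set t | up p (re v) t].
have pre v : p (re v) <= p v.
  rewrite (scZp hp); last lra.
  by have := scD hp v (star v); rewrite (sc_star hp); lra.
have lb v : lbound [set t | up p (re v) t] (- p v).
  by move=> t /= H; have := up_ge hp p1 H; have := pre v; lra.
have Nle v t : up p (re v) t -> N v <= t.
  by move=> H; apply: ge_inf => //; exists (- p v); exact: lb.
have leN v z : (forall t, up p (re v) t -> z <= t) -> z <= N v.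
  move=> H; apply: lb_le_inf => //; exists (p (re v)).
  exact: up_norm.
have reD v w : re (v + w) = re v + re w.
  by rewrite /re starD addrACA scalerDr.
have reZ (t : R) v : re (t%:C *: v) = t%:C *: re v.
  by rewrite /re starZR -scalerDr !scalerA mulrC.
have re_sa v : star v = v -> re v = v.
  by move=> sv; rewrite /re sv half_double.
have hN : sublin setT N.
  split=> [x y _ _|t x].
    rewrite -lerBlDr; apply: (leN _ _) => s hs; rewrite lerBlDr -lerBlDl.
    apply: (leN _ _) => r hr; rewrite lerBlDl; apply: Nle; rewrite reD.
    exact: (upD hp).
  have K (s : R) y : 0 <= s -> N (s%:C *: y) <= s * N y.
    rewrite le_eqVlt => /predU1P[<-|s0].
      rewrite mul0r; apply: Nle; rewrite reZ -[X in up _ _ X](mul0r (p (re y))).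
      by apply: (upZ hp) => //; exact: up_norm.
    rewrite -ler_pdivrMl //; apply: (leN _ _) => r hr; rewrite ler_pdivrMl //.
    by apply: Nle; rewrite reZ; apply: (upZ hp) => //; exact: ltW.
  rewrite le_eqVlt => /predU1P[<- _|t0 _].
    rewrite mul0r; apply/eqP; rewrite eq_le; apply/andP; split.
      by have := K 0 x (lexx 0); rewrite mul0r.
    apply: (leN _ _) => r; rewrite reZ rmorph0 scale0r => /(up_ge hp p1).
    by rewrite (sc0 hp) oppr0.
  apply/eqP; rewrite eq_le K ?(ltW t0) //= -ler_pdivlMl //.
  have := K t^-1 (t%:C *: x); rewrite scalerA -rmorphM mulVf ?gt_eqF //.
  by rewrite rmorph1 scale1r; apply; rewrite invr_ge0 ltW.
have [phi [hphi phiN phia]] := hahn_banach (@subspT A) hN (I : setT (star a * a)).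
have phiup v t : up p (re v) t -> phi v <= t.
  by move=> H; apply: le_trans (phiN v I) (Nle _ _ H).
have phi0 : phi 0 = 0 := rlin0 (@subspT A) hphi.
have phiNe v : phi (- v) = - phi v := rlinN hphi (I : setT v).
have re0 v : re v = 0 -> phi v = 0.
  move=> rv; have : phi v <= 0.
    by apply: phiup; rewrite rv; have := up_norm p 0; rewrite (sc0 hp).
  have : phi (- v) <= 0.
    apply: phiup; rewrite -scaleN1r -(rmorphN1 (@real_complex R)) reZ rv scaler0.
    by have := up_norm p 0; rewrite (sc0 hp).
  by rewrite phiNe; lra.
exists phi; first split=> //.
- by move=> v; apply: phiup; apply: up_le (pre v) _; exact: up_norm.
- move=> b; have : phi (- (star b * b)) <= 0.
    by apply: phiup; rewrite re_sa ?starN ?sa_SM //; exact: starM_pos.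
  by rewrite phiNe; lra.
- move=> v; have : phi (star v - v) = 0.
    by apply: re0; rewrite /re starB starK addrA subrK subrr scaler0.
  by rewrite (rlinB (@subspT A) hphi) // => /eqP; rewrite subr_eq0 => /eqP.
- have h1 : phi 1 <= 1.
    apply: phiup; rewrite re_sa ?star1 //; have := up_cst hp 1.
    by rewrite rmorph1 scale1r.
  have h2 : phi (- 1) <= - 1.
    apply: phiup; rewrite re_sa ?starN ?star1 //; have := up_cst hp (-1).
    by rewrite rmorphN1 scaleN1r.
  by rewrite phiNe in h2; lra.
rewrite phia; apply/eqP; rewrite eq_le; apply/andP; split.
  apply: Nle; rewrite re_sa ?sa_SM // -(scSM hp); exact: up_norm.
apply: (leN _ _) => t; rewrite re_sa ?sa_SM // => H.
(* A negative upper bound would force p a = 0 by [up_starM_norm], and [up_ge] would then give t >=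
   0. *)
have t0 : 0 <= t.
  apply/ler_addgt0Pr => e e0.
  have e2 : 0 < e by [].
  have Hp := up_starM_norm hp.
  rewrite leNgt; apply/negP => te.
  have z : p a ^+ 2 <= 0 by apply: Hp => //; apply: up_le H; lra.
  have pz : p (star a * a) = 0.
    by rewrite (scSM hp); apply/eqP; rewrite eq_le z sqr_ge0.
  by have := up_ge hp p1 H; rewrite pz; lra.
exact: up_starM_norm.
Qed.

End States.

(** * Completeness of the quotients by seminorm kernels *)

Lemma choice_ex (X Y : Type) (P : X -> Y -> Prop) :
  (forall x, exists y, P x y) -> exists f, forall x, P x (f x).
Proof. by move=> /choice[f hf]; exists f. Qed.

Section Frechet.
Context (R : realType) (A : frechetLocCStarType R).
Local Notation C := R[i].
Local Notation hf j := ((2^-1 : R) ^+ j).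

Lemma cssn_csn m : csn (@cssn R A m). Proof. exact: cssn_cstar. Qed.

Lemma cssn_mono m k (a : A) : (m <= k)%N -> cssn m a <= cssn k a.
Proof.
move=> /subnK <-; elim: (k - m)%N => [|n IH] //.
by rewrite addSn; apply: le_trans IH (cssn_nondecreasing _ _).
Qed.

Lemma cssn_ball (m : nat) (e : R) (a : A) : 0 < e ->
  nbhs a [set b | cssn m (a - b) < e].
Proof.
move=> e0; have hE : entourage [set ab : A * A | cssn m (ab.1 - ab.2) < e].
  by apply/cssn_entourage; exists m, e; split.
apply: filterS (nbhs_entourage a hE) => b.
by rewrite /xsection /= inE.
Qed.

Lemma cssn_seq_complete (x : nat -> A) :
  (forall k (e : R), 0 < e -> exists N, forall i j, (N <= i)%N -> (N <= j)%N ->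
    cssn k (x i - x j) < e) ->
  exists a : A, forall k (e : R), 0 < e -> exists N, forall i, (N <= i)%N ->
    cssn k (a - x i) < e.
Proof.
move=> H; pose F : set_system A := x @ \oo.
have PF : ProperFilter F by apply: fmap_proper_filter.
have cF : cauchy F.
  move=> E /cssn_entourage[k [e [e0 hE]]].
  have [N hN] := H k e e0.
  exists ([set b | exists2 i, (N <= i)%N & x i = b], [set b | exists2 i, (N <= i)%N & x i = b]).
    by split; exists N => // i /= Ni; exists i.
  move=> [b c] /= [[i Ni <-] [j Nj <-]]; apply: hE => /=; exact: hN.
have [a Fa] := cssn_complete F PF cF.
exists a => k e e0; have := Fa _ (cssn_ball k a e0).
by move=> [N _ hN]; exists N => i Ni; exact: hN.
Qed.

Lemma hf_small (c e : R) : 0 <= c -> 0 < e -> exists N, forall i, (N <= i)%N -> c * hf i < e.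
Proof.
move=> c0 e0; exists (Num.bound (c / e)) => i Ni.
have := upper_nthrootP Ni; rewrite ltr_pdivrMr // => h.
rewrite exprVn ltr_pdivrMr ?exprn_gt0 // mulrC; lra.
Qed.

Lemma hf_gt0 j : 0 < hf j. Proof. by rewrite exprn_gt0 // invr_gt0. Qed.

Lemma hfS j : hf j.+1 = 2^-1 * hf j. Proof. exact: exprS. Qed.

Lemma geo_tele (p : A -> R) (x : nat -> A) (c : R) : csn p -> 0 <= c ->
  (forall j, p (x j.+1 - x j) <= c * hf j) ->
  forall i j, (i <= j)%N -> p (x j - x i) <= 2 * c * hf i - 2 * c * hf j.
Proof.
move=> hp c0 H i j /subnK <-; elim: (j - i)%N => [|n IH].
  by rewrite add0n !subrr (sc0 hp).
rewrite addSn; have -> : x (n + i).+1 - x i = (x (n + i).+1 - x (n + i)%N) + (x (n + i)%N - x i).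
  by rewrite addrA subrK.
apply: le_trans (scD hp _ _) _; have := H (n + i)%N; rewrite hfS; lra.
Qed.

(** The limit is estimated in every C*-seminorm below some p_m with the rate of that seminorm. The
    lifting argument needs this for the seminorm q and for all p_k at once. *)
Lemma geo_complete (x : nat -> A) :
  (forall k, exists2 c : R, 0 <= c & forall j, cssn k (x j.+1 - x j) <= c * hf j) ->
  exists a : A, forall (p : A -> R) m, csn p -> (forall b, p b <= cssn m b) ->
    forall c : R, 0 <= c -> (forall j, p (x j.+1 - x j) <= c * hf j) ->
    forall j, p (a - x j) <= 2 * c * hf j.
Proof.
move=> H; have [|a ha] := @cssn_seq_complete x.
  move=> k e e0; have [c c0 hc] := H k.
  have [N hN] := @hf_small (4 * c) e (mulr_ge0 (ler0n _ 4) c0) e0.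
  have K i : (N <= i)%N -> cssn k (x i - x N) <= 2 * c * hf N.
    move=> Ni; have := geo_tele (cssn_csn k) c0 hc Ni.
    by have := mulr_ge0 c0 (ltW (hf_gt0 i)); lra.
  exists N => i j Ni Nj.
  have -> : x i - x j = (x i - x N) - (x j - x N) by ncring.
  apply: le_lt_trans (scB (cssn_csn k) _ _) _.
  by have := K i Ni; have := K j Nj; have := hN N (leqnn N); lra.
exists a => p m hp pm c c0 hc j; apply/ler_addgt0Pr => e e0.
have [N hN] := ha m e e0; set i := maxn N j.
have -> : a - x j = (a - x i) + (x i - x j) by ncring.
apply: le_trans (scD hp _ _) _.
have h1 := pm (a - x i); have h2 := hN i (leq_maxl _ _).
have h3 := geo_tele hp c0 hc (leq_maxr N j : (j <= i)%N).
by have := mulr_ge0 c0 (ltW (hf_gt0 i)); lra.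
Qed.

(* exp(ih) is obtained as the limit of (1 + ih/2^j)^(2^j); its real and
   imaginary parts are bounded for all the seminorms simultaneously. *)
Definition expi (h : A) j : A := (1 + (hf j)%:C *: ('i%C *: h)) ^+ (2 ^ j).

Lemma pow_diff (p : A -> R) (a b : A) (M : R) n : csn p -> 1 <= M ->
  p a <= M -> p b <= M -> p (a ^+ n - b ^+ n) <= n%:R * M ^+ n * p (a - b).
Proof.
move=> hp M1 pa pb; have M0 : 0 <= M by lra.
have pX c k : p c <= M -> p (c ^+ k) <= M ^+ k.
  move=> pc; elim: k => [|k IH]; first by rewrite !expr0 (sc1 hp).
  rewrite !exprS; apply: le_trans (scM hp _ _) _.
  by apply: ler_pM; rewrite ?(sc_ge0 hp).
elim: n => [|n IH]; first by rewrite !expr0 subrr (sc0 hp) !mul0r.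
rewrite !exprS; have -> : a * a ^+ n - b * b ^+ n = a * (a ^+ n - b ^+ n) + (a - b) * b ^+ n.
  by ncring.
apply: le_trans (scD hp _ _) _.
have -> : n.+1%:R * (M * M ^+ n) * p (a - b) =
  n%:R * (M * M ^+ n) * p (a - b) + M * M ^+ n * p (a - b).
  by rewrite -natr1; ring.
have d0 := sc_ge0 hp (a - b); apply: lerD.
  apply: le_trans (scM hp _ _) _.
  apply: (@le_trans _ _ (M * (n%:R * M ^+ n * p (a - b)))).
    by apply: ler_pM; rewrite ?(sc_ge0 hp).
  by rewrite !mulrA (mulrC M n%:R).
apply: le_trans (scM hp _ _) _; rewrite mulrC; apply: ler_wpM2r => //.
apply: le_trans (pX b n pb) _; rewrite ler_peMl // exprn_ge0 //.
Qed.

(** With s = 2^-(j+1) and x = i h, (1 + s x)^2 and 1 + 2 s x differ by s^2 x^2; the power 2^j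
    multiplies this by at most 2^j exp(p h) ([pow_diff]), which leaves order 2^-j. *)
Lemma expi_inc (p : A -> R) (h : A) j : csn p ->
  p (expi h j.+1 - expi h j) <= expR (p h) * p h ^+ 2 * hf j.
Proof.
move=> hp; set r := p h; have r0 : 0 <= r := sc_ge0 hp h.
set x := 'i%C *: h; have px : p x = r by exact: (sc_i hp).
set a := (1 + (hf j.+1)%:C *: x) ^+ 2; set b := 1 + (hf j)%:C *: x.
have -> : expi h j.+1 - expi h j = a ^+ (2 ^ j) - b ^+ (2 ^ j).
  by rewrite /expi expnS exprM.
have g0 := hf_gt0 j; have g1 := hf_gt0 j.+1.
pose M : R := expR (hf j * r).
have M1 : 1 <= M.
  apply: le_trans (expR_ge1Dx _); rewrite lerDl mulr_ge0 // ltW.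
have pb : p b <= M.
  apply: le_trans (scD hp _ _) _; rewrite (scZp hp) ?(ltW g0) // px.
  by apply: le_trans (expR_ge1Dx _); rewrite lerD2r (sc1 hp).
have pa : p a <= M.
  rewrite /a expr2; apply: le_trans (scM hp _ _) _.
  have -> : M = expR (hf j.+1 * r) * expR (hf j.+1 * r).
    by rewrite -expRD /M hfS; congr expR; lra.
  have K : p (1 + (hf j.+1)%:C *: x) <= expR (hf j.+1 * r).
    apply: le_trans (scD hp _ _) _; rewrite (scZp hp) ?(ltW g1) // px.
    by apply: le_trans (expR_ge1Dx _); rewrite lerD2r (sc1 hp).
  by apply: ler_pM; rewrite ?(sc_ge0 hp).
apply: le_trans (pow_diff _ hp M1 pa pb) _.
have -> : M ^+ (2 ^ j) = expR r.
  by rewrite -expRM_natl mulrA natrX exprVn divff ?mul1r.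
have -> : a - b = (hf j.+1 * hf j.+1)%:C *: (x * x).
  have key (s t : C) (y : A) : s = t + t ->
      (1 + t *: y) ^+ 2 - (1 + s *: y) = (t * t) *: (y * y).
    move=> ->; rewrite expr2 !mulrDl !mulrDr !mul1r mulr1 -!scalerAl -!scalerAr.
    by rewrite scalerA scalerDl; ncring.
  rewrite /a /b rmorphM; apply: key.
  by rewrite -rmorphD hfS; congr (_ %:C); lra.
have pxx : p (x * x) <= r ^+ 2 by rewrite expr2 -px; exact: (scM hp).
rewrite (scZp hp); last by rewrite mulr_ge0 // ltW.
have NN : (2 ^ j)%:R * hf j.+1 = 2^-1.
  by rewrite hfS natrX exprVn mulrCA divff ?mulr1.
have -> : (2 ^ j)%:R * expR r * (hf j.+1 * hf j.+1 * p (x * x)) =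
   expR r * (((2 ^ j)%:R * hf j.+1) * (hf j.+1 * p (x * x))) by ring.
rewrite NN -mulrA; apply: ler_wpM2l; first exact: expR_ge0.
rewrite hfS; have := sc_ge0 hp (x * x); nra.
Qed.

(** The approximants are nearly unitary: [star (expi h j) * expi h j] is the power 2^j of 1 +
    h^2/4^j, whose norm is at most exp(p(h)^2/2^j). *)
Lemma expi_norm (p : A -> R) (h : A) j : csn p -> star h = h ->
  p (expi h j) ^+ 2 * (1 - p h ^+ 2 * hf j) <= 1.
Proof.
move=> hp hh; set r := p h; have r0 : 0 <= r := sc_ge0 hp h.
have g0 := hf_gt0 j.
rewrite -(scSM hp) /expi starX starD star1 starZR starZ hh conj_i.
set s := (hf j)%:C; set x := s *: ('i%C *: h).
have -> : s *: (- 'i%C *: h) = - x by rewrite /x scaleNr scalerN.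
rewrite -exprMn_comm; last by rewrite /GRing.comm; ncring.
have -> : (1 - x) * (1 + x) = 1 + (hf j * hf j)%:C *: (h * h).
  have -> : (1 - x) * (1 + x) = 1 - x * x by ncring.
  rewrite /x -!scalerAl -!scalerAr !scalerA rmorphM; congr (_ + _).
  by rewrite -scaleNr mulrACA ii_N1 mulrN1 opprK.
set y := hf j * hf j * r ^+ 2.
have y0 : 0 <= y by rewrite /y !mulr_ge0 // ?(ltW g0) // sqr_ge0.
have pX c k : p (c ^+ k) <= (Num.max 1 (p c)) ^+ k.
  elim: k => [|k IH]; first by rewrite !expr0 (sc1 hp).
  rewrite !exprS; apply: le_trans (scM hp _ _) _.
  by apply: ler_pM; rewrite ?(sc_ge0 hp) // le_max lexx orbT.
have pz : Num.max 1 (p (1 + (hf j * hf j)%:C *: (h * h))) <= expR y.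
  rewrite ge_max; apply/andP; split.
    by apply: le_trans (expR_ge1Dx y); rewrite lerDl.
  apply: le_trans (expR_ge1Dx y); apply: le_trans (scD hp _ _) _.
  rewrite (scZp hp) ?mulr_ge0 ?(ltW g0) // lerD ?(sc1 hp) // /y ler_wpM2l //.
  by rewrite expr2; exact: (scM hp).
set P := p _; have P0 : 0 <= P by exact: (sc_ge0 hp).
have hP : P <= expR (r ^+ 2 * hf j).
  apply: le_trans (pX _ _) _.
  have -> : r ^+ 2 * hf j = (2 ^ j)%:R * y.
    by rewrite /y natrX exprVn -mulrA mulrCA mulKf 1?mulrC.
  rewrite expRM_natl lerXn2r ?nnegrE ?expR_ge0 //.
  by rewrite le_max ler01.
have := expR_ge1Dx (- (r ^+ 2 * hf j)); rewrite expRN => h1.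
set e := expR _ in hP h1; have e0 : 0 < e by exact: expR_gt0.
have [/ltW?|h2] := ltP (1 - r ^+ 2 * hf j) 0; first by nra.
apply: (@le_trans _ _ (e * e^-1)); last by rewrite divff ?gt_eqF.
by apply: ler_pM.
Qed.

Lemma le1_of_expi (x : R) : (forall e, 0 < e ->
  exists y, [/\ 0 <= y, x <= y + e & y ^+ 2 * (1 - e) <= 1]) -> x <= 1.
Proof.
move=> H; rewrite leNgt; apply/negP => x1.
pose e := Num.min ((x - 1) / 2) (1 / 4).
have e0 : 0 < e by rewrite /e lt_min; apply/andP; split; lra.
have [e1 e2] : e <= (x - 1) / 2 /\ e <= 1 / 4 by rewrite /e !ge_min !lexx orbT.
have [y [y0 h1 h2]] := H _ e0.
have h3 : 1 + (x - 1) <= y ^+ 2 by rewrite expr2; nra.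
by nra.
Qed.

(** u is exp(ih). The last clause is the tail estimate at j = 0, where the approximant is 1 + i
    h. *)
Lemma expi_lim (h : A) : star h = h -> exists u : A,
  (forall k, cssn k u <= 1) /\
  forall (p : A -> R) m, csn p -> (forall b, p b <= cssn m b) ->
    p (u - (1 + 'i%C *: h)) <= 2 * (expR (p h) * p h ^+ 2).
Proof.
move=> hh; have c0 (p : A -> R) : csn p -> 0 <= expR (p h) * p h ^+ 2.
  by move=> hp; rewrite mulr_ge0 ?expR_ge0 ?sqr_ge0.
have [|u hu] := @geo_complete (expi h).
  move=> k; exists (expR (cssn k h) * cssn k h ^+ 2).
    exact: c0 (cssn_csn k).
  by move=> j; apply: expi_inc; exact: cssn_csn.
have K (p : A -> R) m : csn p -> (forall b, p b <= cssn m b) ->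
    forall j, p (u - expi h j) <= 2 * (expR (p h) * p h ^+ 2) * hf j.
  move=> hp pm; apply: hu pm _ (c0 p hp) _ => // j; exact: expi_inc.
exists u; split=> [k|p m hp pm].
  apply: le1_of_expi => e e0; have hp := cssn_csn k.
  have [N1 h1] := hf_small (mulr_ge0 (ler0n _ 2) (c0 _ hp)) e0.
  have [N2 h2] := hf_small (sqr_ge0 (cssn k h)) e0.
  set j := maxn N1 N2; exists (cssn k (expi h j)); split.
  - exact: (sc_ge0 hp).
  - apply: le_trans (sc_dist hp _ (expi h j)) _; rewrite lerD2l.
    apply: le_trans (K _ k hp (fun b => lexx _) j) _.
    by apply/ltW/h1; exact: leq_maxl.
  - have := expi_norm j hp hh; have := h2 j (leq_maxr _ _).
    have := sqr_ge0 (cssn k (expi h j)); nra.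
have := K p m hp pm 0; rewrite expr0 mulr1 /expi expr0 scale1r expr1.
by [].
Qed.

Section Lift.
Variables (q : A -> R) (m : nat).
Hypotheses (hq : csn q) (qm : forall a, q a <= cssn m a).

(** g is the sine of h, the imaginary part of exp(ih). The bound 1/16 makes the quadratic error 2
    exp(q h) q(h)^2 at most a quarter of 1/16, so that the step can be repeated after scaling by
    4. *)
Lemma lift_step (h : A) : star h = h -> q h <= 16^-1 -> exists g : A,
  [/\ star g = g, forall k, cssn k g <= 1 & q (h - g) <= 4^-1 * 16^-1].
Proof.
move=> hh h4; have [u [u1 hu]] := expi_lim hh.
exists ((2^-1 : R)%:C *: ('i%C *: (star u - u))); split.
- by rewrite starZR starZ conj_i starB starK scaleNr -scalerN opprB.
- move=> k; have hp := cssn_csn k; rewrite (scZp hp); last lra.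
  rewrite (sc_i hp); have := scB hp (star u) u; rewrite (sc_star hp).
  by have := u1 k; lra.
set w := u - (1 + 'i%C *: h).
have qw : q w <= 4^-1 * 16^-1.
  apply: le_trans (hu q m hq qm) _.
  have e43 : expR (q h) <= 4 / 3.
    apply: (@le_trans _ _ (expR (16^-1))); first by rewrite ler_expR.
    have := expR_ge1Dx (- 16^-1 : R); rewrite expRN.
    have := expR_gt0 (16^-1 : R); set e := expR _ => e0 h1.
    have : (1 - 16^-1) * e <= e^-1 * e by apply: ler_wpM2r; lra.
    by rewrite mulVf ?gt_eqF //; lra.
  have := sc_ge0 hq h => h0.
  have : q h ^+ 2 <= 16^-1 * 16^-1 by rewrite expr2; nra.
  have := expR_gt0 (q h); have := sqr_ge0 (q h); nra.
have -> : h - (2^-1 : R)%:C *: ('i%C *: (star u - u)) =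
    (2^-1 : R)%:C *: ('i%C *: (w - star w)).
  rewrite -{1}(half_double h) -scalerBr; congr (_ *: _).
  have -> : h + h = - 'i%C *: ('i%C *: h + 'i%C *: h).
    by rewrite -scalerDr scalerA mulNr ii_N1 opprK scale1r.
  rewrite scaleNr -opprD -scalerDr -scalerN; congr (_ *: _).
  rewrite /w starB starD star1 starZ hh conj_i scaleNr.
  by ncring.
rewrite (scZp hq); last lra.
rewrite (sc_i hq); have := scB hq w (star w); rewrite (sc_star hq); lra.
Qed.

(** Since 4 (h - g) again satisfies the hypotheses of [lift_step], the series of the 4^-j g_j is
    built; it converges in every seminorm and represents h modulo ker q. Its terms are at most 2^-j,
    whence the bound 2. *)
Lemma lift_sa4 (h : A) : star h = h -> q h <= 16^-1 -> exists g : A,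
  (forall k, cssn k g <= 2) /\ q (h - g) = 0.
Proof.
move=> hh h4.
pose T := {x : A | star x = x /\ q x <= 16^-1}.
have [G hG] : exists G : T -> A, forall x, [/\ star (G x) = G x,
    forall k, cssn k (G x) <= 1 & q (sval x - G x) <= 4^-1 * 16^-1].
  apply: (choice_ex (P := fun (x : T) g => [/\ star g = g,
    forall k, cssn k g <= 1 & q (sval x - g) <= 4^-1 * 16^-1])).
  by move=> [x [sx qx]]; exact: lift_step.
have next (x : T) : star ((4 : R)%:C *: (sval x - G x)) = (4 : R)%:C *: (sval x - G x)
    /\ q ((4 : R)%:C *: (sval x - G x)) <= 16^-1.
  have [sG _ qG] := hG x; have [sx _] := svalP x; split.
    by rewrite starZR starB sx sG.
  by rewrite (scZp hq) //; lra.
pose P x := star x = x /\ q x <= 16^-1.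
pose H := fix H j : T := if j is j'.+1 then exist P _ (next (H j')) else exist P h (conj hh h4).
pose S := fix S j : A := if j is j'.+1 then S j' + ((4^-1 : R) ^+ j')%:C *: G (H j') else 0.
have q4 j : (4^-1 : R) ^+ j <= hf j.
  by rewrite lerXn2r ?nnegrE ?invr_ge0 //; lra.
have p4 j : 0 <= (4^-1 : R) ^+ j by rewrite exprn_ge0 // invr_ge0.
have hS (p : A -> R) j : csn p -> p (G (H j)) <= 1 -> p (S j.+1 - S j) <= 1 * hf j.
  move=> hp h1 /=; rewrite addrAC subrr add0r (scZp hp) // mul1r.
  by apply: le_trans (q4 j); rewrite ler_piMr.
have qG j : q (G (H j)) <= 1.
  by apply: le_trans (qm _) _; case: (hG (H j)) => _ + _; apply.
have kG k j : cssn k (G (H j)) <= 1 by case: (hG (H j)) => _ + _; apply.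
have [|a ha] := @geo_complete S.
  by move=> k; exists 1 => // j; apply: hS => //; exact: cssn_csn.
exists a; split=> [k|].
  have := ha _ k (cssn_csn k) (fun b => lexx _) 1 ler01.
  move=> /(_ (fun j => hS _ j (cssn_csn k) (kG k j)) 0).
  by rewrite /= subr0 expr0 !mulr1.
have hSj j : h - S j = ((4^-1 : R) ^+ j)%:C *: sval (H j).
  elim: j => [|j IH] /=; first by rewrite subr0 expr0 scale1r.
  rewrite opprD addrA IH -scalerBr scalerA -rmorphM exprSr -mulrA.
  by rewrite mulVf ?mulr1 // pnatr_eq0.
apply/eqP; rewrite eq_le (sc_ge0 hq) andbT; apply/ler_addgt0Pr => e e0.
have [N hN] := hf_small (ler0n R 3) e0; have {}hN := hN N (leqnn N).
have -> : h - a = (h - S N) - (a - S N) by ncring.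
apply: le_trans (scB hq _ _) _; rewrite add0r hSj (scZp hq) //.
have := ha _ m hq qm 1 ler01 (fun j => hS _ j hq (qG j)) N.
have [_] := svalP (H N); have := q4 N; have := p4 N.
by have := sc_ge0 hq (sval (H N)); nra.
Qed.

(** Every class modulo ker q has a representative bounded in all seminorms simultaneously. A
    self-adjoint class is scaled to norm 1/16, lifted with bound 2 and scaled back, which gives 32;
    real and imaginary parts together give 64. *)
Theorem lift (x : A) : exists x' : A, (forall k, cssn k x' <= 64 * q x) /\ q (x - x') = 0.
Proof.
have K h : star h = h -> exists g : A,
    (forall k, cssn k g <= 32 * q h) /\ q (h - g) = 0.
  move=> hh; have [h0|h0] := eqVneq (q h) 0.
    exists 0; rewrite subr0 h0 mulr0; split=> // k.
    by rewrite (sc0 (cssn_csn k)).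
  have hp : 0 < q h by rewrite lt_def h0 (sc_ge0 hq).
  have [||g [g1 g2]] := @lift_sa4 ((16 * q h)^-1%:C *: h).
  - by rewrite starZR hh.
  - rewrite (scZp hq) ?invr_ge0 ?mulr_ge0 ?(ltW hp) // invfM -mulrA mulVf //.
    by rewrite mulr1.
  exists ((16 * q h)%:C *: g); split=> [k|].
    rewrite (scZp (cssn_csn k)) ?mulr_ge0 ?(ltW hp) //.
    by have := g1 k; nra.
  have -> : h - (16 * q h)%:C *: g = (16 * q h)%:C *: ((16 * q h)^-1%:C *: h - g).
    rewrite scalerBr scalerA -rmorphM divff ?rmorph1 ?scale1r //.
    by rewrite mulf_neq0.
  by rewrite (scZp hq) ?mulr_ge0 ?(ltW hp) // g2 mulr0.
have [y [z [sy sz xyz]]] := sa_parts x.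
have sx : star x = y - 'i%C *: z.
  by rewrite xyz starD starZ sy sz conj_i scaleNr.
have yx : q y <= q x.
  rewrite -(half_double y) (scZp hq); last lra.
  have -> : y + y = x + star x by rewrite sx xyz; ncring.
  by have := scD hq x (star x); rewrite (sc_star hq); lra.
have zx : q z <= q x.
  rewrite -(half_double z) (scZp hq); last lra.
  rewrite -(sc_i hq) scalerDr; have -> : 'i%C *: z + 'i%C *: z = x - star x.
    by rewrite sx xyz; ncring.
  by have := scB hq x (star x); rewrite (sc_star hq); lra.
have [y' [y1 y2]] := K y sy; have [z' [z1 z2]] := K z sz.
exists (y' + 'i%C *: z'); split=> [k|].
  apply: le_trans (scD (cssn_csn k) _ _) _; rewrite (sc_i (cssn_csn k)).
  by have := y1 k; have := z1 k; lra.
have -> : x - (y' + 'i%C *: z') = (y - y') + 'i%C *: (z - z').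
  by rewrite xyz scalerBr; ncring.
apply/eqP; rewrite eq_le (sc_ge0 hq) andbT; apply: le_trans (scD hq _ _) _.
by rewrite (sc_i hq) y2 z2 addr0.
Qed.

End Lift.

Definition qcomplete (q : A -> R) := forall x : nat -> A,
  (forall e : R, 0 < e -> exists N, forall i j, (N <= i)%N -> (N <= j)%N ->
    q (x i - x j) <= e) ->
  exists a : A, forall e : R, 0 < e -> exists N, forall i, (N <= i)%N ->
    q (a - x i) <= e.

(** The differences along a rapidly Cauchy subsequence are lifted, the lifts are summable for all
    seminorms, and their sum in A is the required q-limit. *)
Theorem csn_qcomplete (q : A -> R) m : csn q -> (forall a, q a <= cssn m a) -> qcomplete q.
Proof.
move=> hq qm x hx.
have [n hn] : exists n : nat -> nat, forall j i l, (n j <= i)%N -> (n j <= l)%N ->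
    q (x i - x l) <= hf j.
  apply: (choice_ex (P := fun j N => forall i l, (N <= i)%N -> (N <= l)%N ->
    q (x i - x l) <= hf j)).
  by move=> j; apply: hx; exact: hf_gt0.
(* Summing the chosen indices makes them monotone and keeps M j above n j. *)
pose M j := (\sum_(i < j.+1) n i)%N.
have nM j : (n j <= M j)%N by rewrite /M big_ord_recr leq_addl.
have MS j : (M j <= M j.+1)%N by rewrite {2}/M big_ord_recr leq_addr.
have [d hd] : exists d : nat -> A, forall j,
    (forall k, cssn k (d j) <= 64 * q (x (M j.+1) - x (M j))) /\
    q (x (M j.+1) - x (M j) - d j) = 0.
  apply: (choice_ex (P := fun j d =>
    (forall k, cssn k d <= 64 * q (x (M j.+1) - x (M j))) /\
    q (x (M j.+1) - x (M j) - d) = 0)).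
  by move=> j; exact: lift hq qm _.
pose S := fix S j : A := if j is j'.+1 then S j' + d j' else x (M 0).
have dj (p : A -> R) j : (forall k, p (d j) <= cssn k (d j)) -> p (S j.+1 - S j) <= 64 * hf j.
  move=> H /=; rewrite addrAC subrr add0r; apply: le_trans (H 0) _.
  case: (hd j) => /(_ 0) h _; apply: le_trans h _; rewrite ler_wpM2l //.
  by apply: hn; [exact: leq_trans (nM j) (MS j)|exact: nM].
have kj k j : cssn k (S j.+1 - S j) <= 64 * hf j.
  rewrite /= addrAC subrr add0r; case: (hd j) => /(_ k) h _; apply: le_trans h _.
  rewrite ler_wpM2l //.
  by apply: hn; [exact: leq_trans (nM j) (MS j)|exact: nM].
have [|a ha] := @geo_complete S; first by move=> k; exists 64.
have qS j : q (x (M j) - S j) = 0.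
  elim: j => [|j IH]; first by rewrite /= subrr (sc0 hq).
  have -> : x (M j.+1) - S j.+1 = (x (M j) - S j) + (x (M j.+1) - x (M j) - d j).
    by rewrite /=; ncring.
  apply/eqP; rewrite eq_le (sc_ge0 hq) andbT; apply: le_trans (scD hq _ _) _.
  by rewrite IH (hd j).2 addr0.
have qj j : q (S j.+1 - S j) <= 64 * hf j by apply: le_trans (qm _) (kj m j).
exists a => e e0.
have [N hN] := hf_small (ler0n R 129) e0; have {}hN := hN N (leqnn N).
exists (n N) => i Ni.
have -> : a - x i = (a - S N) - (x (M N) - S N) - (x i - x (M N)) by ncring.
apply: le_trans (scB hq _ _) _.
have := scB hq (a - S N) (x (M N) - S N); rewrite qS addr0.
have := ha q m hq qm 64 (ler0n _ _) qj N; have := hn N i (M N) Ni (nM N).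
have := hf_gt0 N; lra.
Qed.

End Frechet.

(** * Uniqueness of C*-norms and quotient seminorms *)

Section Kernel.
Context (R : realType) (A : starAlgType R) (q : A -> R) (hq : csn q).
Local Notation C := R[i].

Lemma ker_le x : q x <= 0 -> q x = 0.
Proof. by move=> h; apply/eqP; rewrite eq_le h (sc_ge0 hq). Qed.

Lemma kerD x y : q x = 0 -> q y = 0 -> q (x + y) = 0.
Proof. by move=> hx hy; apply: ker_le; have := scD hq x y; lra. Qed.

Lemma kerN x : q x = 0 -> q (- x) = 0.
Proof. by rewrite (scN hq). Qed.

Lemma kerMl a x : q x = 0 -> q (a * x) = 0.
Proof. by move=> hx; apply: ker_le; have := scM hq a x; rewrite hx mulr0. Qed.

Lemma kerMr a x : q x = 0 -> q (x * a) = 0.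
Proof. by move=> hx; apply: ker_le; have := scM hq x a; rewrite hx mul0r. Qed.

Lemma kerZ (c : C) x : q x = 0 -> q (c *: x) = 0.
Proof. by move=> hx; rewrite -[c *: x]mulr_algl; apply: kerMl. Qed.

Lemma ker_eps x : (forall e, 0 < e -> q x <= e) -> q x = 0.
Proof. by move=> H; apply: ker_le; apply/ler_addgt0Pr => e e0; rewrite add0r H. Qed.

Lemma ker_comm_poly (c x : A) (P : {poly C}) : q (c * x - x * c) = 0 ->
  q (horner_alg c P * x - x * horner_alg c P) = 0.
Proof.
move=> h; elim/poly_ind: P => [|P d IH].
  by rewrite rmorph0 mul0r mulr0 subrr (sc0 hq).
rewrite rmorphD rmorphM /= horner_algX horner_algC.
set y := horner_alg c P in IH *.
have -> : (y * c + d%:A) * x - x * (y * c + d%:A) =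
    y * (c * x - x * c) + (y * x - x * y) * c.
  by rewrite mulrDl mulrDr -!scalerAl -!scalerAr mul1r mulr1; ncring.
by apply: kerD; [apply: kerMl|apply: kerMr].
Qed.

End Kernel.

Lemma eta_cauchy (R : realType) (e : R) : 0 < e -> exists N, forall i j, (N <= i)%N ->
  (i <= j)%N -> eta R j - eta R i <= e.
Proof.
move=> e0; pose E := [set eta R n | n in [set: nat]].
have hE : has_sup E.
  split; first by exists (eta R 0), 0%N.
  by exists 1 => _ [n _ <-]; case/andP: (eta_bnd R n).
have mono i j : (i <= j)%N -> eta R i <= eta R j.
  by move=> /subnK <-; elim: (j - i)%N => // n IH; rewrite addSn;
    apply: le_trans IH (eta_le _ _).
have [_ [N _ <-] hN] := sup_adherent e0 hE.
exists N => i j Ni ij; have := mono _ _ Ni.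
have : eta R j <= sup E by apply: sup_upper_bound => //; exists j.
lra.
Qed.

Section ExactSqrt.
Context (R : realType) (A : frechetLocCStarType R) (q : A -> R).
Hypotheses (hq : csn q) (cq : qcomplete q).
Local Notation C := R[i].

(** Completeness of A / ker q gives the iteration [ysq] a limit z. It is only determined modulo ker
    q and need not be self-adjoint, so 1 - z is symmetrized. The last clause holds because k is a
    q-limit of polynomials in c. *)
Lemma exact_sqrt (c : A) : star c = c -> q c <= 1 -> exists k : A,
  [/\ star k = k, q (1 - c - k * k) = 0, q (1 - k) <= 1 &
    forall x, q (c * x - x * c) = 0 -> q (k * x - x * k) = 0].
Proof.
move=> sc c1; have pp := csn_poly hq sc; set ph := fun P => _ in pp.
have pX : ph 'X <= 1 by rewrite /ph horner_algX.
pose y n := horner_alg c (ysq 'X n).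
have ytele i j : (i <= j)%N -> q (y j - y i) <= eta R j - eta R i.
  move=> /subnK <-; elim: (j - i)%N => [|n IH]; first by rewrite !subrr (sc0 hq).
  have := ysq_inc pp (n + i) pX; rewrite /ph rmorphB /= => h.
  have := scD hq (y (n + i).+1 - y (n + i)%N) (y (n + i)%N - y i).
  by rewrite addrA subrK addSn; move: h IH; rewrite -/(y _); lra.
have ysa n : star (1 - y n) = 1 - y n.
  rewrite starB star1 /y horner_alg_star //; congr (_ - horner_alg _ _).
  by apply: ysq_sa; exact: map_polyX.
have y1 n : q (y n) <= 1.
  by apply: le_trans (ysq_bnd pp n pX) _; case/andP: (eta_bnd R n).
have ysq2 n : q (1 - c - (1 - y n) * (1 - y n)) <= 2 * (eta R n.+1 - eta R n).
  have := ysq_inc pp n pX; rewrite (scBC pp); set d := ph _ => hd.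
  have -> : q (1 - c - (1 - y n) * (1 - y n)) = 2 * d.
    rewrite /d -(scZp pp) // rmorph_nat -ysq_half /ph.
    by rewrite !rmorphB rmorphXn /= !rmorphB !rmorph1 /= horner_algX expr2.
  by rewrite ler_pM2l.
have [|z hz] := cq (x := y).
  move=> e e0; have [N hN] := eta_cauchy e0; exists N => i j Ni Nj.
  have [ij|/ltnW ij] := leqP i j.
    by rewrite (scBC hq); apply: le_trans (ytele _ _ ij) (hN _ _ Ni ij).
  by apply: le_trans (ytele _ _ ij) (hN _ _ Nj ij).
pose k := (2^-1 : R)%:C *: ((1 - z) + star (1 - z)).
have appr e : 0 < e -> exists n, q (k - (1 - y n)) <= e /\
    q (1 - c - (1 - y n) * (1 - y n)) <= e.
  move=> e0; have [N1 h1] := hz e e0.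
  have [N2 h2] := eta_cauchy (divr_gt0 e0 (@ltr0n R 2)).
  exists (maxn N1 N2); set n := maxn _ _.
  have hn := h1 n (leq_maxl _ _); split.
    have -> : k - (1 - y n) = (2^-1 : R)%:C *: (- (z - y n) + star (- (z - y n))).
      rewrite -[1 - y n]half_double /k -scalerBr; congr (_ *: _).
      rewrite -{2}(ysa n) !(starN, starB, star1); ncring.
    rewrite (scZp hq); last lra.
    have := scD hq (- (z - y n)) (star (- (z - y n))).
    by rewrite (sc_star hq) (scN hq); lra.
  have := ysq2 n; have := h2 n n.+1 (leq_maxr _ _) (leqnSn _); lra.
exists k; split.
- by rewrite starZR starD starK addrC.
- apply: (ker_eps hq) => e e0.
  have d0 : 0 < Num.min 1 (e / 9%:R) by rewrite lt_min ltr01 /=; lra.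
  have [n [h1 h2]] := appr _ d0; set d := Num.min _ _ in d0 h1 h2.
  have [dd1 dd2] : d <= 1 /\ d <= e / 9%:R by rewrite /d !ge_min !lexx orbT.
  set u := 1 - y n in h1 h2.
  have -> : 1 - c - k * k = (1 - c - u * u) - (k - u) * (k - u) - (k - u) * u - u * (k - u).
    by ncring.
  have un : q u <= 2 by apply: le_trans (scB hq _ _) _; have := sc1 hq; have := y1 n; lra.
  have b1 := scB hq (1 - c - u * u - (k - u) * (k - u) - (k - u) * u) (u * (k - u)).
  have b2 := scB hq (1 - c - u * u - (k - u) * (k - u)) ((k - u) * u).
  have b3 := scB hq (1 - c - u * u) ((k - u) * (k - u)).
  have m1 := scM hq u (k - u); have m2 := scM hq (k - u) u.
  have m3 := scM hq (k - u) (k - u).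
  have z1 := sc_ge0 hq (k - u); have z2 := sc_ge0 hq u.
  by nra.
- apply/ler_addgt0Pr => e e0; have [n [h1 _]] := appr e e0.
  have -> : 1 - k = y n - (k - (1 - y n)) by ncring.
  by apply: le_trans (scB hq _ _) _; have := y1 n; lra.
- move=> x hx; apply: (ker_eps hq) => e e0.
  have e1 : 0 < e / (2 * (1 + q x)).
    by apply: divr_gt0 => //; have := sc_ge0 hq x; lra.
  have [n [h1 _]] := appr _ e1; set u := 1 - y n in h1.
  have -> : k * x - x * k = (k - u) * x - x * (k - u) - (y n * x - x * y n).
    by rewrite /u; ncring.
  apply: le_trans (scB hq _ _) _; rewrite (ker_comm_poly hq _ hx) addr0.
  apply: le_trans (scB hq _ _) _.
  have m1 := scM hq (k - u) x; have m2 := scM hq x (k - u).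
  have x0 := sc_ge0 hq x.
  have : q (k - u) * (2 * (1 + q x)) <= e by rewrite -ler_pdivlMr //; lra.
  have := sc_ge0 hq (k - u); nra.
Qed.

End ExactSqrt.

Section Uniqueness.
Context (R : realType) (A : frechetLocCStarType R) (q Q : A -> R).
Hypotheses (hq : csn q) (cq : qcomplete q) (hQ : csn Q).
Hypothesis kerqQ : forall x, q x = 0 -> Q x = 0.
Local Notation C := R[i].

Lemma csn_le_of_sa (p p' : A -> R) : csn p -> csn p' ->
  (forall h, star h = h -> p h <= p' h) -> forall x, p x <= p' x.
Proof.
move=> hp hp' H x; have := H _ (sa_SM x); rewrite (scSM hp) (scSM hp').
by rewrite ler_sqr ?nnegrE ?(sc_ge0 hp) ?(sc_ge0 hp').
Qed.

(* A contraction h is the real part of the unitary h + i sqrt(1 - h^2). *)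
Theorem csn_le_of_ker x : Q x <= q x.
Proof.
apply: csn_le_of_sa => // h hh; have [h0|h0] := eqVneq (q h) 0.
  by rewrite h0 kerqQ.
have qh : 0 < q h by rewrite lt_def h0 (sc_ge0 hq).
set h' := ((q h)^-1)%:C *: h.
have sh' : star h' = h' by rewrite starZR hh.
have qh' : q h' = 1 by rewrite (scZp hq) ?invr_ge0 ?(ltW qh) // mulVf.
suff Qh' : Q h' <= 1.
  have -> : h = (q h)%:C *: h'.
    by rewrite scalerA -rmorphM mulfV // rmorph1 scale1r.
  rewrite (scZp hQ _ (ltW qh)) (scZp hq _ (ltW qh)) qh' mulr1.
  by rewrite ler_piMr // ltW.
have [||k [sk kk _ kc]] := @exact_sqrt _ _ _ hq cq (h' * h').
- by rewrite starM sh'.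
- by rewrite (sc_sqr hq) // qh' expr1n.
have {}kc : q (k * h' - h' * k) = 0.
  by apply: kc; rewrite mulrA subrr (sc0 hq).
pose u := h' + 'i%C *: k.
have su : star u = h' - 'i%C *: k.
  by rewrite starD sh' starZ sk conj_i scaleNr.
have Qu : Q u <= 1.
  rewrite -(@expr_le1 _ 2) ?(sc_ge0 hQ) // -(scSM hQ).
  have -> : star u * u = 1 - ((1 - h' * h' - k * k) + 'i%C *: (k * h' - h' * k)).
    rewrite su /u; move: h' k {sh' qh' sk kk kc u su} => g l.
    rewrite mulrDl !mulrDr mulNr -!scalerAl -!scalerAr mulNr -scalerAl scalerN scalerA.
    by rewrite ii_N1 scaleN1r scalerBr; ncring.
  apply: le_trans (scB hQ _ _) _.
  have -> : Q ((1 - h' * h' - k * k) + 'i%C *: (k * h' - h' * k)) = 0.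
    by apply: kerqQ; apply: (kerD hq) => //; apply: (kerZ hq).
  by rewrite addr0 (sc1 hQ).
rewrite -(half_double h') (scZp hQ); last lra.
have -> : h' + h' = u + star u by rewrite su /u; ncring.
by have := scD hQ u (star u); rewrite (sc_star hQ); lra.
Qed.

Hypothesis kerQq : forall x, Q x = 0 -> q x = 0.

(* With x = h^2 and y twice the positive part of x - t, which is built from
   a = |x - t|, one has x y^2 = t y^2 + v*v; if Q x < t this forces Q y = 0,
   hence q y = 0 and x <= t. *)
Theorem csn_ge_of_ker x : q x <= Q x.
Proof.
suff K h t : star h = h -> q h ^+ 2 <= 2^-1 -> t <= 2^-1 -> Q h ^+ 2 < t -> q h ^+ 2 <= t.
  move: x; apply: csn_le_of_sa => // h hh.
  (* Rescaling by s brings both seminorms of h below 1/2; later this gives q z <= 1 and 1 - t >=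
     0. *)
  pose s := (1 + 2 * (q h + Q h))^-1.
  have q0 := sc_ge0 hq h; have Q0 := sc_ge0 hQ h.
  have s0 : 0 < s by rewrite invr_gt0; lra.
  have ss : s * (1 + 2 * (q h + Q h)) = 1 by rewrite mulVf // gt_eqF //; lra.
  have sh : star (s%:C *: h) = s%:C *: h by rewrite starZR hh.
  suff : q (s%:C *: h) <= Q (s%:C *: h).
    by rewrite (scZp hq) ?(ltW s0) // (scZp hQ) ?(ltW s0) // ler_pM2l.
  have b1 : q (s%:C *: h) <= 2^-1 by rewrite (scZp hq) ?(ltW s0) //; nra.
  have b2 : Q (s%:C *: h) <= 2^-1 by rewrite (scZp hQ) ?(ltW s0) //; nra.
  move: b1 b2 sh; set g := s%:C *: h => b1 b2 sg.
  have g0 := sc_ge0 hq g; have G0 := sc_ge0 hQ g.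
  have q2 : q g ^+ 2 <= 2^-1 by rewrite expr2; nra.
  have Q2 : Q g ^+ 2 < 2^-1 by rewrite expr2; nra.
  rewrite -ler_sqr ?nnegrE //; apply/ler_addgt0Pr => e e0.
  have [t2|/ltW t2] := leP (Q g ^+ 2 + e) 2^-1; last by apply: le_trans q2 t2.
  by apply: K => //; lra.
move=> hh q2 t2 Qt.
have t0 : 0 < t by apply: le_lt_trans Qt; exact: sqr_ge0.
pose w := h * h; pose z := w - t%:C%:A.
have sw : star w = w by rewrite starM hh.
have sz : star z = z by rewrite starB starZR star1 sw.
have qz : q z <= 1.
  apply: le_trans (scB hq _ _) _; have := p_cst hq t.
  by rewrite (sc_sqr hq) // ger0_norm ?(ltW t0) //; lra.
have [||a [sa za a1 ac]] := @exact_sqrt _ _ _ hq cq (1 - z * z).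
- by rewrite starB starM sz star1.
- have := @sqr_posA _ _ _ hq z 1 sz; rewrite rmorph1 scale1r; apply.
  by rewrite expr_le1 // (sc_ge0 hq).
have {}za : q (z * z - a * a) = 0 by move: za; rewrite subKr.
have {}ac : q (a * z - z * a) = 0.
  apply: ac; have -> : (1 - z * z) * z - z * (1 - z * z) = 0 by ncring.
  exact: (sc0 hq).
(* Modulo ker q one has z y = a y for y = a + z, so w y^2 = t y^2 + y a y. With b a square root of
   a, the second term is [star (b * y) * (b * y)]. *)
have [||b [sb ab _ _]] := @exact_sqrt _ _ _ hq cq (1 - a).
- by rewrite starB star1 sa.
- by [].
have {}ab : q (a - b * b) = 0 by move: ab; rewrite subKr.
pose y := a + z.
have sy : star y = y by rewrite starD sa sz.
have hyv : Q (star ((Num.sqrt t)%:C *: y) * ((Num.sqrt t)%:C *: y) +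
              (star (b * y) * (b * y))) = Q (w * (y * y)).
  apply: (csn_eq (alg_ops A) hQ); apply: kerqQ.
  rewrite starZR sy -scalerAl -scalerAr scalerA -rmorphM -expr2 sqr_sqrtr ?ltW //.
  rewrite starM sy sb.
  have -> : t%:C *: (y * y) + y * b * (b * y) - w * (y * y) =
     - (y * (a - b * b) * y) + (y * a - z * y) * y.
    have -> : w = z + t%:C%:A by rewrite /z subrK.
    have -> : (z + t%:C%:A) * (y * y) = z * (y * y) + t%:C *: (y * y).
      by rewrite mulrDl -scalerAl mul1r.
    by ncring.
  apply: (kerD hq); first by apply: (kerN hq); apply: (kerMr hq); apply: (kerMl hq).
  apply: (kerMr hq); have -> : y * a - z * y = - (z * z - a * a).
    by rewrite /y; ncring.
  exact: (kerN hq).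
have Qy : Q y = 0.
  have H : Q ((Num.sqrt t)%:C *: y) ^+ 2 <= Q (w * (y * y)).
    rewrite -hyv; set al := star _ * _; set be := star _ * _.
    apply: (up_starM_norm hQ); first exact: (sc_ge0 hQ).
    suff : up Q (al + be - be) (Q (al + be) + 0) by rewrite addrK addr0.
    by apply: (upD hQ); [exact: up_norm|exact: starM_pos].
  rewrite (scZp hQ) ?sqrtr_ge0 // exprMn sqr_sqrtr ?(ltW t0) // in H.
  have := scM hQ w (y * y); rewrite (sc_sqr hQ) // (sc_sqr hQ) //.
  move=> H2; have H3 : (t - Q h ^+ 2) * Q y ^+ 2 <= 0.
    by rewrite mulrBl subr_le0; apply: le_trans H _.
  have : Q y ^+ 2 <= 0 by rewrite -(@pmulr_rle0 _ (t - Q h ^+ 2)) // subr_gt0.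
  move=> H4; apply/eqP; rewrite -sqrf_eq0; apply/eqP/le_anti.
  by rewrite H4 sqr_ge0.
have qy : q y = 0 by exact: kerQq.
apply: (up_starM_norm hq); first exact: ltW.
(* 1 - t + h^2 = (1 - a) + y with q y = 0 and q (1 - a) <= 1, which is the upper bound t for h^2. *)
rewrite hh => e e0; exists (1 - t); first lra.
have -> : (1 - t)%:C%:A + h * h = (1 - a) + y.
  rewrite rmorphB rmorph1 scalerBl scale1r /y /z /w; ncring.
by apply: le_trans (scD hq _ _) _; rewrite qy; lra.
Qed.

End Uniqueness.

Section Quotient.
Context (R : realType) (A : frechetLocCStarType R) (p : A -> R) (I : set A).
Hypotheses (hp : csn p) (hI : closed_star_ideal I).
Local Notation C := R[i].
Local Notation qp := (quot_csn p I).

Lemma ideal0 : I 0. Proof. by case: hI => -[]. Qed.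
Lemma idealD x y : I x -> I y -> I (x + y).
Proof. by case: hI => hl _ _ _; apply: subspD. Qed.
Lemma idealZ (c : C) x : I x -> I (c *: x).
Proof. by case: hI => hl _ _ _; apply: subspZ. Qed.
Lemma idealN x : I x -> I (- x).
Proof. by case: hI => hl _ _ _; apply: subspN. Qed.
Lemma idealMl a x : I x -> I (a * x). Proof. by case: hI => _ H _ _ /(H a)[]. Qed.
Lemma idealMr a x : I x -> I (x * a). Proof. by case: hI => _ H _ _ /(H a)[]. Qed.
Lemma ideal_star x : I x -> I (star x). Proof. by case: hI => _ _ H _; apply: H. Qed.

Lemma quot_lb a : lbound [set p (a + b) | b in I] 0.
Proof. by move=> _ [b _ <-]; exact: (sc_ge0 hp). Qed.

Lemma quot_le a b : I b -> qp a <= p (a + b).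
Proof. by move=> Ib; apply: ge_inf; [exists 0; exact: quot_lb|exists b]. Qed.

Lemma le_quot a t : (forall b, I b -> t <= p (a + b)) -> t <= qp a.
Proof.
move=> H; apply: lb_le_inf; first by exists (p (a + 0)), 0 => //; exact: ideal0.
by move=> _ [b Ib <-]; exact: H.
Qed.

Lemma quot_le_self a : qp a <= p a.
Proof. by have := quot_le a ideal0; rewrite addr0. Qed.

Lemma quot_ideal a : I a -> qp a = 0.
Proof.
move=> Ia; apply: le_anti; rewrite le_quot ?andbT; last by move=> b _; exact: (sc_ge0 hp).
by have := quot_le a (idealN Ia); rewrite subrr (sc0 hp).
Qed.

Lemma pstar_X : star ('X : ({poly C} : starAlgType R)) = 'X.
Proof. exact: map_polyX. Qed.

(* N x^2 (1 - x^2)^(2N) <= 1 for |x| <= 1. *)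
Lemma ideal_unit_poly (ph : {poly C} -> R) N : csn (A := {poly C}) ph -> ph 'X <= 1 ->
  up (A := {poly C}) ph (N%:R *: ('X * (1 - 'X ^+ 2) ^+ N) ^+ 2 +
     (1 - 'X ^+ 2) ^+ N ^+ 2) 1.
Proof.
move=> pp X1; set c : {poly C} := 1 - 'X ^+ 2.
have sX2 : star ('X ^+ 2 : ({poly C} : starAlgType R)) = 'X ^+ 2.
  by rewrite starX pstar_X.
have sc : star (c : ({poly C} : starAlgType R)) = c by rewrite starB star1 sX2.
have sq0 (S : {poly C}) : star (S : ({poly C} : starAlgType R)) = S ->
    up (A := {poly C}) ph (- S ^+ 2) 0 by move=> sS; exact: up_sqr.
have sqc (S : {poly C}) : star (S : ({poly C} : starAlgType R)) = S ->
    up (A := {poly C}) ph (- (S ^+ 2 * c)) 0.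
  move=> sS; apply: up_closed => e e0; rewrite add0r.
  have x21 : ph ('X ^+ 2) <= 1.
    by rewrite expr2; apply: le_trans (scM pp _ _) _; have := sc_ge0 pp 'X; nra.
  have b0 := sc_ge0 pp (S ^+ 2).
  have d0 : 0 < e / (1 + ph (S ^+ 2)) by apply: divr_gt0 => //; lra.
  have [k [sk _ hk]] := approx_sqrt pp sX2 x21 d0.
  have -> : - (S ^+ 2 * c) = - (S * k) ^+ 2 + - (S ^+ 2 * (1 - 'X ^+ 2 - k ^+ 2)).
    by rewrite /c; ring.
  rewrite -[e]add0r; apply: (upD pp); first by apply: sq0; apply: sa_M.
  apply: up_le (_ : ph (- (S ^+ 2 * (1 - 'X ^+ 2 - k ^+ 2))) <= e) _; last exact: up_norm.
  rewrite (scN pp); apply: le_trans (scM pp _ _) _.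
  move: hk; rewrite ler_pdivlMr; last lra.
  by have := sc_ge0 pp (1 - 'X ^+ 2 - k ^+ 2); nra.
have sCn n : star (c ^+ n : ({poly C} : starAlgType R)) = c ^+ n by rewrite starX sc.
elim: N => [|n IH].
  rewrite scale0r add0r expr0 expr1n; have := up_cst pp 1.
  by rewrite rmorph1 scale1r.
(* The expression decreases in n: each subtracted term is a square or a square times c = 1 - X^2,
   both nonnegative. *)
have -> : n.+1%:R *: ('X * c ^+ n.+1) ^+ 2 + c ^+ n.+1 ^+ 2 =
  (n%:R *: ('X * c ^+ n) ^+ 2 + c ^+ n ^+ 2) +
   ((n.+1%:R : R)%:C *: (- ('X ^+ 2 * c ^+ n) ^+ 2) +
    (n.+1%:R : R)%:C *: (- (('X ^+ 2 * c ^+ n) ^+ 2 * c)) + - (('X * c ^+ n) ^+ 2 * c)).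
  rewrite rmorph_nat -natr1 [c ^+ n.+1]exprSr; set d := c ^+ n.
  by rewrite /c; pring.
rewrite -[X in up _ _ X](addr0 1); apply: (upD pp) => //.
have sXn : star ('X ^+ 2 * c ^+ n : ({poly C} : starAlgType R)) = 'X ^+ 2 * c ^+ n.
  by apply: sa_M.
rewrite -[0](addr0 0); apply: (upD pp); last first.
  by apply: sqc; apply: sa_M => //; exact: pstar_X.
rewrite -[0](addr0 0); apply: (upD pp); rewrite -[0](mulr0 n.+1%:R).
  by apply: (upZ pp); [exact: ler0n|exact: sq0].
by apply: (upZ pp); [exact: ler0n|exact: sqc].
Qed.

(** g = (1 - h^2)^N with h = b / p b, so 1 - g is divisible by h and acts as an approximate unit of
    I at b. By [ideal_unit_poly] the norm of h g is at most N^(-1/2), which dictates the choice of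
    N. *)
Lemma ideal_unit (b : A) (e : R) : I b -> star b = b -> 0 < e ->
  exists g : A, [/\ star g = g, p g <= 1, I (1 - g) & p (g * b * g) <= e].
Proof.
move=> Ib sb e0.
have [b0|b0] := eqVneq (p b) 0.
  exists 1; rewrite star1 (sc1 hp) subrr mul1r mulr1 b0; split=> //.
    exact: ideal0.
  exact: ltW.
have pb : 0 < p b by rewrite lt_def b0 (sc_ge0 hp).
set h := ((p b)^-1)%:C *: b.
have sh : star h = h by rewrite starZR sb.
have ph1 : p h <= 1 by rewrite (scZp hp) ?invr_ge0 ?(ltW pb) // mulVf.
have pp := csn_poly hp sh; set ph := fun P => _ in pp.
have X1 : ph 'X <= 1 by rewrite /ph horner_algX.
pose N := Num.bound ((p b / e) ^+ 2).
have hN : (p b / e) ^+ 2 <= N%:R by exact/ltW/archi_boundP/sqr_ge0.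
set g := horner_alg h ((1 - 'X ^+ 2) ^+ N).
have U := ideal_unit_poly N pp X1.
set c : {poly C} := 1 - 'X ^+ 2 in U g.
have sc : star (c ^+ N : ({poly C} : starAlgType R)) = c ^+ N.
  by rewrite starX starB star1 starX pstar_X.
have sg : star g = g by rewrite horner_alg_star // sc.
have pg : p g <= 1.
  rewrite -(@expr_le1 _ 2) ?(sc_ge0 hp) // -[p g]/(ph (c ^+ N)) -(scSM pp).
  rewrite (scSM pp); apply: (up_starM_norm pp) => //; rewrite sc -expr2.
  have -> : (c ^+ N) ^+ 2 = (N%:R *: ('X * c ^+ N) ^+ 2 + c ^+ N ^+ 2) +
     (N%:R : R)%:C *: (- ('X * c ^+ N) ^+ 2).
    by rewrite rmorph_nat scalerN addrAC subrr add0r.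
  rewrite -[X in up _ _ X](addr0 1); apply: (upD pp) => //.
  rewrite -[0](mulr0 N%:R); apply: (upZ pp); first exact: ler0n.
  by apply: (up_sqr pp); apply: sa_M => //; exact: pstar_X.
have pX : N%:R * ph ('X * c ^+ N) ^+ 2 <= 1.
  have sXc : star ('X * c ^+ N : ({poly C} : starAlgType R)) = 'X * c ^+ N.
    by apply: sa_M => //; exact: pstar_X.
  have -> : N%:R * ph ('X * c ^+ N) ^+ 2 =
      ph ((Num.sqrt N%:R)%:C *: ('X * c ^+ N)) ^+ 2.
    by rewrite (scZp pp) ?sqrtr_ge0 // exprMn sqr_sqrtr // ler0n.
  apply: (up_starM_norm pp) => //; rewrite starZR sXc -scalerAl -scalerAr scalerA.
  rewrite -rmorphM -expr2 sqr_sqrtr ?ler0n // -expr2.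
  have -> : (N%:R : R)%:C *: ('X * c ^+ N) ^+ 2 = (N%:R *: ('X * c ^+ N) ^+ 2 + c ^+ N ^+ 2) +
     (- (c ^+ N) ^+ 2).
    by rewrite rmorph_nat addrK.
  rewrite -[X in up _ _ X](addr0 1); apply: (upD pp) => //.
  exact: (up_sqr pp).
exists g; split=> //.
  have Ih : I h by apply: idealZ.
  have Ic n : I (1 - horner_alg h (c ^+ n)).
    elim: n => [|n IH]; first by rewrite expr0 rmorph1 subrr; exact: ideal0.
    rewrite exprS rmorphM /= {1}/c rmorphB rmorph1 rmorphXn /= horner_algX.
    set y := horner_alg h _ in IH *.
    have -> : 1 - (1 - h ^+ 2) * y = (1 - y) + h * (h * y) by rewrite expr2; ncring.
    by apply: idealD => //; apply: idealMr.
  exact: Ic.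
have -> : g * b * g = (p b)%:C *: (g * (h * g)).
  by rewrite /h -scalerAl -scalerAr scalerA -rmorphM mulfV // rmorph1 scale1r mulrA.
rewrite (scZp hp) ?(ltW pb) //.
have hg : p (h * g) = ph ('X * c ^+ N) by rewrite /ph rmorphM /= horner_algX.
have m1 := scM hp g (h * g); rewrite hg in m1.
have x0 := sc_ge0 pp ('X * c ^+ N); have g0 := sc_ge0 hp g.
have : p b * ph ('X * c ^+ N) <= e.
  rewrite -ler_sqr ?nnegrE ?(ltW e0) ?mulr_ge0 ?(ltW pb) // exprMn.
  have : (p b / e) ^+ 2 * ph ('X * c ^+ N) ^+ 2 <= 1.
    by apply: le_trans pX; apply: ler_wpM2r => //; exact: sqr_ge0.
  by rewrite expr_div_n mulrAC ler_pdivrMr ?exprn_gt0 // mul1r.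
by nra.
Qed.

(** The point is qp(x)^2 <= qp (star x * x). For b in I, with self-adjoint part b', take g from
    [ideal_unit]: x - x g lies in I, so qp x <= p (x g), and p (x g)^2 = p (g * (star x * x) * g)
    exceeds the norm of g (star x * x + b') g by at most e. Replacing b by b' does not increase the
    norm of star x * x + b. *)
Theorem quot_csn_csn : csn qp.
Proof.
have qM x y : qp (x * y) <= qp x * qp y.
  have qb b c : I b -> I c -> qp (x * y) <= p (x + b) * p (y + c).
    move=> Ib Ic; apply: le_trans (scM hp _ _).
    have -> : (x + b) * (y + c) = x * y + (x * c + b * (y + c)) by ncring.
    by apply: quot_le; apply: idealD; [apply: idealMl|apply: idealMr].
  have q0 z : 0 <= qp z by apply: le_quot => b _; exact: (sc_ge0 hp).
  have [y0|y0] := eqVneq (qp y) 0.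
    rewrite y0 mulr0; apply/ler_addgt0Pr => e e0; rewrite add0r.
    have d0 : 0 < e / (1 + p x) by apply: divr_gt0 => //; have := sc_ge0 hp x; lra.
    have hi : has_inf [set p (y + b) | b in I].
      by split; [exists (p (y + 0)), 0 => //; exact: ideal0|exists 0; exact: quot_lb].
    have [_ [b Ib <-] hb] := inf_adherent d0 hi.
    rewrite -/(qp y) y0 add0r in hb.
    apply: le_trans (qb 0 b ideal0 Ib) _; rewrite addr0.
    move: hb; rewrite ltr_pdivlMr; last by have := sc_ge0 hp x; lra.
    by have := sc_ge0 hp (y + b); nra.
  have yp : 0 < qp y by rewrite lt_def y0 q0.
  rewrite -ler_pdivrMr //; apply: le_quot => b Ib.
  rewrite ler_pdivrMr //; have [x0|x0] := eqVneq (p (x + b)) 0.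
    by rewrite x0 mul0r; apply: le_trans (qb b 0 Ib ideal0) _; rewrite x0 mul0r.
  have xp : 0 < p (x + b) by rewrite lt_def x0 (sc_ge0 hp (x + b)).
  rewrite -ler_pdivrMl //; apply: le_quot => c Ic; rewrite ler_pdivrMl //.
  exact: qb b c Ib Ic.
have qstar x : qp (star x) <= qp x.
  apply: le_quot => b Ib; rewrite -(sc_star hp) starD.
  by apply: quot_le; apply: ideal_star.
split=> [x y|c x|//|x].
- rewrite -lerBlDr; apply: le_quot => b Ib; rewrite lerBlDr -lerBlDl.
  apply: le_quot => d Id; rewrite lerBlDl; apply: le_trans (scD hp _ _).
  by rewrite addrACA; apply: quot_le; apply: idealD.
- have K (d : C) z : qp (d *: z) <= complex.Re `|d| * qp z.
    have [->|d0] := eqVneq d 0.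
      by rewrite scale0r normr0 mul0r quot_ideal //; exact: ideal0.
    have dp : 0 < complex.Re `|d|.
      by rewrite -ltcR RRe_real ?normr_real // rmorph0 normr_gt0.
    rewrite -ler_pdivrMl //; apply: le_quot => b Ib; rewrite ler_pdivrMl //.
    rewrite -(csnZn hp) scalerDr; apply: quot_le; exact: idealZ.
  have [->|c0] := eqVneq c 0.
    rewrite scale0r normr0 mul0r quot_ideal //; exact: ideal0.
  have -> : `|c| = (complex.Re `|c|)%:C by rewrite RRe_real // normr_real.
  rewrite -rmorphM; congr (_ %:C); apply: le_anti; rewrite K /=.
  have cp : 0 < complex.Re `|c|.
    by rewrite -ltcR RRe_real ?normr_real // rmorph0 normr_gt0.
  rewrite -ler_pdivlMl //; have := K c^-1 (c *: x).
  rewrite scalerA mulVf // scale1r normfV.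
  have -> : complex.Re `|c|^-1 = (complex.Re `|c|)^-1 => //.
  apply: complexI; rewrite RRe_real ?realV ?normr_real //.
  transitivity ((complex.Re `|c|)%:C^-1); first by rewrite RRe_real // normr_real.
  exact/esym/(fmorphV (real_complex R)).
- apply: le_anti; apply/andP; split.
    by apply: le_trans (qM _ _) _; rewrite expr2 ler_wpM2r //;
      apply: le_quot => b _; exact: (sc_ge0 hp).
  apply: le_quot => b Ib; apply/ler_addgt0Pr => e e0.
  pose b' := (2^-1 : R)%:C *: (b + star b).
  have Ib' : I b' by apply: idealZ; apply: idealD => //; apply: ideal_star.
  have sb' : star b' = b' by rewrite starZR starD starK addrC.
  have [g [sg g1 Ig hg]] := ideal_unit Ib' sb' e0.
  have h1 : qp x <= p (x * g).
    have -> : x * g = x + (x * (- (1 - g))) by ncring.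
    by apply: quot_le; apply: idealMl; apply: idealN.
  have q0 : 0 <= qp x by apply: le_quot => d _; exact: (sc_ge0 hp).
  have h2 : qp x ^+ 2 <= p (x * g) ^+ 2 by rewrite lerXn2r ?nnegrE // (sc_ge0 hp).
  apply: le_trans h2 _; rewrite -(scSM hp) starM sg.
  have -> : g * star x * (x * g) = g * (star x * x + b') * g - g * b' * g by ncring.
  apply: le_trans (scB hp _ _) _; apply: lerD => //.
  have -> : star x * x + b' =
      (2^-1 : R)%:C *: ((star x * x + b) + star (star x * x + b)).
    rewrite starD sa_SM -{1}(half_double (star x * x)) -scalerDr; congr (_ *: _).
    by ncring.
  set w := star x * x + b.
  have := scM hp (g * ((2^-1 : R)%:C *: (w + star w))) g.
  have := scM hp g ((2^-1 : R)%:C *: (w + star w)).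
  rewrite (scZp hp (t := 2^-1)); last lra.
  have := scD hp w (star w); rewrite (sc_star hp).
  have := sc_ge0 hp w; have := sc_ge0 hp g; have := sc_ge0 hp (w + star w).
  have := sc_ge0 hp (g * ((2^-1 : R)%:C *: (w + star w))).
  set B := p (g * _); nra.
Qed.

End Quotient.

(** * Representations and matrix norms *)

Section Cabs.
Context (R : realType).
Local Notation C := R[i].
Implicit Types z w : C.

(* Fixes one of the two convertible conjugations of R[i], so that rewriting
   does not depend on which of them has been inferred. *)
Definition cj z : C := Num.conj z.

Lemma cjD z w : cj (z + w) = cj z + cj w. Proof. exact: rmorphD. Qed.
Lemma cjM z w : cj (z * w) = cj z * cj w. Proof. exact: rmorphM. Qed.
Lemma cjN z : cj (- z) = - cj z. Proof. exact: rmorphN. Qed.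
Lemma cjR (t : R) : cj t%:C = t%:C. Proof. exact: conjc_real. Qed.
Lemma cj0 : cj 0 = 0. Proof. exact: rmorph0. Qed.
Lemma cj1 : cj 1 = 1. Proof. exact: rmorph1. Qed.
Lemma cjK z : cj (cj z) = z. Proof. exact: conjCK. Qed.
Lemma cj_sum I (r : seq I) (P : pred I) (F : I -> C) :
  cj (\sum_(i <- r | P i) F i) = \sum_(i <- r | P i) cj (F i).
Proof. exact: rmorph_sum. Qed.
Lemma cj_i : cj 'i%C = - 'i%C. Proof. exact: conj_i. Qed.

Definition cabs z : R := complex.Re `|z|.

Lemma cabsE z : `|z| = (cabs z)%:C.
Proof. by rewrite /cabs RRe_real // normr_real. Qed.

Lemma cabs_ge0 z : 0 <= cabs z.
Proof. by rewrite -lecR -cabsE normr_ge0. Qed.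

Lemma cabs_sqr z : z * cj z = (cabs z ^+ 2)%:C.
Proof. by have := sqr_normc z; rewrite cabsE -rmorphXn => ->. Qed.

Lemma cabs_Re z : complex.Re z <= cabs z.
Proof.
by apply: le_trans (ler_norm _) _; rewrite -lecR -cabsE; exact: normc_ge_Re.
Qed.

Lemma cabsM z w : cabs (z * w) = cabs z * cabs w.
Proof. by apply: complexI; rewrite rmorphM -!cabsE normrM. Qed.

Lemma cabsJ z : cabs (cj z) = cabs z.
Proof. by apply: complexI; rewrite -!cabsE normcJ. Qed.

Lemma cabsR (t : R) : cabs t%:C = `|t|.
Proof. by apply: complexI; rewrite -cabsE normcR. Qed.

Lemma cabs_eq0 z : cabs z = 0 -> z = 0.
Proof. by move=> h; apply/eqP; rewrite -normr_eq0 cabsE h. Qed.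

Lemma ReD z w : complex.Re (z + w) = complex.Re z + complex.Re w.
Proof. by case: z; case: w. Qed.
Lemma ImD z w : complex.Im (z + w) = complex.Im z + complex.Im w.
Proof. by case: z; case: w. Qed.
Lemma ReN z : complex.Re (- z) = - complex.Re z. Proof. by case: z. Qed.
Lemma ReJ z : complex.Re (cj z) = complex.Re z. Proof. by case: z. Qed.
Lemma ReZ (t : R) z : complex.Re (t%:C * z) = t * complex.Re z.
Proof. by case: z => a b /=; rewrite mul0r subr0. Qed.
Lemma Re_sum I (r : seq I) (P : pred I) (F : I -> C) :
  complex.Re (\sum_(i <- r | P i) F i) = \sum_(i <- r | P i) complex.Re (F i).
Proof. by elim/big_rec2: _ => // i x y _ <-; rewrite ReD. Qed.
Lemma cabs0 : cabs (0 : C) = 0.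
Proof. by rewrite -(rmorph0 (real_complex R)) cabsR normr0. Qed.

Lemma cabs1 : cabs (1 : C) = 1.
Proof. by rewrite -(rmorph1 (real_complex R)) cabsR normr1. Qed.

Lemma cabsN (x : C) : cabs (- x) = cabs x.
Proof. by rewrite /cabs normrN. Qed.

Lemma cabsD (x y : C) : cabs (x + y) <= cabs x + cabs y.
Proof. by rewrite -lecR rmorphD -!cabsE ler_normD. Qed.

Lemma cabsi : cabs ('i%C : C) = 1.
Proof.
have h : cabs ('i%C : C) ^+ 2 = 1.
  by apply: complexI; rewrite -cabs_sqr cj_i mulrN ii_N1 opprK.
by apply/eqP; rewrite -(@eqrXn2 _ 2) ?cabs_ge0 ?h ?expr1n.
Qed.

Lemma norm_Re (z : C) : `|complex.Re z| <= cabs z.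
Proof. by rewrite -lecR -cabsE; exact: normc_ge_Re. Qed.

Lemma ge0_Re z : 0 <= z -> z = (complex.Re z)%:C.
Proof. by move=> h; rewrite RRe_real // ger0_real. Qed.
Lemma ge0_ReP z : 0 <= z -> 0 <= complex.Re z.
Proof. by rewrite lecE => /andP[_]. Qed.

Lemma sqrt_le (x y : R) : 0 <= y -> x <= y ^+ 2 -> Num.sqrt x <= y.
Proof.
move=> y0 h; rewrite -(ger0_norm y0) -sqrtr_sqr; exact: ler_wsqrtr.
Qed.

End Cabs.

Section Form.
Context (R : realType) (V : lmodType R[i]) (D : set V).
Hypothesis hD : linear_subspace D.
Local Notation C := R[i].

(** Semi-definite and relative to D, so that one notion covers the forms of states, forms on
    finitely supported functions and inner products on subspaces of a Hilbert space. *)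
Definition psdform (B : V -> V -> C) :=
  [/\ forall (c : C) x y z, D x -> D y -> D z -> B (c *: x + y) z = c * B x z + B y z,
      forall x y, D x -> D y -> B y x = cj (B x y) & forall x, D x -> 0 <= B x x].

Variables (B : V -> V -> C) (hB : psdform B).

Lemma formDl x y z : D x -> D y -> D z -> B (x + y) z = B x z + B y z.
Proof. by case: hB => H _ _ hx hy hz; rewrite -{1}[x]scale1r H // mul1r. Qed.

Lemma form0l z : D z -> B 0 z = 0.
Proof.
move=> hz; have := formDl (subsp0 hD) (subsp0 hD) hz; rewrite addr0 => h.
by apply: (addrI (B 0 z)); rewrite addr0 -h.
Qed.

Lemma formZl c x z : D x -> D z -> B (c *: x) z = c * B x z.
Proof.
case: hB => H _ _ hx hz; rewrite -[c *: x]addr0 H // ?form0l ?addr0 //.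
exact: subsp0.
Qed.

Lemma formC x y : D x -> D y -> B y x = cj (B x y).
Proof. by case: hB => _ H _; exact: H. Qed.

Lemma formDr x y z : D x -> D y -> D z -> B x (y + z) = B x y + B x z.
Proof.
move=> hx hy hz; rewrite (formC (subspD hD hy hz) hx) formDl // cjD.
by rewrite -!formC.
Qed.

Lemma formZr c x z : D x -> D z -> B x (c *: z) = cj c * B x z.
Proof.
move=> hx hz; rewrite (formC (subspZ hD c hz) hx) formZl // cjM.
by rewrite -formC.
Qed.

Lemma formNl x z : D x -> D z -> B (- x) z = - B x z.
Proof. by move=> hx hz; rewrite -scaleN1r formZl // mulN1r. Qed.

Lemma formNr x z : D x -> D z -> B x (- z) = - B x z.
Proof.
by move=> hx hz; rewrite -scaleN1r formZr // cjN cj1 mulN1r.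
Qed.

Lemma form0r x : D x -> B x 0 = 0.
Proof. by move=> hx; rewrite (formC (subsp0 hD) hx) form0l // cj0. Qed.

Lemma form_suml I (r : seq I) (P : pred I) (F : I -> V) z :
  (forall i, P i -> D (F i)) -> D z ->
  D (\sum_(i <- r | P i) F i) /\
  B (\sum_(i <- r | P i) F i) z = \sum_(i <- r | P i) B (F i) z.
Proof.
move=> hF hz; elim/big_rec2: _ => [|i x y Pi [h1 h2]].
  by rewrite form0l //; split=> //; exact: subsp0.
split; first by apply: subspD => //; exact: hF.
by rewrite formDl ?h2 //; exact: hF.
Qed.

Definition sqn x : R := complex.Re (B x x).
Definition fnorm x : R := Num.sqrt (sqn x).

Lemma form_sqn x : D x -> B x x = (sqn x)%:C.
Proof. by case: hB => _ _ H hx; apply: ge0_Re; exact: H. Qed.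

Lemma sqn_ge0 x : D x -> 0 <= sqn x.
Proof. by case: hB => _ _ H hx; apply: ge0_ReP; exact: H. Qed.

Lemma fnorm_ge0 x : 0 <= fnorm x. Proof. exact: sqrtr_ge0. Qed.

Lemma fnorm_sqr x : D x -> fnorm x ^+ 2 = sqn x.
Proof. by move=> hx; rewrite sqr_sqrtr // sqn_ge0. Qed.

Lemma sqnD x y : D x -> D y -> sqn (x + y) = sqn x + sqn y + 2 * complex.Re (B x y).
Proof.
move=> hx hy; have hxy := subspD hD hx hy; rewrite /sqn formDl // !formDr //.
by rewrite !ReD (formC hx hy) ReJ; ring.
Qed.

Lemma sqnZ c x : D x -> sqn (c *: x) = cabs c ^+ 2 * sqn x.
Proof.
move=> hx; have hcx := subspZ hD c hx.
by rewrite /sqn formZl // formZr // mulrA cabs_sqr ReZ.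
Qed.

Lemma cauchy_schwarz x y : D x -> D y -> cabs (B x y) <= fnorm x * fnorm y.
Proof.
move=> hx hy; set K := cabs (B x y) ^+ 2.
have H (s : R) : 0 <= sqn x - 2 * s * K + s ^+ 2 * K * sqn y.
  pose c := - s%:C * B x y; have hcy := subspZ hD c hy.
  have := sqn_ge0 (subspD hD hx hcy); rewrite sqnD // sqnZ // formZr //.
  have -> : cabs c ^+ 2 = s ^+ 2 * K.
    by rewrite /c cabsM exprMn -rmorphN cabsR normrN real_normK ?num_real.
  have -> : complex.Re (cj c * B x y) = - s * K.
    rewrite /c cjM -mulrA [cj _ * B x y]mulrC cabs_sqr -rmorphN cjR.
    by rewrite -rmorphM.
  by move=> h; apply: le_trans h _; rewrite le_eqVlt; apply/orP; left; apply/eqP; ring.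
have hK : K <= sqn x * sqn y.
  have K0 : 0 <= K by exact: sqr_ge0.
  have x0 := sqn_ge0 hx; have y0 := sqn_ge0 hy.
  have [yz|yz] := eqVneq (sqn y) 0.
    rewrite yz mulr0 leNgt; apply/negP => Kp.
    have := H ((sqn x + 1) / K); rewrite yz mulr0 addr0.
    by rewrite -!mulrA mulVf ?gt_eqF //; lra.
  have yp : 0 < sqn y by rewrite lt_def yz.
  have := H (sqn y)^-1; rewrite expr2 => h.
  have e1 : sqn y * ((sqn y)^-1 * (sqn y)^-1 * K * sqn y) = K by field.
  have e2 : sqn y * (2 * (sqn y)^-1 * K) = 2 * K by field.
  have := mulr_ge0 y0 h; rewrite mulrDr mulrBr e1 e2; lra.
rewrite -ler_sqr ?nnegrE ?cabs_ge0 ?mulr_ge0 ?fnorm_ge0 //.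
by rewrite exprMn !fnorm_sqr.
Qed.

Lemma fnormD x y : D x -> D y -> fnorm (x + y) <= fnorm x + fnorm y.
Proof.
move=> hx hy; apply: sqrt_le; first by rewrite addr_ge0 ?fnorm_ge0.
rewrite sqnD // sqrrD !fnorm_sqr //.
have := cauchy_schwarz hx hy; have := cabs_Re (B x y); rewrite -mulr_natl; lra.
Qed.

Lemma fnormZ c x : D x -> fnorm (c *: x) = cabs c * fnorm x.
Proof.
by move=> hx; rewrite /fnorm sqnZ // sqrtrM ?sqr_ge0 // sqrtr_sqr ger0_norm // cabs_ge0.
Qed.

Lemma fnorm0 : fnorm 0 = 0.
Proof. by rewrite /fnorm /sqn form0l ?sqrtr0 //; exact: subsp0. Qed.

Lemma fnorm_sum I (r : seq I) (P : pred I) (F : I -> V) :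
  (forall i, P i -> D (F i)) ->
  fnorm (\sum_(i <- r | P i) F i) <= \sum_(i <- r | P i) fnorm (F i).
Proof.
move=> hF; suff [] : D (\sum_(i <- r | P i) F i) /\
  fnorm (\sum_(i <- r | P i) F i) <= \sum_(i <- r | P i) fnorm (F i) by [].
elim/big_rec2: _ => [|i x y Pi [h1 h2]].
  by rewrite fnorm0; split=> //; exact: subsp0.
split; first by apply: subspD => //; exact: hF.
by apply: le_trans (fnormD (hF i Pi) h1) _; rewrite lerD2l.
Qed.

End Form.

Lemma mx_ops (R : realType) (A : frechetLocCStarType R) n :
  star_ops (fun (c : R[i]) (x : 'M[A]_n) => map_mx (fun a => c *: a) x)
  (fun x y => x *m y) (@mxstar R A n).
Proof.
split.
- by move=> x; apply/matrixP => i j; rewrite !mxE scale0r.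
- by move=> x; apply/matrixP => i j; rewrite !mxE scaleN1r.
- by move=> x; apply/matrixP => i j; rewrite !mxE starK.
- move=> x y; apply/matrixP => i j; rewrite !mxE star_sum.
  by apply: eq_bigr => k _; rewrite starM !mxE.
Qed.

Lemma mx_homogeneous (R : realType) (A : frechetLocCStarType R) n (N : 'M[A]_n -> R) :
  (forall x, 0 <= N x) ->
  (forall (d : R[i]) x, N (map_mx (fun a => d *: a) x) <= cabs d * N x) ->
  forall (c : R[i]) x, (N (map_mx (fun a => c *: a) x))%:C = `|c| * (N x)%:C.
Proof.
move=> N0 K c x; rewrite cabsE -rmorphM; congr (_ %:C); apply: le_anti; rewrite K /=.
have [c0|c0] := eqVneq c 0; first by rewrite c0 cabs0 mul0r.
have cp : 0 < cabs c.
  rewrite lt_def cabs_ge0 andbT; apply/negP => /eqP /cabs_eq0 h.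
  by rewrite h eqxx in c0.
rewrite -ler_pdivlMl //; have := K c^-1 (map_mx (fun a => c *: a) x).
have -> : map_mx (fun a => c^-1 *: a) (map_mx (fun a => c *: a) x) = x.
  by apply/matrixP => i j; rewrite !mxE scalerA mulVf // scale1r.
have -> // : cabs c^-1 = (cabs c)^-1.
by apply: (mulfI (lt0r_neq0 cp)); rewrite -cabsM (divff c0) divff ?gt_eqF // cabs1.
Qed.

Section PreRep.
Context (R : realType) (A : frechetLocCStarType R) (W : lmodType R[i]) (D : set W).
Local Notation C := R[i].
Variables (B : W -> W -> C) (T : A -> W -> W).

(* Representations on the semi-inner product spaces produced by states, as well
   as those on closed subspaces of Hilbert spaces. *)
Definition prerep :=
  [/\ forall a w, D w -> D (T a w),
      forall (c : C) a b w, D w -> T (c *: a + b) w = c *: T a w + T b w,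
      forall a (c : C) w w', D w -> D w' -> T a (c *: w + w') = c *: T a w + T a w',
      forall a b w, D w -> T (a * b) w = T a (T b w)
    & forall a w w', D w -> D w' -> B (T a w) w' = B w (T (star a) w')].

Hypotheses (hD : linear_subspace D) (hB : psdform D B) (hT : prerep).
Variable bnd : A -> R.
Hypothesis bnd0 : forall a, 0 <= bnd a.
Hypothesis hbnd : forall a w, D w -> fnorm B (T a w) <= bnd a * fnorm B w.

Lemma prep_st a w : D w -> D (T a w). Proof. by case: hT => H _ _ _ _; exact: H. Qed.

Lemma prep0 w : D w -> T 0 w = 0.
Proof.
move=> hw; case: hT => _ H _ _ _; have := H (-1) 0 0 w hw.
by rewrite scaleN1r addr0 oppr0 scaleN1r addNr.
Qed.

Lemma prepD a b w : D w -> T (a + b) w = T a w + T b w.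
Proof. by case: hT => _ H _ _ _ hw; rewrite -{1}[a]scale1r H // scale1r. Qed.

Lemma prepZ c a w : D w -> T (c *: a) w = c *: T a w.
Proof. by case: hT => _ H _ _ _ hw; rewrite -[c *: a]addr0 H // prep0 // addr0. Qed.

Lemma prep_sum I (r : seq I) (P : pred I) (F : I -> A) w : D w ->
  T (\sum_(i <- r | P i) F i) w = \sum_(i <- r | P i) T (F i) w.
Proof.
move=> hw; elim/big_rec2: _ => [|i x y _ <-]; first exact: prep0.
exact: prepD.
Qed.

Lemma prep_r0 a : T a 0 = 0.
Proof.
case: hT => _ _ H _ _; have := H a (-1) 0 0 (subsp0 hD) (subsp0 hD).
by rewrite scaleN1r addr0 oppr0 scaleN1r addNr.
Qed.

Lemma prep_rD a w w' : D w -> D w' -> T a (w + w') = T a w + T a w'.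
Proof. by case: hT => _ _ H _ _ hw hw'; rewrite -{1}[w]scale1r H // scale1r. Qed.

Lemma prep_rZ a c w : D w -> T a (c *: w) = c *: T a w.
Proof.
move=> hw; case: hT => _ _ H _ _; rewrite -[c *: w]addr0 H //.
  by rewrite prep_r0 addr0.
exact: subsp0.
Qed.

Lemma prep_rsum a I (r : seq I) (P : pred I) (F : I -> W) :
  (forall i, P i -> D (F i)) -> D (\sum_(i <- r | P i) F i) /\
  T a (\sum_(i <- r | P i) F i) = \sum_(i <- r | P i) T a (F i).
Proof.
move=> hF; elim/big_rec2: _ => [|i x y Pi [h1 h2]].
  by rewrite prep_r0; split=> //; exact: subsp0.
split; first by apply: subspD => //; exact: hF.
by rewrite prep_rD ?h2 //; exact: hF.
Qed.

Section Matrix.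
Variable n : nat.
Implicit Types (x y : 'M[A]_n) (v w : 'I_n -> W).

Definition Dn : set ('I_n -> W) := [set v | forall i, D (v i)].
Definition Bn v w := \sum_i B (v i) (w i).
Definition act x v : 'I_n -> W := fun i => \sum_j T (x i j) (v j).
Let nn := fnorm Bn.

Lemma Dn_sub : linear_subspace Dn.
Proof.
split=> [i|c v w hv hw i]; first exact: subsp0.
by case: hD => _; apply.
Qed.

Lemma Bn_form : psdform Dn Bn.
Proof.
case: hB => h1 h2 h3; split.
- move=> c x y z hx hy hz; rewrite /Bn mulr_sumr -big_split /=.
  by apply: eq_bigr => i _; rewrite -h1.
- by move=> x y hx hy; rewrite /Bn cj_sum; apply: eq_bigr => i _; rewrite h2.
- by move=> x hx; apply: sumr_ge0 => i _; exact: h3.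
Qed.

Lemma sqn_Bn v : sqn Bn v = \sum_i sqn B (v i).
Proof. by rewrite /sqn Re_sum. Qed.

Lemma fnorm_le_Bn v i : Dn v -> fnorm B (v i) <= nn v.
Proof.
move=> hv; apply: ler_wsqrtr; rewrite sqn_Bn (bigD1 i) //= lerDl.
by apply: sumr_ge0 => j _; apply: (sqn_ge0 hB).
Qed.

Lemma Bn_le_fnorm v : Dn v -> nn v <= \sum_i fnorm B (v i).
Proof.
move=> hv; have K (r : seq 'I_n) : \sum_(i <- r) sqn B (v i) <= (\sum_(i <- r) fnorm B (v i)) ^+ 2.
  elim: r => [|i r IH]; first by rewrite !big_nil expr0n.
  rewrite !big_cons sqrrD (fnorm_sqr hB) // -addrA lerD2l.
  apply: le_trans IH _; rewrite lerDr mulrn_wge0 // mulr_ge0 ?fnorm_ge0 //.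
  by apply: sumr_ge0 => j _; exact: fnorm_ge0.
apply: sqrt_le; first by apply: sumr_ge0 => j _; exact: fnorm_ge0.
by rewrite sqn_Bn.
Qed.

Lemma act_st x v : Dn v -> Dn (act x v).
Proof.
move=> hv i; suff [] : D (\sum_j T (x i j) (v j)) /\ T 0 (\sum_j T (x i j) (v j)) =
  \sum_j T 0 (T (x i j) (v j)) by [].
by apply: prep_rsum => j _; apply: prep_st.
Qed.

Lemma act_bound x v : Dn v -> nn (act x v) <= (\sum_i \sum_j bnd (x i j)) * nn v.
Proof.
move=> hv; apply: le_trans (Bn_le_fnorm (act_st x hv)) _.
rewrite mulr_suml; apply: ler_sum => i _.
rewrite /act; apply: (le_trans (fnorm_sum hD hB _ _)).
  by move=> j _; apply: prep_st.
rewrite mulr_suml; apply: ler_sum => j _.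
apply: le_trans (hbnd _ (hv j)) _; apply: ler_wpM2l => //; exact: fnorm_le_Bn.
Qed.

(** The operator seminorm of x on n copies of D. By [act_bound] the supremum is finite and null
    vectors are sent to null vectors, so no quotient has to be formed. *)
Definition opq x : R := sup [set nn (act x v) | v in [set v | Dn v /\ nn v <= 1]].

Lemma opq_has_sup x : has_sup [set nn (act x v) | v in [set v | Dn v /\ nn v <= 1]].
Proof.
split; first by exists (nn (act x 0)), 0; split=> //;
  [exact: subsp0 Dn_sub|rewrite /nn (fnorm0 Dn_sub Bn_form) ler01].
exists (\sum_i \sum_j bnd (x i j)) => _ [v [hv v1] <-].
apply: le_trans (act_bound x hv) _; rewrite ler_piMr //.
by apply: sumr_ge0 => i _; apply: sumr_ge0.
Qed.

Lemma actZr x c v : Dn v -> act x (c *: v) = c *: act x v.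
Proof.
move=> hv; apply/funext => i; rewrite /act; rewrite [RHS]scaler_sumr.
by apply: eq_bigr => j _; rewrite -prep_rZ.
Qed.

Lemma opq_le x v : Dn v -> nn (act x v) <= opq x * nn v.
Proof.
move=> hv; have nf := Bn_form; have [v0|v0] := eqVneq (nn v) 0.
  by apply: le_trans (act_bound x hv) _; rewrite v0 !mulr0.
have vp : 0 < nn v by rewrite lt_def v0 fnorm_ge0.
rewrite -ler_pdivrMr //.
have hw : Dn ((nn v)^-1%:C *: v) by apply: subspZ Dn_sub _ _ hv.
apply: (@le_trans _ _ (nn (act x ((nn v)^-1%:C *: v)))).
  rewrite actZr // /nn (fnormZ Dn_sub nf) ?cabsR; last exact: act_st.
  by rewrite ger0_norm ?invr_ge0 ?fnorm_ge0 // mulrC.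
apply: (sup_upper_bound (opq_has_sup x)); exists ((nn v)^-1%:C *: v) => //.
split=> //; rewrite /nn (fnormZ Dn_sub nf) // cabsR ger0_norm ?invr_ge0 ?fnorm_ge0 //.
by rewrite mulVf.
Qed.

Lemma le_opq x (M : R) : 0 <= M -> (forall v, Dn v -> nn (act x v) <= M * nn v) -> opq x <= M.
Proof.
move=> M0 H; apply: ge_sup; first exact: (opq_has_sup x).1.
move=> _ [v [hv v1] <-]; apply: le_trans (H v hv) _.
by rewrite ler_piMr.
Qed.

Lemma opq_ge0 x : 0 <= opq x.
Proof.
apply: (sup_upper_bound (opq_has_sup x)); exists 0 => //.
  by split; [exact: subsp0 Dn_sub|rewrite /nn (fnorm0 Dn_sub Bn_form) ler01].
have -> : act x 0 = 0.
  by apply/funext => i; rewrite /act big1 // => j _; exact: prep_r0.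
by rewrite /nn (fnorm0 Dn_sub Bn_form).
Qed.

Lemma opq_le_sum x : opq x <= \sum_i \sum_j bnd (x i j).
Proof.
apply: le_opq; first by apply: sumr_ge0 => i _; apply: sumr_ge0.
exact: act_bound.
Qed.

Lemma act_adj x v w : Dn v -> Dn w -> Bn (act x v) w = Bn v (act (mxstar x) w).
Proof.
move=> hv hw; rewrite /Bn.
under eq_bigr => i _.
  rewrite (form_suml hD hB _ _ (hw i)).2; last by move=> j _; apply: prep_st.
  over.
rewrite exchange_big /=; apply: eq_bigr => j _.
have hs : forall i, true -> D (T (mxstar x j i) (w i)) by move=> i _; apply: prep_st.
have [h1 _] := prep_rsum 0 (index_enum 'I_n) hs.
rewrite /act (formC hB h1 (hv j)) (form_suml hD hB _ hs (hv j)).2 cj_sum.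
apply: eq_bigr => i _; rewrite -(formC hB) //; last by apply: prep_st.
by case: hT => _ _ _ _ H; rewrite H // !mxE.
Qed.

Lemma act_mul x y v : Dn v -> act (x *m y) v = act x (act y v).
Proof.
move=> hv; apply/funext => i; rewrite /act.
under eq_bigr => j _ do rewrite mxE prep_sum //.
rewrite exchange_big /=; apply: eq_bigr => k _.
rewrite (prep_rsum _ _ _).2; last by move=> j _; apply: prep_st.
by apply: eq_bigr => j _; case: hT => _ _ _ H _; rewrite H.
Qed.

Theorem opq_csn : is_cstar_seminorm (fun (c : C) (x : 'M[A]_n) => map_mx (fun a => c *: a) x)
  (fun x y => x *m y) (@mxstar R A n) opq.
Proof.
have nf := Bn_form; have nd := Dn_sub.
have qM x y : opq (x *m y) <= opq x * opq y.
  apply: le_opq; first by rewrite mulr_ge0 ?opq_ge0.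
  move=> v hv; rewrite act_mul //; apply: le_trans (opq_le x (act_st y hv)) _.
  by rewrite -mulrA; apply: ler_wpM2l; [exact: opq_ge0|exact: opq_le].
have qs x : opq (mxstar x) <= opq x.
  apply: le_opq; first exact: opq_ge0.
  move=> v hv; set w := act (mxstar x) v; have hw : Dn w by exact: act_st.
  have [w0|w0] := eqVneq (nn w) 0.
    by rewrite w0 mulr_ge0 ?opq_ge0 ?fnorm_ge0.
  have wp : 0 < nn w by rewrite lt_def w0 fnorm_ge0.
  rewrite -(ler_pM2l wp) -expr2 /nn (fnorm_sqr nf) //.
  have -> : sqn Bn w = complex.Re (Bn (act x w) v).
    by rewrite act_adj.
  apply: le_trans (cabs_Re _) _; apply: le_trans (cauchy_schwarz nd nf (act_st x hw) hv) _.
  by rewrite mulrA [fnorm Bn w * _]mulrC ler_wpM2r ?fnorm_ge0 //; exact: opq_le.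
have qmx x : opq (mxstar (mxstar x)) = opq x by case: (mx_ops A n) => _ _ -> _.
split=> [x y|c x|//|x].
- apply: le_opq; first by rewrite addr_ge0 ?opq_ge0.
  move=> v hv; have -> : act (x + y) v = act x v + act y v.
    apply/funext => i; transitivity (act x v i + act y v i) => //.
    rewrite /act -big_split /=.
    by apply: eq_bigr => j _; rewrite mxE prepD.
  rewrite mulrDl; apply: le_trans (fnormD nd nf (act_st x hv) (act_st y hv)) _.
  by apply: lerD; exact: opq_le.
- have aZ (d : C) z v : Dn v -> act (map_mx (fun a => d *: a) z) v = d *: act z v.
    move=> hv; apply/funext => i; rewrite /act [RHS]scaler_sumr.
    by apply: eq_bigr => j _; rewrite mxE prepZ.
  have K (d : R[i]) z : opq (map_mx (fun a => d *: a) z) <= cabs d * opq z.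
    apply: le_opq; first by rewrite mulr_ge0 ?opq_ge0 ?cabs_ge0.
    move=> v hv; rewrite aZ // /nn (fnormZ nd nf) -?mulrA; last exact: act_st.
    by apply: ler_wpM2l; [exact: cabs_ge0|exact: opq_le].
  exact: (mx_homogeneous opq_ge0 K).
- apply: le_anti; apply/andP; split.
    by apply: le_trans (qM _ _) _; rewrite expr2 ler_wpM2r ?opq_ge0.
  rewrite -[leRHS]sqr_sqrtr ?opq_ge0 // lerXn2r ?nnegrE ?opq_ge0 ?sqrtr_ge0 //.
  apply: le_opq; first exact: sqrtr_ge0.
  move=> v hv; have hx := act_st x hv.
  rewrite -ler_sqr ?nnegrE ?mulr_ge0 ?sqrtr_ge0 ?fnorm_ge0 // exprMn.
  rewrite [X in _ <= X * _]sqr_sqrtr ?opq_ge0 // /nn (fnorm_sqr nf) //.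
  have -> : sqn Bn (act x v) = complex.Re (Bn v (act (mxstar x *m x) v)).
    by rewrite act_mul // -act_adj.
  have hxx : Dn (act (mxstar x *m x) v) by exact: act_st.
  apply: le_trans (cabs_Re _) _; apply: le_trans (cauchy_schwarz nd nf hv hxx) _.
  rewrite expr2 mulrCA ler_wpM2l ?fnorm_ge0 //; exact: opq_le.
Qed.

End Matrix.
End PreRep.

Section Complexify.
Context (R : realType) (V : lmodType R[i]) (D : set V).
Hypothesis hD : linear_subspace D.
Local Notation C := R[i].

(** The complex-linear functional with real part f; it lets states be handled as real-linear
    functionals, to which the sublinear machinery applies. *)
Definition cplx (f : V -> R) (v : V) : C := (f v) +i* (- f ('i%C *: v)).

Variables (f : V -> R) (hf : rlin D f).

Lemma cplxD v w : D v -> D w -> cplx f (v + w) = cplx f v + cplx f w.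
Proof.
move=> hv hw; rewrite /cplx scalerDr !hf.1 ?opprD //; exact: subspZ.
Qed.

Lemma cplxZ c v : D v -> cplx f (c *: v) = c * cplx f v.
Proof.
move=> hv; have hiv : D ('i%C *: v) by apply: subspZ.
have K (a b : R) w : D w -> f ((a +i* b) *: w) = a * f w + b * f ('i%C *: w).
  move=> hw; have -> : a +i* b = a%:C + b%:C * 'i%C.
    apply/eqP; rewrite eq_complex /=; apply/andP; split; apply/eqP; ring.
  by rewrite scalerDl -scalerA hf.1 ?hf.2 //; do ?apply: subspZ => //.
case: c => a b; rewrite /cplx (K a b v hv).
have -> : 'i%C *: ((a +i* b) *: v) = (a +i* b) *: ('i%C *: v).
  by rewrite !scalerA mulrC.
rewrite (K a b _ hiv) (scalerA 'i%C 'i%C) ii_N1 scaleN1r (rlinN hf) //.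
apply/eqP; rewrite eq_complex /=; apply/andP; split; apply/eqP; ring.
Qed.

(** One construction for three forms: those of states of A, those of matrix states, and the one
    behind Arveson's theorem. [pr] is the pairing and [iv] the involution. *)
Lemma cplx_form (W : lmodType C) (E : set W) (pr : W -> W -> V) (iv : V -> V) :
  linear_subspace E ->
  (forall x y, E x -> E y -> D (pr x y)) ->
  (forall (c : C) x x' y, E x -> E x' -> E y -> pr (c *: x + x') y = c *: pr x y + pr x' y) ->
  (forall x y, E x -> E y -> pr y x = iv (pr x y)) ->
  (forall (c : C) v, iv (c *: v) = cj c *: iv v) ->
  (forall v, D v -> f (iv v) = f v) ->
  (forall x, E x -> 0 <= f (pr x x)) ->
  psdform E (fun x y => cplx f (pr x y)).
Proof.
move=> hE h1 h2 h3 h4 h5 h6.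
have herm x y : E x -> E y -> cplx f (pr y x) = cj (cplx f (pr x y)).
  move=> hx hy; have hxy := h1 _ _ hx hy; rewrite h3 // /cplx h5 //.
  have -> : 'i%C *: iv (pr x y) = iv (- 'i%C *: pr x y).
    by rewrite h4 cjN cj_i opprK.
  rewrite h5; last by apply: subspZ.
  rewrite scaleNr (rlinN hf) ?opprK; last by apply: subspZ.
  by apply/eqP; rewrite eq_complex /= opprK !eqxx.
split=> //.
- move=> c x y z hx hy hz; rewrite h2 // cplxD ?cplxZ //; last exact: h1.
    exact: h1.
  by apply: subspZ => //; exact: h1.
- move=> x hx; have := herm x x hx hx; case e : (cplx f (pr x x)) => [a b].
  move=> /eqP; rewrite eq_complex /= => /andP[_ /eqP hb].
  have := h6 x hx; have -> : f (pr x x) = a by case: e.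
  by move=> a0; rewrite lecE /= a0 andbT; apply/eqP; lra.
Qed.

Lemma Re_cplx v : complex.Re (cplx f v) = f v. Proof. by []. Qed.

End Complexify.

Section PosFunctional.
Context (R : realType) (A : starAlgType R) (p : A -> R) (hp : csn p).
Local Notation C := R[i].

(** For t slightly above p a ^+ 2, the element 1 - star a * a / t is a square y^2 up to a small
    error; b is nonnegative on the square, and the bound by K p controls the error. The summand e /
    (1 + b 1) keeps t positive when p a = 0. *)
Lemma pos_functional_bound (b : A -> R) : rlin setT b ->
  (forall x, 0 <= b (star x * x)) ->
  (exists2 K : R, 0 <= K & forall x, b x <= K * p x) ->
  forall a, b (star a * a) <= p a ^+ 2 * b 1.
Proof.
move=> hb bpos [K K0 bK] a.
have b1 : 0 <= b 1 by have := bpos 1; rewrite star1 mul1r.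
apply/ler_addgt0Pr => e e0.
set t := p a ^+ 2 + e / (1 + b 1).
have t0 : 0 < t by have := sqr_ge0 (p a); have := divr_gt0 e0 (_ : 0 < 1 + b 1); rewrite /t; lra.
set c := t^-1%:C *: (star a * a).
have sc : star c = c by rewrite starZR sa_SM.
have c1 : p c <= 1.
  rewrite (scZp hp) ?invr_ge0 ?(ltW t0) // (scSM hp) mulrC ler_pdivrMr // mul1r.
  by rewrite /t lerDl divr_ge0 ?(ltW e0) //; lra.
have H : b c <= b 1.
  apply/ler_addgt0Pr => d d0; have pp := csn_poly hp sc.
  have pX : p (horner_alg c 'X) <= 1 by rewrite horner_algX.
  have d1 : 0 < d / (1 + K) by apply: divr_gt0 => //; lra.
  have [k [sk _ hk]] := approx_sqrt pp (pstar_X _) pX d1.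
  set y := horner_alg c k.
  have sy : star y = y by rewrite horner_alg_star // sk.
  have := bK (- (1 - c - y * y)); rewrite (scN hp).
  have -> : - (1 - c - y * y) = c - 1 + star y * y by rewrite sy; ncring.
  rewrite hb.1 // (rlinB (@subspT R A) hb) //.
  have -> : 1 - c - y * y = horner_alg c (1 - 'X - k ^+ 2).
    by rewrite !rmorphB rmorph1 rmorphXn /= horner_algX expr2.
  have := bpos y; move: hk; rewrite ler_pdivlMr; last lra.
  by have := sc_ge0 hp (horner_alg c (1 - 'X - k ^+ 2)); nra.
move: H; rewrite /c hb.2 // mulrC ler_pdivrMr // => H.
apply: le_trans H _; rewrite /t mulrDr mulrC lerD2l mulrCA ler_piMr ?(ltW e0) //.
by rewrite ler_pdivrMr; lra.
Qed.

End PosFunctional.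

Section StateForm.
Context (R : realType) (A : frechetLocCStarType R) (p : A -> R) (hp : csn p).
Local Notation C := R[i].

Definition gns (phi : A -> R) (a b : A) : C := cplx phi (star b * a).

Lemma gns_form phi : state p phi -> psdform setT (gns phi).
Proof.
case=> h1 h2 h3 h4 h5; apply: (cplx_form (@subspT R A) h1 (iv := star)) => //.
- by move=> c x x' y _ _ _; rewrite mulrDr -scalerAr.
- by move=> x y _ _; rewrite starM starK.
- by move=> c v; rewrite starZ.
Qed.

Lemma gns_prep phi : prerep setT (gns phi) (fun a w : A => a * w).
Proof.
split=> //.
- by move=> c a b w _; rewrite mulrDl -scalerAl.
- by move=> a c w w' _ _; rewrite mulrDr -scalerAr.
- by move=> a b w _; rewrite mulrA.
- by move=> a w w' _ _; rewrite /gns starM starK mulrA.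
Qed.

Lemma state_bound phi a w : state p phi ->
  fnorm (gns phi) (a * w) <= p a * fnorm (gns phi) w.
Proof.
move=> hs; have hg := gns_form hs; case: (hs) => h1 h2 h3 h4 h5.
have p0 := sc_ge0 hp a.
rewrite -ler_sqr ?nnegrE ?mulr_ge0 ?fnorm_ge0 // exprMn !(fnorm_sqr hg) //.
rewrite /sqn /gns !Re_cplx.
have := pos_functional_bound hp (b := fun x => phi (star w * x * w)) _ _ _ a.
rewrite mulr1 starM !mulrA; apply.
- split=> [x y _ _|t x _]; first by rewrite mulrDr mulrDl h1.1.
  by rewrite -scalerAr -scalerAl h1.2.
- by move=> x; have := h3 (x * w); rewrite starM !mulrA.
- exists (p w ^+ 2); first exact: sqr_ge0.
  move=> x; apply: le_trans (h2 _) _; apply: le_trans (scM hp _ _) _.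
  have := scM hp (star w) x; rewrite (sc_star hp).
  have := sc_ge0 hp w; have := sc_ge0 hp (star w * x); nra.
Qed.

End StateForm.

(** * Matrix units and uniqueness of the matrix seminorm *)

Section Corners.
Context (R : realType) (A : frechetLocCStarType R) (n : nat).
Local Notation C := R[i].

Implicit Types (x y : 'M[A]_n) (Q : 'M[A]_n -> R).

Definition mcsn (Q : 'M[A]_n -> R) :=
  is_cstar_seminorm (fun (c : C) (x : 'M[A]_n) => map_mx (fun a => c *: a) x)
    (fun x y => x *m y) (@mxstar R A n) Q.

Definition mxe (a : A) (i j : 'I_n) : 'M[A]_n :=
  \matrix_(k, l) (if (k == i) && (l == j) then a else 0).

Lemma mxe_mul a b i j l : mxe a i j *m mxe b j l = mxe (a * b) i l.
Proof.
apply/matrixP => k m; rewrite !mxE (bigD1 j) //= !mxE !eqxx andbT /=.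
rewrite big1 ?addr0 => [|u uj]; last by rewrite !mxE (negbTE uj) andbF mul0r.
by case: (k == i); case: (m == l); rewrite /= ?mulr0 ?mul0r.
Qed.

Lemma mxe_star a i j : mxstar (mxe a i j) = mxe (star a) j i.
Proof. by apply/matrixP => k l; rewrite !mxE andbC; case: ifP; rewrite ?star0. Qed.

Lemma mxe_sum (x : 'M[A]_n) : x = \sum_i \sum_j mxe (x i j) i j.
Proof.
apply/matrixP => k l; rewrite summxE (bigD1 k) //= summxE (bigD1 l) //= mxE !eqxx /=.
rewrite big1 ?addr0 => [|j jl]; last by rewrite mxE eqxx eq_sym (negbTE jl).
rewrite big1 ?addr0 // => i ik; rewrite summxE big1 // => j _.
by rewrite mxE eq_sym (negbTE ik).
Qed.

Lemma mxe_compress (x : 'M[A]_n) i j : mxe 1 i i *m x *m mxe 1 j j = mxe (x i j) i j.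
Proof.
apply/matrixP => k l; rewrite !mxE (bigD1 j) //= !mxE !eqxx /=.
rewrite [X in _ + X]big1 ?addr0 => [|u uj]; last by rewrite !mxE (negbTE uj) mulr0.
rewrite (bigD1 i) //= !mxE eqxx andbT.
rewrite big1 ?addr0 => [|u ui]; last by rewrite !mxE (negbTE ui) andbF mul0r.
by case: (k == i); case: (l == j); rewrite /= ?mulr1 ?mul1r ?mulr0 ?mul0r.
Qed.

Lemma corner_csn Q j : mcsn Q -> csn (fun a : A => Q (mxe a j j)).
Proof.
move=> hQ; split=> [x y|c x|x y|x].
- have -> : mxe (x + y) j j = mxe x j j + mxe y j j.
    by apply/matrixP => k l; rewrite !mxE; case: ifP; rewrite ?addr0.
  exact: (csnD hQ).
- have -> : mxe (c *: x) j j = map_mx (fun a => c *: a) (mxe x j j).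
    by apply/matrixP => k l; rewrite !mxE; case: ifP; rewrite ?scaler0.
  by case: hQ.
- by rewrite -(mxe_mul x y j j j); exact: (csnM hQ).
- by rewrite -(mxe_mul _ _ j j j) -mxe_star (csnSM hQ).
Qed.

Lemma mxe_sqr Q a i j : mcsn Q -> Q (mxe a i j) ^+ 2 = Q (mxe (star a * a) j j).
Proof. by move=> hQ; rewrite -(csnSM hQ) mxe_star mxe_mul. Qed.

Variables (p : A -> R) (hp : csn p) (cp : qcomplete p).

Definition kills Q := forall x, (forall i j, p (x i j) = 0) -> Q x = 0.

Lemma kills_mxe Q a i j : kills Q -> p a = 0 -> Q (mxe a i j) = 0.
Proof.
by move=> kQ h; apply: kQ => k l; rewrite mxE; case: ifP; rewrite // (sc0 hp).
Qed.

(** By the C*-identity ([mxe_sqr]) it is enough to treat the diagonal corner, where Q restricts to a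
    C*-seminorm on A that vanishes on ker p; [csn_le_of_ker] compares it with p. *)
Lemma mxe_le Q a i j : mcsn Q -> kills Q -> Q (mxe a i j) <= p a.
Proof.
move=> hQ kQ; have ops := mx_ops A n.
rewrite -ler_sqr ?nnegrE ?(sc_ge0 hp) ?(csn_ge0 ops hQ) // mxe_sqr // -(scSM hp).
by apply: (csn_le_of_ker hp cp (corner_csn j hQ)) => x; exact: kills_mxe.
Qed.

Lemma mcsn_le_sum Q x : mcsn Q -> kills Q -> Q x <= \sum_i \sum_j p (x i j).
Proof.
move=> hQ kQ; have ops := mx_ops A n; rewrite {1}(mxe_sum x).
apply: le_trans (csn_sum ops hQ _ _ _) _; apply: ler_sum => i _.
apply: le_trans (csn_sum ops hQ _ _ _) _; apply: ler_sum => j _.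
exact: mxe_le.
Qed.

(** On a diagonal corner Q has the same kernel as p, so [csn_ge_of_ker] applies; multiplication by
    matrix units on both sides extracts the entry without increasing Q. *)
Lemma mcsn_entry Q x i j : mcsn Q -> (forall y, Q y = 0 <-> forall i j, p (y i j) = 0) ->
  p (x i j) <= Q x.
Proof.
move=> hQ hk; have ops := mx_ops A n.
have kQ : kills Q by move=> y /hk.
have H a : p a <= Q (mxe a i j).
  rewrite -ler_sqr ?nnegrE ?(sc_ge0 hp) ?(csn_ge0 ops hQ) // mxe_sqr // -(scSM hp).
  apply: (csn_ge_of_ker hp cp (corner_csn j hQ)) => y; first exact: kills_mxe.
  by move=> /hk /(_ j j); rewrite mxE !eqxx.
apply: le_trans (H _) _; rewrite -mxe_compress.
have e1 k : Q (mxe 1 k k) <= 1 by apply: le_trans (mxe_le 1 k k hQ kQ) (sc1 hp).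
have := csnM hQ (mxe 1 i i *m x) (mxe 1 j j); have := csnM hQ (mxe 1 i i) x.
have := e1 i; have := e1 j; have := csn_ge0 ops hQ (mxe 1 i i).
have := csn_ge0 ops hQ (mxe 1 j j); have := csn_ge0 ops hQ x.
have := csn_ge0 ops hQ (mxe 1 i i *m x); set u := Q (_ *m x); nra.
Qed.

(** Comparing both sides with the entries gives Q <= n^2 Q', and [csn_le_of_equiv] removes the
    constant. *)
Lemma mcsn_le Q Q' : mcsn Q -> kills Q -> mcsn Q' -> (forall x i j, p (x i j) <= Q' x) ->
  forall x, Q x <= Q' x.
Proof.
move=> hQ kQ hQ' hp'; apply: (csn_le_of_equiv (mx_ops A n) hQ hQ' (C := n%:R * n%:R)).
move=> x; apply: le_trans (mcsn_le_sum x hQ kQ) _.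
apply: (@le_trans _ _ (\sum_(i < n) \sum_(j < n) Q' x)).
  by apply: ler_sum => i _; apply: ler_sum => j _.
by rewrite !sumr_const !card_ord -mulrnA -[leLHS]mulr_natl natrM.
Qed.

End Corners.

Section MxNorm.
Context (R : realType) (A : frechetLocCStarType R) (p : A -> R) (n : nat).
Local Notation C := R[i].
Hypotheses (hp : csn p) (p1 : p 1 = 1).
Implicit Types (x y : 'M[A]_n).
Let opphi (phi : A -> R) (x : 'M[A]_n) : R := opq setT (gns phi) (fun a w : A => a * w) x.

Lemma opphi_csn phi : state p phi -> mcsn (opphi phi).
Proof.
move=> hs; apply: (opq_csn (@subspT R A) (gns_form hs) (gns_prep phi) (sc_ge0 hp)).
by move=> a w _; exact: (state_bound hp).
Qed.

Lemma opphi_le_sum phi x : state p phi -> opphi phi x <= \sum_i \sum_j p (x i j).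
Proof.
move=> hs; apply: (opq_le_sum (@subspT R A) (gns_form hs) (gns_prep phi) (sc_ge0 hp)).
by move=> a w _; exact: (state_bound hp).
Qed.

Lemma opphi_le phi x (v : 'I_n -> A) : state p phi ->
  fnorm (Bn (gns phi) (n := n)) (act (fun a w : A => a * w) x v) <=
  opphi phi x * fnorm (Bn (gns phi) (n := n)) v.
Proof.
move=> hs; apply: (opq_le (@subspT R A) (gns_form hs) (gns_prep phi) (sc_ge0 hp)) => //.
by move=> a w _; exact: (state_bound hp).
Qed.

(** The concrete C*-norm behind [mxcsn], the supremum over the GNS representations of all states. It
    shows that the set from which [mxcsn] chooses is inhabited, and [mxcsn_repnorm] identifies the
    two. *)
Definition repnorm (x : 'M[A]_n) : R := sup [set opphi phi x | phi in state p].

Lemma repnorm_has_sup x : has_sup [set opphi phi x | phi in state p].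
Proof.
split; last by exists (\sum_i \sum_j p (x i j)) => _ [phi hs <-]; exact: opphi_le_sum.
by have [phi hs _] := state_exists 1 hp p1; exists (opphi phi x), phi.
Qed.

Lemma opphi_repnorm phi x : state p phi -> opphi phi x <= repnorm x.
Proof. by move=> hs; apply: (sup_upper_bound (repnorm_has_sup x)); exists phi. Qed.

Lemma repnorm_le x (t : R) : (forall phi, state p phi -> opphi phi x <= t) -> repnorm x <= t.
Proof.
move=> H; apply: ge_sup; first exact: (repnorm_has_sup x).1.
by move=> _ [phi hs <-]; exact: H.
Qed.

Lemma repnorm_ge0 x : 0 <= repnorm x.
Proof.
have [phi hs _] := state_exists 1 hp p1.
by apply: le_trans (opphi_repnorm x hs); apply: (csn_ge0 (mx_ops A n) (opphi_csn hs)).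
Qed.

Lemma repnorm_csn : mcsn repnorm.
Proof.
have ops := mx_ops A n.
have qM x y : repnorm (x *m y) <= repnorm x * repnorm y.
  apply: repnorm_le => phi hs; apply: le_trans (csnM (opphi_csn hs) _ _) _.
  by apply: ler_pM; rewrite ?(csn_ge0 ops (opphi_csn hs)) ?opphi_repnorm.
split=> [x y|c x|//|x].
- apply: repnorm_le => phi hs; apply: le_trans (csnD (opphi_csn hs) _ _) _.
  by apply: lerD; exact: opphi_repnorm.
- have K (d : C) z : repnorm (map_mx (fun a => d *: a) z) <= cabs d * repnorm z.
    apply: repnorm_le => phi hs; rewrite (csnZn (opphi_csn hs)).
    by apply: ler_wpM2l; [exact: cabs_ge0|exact: opphi_repnorm].
  exact: (mx_homogeneous repnorm_ge0 K).
- have qs y : repnorm (mxstar y) <= repnorm y.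
    by apply: repnorm_le => phi hs; rewrite (csn_star ops (opphi_csn hs)) opphi_repnorm.
  apply: le_anti; apply/andP; split.
    by apply: le_trans (qM _ _) _; rewrite expr2 ler_wpM2r ?repnorm_ge0.
  rewrite -[leRHS]sqr_sqrtr ?repnorm_ge0 // lerXn2r ?nnegrE ?repnorm_ge0 ?sqrtr_ge0 //.
  apply: repnorm_le => phi hs.
  rewrite -ler_sqr ?nnegrE ?sqrtr_ge0 ?(csn_ge0 ops (opphi_csn hs)) //.
  by rewrite sqr_sqrtr ?repnorm_ge0 // -(csnSM (opphi_csn hs)) opphi_repnorm.
Qed.

(** A state with phi (star a * a) = p a ^+ 2 for a = x i j, tested on the j-th unit vector, sees the
    full norm of this entry. *)
Lemma repnorm_entry x i j : p (x i j) <= repnorm x.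
Proof.
have [phi hs he] := state_exists (x i j) hp p1.
have hg := gns_form hs; have hT := gns_prep phi.
apply: le_trans (opphi_repnorm x hs).
pose v : 'I_n -> A := fun k => if k == j then 1 else 0.
have nv : fnorm (Bn (gns phi) (n := n)) v = 1.
  rewrite /fnorm sqn_Bn (bigD1 j) //= /v eqxx big1 ?addr0 => [|k kj].
    by rewrite /sqn /gns star1 mul1r Re_cplx; case: hs => _ _ _ _ ->; rewrite sqrtr1.
  by rewrite (negbTE kj) /sqn (form0l (@subspT R A) hg).
have := opphi_le x v hs; rewrite nv mulr1; apply: le_trans.
have hv : Dn setT (act (fun a w : A => a * w) x v) by [].
apply: le_trans (fnorm_le_Bn hg i hv).
have -> : act (fun a w : A => a * w) x v i = x i j.
  rewrite /act (bigD1 j) //= /v eqxx mulr1 big1 ?addr0 // => k kj.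
  by rewrite (negbTE kj) mulr0.
by rewrite /fnorm /sqn /gns Re_cplx he sqrtr_sqr ler_norm.
Qed.

Lemma repnorm_ker x : repnorm x = 0 <-> forall i j, p (x i j) = 0.
Proof.
split=> [h i j|h].
  by apply/eqP; rewrite eq_le (sc_ge0 hp) andbT -h repnorm_entry.
apply/eqP; rewrite eq_le repnorm_ge0 andbT; apply: repnorm_le => phi hs.
apply: le_trans (opphi_le_sum x hs) _.
by rewrite big1 // => i _; rewrite big1.
Qed.

Lemma mxcsn_spec : mcsn (@mxcsn R A p n) /\
  forall x, mxcsn p x = 0 <-> forall i j, p (x i j) = 0.
Proof.
rewrite /mxcsn; set P := [set q | _].
have : P (xget (fun=> 0) P); last by case.
by apply: xgetPex; exists repnorm; split; [exact: repnorm_csn|exact: repnorm_ker].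
Qed.

Lemma mxcsn_eq0 x : mxcsn p x = 0 <-> forall i j, p (x i j) = 0.
Proof. exact: mxcsn_spec.2. Qed.

Hypothesis cp : qcomplete p.

Lemma mxcsn_repnorm x : mxcsn p x = repnorm x.
Proof.
have [h1 h2] := mxcsn_spec; apply: le_anti; apply/andP; split.
  apply: (mcsn_le hp cp) => //; first by move=> y /h2.
    exact: repnorm_csn.
  exact: repnorm_entry.
apply: (mcsn_le hp cp) => //; first exact: repnorm_csn.
  by move=> y /repnorm_ker.
by move=> y i j; exact: mcsn_entry.
Qed.

Lemma mxcsn_ge Q : mcsn Q -> kills p Q -> forall x, Q x <= mxcsn p x.
Proof.
have [h1 h2] := mxcsn_spec; move=> hQ kQ; apply: (mcsn_le hp cp) => //.
by move=> y i j; exact: mcsn_entry.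
Qed.

End MxNorm.

(** * Matrix states and dilations *)

Section MatrixFunctionals.
Context (R : realType) (A : frechetLocCStarType R) (p : A -> R) (T : finType).
Hypotheses (hp : csn p) (p1 : p 1 = 1).
Local Notation C := R[i].
Implicit Types (a : A) (b c d : T -> A) (v : T -> T -> A) (u w : T).

(** Functions T -> A are rows, and this is the matrix of the product of the adjoint of the row c
    with the row b. A matrix state phi turns rows into the space of a representation of A by [lm],
    and phi is recovered as the state of the tuple of vectors [eu u] ([mst_entries]), whose squared
    norms sum to 1. *)
Definition outer c b : T -> T -> A := fun u w => star (c u) * b w.
Definition vst v : T -> T -> A := fun u w => star (v w u).
Definition lm a b : T -> A := fun u => a * b u.
Definition eu u : T -> A := fun w => if w == u then 1 else 0.
Definition vdiag : T -> T -> A := fun u w => if u == w then 1 else 0.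

(* The real parts of the states of the C*-algebra of matrices over A / ker p
   indexed by T. *)
Definition mstate (phi : (T -> T -> A) -> R) :=
  [/\ rlin setT phi, forall v, phi v <= \sum_u \sum_w p (v u w),
      forall v, phi (vst v) = phi v, forall b, 0 <= phi (outer b b) & phi vdiag = 1].

Definition Bf (phi : (T -> T -> A) -> R) b c : C := cplx phi (outer c b).

Lemma Bf_form phi : mstate phi -> psdform setT (Bf phi).
Proof.
case=> h1 h2 h3 h4 h5.
apply: (cplx_form (@subspT R _) h1 (pr := fun x y => outer y x) (iv := vst)) => //.
- move=> c x x' y _ _ _; apply/funext => u; apply/funext => w.
  by transitivity (star (y u) * (c *: x w + x' w)); rewrite // mulrDr -scalerAr.
- by move=> x y _ _; apply/funext => u; apply/funext => w; rewrite /vst starM starK.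
- by move=> c v; apply/funext => u; apply/funext => w; rewrite /vst starZ.
Qed.

Lemma lm_prep phi : prerep setT (Bf phi) lm.
Proof.
split=> //.
- move=> c a b w _; apply/funext => u.
  by transitivity ((c *: a + b) * w u); rewrite // mulrDl -scalerAl.
- move=> a c w w' _ _; apply/funext => u.
  by transitivity (a * (c *: w u + w' u)); rewrite // mulrDr -scalerAr.
- by move=> a b w _; apply/funext => u; rewrite /lm mulrA.
- move=> a w w' _ _; rewrite /Bf; congr (cplx phi _).
  by apply/funext => u; apply/funext => v; rewrite /outer /lm starM starK mulrA.
Qed.

Lemma Bf_bound phi a b : mstate phi ->
  fnorm (Bf phi) (lm a b) <= p a * fnorm (Bf phi) b.
Proof.
move=> hs; have hg := Bf_form hs; case: (hs) => h1 h2 h3 h4 h5.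
have p0 := sc_ge0 hp a.
rewrite -ler_sqr ?nnegrE ?mulr_ge0 ?fnorm_ge0 // exprMn !(fnorm_sqr hg) //.
rewrite /sqn /Bf !Re_cplx.
have E x y : outer (lm x b) (lm y b) = outer b (lm (star x * y) b).
  by apply/funext => u; apply/funext => v; rewrite /outer /lm starM !mulrA.
rewrite E; have := pos_functional_bound hp (b := fun x => phi (outer b (lm x b))) _ _ _ a.
have -> : lm 1 b = b by apply/funext => u; rewrite /lm mul1r.
apply.
- split=> [x y _ _|t x _]; rewrite -?h1.1 -?h1.2 //; congr phi;
    apply/funext => u; apply/funext => v.
    by transitivity (star (b u) * ((x + y) * b v)); rewrite // mulrDl mulrDr.
  by transitivity (star (b u) * ((t%:C *: x) * b v)); rewrite // -scalerAl -scalerAr.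
- by move=> x; rewrite -E.
- exists (\sum_u \sum_w p (b u) * p (b w)).
    by do 2!apply: sumr_ge0 => ? _; apply: mulr_ge0; exact: (sc_ge0 hp).
  move=> x; apply: le_trans (h2 _) _; rewrite mulr_suml; apply: ler_sum => u _.
  rewrite mulr_suml; apply: ler_sum => w _; rewrite /outer /lm.
  apply: le_trans (scM hp _ _) _; rewrite (sc_star hp) -mulrA ler_wpM2l ?(sc_ge0 hp) //.
  by rewrite mulrC; exact: (scM hp).
Qed.

Lemma eu_diag : vdiag = \sum_u outer (eu u) (eu u).
Proof.
apply/funext => u; apply/funext => w.
have -> : (\sum_k outer (eu k) (eu k)) u w = \sum_k star (eu k u) * eu k w.
  by rewrite !fct_sumE.
rewrite /vdiag /eu (bigD1 u) //= eqxx star1 mul1r big1 ?addr0 => [|k ku].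
  by rewrite eq_sym.
by rewrite eq_sym (negbTE ku) star0 mul0r.
Qed.

Lemma mst_sum phi I (r : seq I) (F : I -> T -> T -> A) : rlin setT phi ->
  phi (\sum_(i <- r) F i) = \sum_(i <- r) phi (F i).
Proof.
move=> h; elim/big_rec2: _ => [|i x y _ <-]; first exact: (rlin0 (@subspT R _)).
by rewrite h.1.
Qed.

Lemma eu_norm1 phi : mstate phi -> \sum_u sqn (Bf phi) (eu u) = 1.
Proof.
case=> h1 _ _ _ <-; rewrite eu_diag mst_sum //.
Qed.

Lemma eu_le1 phi u : mstate phi -> fnorm (Bf phi) (eu u) <= 1.
Proof.
move=> hs; apply: sqrt_le; rewrite ?ler01 // expr1n -(eu_norm1 hs) (bigD1 u) //=.
by rewrite lerDl; apply: sumr_ge0 => w _; apply: (sqn_ge0 (Bf_form hs)).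
Qed.

Lemma outer_sum v : v = \sum_u \sum_w outer (eu u) (lm (v u w) (eu w)).
Proof.
apply/funext => k; apply/funext => l.
rewrite fct_sumE fct_sumE (bigD1 k) //= fct_sumE fct_sumE (bigD1 l) //=.
rewrite /outer /lm /eu !eqxx star1 mul1r mulr1 big1 ?addr0 => [|w wl].
  rewrite big1 ?addr0 // => u uk; rewrite fct_sumE fct_sumE big1 // => w _.
  by rewrite eq_sym (negbTE uk) star0 mul0r.
by rewrite eq_sym (negbTE wl) !mulr0.
Qed.

Lemma lm_eu b : b = \sum_u lm (b u) (eu u).
Proof.
apply/funext => k; rewrite fct_sumE (bigD1 k) //= /lm /eu eqxx mulr1 big1 ?addr0 //.
by move=> w wk; rewrite eq_sym (negbTE wk) mulr0.
Qed.

Lemma mst_entries phi v : rlin setT phi ->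
  phi v = \sum_u \sum_w complex.Re (Bf phi (lm (v u w) (eu w)) (eu u)).
Proof.
move=> h; rewrite {1}(outer_sum v) mst_sum //; apply: eq_bigr => u _.
by rewrite mst_sum.
Qed.

End MatrixFunctionals.
Arguments mstate {R A} p {T} phi.
Arguments eu {R A T} u.
Arguments vdiag {R A T}.

Section Dilation.
Context (R : realType) (A : frechetLocCStarType R) (p : A -> R) (T : finType) (S : set A).
Hypotheses (hp : csn p) (p1 : p 1 = 1) (S1 : S 1).
Local Notation C := R[i].
Local Notation V := (T -> T -> A).
Implicit Types (a : A) (b c d : T -> A) (v : V) (u w : T).

(* [G a b c] stands for the matrix coefficient <g(a) b, c> of a completely
   positive map g extending the restriction to S of the representation
   attached to [phi]. *)
Definition dilation (phi : V -> R) (G : A -> (T -> A) -> (T -> A) -> C) :=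
  [/\ forall (z : C) a a' b d, G (z *: a + a') b d = z * G a b d + G a' b d,
      forall (z : C) a b b' d, G a (z *: b + b') d = z * G a b d + G a b' d,
      forall a b d, G (star a) d b = cj (G a b d),
      forall n (a : 'I_n -> A) (b : 'I_n -> T -> A),
        0 <= \sum_k \sum_l G (star (a k) * a l) (b l) (b k) &
      forall a b, complex.Re (G (star a * a) b b) <= p a ^+ 2 * complex.Re (G 1 b b)] /\
  forall s b d, S s -> G s b d = Bf phi (lm s b) d.

(** The functional that g determines through the same vectors [eu u] that recover phi; it is again a
    matrix state ([compress_mstate]). *)
Definition compress (G : A -> (T -> A) -> (T -> A) -> C) v : R :=
  complex.Re (\sum_u \sum_w G (v u w) (eu w) (eu u)).

Section OneDilation.
Variables (phi : V -> R) (G : A -> (T -> A) -> (T -> A) -> C).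
Hypotheses (hs : mstate p phi) (hG : dilation phi G).

Lemma dil1 b d : G 1 b d = Bf phi b d.
Proof.
rewrite hG.2 //; congr (Bf phi _ _).
by apply/funext => u; rewrite /lm mul1r.
Qed.

(** The Stinespring form of g on sums of tensors of a k with b k, for a fixed finite family a.
    Cauchy-Schwarz for it replaces the construction of the dilation space. *)
Definition dform n (a : 'I_n -> A) (b c : 'I_n -> T -> A) : C :=
  \sum_k \sum_l G (star (a k) * a l) (b l) (c k).

Lemma dform_form n (a : 'I_n -> A) : psdform setT (dform a).
Proof.
case: hG => -[h1 h2 h3 h4 h5] _; split=> [z x y w _ _ _|x y _ _|x _].
- rewrite /dform mulr_sumr -big_split /=; apply: eq_bigr => k _.
  rewrite mulr_sumr -big_split /=; apply: eq_bigr => l _; exact: h2.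
- rewrite /dform cj_sum exchange_big /=; apply: eq_bigr => k _.
  rewrite cj_sum; apply: eq_bigr => l _.
  by rewrite -h3 starM starK.
- exact: h4.
Qed.

Lemma dil0a b d : G 0 b d = 0.
Proof.
by case: hG => -[h _ _ _ _] _; have := h (-1) 0 0 b d;
  rewrite scaleN1r addr0 oppr0 mulN1r addNr.
Qed.

Lemma dil0b a d : G a 0 d = 0.
Proof.
by case: hG => -[_ h _ _ _] _; have := h (-1) a 0 0 d;
  rewrite scaleN1r addr0 oppr0 mulN1r addNr.
Qed.

Lemma dil0c a b : G a b 0 = 0.
Proof. by case: hG => -[_ _ h _ _] _; rewrite -(starK a) h dil0b cj0. Qed.

Lemma dilZ z a b d : G (z *: a) b d = z * G a b d.
Proof. by case: hG => -[h _ _ _ _] _; rewrite -[z *: a]addr0 h dil0a addr0. Qed.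

Lemma dilD a a' b d : G (a + a') b d = G a b d + G a' b d.
Proof. by case: hG => -[h _ _ _ _] _; rewrite -{1}[a]scale1r h mul1r. Qed.

Lemma dil_sumb a I (r : seq I) (F : I -> T -> A) d :
  G a (\sum_(i <- r) F i) d = \sum_(i <- r) G a (F i) d.
Proof.
elim/big_rec2: _ => [|i x y _ <-]; first exact: dil0b.
by case: hG => -[_ h _ _ _] _; rewrite -{1}[F i]scale1r h mul1r.
Qed.

(** Cauchy-Schwarz in the Stinespring form for the tensors a with b and 1 with d. *)
Lemma dil_bound a b d : cabs (G a b d) <= p a * fnorm (Bf phi) b * fnorm (Bf phi) d.
Proof.
case: (hG) => -[h1 h2 h3 h4 h5] _.
pose aa (k : 'I_2) := if k == 0 then 1 else a.
pose x (k : 'I_2) := if k == 0 then 0 else b.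
pose y (k : 'I_2) := if k == 0 then d else 0.
have := cauchy_schwarz (@subspT R _) (dform_form aa) (x := x) (y := y) I I.
have -> : dform aa x y = G a b d.
  rewrite /dform !big_ord_recl !big_ord0 /= /aa /x /y /= !dil0b !dil0c.
  by rewrite star1 mul1r !addr0 add0r.
have -> : fnorm (dform aa) y = fnorm (Bf phi) d.
  rewrite /fnorm /sqn /dform !big_ord_recl !big_ord0 /= /aa /y /= !dil0b !dil0c.
  by rewrite star1 mul1r !addr0 dil1.
move=> h; apply: le_trans h _; apply: ler_wpM2r; first exact: fnorm_ge0.
apply: sqrt_le; first by rewrite mulr_ge0 ?fnorm_ge0 ?(sc_ge0 hp).
rewrite exprMn (fnorm_sqr (Bf_form hs)) // /sqn -dil1.
rewrite /dform !big_ord_recl !big_ord0 /= /aa /x /= !dil0b !dil0c !addr0 !add0r.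
exact: h5.
Qed.

Lemma compress_mstate : mstate p (compress G).
Proof.
case: (hG) => -[h1 h2 h3 h4 h5] _; split.
- split=> [x y _ _|t x _].
    rewrite /compress -ReD -big_split /=; congr (complex.Re _); apply: eq_bigr => u _.
    rewrite -big_split /=; apply: eq_bigr => w _; exact: dilD.
  rewrite /compress -ReZ mulr_sumr; congr (complex.Re _); apply: eq_bigr => u _.
  rewrite mulr_sumr; apply: eq_bigr => w _; exact: dilZ.
- move=> v; rewrite /compress Re_sum; apply: ler_sum => u _.
  rewrite Re_sum; apply: ler_sum => w _; apply: le_trans (cabs_Re _) _.
  apply: le_trans (dil_bound _ _ _) _.
  have := eu_le1 u hs; have := eu_le1 w hs.
  have := fnorm_ge0 (Bf phi) (eu u); have := fnorm_ge0 (Bf phi) (eu w).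
  have := sc_ge0 hp (v u w); set x := fnorm _ _; set y := fnorm _ _; set z := p _.
  move=> z0 x0 y0 x1 y1; rewrite -mulrA ler_piMr //.
  by rewrite mulr_ile1.
- move=> v; rewrite /compress -[RHS]ReJ cj_sum; congr (complex.Re _).
  under [RHS]eq_bigr => u _ do rewrite cj_sum.
  rewrite exchange_big /=; apply: eq_bigr => u _; apply: eq_bigr => w _.
  exact: h3.
- move=> b; rewrite /compress.
  have -> : \sum_u \sum_w G (outer b b u w) (eu w) (eu u) =
    \sum_(k < #|T|) \sum_(l < #|T|) G (star (b (enum_val k)) * b (enum_val l))
      (eu (enum_val l)) (eu (enum_val k)).
    rewrite (reindex (@enum_val T T)) /=; last exact/onW_bij/enum_val_bij.
    apply: eq_bigr => k _; rewrite (reindex (@enum_val T T)) //=.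
    exact/onW_bij/enum_val_bij.
  exact/ge0_ReP/(h4 _ (fun k => b (enum_val k)) (fun k => eu (enum_val k))).
- rewrite /compress -(eu_norm1 hs) Re_sum; apply: eq_bigr => u _.
  rewrite (bigD1 u) //= /vdiag eqxx big1 ?addr0 => [|w wu]; first by rewrite dil1.
  by rewrite eq_sym (negbTE wu) dil0a.
Qed.

(** Hence dilations preserve the value at the given matrix over S, and its maximizing states remain
    maximizing. *)
Lemma compress_S v : (forall u w, S (v u w)) -> compress G v = phi v.
Proof.
move=> Sv; case: hs => h1 _ _ _ _; rewrite (mst_entries v h1) /compress Re_sum.
apply: eq_bigr => u _; rewrite Re_sum; apply: eq_bigr => w _.
by rewrite hG.2.
Qed.

(** In the Stinespring form the tensor of s with b minus that of 1 with s b has squared norm equal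
    to the difference of the two sides, which is the Schwarz inequality. If it is null, it is
    orthogonal to the tensor of [star a] with d, and this is the second claim. The index set 'I_3
    holds the factors s, 1 and [star a]. *)
Lemma dil_gap s b : S s -> S (star s) ->
  sqn (Bf phi) (lm s b) <= complex.Re (G (star s * s) b b) /\
  (complex.Re (G (star s * s) b b) <= sqn (Bf phi) (lm s b) ->
   forall a d, G (a * s) b d = G a (lm s b) d).
Proof.
move=> Ss Ss'; case: (hG) => -[h1 h2 h3 h4 h5] hS.
pose aa a (k : 'I_3) := if k == 0 then s else if k == 1 then 1 else star a.
pose x (k : 'I_3) := if k == 0 then b else if k == 1 then - lm s b else 0.
have dN a c d : G a (- c) d = - G a c d.
  by rewrite -[- c]addr0 -scaleN1r h2 dil0b addr0 mulN1r.
have dNr a c d : G a c (- d) = - G a c d.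
  by rewrite -{1}(starK a) h3 dN cjN -h3 starK.
have e a : dform (aa a) x x = G (star s * s) b b - Bf phi (lm s b) (lm s b).
  rewrite /dform !big_ord_recl !big_ord0 /= /aa /x /= !dil0b !dil0c !dN !dNr.
  rewrite star1 !mul1r mulr1 dil1 (hS (star s)) // (hS s) //.
  have -> : Bf phi (lm (star s) (lm s b)) b = Bf phi (lm s b) (lm s b).
    by case: (lm_prep phi) => _ _ _ _ ->; rewrite ?starK.
  ring.
have q0 a : 0 <= sqn (dform (aa a)) x.
  exact: (sqn_ge0 (dform_form _)).
have eR a : sqn (dform (aa a)) x = complex.Re (G (star s * s) b b) - sqn (Bf phi) (lm s b).
  by rewrite /sqn e ReD ReN.
split=> [|h a d]; first by have := q0 0; rewrite eR; lra.
pose y (k : 'I_3) := if k == 0 then 0 else if k == 1 then 0 else d.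
have := cauchy_schwarz (@subspT R _) (dform_form (aa a)) (x := x) (y := y) I I.
have -> : fnorm (dform (aa a)) x = 0.
  by apply/eqP; rewrite sqrtr_eq0 eR; lra.
rewrite mul0r => cs; have {cs} : cabs (dform (aa a) x y) = 0.
  by apply/eqP; rewrite eq_le cs cabs_ge0.
move/cabs_eq0; rewrite /dform !big_ord_recl !big_ord0 /= /aa /x /y /=.
rewrite !dil0b !dil0c !dN starK mulr1 !addr0 !add0r => /eqP.
by rewrite subr_eq0 => /eqP.
Qed.

End OneDilation.

End Dilation.

Section Generation.
Context (R : realType) (A : frechetLocCStarType R) (S : set A).
Hypotheses (opS : local_operator_system S) (genS : generates S).
Variable m : nat.
Let p : A -> R := cssn m.
Let hp : csn p := cssn_csn A m.

(** The elements a such that both a and [star a] multiply L into itself form a closed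
    star-subalgebra containing S; it is therefore everything, and it is applied to 1 in L. *)
Lemma generates_stable (L : set A) : linear_subspace L ->
  (forall x, (forall e, 0 < e -> exists2 y, L y & p (x - y) < e) -> L x) ->
  L 1 -> (forall s x, S s -> L x -> L (s * x)) -> L = setT.
Proof.
move=> hL cL L1 SL.
pose B := [set a | (forall x, L x -> L (a * x)) /\ (forall x, L x -> L (star a * x))].
have : B = setT; last first.
  move=> hB; apply/seteqP; split=> // x _; have : B x by rewrite hB.
  by move=> [/(_ 1 L1)]; rewrite mulr1.
have clo (F : set A) (h : A -> A) : (forall a, p (h a) = p a) ->
    (forall a b, h (a - b) = h a - h b) -> (forall a, F a -> forall x, L x -> L (h a * x)) ->
    forall a, closure F a -> forall x, L x -> L (h a * x).
  move=> hpp hB hF a Fa x Lx; apply: cL => e e0.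
  have d0 : 0 < e / (1 + p x) by apply: divr_gt0 => //; have := sc_ge0 hp x; lra.
  have [b [Fb /= hb]] := Fa _ (cssn_ball m a d0).
  exists (h b * x); first exact: hF.
  rewrite -mulrBl -hB; apply: le_lt_trans (scM hp _ _) _; rewrite hpp.
  move: hb; rewrite -/p ltr_pdivlMr; last by have := sc_ge0 hp x; lra.
  have := sc_ge0 hp (a - b); lra.
apply: genS => [|s Ss]; last first.
  by case: opS => _ Ss' _; split=> x Lx; apply: (SL _ _ _ Lx) => //; exact: Ss'.
split.
- split; first by split=> x Lx; rewrite ?star0 mul0r; exact: subsp0 hL.
  move=> c a b [a1 a2] [b1 b2]; split=> x Lx; rewrite ?starD ?starZ mulrDl -scalerAl;
  by apply: hL.2; auto.
- move=> a b [a1 a2] [b1 b2]; split=> x Lx; rewrite ?starM -mulrA; auto.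
- by move=> a [a1 a2]; split=> x Lx; rewrite ?starK; auto.
- move=> a Ba; split.
    by apply: (clo B id) Ba => // b [].
  by apply: (clo B star) Ba => [b|b c|b []] //; rewrite ?(sc_star hp) ?starB.
Qed.

Variable T : finType.
Local Notation V := (T -> T -> A).
Implicit Types (phi psi : V -> R).

(* A state that is only related to itself has an irreducible GNS representation
   (first clause) with the unique extension property (second clause). *)
Definition msRel phi psi :=
  (exists t psi', [/\ 0 < t < 1, mstate p psi, mstate p psi' &
     forall v, phi v = t * psi v + (1 - t) * psi' v]) \/
  (exists2 G, dilation p S phi G & psi = compress G).

(** All states below a minimal good N turn out to agree. Minimality makes them agree at every v
    whose value dilations cannot decrease ([allow]). If dilations act on x e_j as the representation
    does, [dil_gap] provides such a v for r x with r in S, and equality there gives the same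
    property of r x. Thus L is stable under S and equal to A, dilations are trivial, and then every
    v qualifies. *)
Theorem extremal_mstate (s : V) : (exists phi, mstate p phi) -> (forall u w, S (s u w)) ->
  exists phi, [/\ mstate p phi, forall psi, mstate p psi -> psi s <= phi s,
    forall psi, msRel phi psi -> psi = phi &
    forall G, dilation p S phi G -> forall a b d, G a b d = Bf phi (lm a b) d].
Proof.
have hV := @subspT R V; have S1 : S 1 by case: opS.
have Ss a : S a -> S (star a) by case: opS => _ h _; exact: h.
move=> [phi0 h0] hs.
pose N0 (v : V) := sup [set phi v | phi in mstate p].
have N0P (v : V) : has_sup [set phi v | phi in mstate p].
  split; first by exists (phi0 v), phi0.
  by exists (\sum_u \sum_w p (v u w)) => _ [phi [_ h _ _ _] <-].
have leN0 v phi : mstate p phi -> phi v <= N0 v.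
  by move=> h; apply: (sup_upper_bound (N0P v)); exists phi.
have N0le v z : (forall phi, mstate p phi -> phi v <= z) -> N0 v <= z.
  by move=> h; apply: ge_sup; [exact: (N0P v).1|move=> _ [phi hphi <-]; exact: h].
have N0S : sublin setT N0.
  split=> [x y _ _|t x t0 _].
    apply: N0le => phi hphi; case: (hphi) => [h1 _ _ _ _].
    by rewrite h1.1 // lerD ?leN0.
  apply: le_anti; apply/andP; split.
    apply: N0le => phi hphi; case: (hphi) => [h1 _ _ _ _].
    by rewrite h1.2 // ler_wpM2l ?leN0.
  have [->|tn] := eqVneq t 0.
    by rewrite mul0r; apply: le_trans (leN0 _ _ h0); case: h0 => [h1 _ _ _ _]; rewrite h1.2 ?mul0r.
  have {}t0 : 0 < t by rewrite lt_def tn.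
  rewrite -ler_pdivlMl //; apply: N0le => phi hphi; rewrite ler_pdivlMl //.
  by case: (hphi) => [h1 _ _ _ _]; rewrite -h1.2 // leN0.
(* The conditions in [mstate] are linear inequalities and equations, so they pass to every linear
   functional below the supremum of the states. *)
have N0K phi : rlin setT phi -> le_on setT phi N0 -> mstate p phi.
  move=> hf fN; have le v z : (forall psi, mstate p psi -> psi v <= z) -> phi v <= z.
    by move=> h; apply: le_trans (fN v I) _; exact: N0le.
  have phN v : phi (- v) = - phi v by apply: rlinN hf I.
  split=> // [v|v|b|].
  - by apply: le => psi [_ h _ _ _].
  - have e w : phi (vst w - w) <= 0.
      apply: le => psi [h1 _ h3 _ _]; rewrite (rlinB hV h1) // h3 subrr //.
    have vK : vst (vst v) = v.
      by apply/funext => u; apply/funext => w; rewrite /vst starK.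
    have := e v; have := e (vst v); rewrite vK !(rlinB hV hf) //; lra.
  - suff : phi (- outer b b) <= 0 by rewrite phN; lra.
    by apply: le => psi [h1 _ _ h4 _]; rewrite (rlinN h1) // oppr_le0 h4.
  - apply: le_anti; apply/andP; split; first by apply: le => psi [h1 _ _ _ ->].
    suff : phi (- (vdiag : V)) <= - 1 by rewrite phN; lra.
    by apply: le => psi [h1 _ _ _ h5]; rewrite (rlinN h1) // h5.
have relK phi psi : mstate p phi -> msRel phi psi -> mstate p psi.
  move=> hphi [[t [psi' [_ ? _ _]]] //|[G hG ->]].
  exact: (compress_mstate hp S1 hphi hG).
(* The face at v is closed under convex components in any case, because both components of a
   maximizer are maximizers; only dilations require the last hypothesis. *)
have shG N v : sublin setT N -> good setT msRel N -> le_on setT N N0 ->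
    (forall phi G, mstate p phi -> le_on setT phi N -> phi v = N v ->
      dilation p S phi G -> phi v <= compress G v) ->
    good setT msRel (shave N v).
  move=> hN gN NN0 hv phi psi hphi phis Rpp.
  have [phiN phiv] := rlin_shave_eq hV hN I hphi phis.
  have psiN := gN _ _ hphi phiN Rpp.
  suff [hpsi psiv] : rlin setT psi /\ psi v = N v by apply: rlin_le_shave.
  case: Rpp => [[t [psi' [tt h1 h2 e]]]|[G hG e]].
    split; first by case: h1.
    have psi'N : le_on setT psi' N.
      apply: (gN _ _ hphi phiN); left; exists (1 - t), psi; split=> //.
      - by case/andP: tt => *; apply/andP; split; lra.
      - by move=> x; rewrite e; ring.
    have := psiN v I; have := psi'N v I; move: phiv; rewrite e; case/andP: tt; nra.
  have mphi : mstate p phi by apply: N0K => // x _; apply: le_trans (phiN x I) (NN0 x I).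
  have := compress_mstate hp S1 mphi hG; rewrite -e => mpsi; split; first by case: mpsi.
  apply: le_anti; rewrite psiN //= -phiv e; exact: hv.
have g0 : good setT msRel N0.
  move=> phi psi hphi phiN Rpp x _; apply: leN0; apply: relK Rpp.
  exact: N0K.
have g1 : good setT msRel (shave N0 s).
  apply: shG => // phi G mphi _ _ hG.
  by rewrite (compress_S mphi hG hs).
have [N [hN gN NN1 Nmin]] := good_min hV (shave_sublin hV N0S I) g1.
have NN0 : le_on setT N N0.
  by move=> x hx; apply: le_trans (NN1 x hx) _; apply: (shave_le_self hV).
have NK phi : rlin setT phi -> le_on setT phi N -> mstate p phi.
  by move=> hphi phiN; apply: N0K => // x _; apply: le_trans (phiN x I) (NN0 x I).
(* If shaving at v keeps N good, minimality forces the shaved functional to equal N, so every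
   functional below N attains N v. *)
have allow v : (forall phi G, mstate p phi -> le_on setT phi N -> phi v = N v ->
      dilation p S phi G -> phi v <= compress G v) ->
    forall phi, rlin setT phi -> le_on setT phi N -> phi v = N v.
  move=> hv phi hphi phiN; have gs := shG N v hN gN NN0 hv.
  have Ns := Nmin _ (shave_sublin hV hN I) gs (shave_le_self hV hN I).
  have [] // := @rlin_shave_eq _ _ _ hV N phi v hN I hphi _.
  by move=> x hx; apply: le_trans (phiN x hx) (Ns x hx).
pose e (x : A) j : T -> A := lm x (eu j).
(* The property quantifies over all states below N, not just one, because [allow] needs the
   inequality for each of them. *)
pose L := [set x : A | forall phi, mstate p phi -> le_on setT phi N ->
   forall G, dilation p S phi G -> forall a j d, G (a * x) (eu j) d = G a (e x j) d].
have eD c x y j : e (c *: x + y) j = c *: e x j + e y j.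
  by case: (lm_prep phi0) => _ h _ _ _; exact: h.
have LT : L = setT.
  apply: generates_stable.
  - split=> [phi mphi phiN G hG a j d|c x y Lx Ly phi mphi phiN G hG a j d].
      rewrite mulr0 (dil0a hG); have -> : e 0 j = 0.
        by apply/funext => u; rewrite /e /lm mul0r.
      by rewrite (dil0b hG).
    case: (hG) => -[h1 h2 _ _ _] _.
    by rewrite eD mulrDr -scalerAr h1 h2 (Lx _ mphi phiN _ hG) (Ly _ mphi phiN _ hG).
  - move=> x cx phi mphi phiN G hG a j d.
    apply/eqP; rewrite -subr_eq0; apply/eqP/cabs_eq0/eqP.
    rewrite eq_le cabs_ge0 andbT; apply/ler_addgt0Pr => t t0; rewrite add0r.
    set K := 2 * (p a * fnorm (Bf phi) d) + 1.
    have K0 : 0 < K.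
      by have := mulr_ge0 (sc_ge0 hp a) (fnorm_ge0 (Bf phi) d); rewrite /K; lra.
    have [y Ly hy] := cx _ (divr_gt0 t0 K0).
    have -> : G (a * x) (eu j) d - G a (e x j) d =
       G (a * (x - y)) (eu j) d - G a (e (x - y) j) d.
      have -> : x - y = -1 *: y + x by rewrite scaleN1r addrC.
      case: (hG) => -[h1 h2 _ _ _] _.
      rewrite eD mulrDr -scalerAr h1 h2 (Ly _ mphi phiN _ hG); ring.
    apply: le_trans (_ : cabs (G (a * (x - y)) (eu j) d) + cabs (G a (e (x - y) j) d) <= _).
      rewrite -lecR rmorphD -!cabsE; exact: ler_normB.
    have b1 := dil_bound hp S1 mphi hG (a * (x - y)) (eu j) d.
    have b2 := dil_bound hp S1 mphi hG a (e (x - y) j) d.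
    have b3 := Bf_bound hp (x - y) (eu j) mphi.
    have b4 := eu_le1 j mphi; have b5 := scM hp a (x - y).
    have n0 := fnorm_ge0 (Bf phi) d; have a0 := sc_ge0 hp a.
    have xy0 := sc_ge0 hp (x - y); have e0 := fnorm_ge0 (Bf phi) (eu j).
    have c1 : p (a * (x - y)) * fnorm (Bf phi) (eu j) * fnorm (Bf phi) d <=
        p a * fnorm (Bf phi) d * p (x - y).
      rewrite mulrAC [leRHS]mulrAC -[leRHS]mulr1; apply: ler_pM => //.
        by rewrite mulr_ge0 ?(sc_ge0 hp).
      by apply: ler_wpM2r.
    have c2 : p a * fnorm (Bf phi) (e (x - y) j) * fnorm (Bf phi) d <=
        p a * fnorm (Bf phi) d * p (x - y).
      rewrite mulrAC; apply: ler_wpM2l; first exact: mulr_ge0.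
      by apply: le_trans b3 _; rewrite ler_piMr.
    move: hy; rewrite ltr_pdivlMr // /K; lra.
  - move=> phi mphi phiN G hG a j d; rewrite mulr1; congr (G a _ d).
    by apply/funext => u; rewrite /e /lm mul1r.
  - move=> r x Sr Lx phi mphi phiN G hG a j d; have Sr' := Ss r Sr.
    pose v0 := outer (e (r * x) j) (e (r * x) j).
    have er : e (r * x) j = lm r (e x j).
      by apply/funext => u; rewrite /e /lm mulrA.
    have cv psi F : mstate p psi -> le_on setT psi N -> dilation p S psi F ->
        compress F v0 = complex.Re (F (star r * r) (e x j) (e x j)).
      move=> mpsi psiN hF; case: (hF) => -[_ _ h3 _ _] _; rewrite /compress.
      rewrite (bigD1 j) //= [X in _ + X]big1 ?addr0; last first.
        move=> u uj; rewrite big1 // => w _.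
        by rewrite /v0 /outer /e /lm /eu (negbTE uj) mulr0 star0 mul0r (dil0a hF).
      rewrite (bigD1 j) //= [X in _ + X]big1 ?addr0; last first.
        by move=> w wj; rewrite /v0 /outer /e /lm /eu (negbTE wj) !mulr0 (dil0a hF).
      rewrite /v0 /outer {1 2}/e /lm /eu eqxx !mulr1 mulrA.
      (* The property of x moves the right factor x into the vector; after passing to adjoints it
         moves the left factor [star x] in the same way. *)
      rewrite (Lx _ mpsi psiN _ hF) -ReJ -h3 !starM !starK mulrA.
      rewrite (Lx _ mpsi psiN _ hF); congr (complex.Re _).
    have pv psi : psi v0 = sqn (Bf psi) (lm r (e x j)) by rewrite -er.
    have av : forall psi, rlin setT psi -> le_on setT psi N -> psi v0 = N v0.
      apply: allow => psi F mpsi psiN _ hF; rewrite (cv psi) // pv.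
      exact: (dil_gap S1 hF _ Sr Sr').1.
    have [hphi _ _ _ _] := mphi.
    have eqv := av _ hphi phiN.
    rewrite mulrA (Lx _ mphi phiN _ hG) (dil_gap S1 hG _ Sr Sr').2 ?er //.
    rewrite -(cv phi) // -pv eqv; apply: (gN _ _ hphi phiN) => //.
    by right; exists G.
have dilT phi G : mstate p phi -> le_on setT phi N -> dilation p S phi G ->
    forall a b d, G a b d = Bf phi (lm a b) d.
  move=> mphi phiN hG a b d.
  have LG c u z : G c (lm z (eu u)) d = G (c * z) (eu u) d.
    have Lz : L z by rewrite LT.
    by rewrite (Lz _ mphi phiN _ hG).
  rewrite -(dil1 S1 hG) {1}(lm_eu b) (lm_eu (lm a b)) !(dil_sumb hG).
  by apply: eq_bigr => u _; rewrite !LG mul1r.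
have allT v phi : rlin setT phi -> le_on setT phi N -> phi v = N v.
  apply: allow => {}phi G mphi phiN _ hG; have [h1 _ _ _ _] := mphi.
  rewrite (mst_entries v h1) /compress Re_sum le_eqVlt; apply/orP; left; apply/eqP.
  apply: eq_bigr => u _; rewrite Re_sum; apply: eq_bigr => w _.
  by rewrite (dilT phi).
have [phi hphi phiN] := hahn_banach_le hV hN.
have mphi := NK phi hphi phiN.
exists phi; split=> //.
- move=> psi mpsi; have phiN1 : le_on setT phi (shave N0 s).
    by move=> x hx; apply: le_trans (phiN x hx) (NN1 x hx).
  by have [_ ->] := rlin_shave_eq hV N0S I hphi phiN1; exact: leN0.
- move=> psi Rpp; have psiN := gN _ _ hphi phiN Rpp.
  have [hpsi _ _ _ _] := relK _ _ mphi Rpp.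
  by apply/funext => v; rewrite !allT.
- by move=> G hG; exact: (dilT phi G mphi phiN hG).
Qed.

End Generation.

(** * Completion of semi-inner product spaces *)

Record psdspace (R : realType) := Psdspace {
  pV : lmodType R[i] ;
  pD : set pV ;
  pB : pV -> pV -> R[i] ;
  pD_sub : linear_subspace pD ;
  pB_form : psdform pD pB
}.

(* The completion of a semi-inner product space, realized as the space of its
   bounded conjugate-linear functionals: v stands for the functional
   w |-> <v, w>. *)
Section DualNorm.
Context (R : realType) (P : psdspace R).
Local Notation C := R[i].
Local Notation V := (pV P).
Local Notation D := (@pD R P).
Local Notation B := (@pB R P).
Let hD := pD_sub P.
Let hB := pB_form P.
Implicit Types (f g h : V -> C^o) (v w : V).

(** Functionals vanish off D, so that equality of functions coincides with equality on D. *)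
Definition antilin f := [/\ forall (c : C) v w, D v -> D w -> f (c *: v + w) = cj c * f v + f w,
  forall v, ~ D v -> f v = 0 &
  exists2 M : R, 0 <= M & forall v, D v -> cabs (f v) ^+ 2 <= M * sqn B v].

Definition antilin_pred : {pred (V -> C^o)} := fun f => `[< antilin f >].

Lemma antilinP f : reflect (antilin f) (f \in antilin_pred).
Proof. exact: asboolP. Qed.

Lemma antilin_submod : submod_closed antilin_pred.
Proof.
split.
  apply/antilinP; split=> // [c v w _ _|]; first by rewrite mulr0 addr0.
  exists 0 => // v _; rewrite mul0r.
  by rewrite cabs0 expr0n.
move=> c f g /antilinP [f1 f2 [M M0 fM]] /antilinP [g1 g2 [K K0 gK]]; apply/antilinP.
have E v : (c *: f + g) v = c * f v + g v by [].
split.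
- by move=> z v w hv hw; rewrite !E f1 // g1 //; ring.
- by move=> v hv; rewrite E f2 // g2 // mulr0 addr0.
- exists (2 * (cabs c ^+ 2 * M + K)).
    by rewrite mulr_ge0 // addr_ge0 // mulr_ge0 // sqr_ge0.
  move=> v hv; rewrite E; have := fM v hv; have := gK v hv.
  have := cabsD (c * f v) (g v); rewrite cabsM.
  have := cabs_ge0 (c * f v + g v); have := cabs_ge0 c; have := cabs_ge0 (f v).
  have := cabs_ge0 (g v); set a := cabs (g v); set b := cabs (f v); set k := cabs c.
  set z := cabs _; set s := sqn _ _ => a0 b0 k0 z0 h1 h2 h3.
  apply: (@le_trans _ _ ((k * b + a) ^+ 2)).
    by rewrite lerXn2r ?nnegrE // addr_ge0 // mulr_ge0.
  have : k ^+ 2 * b ^+ 2 <= k ^+ 2 * (M * s) by rewrite ler_wpM2l // sqr_ge0.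
  have := sqr_ge0 (k * b - a); rewrite !expr2; lra.
Qed.

(** The supremum of these values is the squared dual norm. In this form the parallelogram law
    follows by substituting half the sum and half the difference of two test vectors. *)
Definition qvals f := [set 2 * complex.Re (f v) - sqn B v | v in D].
Definition qn f : R := sup (qvals f).

Lemma qvals_bound f (M : R) : 0 <= M ->
  (forall v, D v -> cabs (f v) ^+ 2 <= M * sqn B v) ->
  ubound (qvals f) M.
Proof.
move=> M0 h _ [v hv <-]; have := h v hv; have := cabs_Re (f v).
have := cabs_ge0 (f v); have := sqn_ge0 hB hv.
set s := sqn _ _; set a := cabs _; set r := complex.Re _ => s0 a0 ra h1.
have [r0|/ltW r0] := leP r 0; first lra.
have : r ^+ 2 <= M * s by apply: le_trans h1; rewrite lerXn2r.
rewrite !expr2; have := sqr_ge0 (M - s); rewrite expr2 => h2 h3.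
by rewrite leNgt; apply/negP => h4; nra.
Qed.

Lemma qn_has_sup f : antilin f -> has_sup (qvals f).
Proof.
case=> _ _ [M M0 h]; split; last by exists M; exact: qvals_bound.
by exists (2 * complex.Re (f 0) - sqn B 0), 0 => //; exact: subsp0 hD.
Qed.

Lemma qn_ge f v : antilin f -> D v -> 2 * complex.Re (f v) - sqn B v <= qn f.
Proof. by move=> hf hv; apply: (sup_upper_bound (qn_has_sup hf)); exists v. Qed.

Lemma le_qn f z : (forall v, D v -> 2 * complex.Re (f v) - sqn B v <= z) -> qn f <= z.
Proof.
move=> h; apply: ge_sup => [|_ [v hv <-]]; last exact: h.
by exists (2 * complex.Re (f 0) - sqn B 0), 0 => //; exact: subsp0 hD.
Qed.

Lemma qn_le f (M : R) : 0 <= M ->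
  (forall v, D v -> cabs (f v) ^+ 2 <= M * sqn B v) -> qn f <= M.
Proof. by move=> M0 /(qvals_bound M0) h; apply: le_qn => v hv; apply: h; exists v. Qed.

Lemma al0 f : antilin f -> f 0 = 0.
Proof.
case=> h _ _; have := h (-1) 0 0 (subsp0 hD) (subsp0 hD).
by rewrite scaleN1r addr0 oppr0 cjN cj1 mulN1r addNr.
Qed.

Lemma alZ f c v : antilin f -> D v -> f (c *: v) = cj c * f v.
Proof.
move=> hf hv; have z := al0 hf; case: hf => h _ _.
by rewrite -[c *: v]addr0 h ?z ?addr0 //; exact: subsp0 hD.
Qed.

Lemma alD f v w : antilin f -> D v -> D w -> f (v + w) = f v + f w.
Proof. by case=> h _ _ hv hw; rewrite -{1}[v]scale1r h // cj1 mul1r. Qed.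

Lemma qn_ge0 f : antilin f -> 0 <= qn f.
Proof.
move=> hf; apply: le_trans (qn_ge hf (subsp0 hD)).
by rewrite (al0 hf) /sqn (form0l hD hB) ?mulr0 ?subr0 //; exact: subsp0 hD.
Qed.

Lemma qn_cs f v : antilin f -> D v -> cabs (f v) ^+ 2 <= qn f * sqn B v.
Proof.
move=> hf hv; set K := _ ^+ 2; have s0 := sqn_ge0 hB hv.
have [sz|sz] := eqVneq (sqn B v) 0.
  by case: (hf) => _ _ [M _ h]; have := h v hv; rewrite sz !mulr0.
have sp : 0 < sqn B v by rewrite lt_def sz.
set t := (sqn B v)^-1; pose c := t%:C * f v.
have := qn_ge hf (subspZ hD c hv); rewrite alZ // (sqnZ hD hB) // /c cjM cjR cabsM cabsR.
have -> : t%:C * cj (f v) * f v = t%:C * K%:C.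
  by rewrite -mulrA [cj _ * _]mulrC cabs_sqr.
rewrite -rmorphM /= exprMn real_normK ?num_real // -/K => h.
rewrite mulrC -ler_pdivrMl //; apply: le_trans h; rewrite -/t.
have -> : t ^+ 2 * K * sqn B v = t * K * (t * sqn B v) by ring.
by rewrite mulVf //; lra.
Qed.

Lemma al_scale c f : antilin f -> antilin (c *: f).
Proof.
move=> /antilinP hf; apply/antilinP; rewrite -[c *: f]addr0.
by case: antilin_submod => z; apply.
Qed.

Lemma al_add f g : antilin f -> antilin g -> antilin (f + g).
Proof.
move=> /antilinP hf /antilinP hg; apply/antilinP; rewrite -[f]scale1r.
by case: antilin_submod => z; apply.
Qed.

Lemma al_opp f : antilin f -> antilin (- f).
Proof. by move=> hf; rewrite -scaleN1r; exact: al_scale. Qed.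

Lemma qnZ_le c f : antilin f -> qn (c *: f) <= cabs c ^+ 2 * qn f.
Proof.
move=> hf; apply: qn_le; first by rewrite mulr_ge0 ?sqr_ge0 ?qn_ge0.
move=> v hv; have -> : (c *: f) v = c * f v by [].
by rewrite cabsM exprMn -mulrA ler_wpM2l ?sqr_ge0 ?qn_cs.
Qed.

Lemma qn0 : qn 0 = 0.
Proof.
have a0 : antilin 0 by apply/antilinP; case: antilin_submod.
apply/eqP; rewrite eq_le qn_ge0 // andbT; apply: qn_le => // v hv.
by have -> : (0 : V -> C^o) v = 0 by []; rewrite cabs0 expr0n mul0r.
Qed.

Lemma qnZ c f : antilin f -> qn (c *: f) = cabs c ^+ 2 * qn f.
Proof.
move=> hf; have [->|c0] := eqVneq c 0.
  by rewrite scale0r qn0 cabs0 expr0n mul0r.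
apply: le_anti; rewrite qnZ_le //=.
have := qnZ_le c^-1 (al_scale c hf); rewrite scalerA mulVf // scale1r.
have e : cabs c^-1 * cabs c = 1 by rewrite -cabsM mulVf // cabs1.
have := sqr_ge0 (cabs c) => cc h.
have := ler_wpM2l cc h; rewrite mulrA -exprMn mulrC [cabs c * _]mulrC e expr1n; lra.
Qed.

Lemma qnN f : antilin f -> qn (- f) = qn f.
Proof.
move=> hf; rewrite -scaleN1r qnZ // -(rmorphN1 (real_complex R)) cabsR.
by rewrite normrN1 expr1n mul1r.
Qed.

Lemma half_cj : cj ((2^-1 : R)%:C : C) = (2^-1 : R)%:C. Proof. exact: cjR. Qed.

Lemma parallelogram_le f g : antilin f -> antilin g ->
  qn (f + g) + qn (f - g) <= 2 * qn f + 2 * qn g.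
Proof.
move=> hf hg; rewrite -lerBrDr; apply: le_qn => v hv.
rewrite lerBrDr -lerBrDl; apply: le_qn => w hw; rewrite lerBrDl.
pose t : C := (2^-1 : R)%:C.
have ha : D (t *: (v + w)) by apply: subspZ => //; apply: subspD.
have hb : D (t *: (v - w)) by apply: subspZ => //; apply: subspB.
have := qn_ge hf ha; have := qn_ge hg hb.
have hw' := subspN hD hw.
rewrite !(sqnZ hD hB) //; try exact: subspD; try exact: subspB.
rewrite cabsR ger0_norm ?invr_ge0 // !alZ //; try exact: subspD; try exact: subspB.
rewrite !alD // half_cj !ReZ !(sqnD hD hB) // (formNr hD hB) // !ReD !ReN.
have -> : sqn B (- w) = sqn B w by rewrite /sqn (formNl hD) // (formNr hD) // opprK.
have -> : g (- w) = - g w by rewrite -scaleN1r alZ // cjN cj1 mulN1r.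
rewrite ReN expr2; lra.
Qed.

Lemma parallelogram f g : antilin f -> antilin g ->
  qn (f + g) + qn (f - g) = 2 * qn f + 2 * qn g.
Proof.
move=> hf hg; apply: le_anti; rewrite parallelogram_le //=.
have := parallelogram_le (al_add hf hg) (al_add hf (al_opp hg)).
have -> : f + g + (f - g) = 2%:C *: f.
  by rewrite rmorphMn rmorph1 scaler_nat mulr2n addrACA subrr addr0.
have -> : f + g - (f - g) = 2%:C *: g.
  by rewrite rmorphMn rmorph1 scaler_nat mulr2n opprB addrC addrA subrK.
rewrite !qnZ // cabsR ger0_norm // !expr2; lra.
Qed.

Definition dnorm f := Num.sqrt (qn f).

Lemma dnorm_ge0 f : 0 <= dnorm f. Proof. exact: sqrtr_ge0. Qed.

Lemma dnorm_sqr f : antilin f -> dnorm f ^+ 2 = qn f.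
Proof. by move=> hf; rewrite sqr_sqrtr // qn_ge0. Qed.

Lemma dnorm_cs f v : antilin f -> D v -> cabs (f v) <= dnorm f * fnorm B v.
Proof.
move=> hf hv; rewrite -ler_sqr ?nnegrE ?cabs_ge0 ?mulr_ge0 ?sqrtr_ge0 //.
by rewrite exprMn dnorm_sqr // (fnorm_sqr hB) // qn_cs.
Qed.

Lemma dnorm_le f (M : R) : 0 <= M ->
  (forall v, D v -> cabs (f v) <= M * fnorm B v) -> dnorm f <= M.
Proof.
move=> M0 h; apply: sqrt_le => //; apply: qn_le; first exact: sqr_ge0.
move=> v hv; rewrite -(fnorm_sqr hB hv) -exprMn lerXn2r ?nnegrE ?cabs_ge0 //.
  by rewrite mulr_ge0 ?fnorm_ge0.
exact: h.
Qed.

Lemma dnormD f g : antilin f -> antilin g -> dnorm (f + g) <= dnorm f + dnorm g.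
Proof.
move=> hf hg; apply: dnorm_le; first by rewrite addr_ge0 ?dnorm_ge0.
move=> v hv; rewrite mulrDl; apply: le_trans (cabsD _ _) _.
by rewrite lerD // dnorm_cs.
Qed.

Lemma dnormZ c f : antilin f -> dnorm (c *: f) = cabs c * dnorm f.
Proof.
by move=> hf; rewrite /dnorm qnZ // sqrtrM ?sqr_ge0 // sqrtr_sqr ger0_norm ?cabs_ge0.
Qed.

Lemma dnormB f g : antilin f -> antilin g -> dnorm (f - g) = dnorm (g - f).
Proof. by move=> hf hg; rewrite /dnorm -opprB qnN //; apply: al_add (al_opp _). Qed.

Lemma dnorm_eq0 f : antilin f -> dnorm f = 0 -> f = 0.
Proof.
move=> hf h; apply/funext => v; have [hv|hv] := pselect (D v); last by case: hf => _ ->.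
apply: cabs_eq0; apply/eqP; rewrite eq_le cabs_ge0 andbT.
by have := dnorm_cs hf hv; rewrite h mul0r.
Qed.

Definition repr v w : C^o := if pselect (D w) then B v w else 0.

Lemma reprE v w : D w -> repr v w = B v w.
Proof. by rewrite /repr; case: pselect. Qed.

Lemma repr_al v : D v -> antilin (repr v).
Proof.
move=> hv; split.
- move=> c x y hx hy; rewrite !reprE //; last by apply: subspD => //; apply: subspZ.
  by rewrite (formDr hD) // ?(formZr hD) //; apply: subspZ.
- by move=> w hw; rewrite /repr; case: pselect.
- exists (sqn B v) => [|w hw]; first exact: (sqn_ge0 hB).
  rewrite reprE // -!(fnorm_sqr hB) // -exprMn lerXn2r ?nnegrE ?cabs_ge0 //.
    by rewrite mulr_ge0 ?fnorm_ge0.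
  exact: (cauchy_schwarz hD).
Qed.

Lemma qn_repr f v : antilin f -> D v ->
  qn (f + repr v) = qn f + 2 * complex.Re (f v) + sqn B v.
Proof.
move=> hf hv; have hr := al_add hf (repr_al hv).
apply: le_anti; apply/andP; split.
  apply: le_qn => w hw; have := qn_ge hf (subspB hD hw hv).
  rewrite alD // -?[- v]scaleN1r ?alZ ?(sqnD hD hB) ?(sqnZ hD hB) ?(formZr hD) //; try exact: subspZ.
  have -> : (f + repr v) w = f w + B v w by rewrite -reprE.
  rewrite (formC hB hv hw).
  rewrite -(rmorphN1 (real_complex R)) cabsR normrN1 expr1n !cjR.
  rewrite !ReD !ReZ ReJ; lra.
rewrite -lerBrDr -lerBrDr; apply: le_qn => w hw.
have := qn_ge hr (subspD hD hw hv).
have -> : (f + repr v) (w + v) = f w + f v + (B v w + B v v).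
  by rewrite -[RHS]/(_ + _) -alD // -(formDr hD hB) // -reprE //; apply: subspD.
rewrite (sqnD hD hB) // (formC hB hw hv) !ReD ReJ /sqn; lra.
Qed.

(** By [qn_repr] the squared distance from f to [repr v] is qn f minus the value of [qvals] at v, so
    nearly maximizing v give good approximations. *)
Lemma repr_dense f (e : R) : antilin f -> 0 < e ->
  exists2 v, D v & dnorm (f - repr v) < e.
Proof.
move=> hf e0; have e2 : 0 < e ^+ 2 by rewrite exprn_gt0.
have [_ [v hv <-] hlt] := sup_adherent e2 (qn_has_sup hf).
exists v => //; rewrite -[ltRHS]ger0_norm ?(ltW e0) // -sqrtr_sqr ltr_sqrt //.
have nv : D (- v) by apply: subspN.
have -> : f - repr v = f + repr (- v).
  congr (_ + _); apply/funext => w; rewrite /repr -[LHS]/(- (repr v w)) /repr.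
  by case: pselect => hw; rewrite ?oppr0 // (formNl hD).
rewrite qn_repr // -scaleN1r alZ // (sqnZ hD hB) // -(rmorphN1 (real_complex R)) cabsR cjR.
rewrite ReZ normrN1 expr1n; move: hlt; rewrite -/(qn f); lra.
Qed.

(** Polarization. Additivity follows from the parallelogram law as in the Jordan-von Neumann
    theorem, whereas complex homogeneity is first clear against the functionals [repr v] and then
    extended by density ([dinnerZl]). *)
Definition rinner f g : R := (qn (f + g) - qn (f - g)) / 4.

Lemma rinnerD f g h : antilin f -> antilin g -> antilin h ->
  rinner (f + g) h = rinner f h + rinner g h.
Proof.
have K x y z : antilin x -> antilin y -> antilin z ->
    2 * (rinner x z + rinner y z) = rinner (x + y) (2%:C *: z).
  move=> hx hy hz; have hz' := al_opp hz.
  have := parallelogram (al_add hx hz) (al_add hy hz).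
  have := parallelogram (al_add hx hz') (al_add hy hz').
  have e : 2%:C *: z = z + z by rewrite rmorphMn rmorph1 scaler_nat mulr2n.
  have -> : x - z + (y - z) = x + y - 2%:C *: z by rewrite addrACA -opprD e.
  have -> : x - z - (y - z) = x - y by rewrite opprB addrA subrK.
  have -> : x + z + (y + z) = x + y + 2%:C *: z by rewrite addrACA e.
  have -> : x + z - (y + z) = x - y by rewrite opprD addrACA subrr addr0.
  rewrite /rinner; lra.
have r0 z : antilin z -> rinner 0 z = 0.
  by move=> hz; rewrite /rinner !add0r qnN // subrr mul0r.
have a0 : antilin 0 by apply/antilinP; case: antilin_submod.
move=> hf hg hh.
have h1 := K _ _ _ (al_add hf hg) a0 hh; have h2 := K _ _ _ hf hg hh.
move: h1; rewrite addr0 (r0 h hh) -h2; lra.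
Qed.

Lemma rinnerC f g : antilin f -> antilin g -> rinner g f = rinner f g.
Proof.
move=> hf hg; rewrite /rinner [g + f]addrC -[g - f]opprB qnN //.
exact: al_add (al_opp hg).
Qed.

Lemma rinnerN f g : rinner f (- g) = - rinner f g.
Proof. by rewrite /rinner opprK -mulNr opprB. Qed.

Lemma rinner_bound f g : antilin f -> antilin g -> `|rinner f g| <= dnorm f * dnorm g.
Proof.
have K x y : antilin x -> antilin y -> rinner x y <= dnorm x * dnorm y.
  move=> hx hy; have hxy := al_add hx hy; have hxy' := al_add hx (al_opp hy).
  rewrite /rinner -!dnorm_sqr //; have h1 := dnormD hx hy.
  have h2 := dnormD hxy' hy; have h3 := dnormD (al_opp hxy') hx; move: h2 h3.
  rewrite subrK opprB subrK -[y - x]opprB /dnorm qnN // -!/(dnorm _).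
  have := dnorm_ge0 (x + y); have := dnorm_ge0 (x - y).
  have := dnorm_ge0 x; have := dnorm_ge0 y.
  move: h1; set a := dnorm x; set b := dnorm y; set c := dnorm (x + y).
  set d := dnorm (x - y) => h1 b0 a0 d0 c0 h2 h3.
  have : c ^+ 2 <= (a + b) ^+ 2 by rewrite lerXn2r ?nnegrE //; lra.
  have : (a - b) ^+ 2 <= d ^+ 2.
    rewrite -[leLHS]real_normK ?num_real // lerXn2r ?nnegrE // ler_norml.
    by apply/andP; split; lra.
  rewrite !expr2; lra.
move=> hf hg; rewrite ler_norml K // andbT lerNl -rinnerN.
by rewrite (le_trans (K _ _ hf (al_opp hg))) // /dnorm qnN.
Qed.

Lemma repr_lin c v w : D v -> D w -> repr (c *: v + w) = c *: repr v + repr w.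
Proof.
move=> hv hw; apply/funext => x; rewrite /repr.
rewrite -[RHS]/(c * _ + _) /repr; case: pselect => hx; last by rewrite mulr0 addr0.
by case: hB => h _ _; exact: h.
Qed.

Lemma reprZ c v : D v -> repr (c *: v) = c *: repr v.
Proof.
move=> hv; have z := repr_lin (-1) (subsp0 hD) (subsp0 hD).
rewrite -[c *: v]addr0 repr_lin //; last exact: subsp0 hD.
by move: z; rewrite scaleN1r addr0 oppr0 scaleN1r addNr => ->; rewrite addr0.
Qed.

Lemma rinner_repr f v : antilin f -> D v -> rinner f (repr v) = complex.Re (f v).
Proof.
move=> hf hv; rewrite /rinner -[- repr v]scaleN1r -reprZ //.
rewrite !qn_repr //; last exact: subspZ.
rewrite alZ // (sqnZ hD hB) // -(rmorphN1 (real_complex R)) cabsR cjR ReZ normrN1; lra.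
Qed.

Definition dinner f g : C := (rinner f g) +i* (rinner f ('i%C *: g)).

Lemma cplx_eq (a b c d : R) : a = c -> b = d -> (a +i* b) = (c +i* d) :> C.
Proof. by move=> -> ->. Qed.

Lemma dinner_repr f v : antilin f -> D v -> dinner f (repr v) = f v.
Proof.
move=> hf hv; rewrite /dinner -reprZ // !rinner_repr //; last exact: subspZ.
rewrite alZ // cj_i; case: (f v) => a b /=; apply: cplx_eq => //; ring.
Qed.

Lemma dinnerDl f g h : antilin f -> antilin g -> antilin h ->
  dinner (f + g) h = dinner f h + dinner g h.
Proof.
by move=> hf hg hh; rewrite /dinner !rinnerD //; exact: al_scale.
Qed.

Lemma dinnerDr f g h : antilin f -> antilin g -> antilin h ->
  dinner f (g + h) = dinner f g + dinner f h.
Proof.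
move=> hf hg hh; have ig := al_scale 'i%C hg; have ih := al_scale 'i%C hh.
have K x y : antilin x -> antilin y -> rinner f (x + y) = rinner f x + rinner f y.
  by move=> hx hy; rewrite rinnerC ?rinnerD ?(rinnerC hf) //; exact: al_add.
by rewrite /dinner scalerDr !K.
Qed.

Lemma dinner_bound2 f g : antilin f -> antilin g -> cabs (dinner f g) <= 2 * (dnorm f * dnorm g).
Proof.
move=> hf hg; have ig := al_scale 'i%C hg.
have -> : dinner f g = (rinner f g)%:C + 'i%C * (rinner f ('i%C *: g))%:C.
  by apply/eqP; rewrite eq_complex /=; apply/andP; split; apply/eqP; ring.
apply: le_trans (cabsD _ _) _; rewrite cabsM !cabsR.
have := rinner_bound hf hg; have := rinner_bound hf ig.
by rewrite dnormZ // cabsi !mul1r; lra.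
Qed.

Lemma dinnerZl c f g : antilin f -> antilin g -> dinner (c *: f) g = c * dinner f g.
Proof.
move=> hf hg; have hcf := al_scale c hf.
apply/eqP; rewrite -subr_eq0; apply/eqP/cabs_eq0/eqP; rewrite eq_le cabs_ge0 andbT.
apply/ler_addgt0Pr => e e0; rewrite add0r.
set K := 4 * (cabs c * dnorm f) + 1.
have K0 : 0 < K by have := mulr_ge0 (cabs_ge0 c) (dnorm_ge0 f); rewrite /K; lra.
have [v hv gv] := repr_dense hg (divr_gt0 e0 K0).
have hr := repr_al hv; have hgr := al_add hg (al_opp hr).
have -> : dinner (c *: f) g - c * dinner f g =
    dinner (c *: f) (g - repr v) - c * dinner f (g - repr v).
  rewrite -{1 2}(subrK (repr v) g) !(dinnerDr _ hgr) // !dinner_repr //.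
  by rewrite -[(c *: f) v]/(c * f v); ring.
apply: le_trans (cabsD _ _) _; rewrite cabsN cabsM.
have b1 := dinner_bound2 hcf hgr; have b2 := dinner_bound2 hf hgr.
have := ler_wpM2l (cabs_ge0 c) b2.
move: b1; rewrite dnormZ //; move: gv; rewrite ltr_pdivlMr // /K.
have := dnorm_ge0 (g - repr v); set x := dnorm (g - _); set y := cabs c; set z := dnorm f; lra.
Qed.

Lemma dinnerC f g : antilin f -> antilin g -> dinner g f = cj (dinner f g).
Proof.
move=> hf hg; have i_f := al_scale 'i%C hf; have ig := al_scale 'i%C hg.
have : rinner ('i%C *: f) g = - rinner f ('i%C *: g).
  have /(congr1 (@complex.Re R)) := dinnerZl 'i%C hf hg.
  by rewrite /dinner /= => ->; ring.
rewrite /dinner [rinner g f]rinnerC // [rinner g _]rinnerC // => ->.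
exact: cplx_eq.
Qed.

Lemma dinner_self f : antilin f -> dinner f f = (qn f)%:C.
Proof.
move=> hf; have := dinnerC hf hf; rewrite /dinner => /eqP.
rewrite eq_complex /= => /andP[_ /eqP h]; apply: cplx_eq; last by lra.
rewrite /rinner subrr qn0 subr0.
have -> : f + f = 2%:C *: f by rewrite rmorphMn rmorph1 scaler_nat mulr2n.
rewrite qnZ // cabsR ger0_norm //; lra.
Qed.

End DualNorm.

Record rkhs (R : realType) (P : psdspace R) := Rkhs {
  rfun :> pV P -> R[i]^o ; _ : rfun \in @antilin_pred R P }.

HB.instance Definition _ (R : realType) (P : psdspace R) :=
  GRing.isSubmodClosed.Build R[i] (pV P -> R[i]^o) (@antilin_pred R P) (antilin_submod P).
HB.instance Definition _ (R : realType) (P : psdspace R) := [isSub for @rfun R P].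
HB.instance Definition _ (R : realType) (P : psdspace R) := [Choice of rkhs P by <:].
HB.instance Definition _ (R : realType) (P : psdspace R) :=
  [SubChoice_isSubLmodule of rkhs P by <:].

Section HilbertSpace.
Context (R : realType) (P : psdspace R).
Local Notation C := R[i].
Local Notation H := (rkhs P).
Implicit Types (x y z : H) (c : C).

Lemma rkhs_al x : antilin x. Proof. by apply/antilinP; case: x. Qed.

Lemma rfunD x y : rfun (x + y) = rfun x + rfun y. Proof. by []. Qed.
Lemma rfunZ c x : rfun (c *: x) = c *: rfun x. Proof. by []. Qed.
Lemma rfunN x : rfun (- x) = - rfun x. Proof. by []. Qed.

Definition rnorm x : C := (dnorm x)%:C.

Lemma rnormD x y : rnorm (x + y) <= rnorm x + rnorm y.
Proof.
rewrite /rnorm -rmorphD lecR rfunD; apply: dnormD; exact: rkhs_al.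
Qed.

Lemma rnormZ c x : rnorm (c *: x) = `|c| * rnorm x.
Proof. by rewrite /rnorm rfunZ dnormZ ?cabsE ?rmorphM //; exact: rkhs_al. Qed.

Lemma rnorm_eq0 x : rnorm x = 0 -> x = 0.
Proof.
move=> h; apply: val_inj => /=; apply: dnorm_eq0; first exact: rkhs_al.
exact: complexI.
Qed.

HB.instance Definition _ := @Lmodule_isNormed.Build C H rnorm rnormD rnormZ rnorm_eq0.

Lemma norm_rkhs x : `|x| = (dnorm x)%:C. Proof. by []. Qed.

(** Evaluation at each v is Lipschitz for the dual norm, so a Cauchy filter converges pointwise; the
    limit is again antilinear and bounded, and the norm estimates pass to it pointwise. *)
Lemma rkhs_complete (F : set_system H) : ProperFilter F -> cauchy F -> cvg F.
Proof.
move=> FF cF.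
have cex (e : R) : 0 < e -> exists2 x0 : H, True & F [set y | dnorm (x0 - y) < e].
  move=> e0; have e0C : 0 < e%:C by rewrite ltcR.
  have [x0 h] := (cauchyP F).1 cF e%:C e0C; exists x0 => //.
  move: h; rewrite -ball_normE; apply: filterS => y /=.
  by rewrite norm_rkhs ltcR.
have lim1 (g : H -> R) (K : R) : 0 < K -> (forall x y, `|g x - g y| <= K * dnorm (x - y)) ->
    exists l, forall e : R, 0 < e -> F [set x | `|l - g x| < e].
  move=> K0 gK; have cg : cauchy (g @ F).
    apply: cauchy_exP => e e0; have [x0 _ h] := cex _ (divr_gt0 e0 K0).
    exists (g x0); rewrite -ball_normE /=; apply: filterS h => y /=.
    by rewrite ltr_pdivlMr // mulrC; apply: le_lt_trans; exact: gK.
  have /cvg_ex [l hl] := R_complete (fmap_proper_filter g FF) cg; exists l => e e0.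
  by have /cvgrPdist_lt /(_ e e0) := hl.
(* Taking 0 off D makes the evaluation bound [bx] valid for every v. *)
pose b v : R := if pselect (pD v) then fnorm (@pB R P) v else 0.
have b0 v : 0 <= b v by rewrite /b; case: pselect => h //=; exact: fnorm_ge0.
have bx x v : cabs (x v) <= dnorm x * b v.
  rewrite /b; case: pselect => hv /=; first by apply: dnorm_cs => //; exact: rkhs_al.
  by have [_ -> //] := rkhs_al x; rewrite mulr0 cabs0.
have nb x y (e : R) : dnorm (x - y) < e -> dnorm (y - x) <= e.
  by move=> /ltW; rewrite dnormB //; exact: rkhs_al.
have L1 v : exists l : C, forall e : R, 0 < e -> F [set x : H | cabs (x v - l) < e].
  have K0 : 0 < b v + 1 by have := b0 v; lra.
  have bd x y : cabs (x v - y v) <= (b v + 1) * dnorm (x - y).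
    have := bx (x - y) v; rewrite rfunD rfunN -[(_ - _) v]/(x v - y v).
    by have := dnorm_ge0 (x - y); rewrite rfunD rfunN; lra.
  have [|r hr] := lim1 (fun x => complex.Re (x v)) _ K0.
    by move=> x y; apply: le_trans (bd x y); rewrite -ReN -ReD norm_Re.
  have [|s hs] := lim1 (fun x => complex.Re (- 'i%C * x v)) _ K0.
    move=> x y; apply: le_trans (bd x y); rewrite -ReN -ReD -mulrBr.
    have e (z : C) : cabs (- 'i%C * z) = cabs z.
      by rewrite cabsM cabsN cabsi mul1r.
    by rewrite -e norm_Re.
  exists (r +i* s) => e e0; have e2 : 0 < e / 2 by lra.
  apply: filterS (filterI (hr _ e2) (hs _ e2)) => x /= [h1 h2].
  have -> : x v - (r +i* s) = (complex.Re (x v) - r)%:C +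
     'i%C * (complex.Re (- 'i%C * x v) - s)%:C.
    by case: (x v) => p q; apply/eqP; rewrite eq_complex /=; apply/andP; split; apply/eqP; ring.
  apply: le_lt_trans (cabsD _ _) _; rewrite cabsM cabsi mul1r !cabsR.
  rewrite distrC [`|_ - s|]distrC; lra.
have [L hL] := choice_ex (P := fun v l => forall e : R, 0 < e ->
  F [set x : H | cabs (x v - l) < e]) L1.
have pick (Q : set H) : F Q -> exists x, Q x by move=> /filter_ex.
have near (X : set H) v (e : R) : F X -> 0 < e -> exists2 x : H, X x & cabs (x v - L v) < e.
  by move=> FX e0; have [x [h1 h2]] := pick _ (filterI FX (hL v e e0)); exists x.
have Lbd X v (M : R) (y : H) : F X -> (forall x, X x -> dnorm (x - y) <= M) ->
    cabs (L v - y v) <= M * b v.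
  move=> FX hX; apply/ler_addgt0Pr => e e0; have [x Xx hx] := near X v e FX e0.
  have -> : L v - y v = (x v - y v) - (x v - L v) by ring.
  apply: le_trans (cabsD _ _) _; rewrite cabsN lerD ?(ltW hx) //.
  apply: le_trans (bx (x - y) v : cabs (x v - y v) <= _) _.
  by rewrite ler_wpM2r // hX.
have LH : (L : pV P -> C^o) \in @antilin_pred R P.
  apply/antilinP; split.
  - move=> c v w hv hw; apply/eqP; rewrite -subr_eq0; apply/eqP/cabs_eq0/eqP.
    rewrite eq_le cabs_ge0 andbT; apply/ler_addgt0Pr => e e0; rewrite add0r.
    have K0 : 0 < 2 + cabs c by have := cabs_ge0 c; lra.
    set d := e / (2 + cabs c); have d0 : 0 < d by exact: divr_gt0.
    have [x [[/= h1 h2] h3]] := pick _ (filterI (filterI (hL v d d0) (hL w d d0)) (hL (c *: v + w) d d0)).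
    have [xl _ _] := rkhs_al x.
    have -> : L (c *: v + w) - (cj c * L v + L w) =
       - (x (c *: v + w) - L (c *: v + w)) + cj c * (x v - L v) + (x w - L w).
      by rewrite xl //; ring.
    apply: le_trans (cabsD _ _) _; apply: le_trans (lerD (cabsD _ _) (lexx _)) _.
    rewrite cabsN cabsM cabsJ; have : d * (2 + cabs c) = e by rewrite /d divfK ?gt_eqF.
    have := ler_wpM2l (cabs_ge0 c) (ltW h1); move: h2 h3 => /=; lra.
  - move=> v hv; apply: cabs_eq0; apply/eqP; rewrite eq_le cabs_ge0 andbT.
    have [x _ hx] := cex 1 ltr01; have := Lbd _ v 1 x hx.
    have [_ x0 _] := rkhs_al x; rewrite x0 // subr0 /b; case: pselect => hv_ //=.
    by rewrite mulr0; apply => y; exact: nb.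
  - have [x _ hx] := cex 1 ltr01; exists ((1 + dnorm x) ^+ 2); first exact: sqr_ge0.
    move=> v hv; have := Lbd _ v 1 x hx.
    rewrite -(fnorm_sqr (pB_form P) hv) -exprMn => h.
    rewrite lerXn2r ?nnegrE ?cabs_ge0 //.
      by rewrite mulr_ge0 ?fnorm_ge0 ?addr_ge0 ?dnorm_ge0.
    have -> : L v = (L v - x v) + x v by rewrite subrK.
    apply: le_trans (cabsD _ _) _; have := bx x v; move: h.
    rewrite /b; case: pselect => hv_ //= h' h''; rewrite mulrDl lerD //; apply: h' => y; exact: nb.
apply/cvg_ex; exists (Rkhs LH); apply/fcvgrPdist_lt => e e0.
have er : 0 < complex.Re e by move: e0; rewrite ltcE => /andP[].
have ee : e = (complex.Re e)%:C by apply: ge0_Re; exact: ltW.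
have e2 : 0 < complex.Re e / 3 by lra.
have [x0 _ hx] := cex _ e2; near=> y.
rewrite norm_rkhs ee ltcR; apply: (@le_lt_trans _ _ (complex.Re e / 3 + complex.Re e / 3)); last by lra.
have hy : dnorm (x0 - y) < complex.Re e / 3 by near: y.
apply: dnorm_le; first by lra.
move=> v hv; have := Lbd _ v (complex.Re e / 3 + complex.Re e / 3) y hx.
rewrite /b; case: pselect => hv_ //=; apply=> z /= hz.
have -> : rfun z - rfun y = (rfun z - rfun x0) + (rfun x0 - rfun y) by rewrite addrA subrK.
apply: le_trans (dnormD (rkhs_al (z - x0)) (rkhs_al (x0 - y))) _.
by rewrite lerD ?(ltW hy) // nb.
Unshelve. all: by end_near. Qed.

HB.instance Definition _ := Uniform_isComplete.Build H rkhs_complete.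

Definition hinner x y : C := dinner x y.

Lemma hinner_bilinear : bilinear_for
  (GRing.Scale.Law.clone _ _ ( *%R ) _) (GRing.Scale.Law.clone _ _ (Num.conj \; *%R ) _) hinner.
Proof.
have al x : antilin x := rkhs_al x.
have aZ c x : antilin (c *: rfun x) by apply: al_scale.
split=> u c x y; rewrite /= /hinner rfunD rfunZ.
  by rewrite dinnerDl ?dinnerZl.
rewrite (dinnerDr (al u) (aZ c x) (al y)) (dinnerC (aZ c x) (al u)).
by rewrite dinnerZl // cjM -dinnerC.
Qed.

HB.instance Definition _ := bilinear_isBilinear.Build C H H C
  (GRing.Scale.Law.clone _ _ ( *%R ) _) (GRing.Scale.Law.clone _ _ (Num.conj \; *%R ) _)
  hinner hinner_bilinear.

Lemma hinner_herm x y : hinner x y = (-1) ^+ false * Num.conj (hinner y x).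
Proof. by rewrite expr0 mul1r; apply: dinnerC; exact: rkhs_al. Qed.

HB.instance Definition _ := isHermitianSesquilinear.Build C H false (@Num.conj C) hinner hinner_herm.

Lemma hinner_gt0 x : x != 0 -> 0 < hinner x x.
Proof.
move=> x0; rewrite /hinner dinner_self; last exact: rkhs_al.
rewrite ltcR lt_def qn_ge0 ?andbT; last exact: rkhs_al.
apply: contra_neq x0 => h; apply: rnorm_eq0.
by rewrite /rnorm /dnorm h sqrtr0.
Qed.

HB.instance Definition _ := isDotProduct.Build C H hinner hinner_gt0.

Lemma hinner_norm x : `|x| ^+ 2 = (hinner : {dot H for @Num.conj C}) x x.
Proof.
rewrite norm_rkhs -rmorphXn /= dnorm_sqr; last exact: rkhs_al.
by rewrite -dinner_self //; exact: rkhs_al.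
Qed.

HB.instance Definition _ := @CompleteNormedModule_isHilbert.Build R H hinner hinner_norm.

End HilbertSpace.

Definition rkhsH (R : realType) (P : psdspace R) : hilbertType R := rkhs P.

Lemma inner_rkhs (R : realType) (P : psdspace R) (x y : rkhs P) :
  inner (x : rkhsH P) (y : rkhsH P) = dinner x y.
Proof. by []. Qed.

(** * Hilbert spaces and completely positive maps *)

Section Hilbert.
Context (R : realType) (H : hilbertType R).
Local Notation C := R[i].
Implicit Types (x y z : H) (c : C) (K : set H).

Definition ip x y : C := inner x y.
Definition hn x : R := fnorm ip x.

Lemma ip_lin c x y z : ip (c *: x + y) z = c * ip x z + ip y z.
Proof. by rewrite /ip linearPl. Qed.

Lemma ipC x y : ip y x = cj (ip x y).
Proof. by rewrite /ip (hermC (inner : {dot H for _})) expr0 mul1r. Qed.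

Lemma ip_form K : psdform K ip.
Proof.
split=> [c x y z _ _ _|x y _ _|x _]; [exact: ip_lin|exact: ipC|].
by rewrite /ip -normr_inner; apply: exprn_ge0.
Qed.

Lemma norm_hn x : `|x| = (hn x)%:C.
Proof.
have e : `|x| ^+ 2 = (hn x)%:C ^+ 2.
  rewrite normr_inner -rmorphXn /= (fnorm_sqr (ip_form setT)) //.
  by rewrite -(form_sqn (ip_form setT)).
by apply/eqP; rewrite -(@eqrXn2 _ 2) ?e // lecR fnorm_ge0.
Qed.

Lemma hn_eq0 x : hn x = 0 -> x = 0.
Proof. by move=> h; apply/eqP; rewrite -normr_eq0 norm_hn h. Qed.

Let hT := @subspT R H.
Let fT := ip_form setT.
Lemma ipDl x y z : ip (x + y) z = ip x z + ip y z. Proof. exact: (formDl fT). Qed.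
Lemma ipDr x y z : ip x (y + z) = ip x y + ip x z. Proof. exact: (formDr hT fT). Qed.
Lemma ipZl c x z : ip (c *: x) z = c * ip x z. Proof. exact: (formZl hT fT). Qed.
Lemma ipZr c x z : ip x (c *: z) = cj c * ip x z. Proof. exact: (formZr hT fT). Qed.
Lemma ipNl x z : ip (- x) z = - ip x z. Proof. exact: (formNl hT fT). Qed.
Lemma ipNr x z : ip x (- z) = - ip x z. Proof. exact: (formNr hT fT). Qed.
Lemma ipBl x y z : ip (x - y) z = ip x z - ip y z. Proof. by rewrite ipDl ipNl. Qed.
Lemma ipBr x y z : ip x (y - z) = ip x y - ip x z. Proof. by rewrite ipDr ipNr. Qed.
Lemma ip0l x : ip 0 x = 0. Proof. exact: (form0l hT fT). Qed.
Lemma ip0r x : ip x 0 = 0. Proof. exact: (form0r hT fT). Qed.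
Lemma hn_ge0 x : 0 <= hn x. Proof. exact: fnorm_ge0. Qed.
Lemma hn_sqr x : hn x ^+ 2 = complex.Re (ip x x). Proof. exact: (fnorm_sqr fT). Qed.
Lemma ip_cs x y : cabs (ip x y) <= hn x * hn y.
Proof. exact: (cauchy_schwarz hT fT). Qed.
Lemma hnZ c x : hn (c *: x) = cabs c * hn x. Proof. exact: (fnormZ hT fT). Qed.
Lemma hn_sqrD x y : hn (x + y) ^+ 2 = hn x ^+ 2 + hn y ^+ 2 + 2 * complex.Re (ip x y).
Proof. by rewrite !(fnorm_sqr fT) // (sqnD hT fT). Qed.

Lemma ip_suml I (r : seq I) (P : pred I) (F : I -> H) z :
  ip (\sum_(i <- r | P i) F i) z = \sum_(i <- r | P i) ip (F i) z.
Proof. by elim/big_rec2: _ => [|i a b _ <-]; rewrite ?ip0l ?ipDl. Qed.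
Lemma ip_sumr I (r : seq I) (P : pred I) (F : I -> H) z :
  ip z (\sum_(i <- r | P i) F i) = \sum_(i <- r | P i) ip z (F i).
Proof. by elim/big_rec2: _ => [|i a b _ <-]; rewrite ?ip0r ?ipDr. Qed.

Lemma ip_self0 x : ip x x = 0 -> x = 0.
Proof.
by move=> h; apply: hn_eq0; apply/eqP; rewrite -sqrf_eq0 hn_sqr h.
Qed.

Lemma hilbert_complete (x : nat -> H) :
  (forall e : R, 0 < e -> exists N, forall i j, (N <= i)%N -> (N <= j)%N -> hn (x i - x j) < e) ->
  exists y, forall e : R, 0 < e -> exists N, forall i, (N <= i)%N -> hn (y - x i) < e.
Proof.
move=> h; have : cauchy (x @ \oo).
  apply: cauchy_exP => e e0.
  have er : 0 < complex.Re e by move: e0; rewrite ltcE => /andP[].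
  have [N hN] := h _ er; exists (x N); exists N => // i /= Ni.
  rewrite -ball_normE /= norm_hn (ge0_Re (ltW e0)) ltcR; exact: hN.
move=> /cauchy_cvg /cvg_ex [y hy]; exists y => e e0.
have eC : 0 < e%:C by rewrite ltcR.
have /cvgrPdist_lt /(_ _ eC) [N _ hN] := hy; exists N => i Ni.
by have := hN i Ni; rewrite /= norm_hn ltcR.
Qed.

Lemma closed_lim K y : closed K ->
  (forall e : R, 0 < e -> exists2 x, K x & hn (y - x) < e) -> K y.
Proof.
move=> cK h; apply: cK => U /nbhs_ballP [e /= e0 hU].
have er : 0 < complex.Re e by move: e0; rewrite ltcE => /andP[].
have [x Kx hx] := h _ er; exists x; split=> //; apply: hU.
by rewrite -ball_normE /= norm_hn (ge0_Re (ltW e0)) ltcR.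
Qed.

Lemma small0 (t M : R) : 0 <= t -> 0 <= M -> (forall e, 0 < e -> t <= M * e) -> t = 0.
Proof.
move=> t0 M0 h; apply: le_anti; rewrite t0 andbT; apply/ler_addgt0Pr => e e0.
have M1 : 0 < M + 1 by lra.
have := h _ (divr_gt0 e0 M1); rewrite add0r => h1; apply: le_trans h1 _.
by rewrite mulrCA ler_piMr ?(ltW e0) // ler_pdivrMr //; lra.
Qed.

(** The vector minimizes J x = |x|^2 - 2 Re l(x) on K: the parallelogram identity makes a minimizing
    sequence Cauchy, and varying it in the direction z shows that l z is the inner product of z with
    the limit. *)
Theorem riesz K (l : H -> C) (M : R) : closed_subspace K -> 0 <= M ->
  (forall c x y, K x -> K y -> l (c *: x + y) = c * l x + l y) ->
  (forall x, K x -> cabs (l x) <= M * hn x) ->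
  exists2 y, K y & forall x, K x -> l x = ip x y.
Proof.
move=> [hK cK] M0 ll lM.
pose J x := hn x ^+ 2 - 2 * complex.Re (l x).
have lD x y : K x -> K y -> l (x + y) = l x + l y.
  by move=> hx hy; rewrite -{1}[x]scale1r ll // mul1r.
have l0 : l 0 = 0.
  by have := lD 0 0 (subsp0 hK) (subsp0 hK); rewrite addr0 => h; apply: (addrI (l 0)); rewrite addr0 -h.
have lZ c x : K x -> l (c *: x) = c * l x.
  by move=> hx; rewrite -[c *: x]addr0 ll ?l0 ?addr0 //; exact: subsp0 hK.
have JM x : K x -> - M ^+ 2 <= J x.
  move=> hx; rewrite /J; have := lM x hx; have := cabs_Re (l x).
  have := sqr_ge0 (hn x - M); rewrite !expr2; lra.
pose I := [set J x | x in K]; pose d := inf I.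
have hI : has_inf I.
  split; first by exists (J 0), 0 => //; exact: subsp0 hK.
  by exists (- M ^+ 2) => _ [x hx <-]; exact: JM.
have dJ x : K x -> d <= J x by move=> hx; apply: (ge_inf hI.2); exists x.
have JE x z c : K x -> K z -> J (x + c *: z) =
    J x + 2 * complex.Re (cj c * ip x z - c * l z) + cabs c ^+ 2 * hn z ^+ 2.
  move=> hx hz; rewrite /J hn_sqrD hnZ exprMn ipZr lD ?lZ //; last exact: subspZ.
  by rewrite !ReD ReN; ring.
pose t n : R := (n.+1%:R)^-1.
have t0 n : 0 < t n by rewrite invr_gt0 ltr0n.
have [x hx] : exists x : nat -> H, forall n, K (x n) /\ J (x n) < d + t n.
  apply: (choice_ex (P := fun n x => K x /\ J x < d + t n)) => n.
  by have [_ [x Kx <-] h] := inf_adherent (t0 n) hI; exists x.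
have xx i j : hn (x i - x j) ^+ 2 <= 2 * t i + 2 * t j.
  have [[Ki Ji] [Kj Jj]] := (hx i, hx j).
  have Kij := subspB hK Ki Kj.
  (* The competitor is the midpoint of x i and x j. *)
  have := dJ _ (subspD hK Kj (subspZ hK (2^-1)%:C Kij)); rewrite JE //.
  have := JE (x j) (x i - x j) 1 Kj Kij.
  rewrite scale1r addrC subrK cj1 cabs1 !mul1r expr1n mul1r.
  rewrite cjR cabsR ger0_norm ?invr_ge0 // -mulrBr ReZ expr2; lra.
have tlim (e : R) : 0 < e -> exists N, forall i, (N <= i)%N -> t i < e.
  move=> e0; exists (Num.bound (e^-1)) => i Ni; rewrite /t invf_plt ?posrE ?ltr0n //.
  apply: lt_le_trans (archi_boundP _) _; first by rewrite invr_ge0 ltW.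
  by rewrite ler_nat leqW.
have [y hy] : exists y, forall e : R, 0 < e -> exists N, forall i, (N <= i)%N -> hn (y - x i) < e.
  apply: hilbert_complete => e e0; have e2 : 0 < e ^+ 2 / 4 by rewrite divr_gt0 // exprn_gt0.
  have [N hN] := tlim _ e2; exists N => i j Ni Nj.
  rewrite -ltr_sqr ?nnegrE ?hn_ge0 ?(ltW e0) //; apply: le_lt_trans (xx i j) _.
  by have := hN i Ni; have := hN j Nj; lra.
exists y.
  apply: closed_lim => // e /hy [N hN]; exists (x N); [exact: (hx N).1|exact: hN].
move=> z hz; apply/eqP; rewrite -subr_eq0; apply/eqP/cabs_eq0.
apply: (@small0 _ (2 + hn z)); [exact: cabs_ge0| |].
  by have := hn_ge0 z; lra.
move=> e e0; have e2 : 0 < e ^+ 2 by rewrite exprn_gt0.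
have z1 : 0 < 1 + hn z ^+ 2 by have := sqr_ge0 (hn z); lra.
have [N hN] := hy e e0; have [N' hN'] := tlim _ (divr_gt0 e2 z1).
pose n := maxn N N'; have [Kn Jn] := hx n.
have hn1 := hN n (leq_maxl _ _); have hn2 := hN' n (leq_maxr _ _).
pose w := ip z (x n) - l z.
have wE : cabs w ^+ 2 <= t n * (1 + hn z ^+ 2).
  (* With this step J drops by at least s |w|^2, while x n is within t n of the infimum. The summand
     1 covers z = 0. *)
  pose s := (1 + hn z ^+ 2)^-1; pose c := - s%:C * cj w.
  have s0 : 0 < s by rewrite invr_gt0.
  have := dJ _ (subspD hK Kn (subspZ hK c hz)); rewrite JE //.
  have -> : complex.Re (cj c * ip (x n) z - c * l z) = - s * cabs w ^+ 2.
    rewrite ReD ReN -ReJ cjM cjK -ipC -ReN -ReD -mulrBr /c -mulrA [cj w * _]mulrC cabs_sqr.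
    by rewrite -rmorphN -rmorphM.
  rewrite /c cabsM cabsN cabsR cabsJ exprMn real_normK ?num_real // => h.
  have : s * cabs w ^+ 2 <= t n.
    have sz : s * hn z ^+ 2 <= 1.
      by rewrite mulrC ler_pdivrMr // mul1r lerDr.
    have : s * (s * hn z ^+ 2) * cabs w ^+ 2 <= s * cabs w ^+ 2.
      by rewrite ler_wpM2r ?sqr_ge0 // ler_piMr // ltW.
    move: h; rewrite expr2; lra.
  by rewrite mulrC ler_pdivrMr.
have we : cabs w <= e.
  rewrite -ler_sqr ?nnegrE ?cabs_ge0 ?(ltW e0) //; apply: le_trans wE _.
  by rewrite -ler_pdivlMr // ltW.
have -> : l z - ip z y = - w - ip z (y - x n) by rewrite ipBr /w; ring.
apply: le_trans (cabsD _ _) _; rewrite !cabsN.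
have := ip_cs z (y - x n); have := ler_wpM2l (hn_ge0 z) (ltW hn1).
have := hn_ge0 z; lra.
Qed.

Lemma projection K x : closed_subspace K ->
  exists2 y, K y & forall z, K z -> ip z (x - y) = 0.
Proof.
move=> hK; have [||y Ky h] := @riesz K (ip^~ x) (hn x) hK (hn_ge0 x).
- by move=> c y z _ _; exact: ip_lin.
- by move=> z _; rewrite mulrC; exact: ip_cs.
by exists y => // z Kz; rewrite ipBr h // subrr.
Qed.

End Hilbert.

Section VectorStates.
Context (R : realType) (A : frechetLocCStarType R) (p : A -> R) (T : finType).
Context (W : lmodType R[i]) (D : set W) (B : W -> W -> R[i]) (f : A -> W -> W).
Hypotheses (hp : csn p) (hD : linear_subspace D) (hB : psdform D B).
Hypotheses (hf : prerep D B f).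
Hypothesis f1 : forall w, D w -> f 1 w = w.
Hypothesis hbnd : forall a w, D w -> fnorm B (f a w) <= p a * fnorm B w.

Definition vecf (x : T -> W) (v : T -> T -> A) : R :=
  complex.Re (\sum_u \sum_w B (f (v u w) (x w)) (x u)).

Lemma vec_mstate x : (forall u, D (x u)) -> \sum_u sqn B (x u) = 1 -> mstate p (vecf x).
Proof.
move=> hx x1.
have st a w : D w -> D (f a w) := prep_st hf a (w := w).
have n1 u : fnorm B (x u) <= 1.
  apply: sqrt_le; rewrite ?ler01 // expr1n -x1 (bigD1 u) //= lerDl.
  by apply: sumr_ge0 => w _; apply: (sqn_ge0 hB).
split.
- split=> [v w _ _|t v _].
    rewrite /vecf -ReD -big_split /=; congr (complex.Re _); apply: eq_bigr => u _.
    rewrite -big_split /=; apply: eq_bigr => k _.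
    by rewrite -(formDl hB) ?(prepD hf) //; apply: st.
  rewrite /vecf -ReZ mulr_sumr; congr (complex.Re _); apply: eq_bigr => u _.
  rewrite mulr_sumr; apply: eq_bigr => k _.
  by rewrite -(formZl hD hB) -?(prepZ hf) //; apply: st.
- move=> v; rewrite /vecf Re_sum; apply: ler_sum => u _.
  rewrite Re_sum; apply: ler_sum => w _; apply: le_trans (cabs_Re _) _.
  have hfx := st (v u w) _ (hx w).
  apply: le_trans (cauchy_schwarz hD hB hfx (hx u)) _.
  have := hbnd (v u w) (hx w); have := n1 u; have := n1 w.
  have := fnorm_ge0 B (x u); have := fnorm_ge0 B (x w); have := sc_ge0 hp (v u w).
  have := fnorm_ge0 B (f (v u w) (x w)).
  set a := fnorm _ _; set b := fnorm _ _; set c := fnorm _ _; set d := p _.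
  move=> a0 d0 b0 c0 b1 c1 h; apply: (@le_trans _ _ (a * 1)); first by rewrite ler_wpM2l.
  by rewrite mulr1; apply: le_trans h _; rewrite ler_piMr.
- move=> v; rewrite /vecf -[RHS]ReJ cj_sum; congr (complex.Re _).
  under [RHS]eq_bigr => u _ do rewrite cj_sum.
  rewrite exchange_big /=; apply: eq_bigr => u _; apply: eq_bigr => w _.
  case: (hf) => _ _ _ _ ->; rewrite ?starK //.
  by rewrite -(formC hB) //; apply: st.
- move=> b; rewrite /vecf.
  have hF i : true -> D (f (b i) (x i)) by move=> _; apply: st.
  have [hS _] := form_suml hD hB (index_enum T) hF (subsp0 hD).
  suff -> : \sum_u \sum_w B (f (outer b b u w) (x w)) (x u) =
      B (\sum_w f (b w) (x w)) (\sum_w f (b w) (x w)).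
    by apply: ge0_ReP; case: hB => _ _; apply.
  rewrite (form_suml hD hB (index_enum T) hF hS).2 exchange_big /=; apply: eq_bigr => w _.
  rewrite (formC hB hS) ?(form_suml hD hB (index_enum T) hF _).2 ?cj_sum //; try exact: hF.
  apply: eq_bigr => u _; rewrite -(formC hB); try exact: hF.
  case: hf => _ _ _ hM hA; rewrite /outer hM // hA ?starK //; exact: st.
- rewrite /vecf -x1 Re_sum; apply: eq_bigr => u _.
  rewrite (bigD1 u) //= /vdiag eqxx big1 ?addr0 => [|w wu]; first by rewrite f1.
  by rewrite eq_sym (negbTE wu) (prep0 hf) // (form0l hD hB).
Qed.

End VectorStates.

(** The matrix [mxstar b *m b] is the sum over the rows k of b of the matrices star (b k i) * b k j,
    so positivity need only be tested on those. *)
Lemma mCP_intro (R : realType) (A : frechetLocCStarType R) (H : hilbertType R) (m : nat)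
  (K : set H) (g : A -> H -> H) :
  (forall a, bounded_op K (g a)) -> linear_map K g ->
  (forall a x, cssn m a = 0 -> K x -> g a x = 0) ->
  (forall n (a : 'I_n -> A) (h : 'I_n -> H), (forall i, K (h i)) ->
    0 <= \sum_k \sum_l ip (g (star (a k) * a l) (h l)) (h k)) -> m_CP m K g.
Proof.
move=> gb gl gk gp; split=> // n a; have hp := cssn_csn A m.
have ker (x : 'M[A]_n.+1) : mxcsn (cssn m) x = 0 -> forall i j y, K y -> g (x i j) y = 0.
  by move=> /(mxcsn_eq0 hp (cssn1 m) _) px i j y hy; apply: gk.
split; last exact: ker.
move=> [b [c [-> /ker c0]]] h hh.
have g0 y : K y -> g 0 y = 0 by move=> hy; apply: gk => //; exact: (sc0 hp).
have gD x x' y : K y -> g (x + x') y = g x y + g x' y.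
  by move=> hy; rewrite -{1}[x]scale1r gl // scale1r.
have gsum I (r : seq I) (F : I -> A) y : K y -> g (\sum_(i <- r) F i) y = \sum_(i <- r) g (F i) y.
  by move=> hy; elim/big_rec2: _ => [|i u v _ <-]; rewrite ?g0 ?gD.
suff -> : \sum_i \sum_j inner (g ((mxstar b *m b + c) i j) (h j)) (h i) =
    \sum_k \sum_i \sum_j ip (g (star (b k i) * b k j) (h j)) (h i).
  by apply: sumr_ge0 => k _; exact: gp.
rewrite [RHS]exchange_big /=; apply: eq_bigr => i _; rewrite [RHS]exchange_big /=; apply: eq_bigr => j _.
rewrite -[LHS]/(ip _ _) !mxE gD // c0 // addr0 gsum // ip_suml; apply: eq_bigr => k _.
by rewrite !mxE.
Qed.

Section CPMaps.
Context (R : realType) (A : frechetLocCStarType R) (H : hilbertType R) (m : nat).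
Local Notation C := R[i].
Let p : A -> R := cssn m.
Let hp : csn p := cssn_csn A m.
Let p1 : p 1 = 1 := cssn1 m.
Let cp : qcomplete p := csn_qcomplete hp (fun a => lexx (p a)).
Variables (K : set H) (hK : linear_subspace K).

Section OneMap.
Variables (g : A -> H -> H) (hg : m_CP m K g).

Lemma mCP_st a x : K x -> K (g a x).
Proof. by case: hg => h _ _; case: (h a) => -[h' _] _; exact: h'. Qed.

Lemma mCP_lin c a b x : K x -> g (c *: a + b) x = c *: g a x + g b x.
Proof. by case: hg => _ h _; exact: h. Qed.

Lemma mCP_rlin c a x y : K x -> K y -> g a (c *: x + y) = c *: g a x + g a y.
Proof. by case: hg => h _ _; case: (h a) => -[_ h'] _; exact: h'. Qed.

Lemma mCP_ker a x : p a = 0 -> K x -> g a x = 0.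
Proof.
move=> pa hx; case: hg => _ _ /(_ 0%N (const_mx a)) [_ h].
rewrite -(h _ ord0 ord0 x hx) ?mxE //.
by apply/(mxcsn_eq0 hp p1 _) => i j; rewrite mxE.
Qed.

Lemma mCP_psd n (a : 'I_n.+1 -> A) (h : 'I_n.+1 -> H) : (forall i, K (h i)) ->
  0 <= \sum_k \sum_l ip (g (star (a k) * a l) (h l)) (h k).
Proof.
move=> hh; case: hg => _ _ /(_ n (\matrix_(k, l) (star (a k) * a l))) [hpos _].
have /(_ _ hh) : mx_psd K g (\matrix_(k, l) (star (a k) * a l)).
  (* The matrix with first row a and zeros below. *)
  apply: hpos; exists (\matrix_(k, l) (if k == 0 then a l else 0)), 0; split; last first.
    by apply/(mxcsn_eq0 hp p1 _) => i j; rewrite mxE (sc0 hp).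
  apply/matrixP => k l; rewrite !mxE addr0 (bigD1 0) //= !mxE eqxx big1 ?addr0 // => i i0.
  by rewrite !mxE (negbTE i0) mulr0.
move=> h0; apply: le_trans h0 _; rewrite le_eqVlt; apply/orP; left; apply/eqP.
by apply: eq_bigr => k _; apply: eq_bigr => l _; rewrite mxE.
Qed.

Lemma mCP_psd1 a x : K x -> 0 <= ip (g (star a * a) x) x.
Proof.
move=> hx; have := @mCP_psd 0 (fun=> a) (fun=> x) (fun=> hx).
by rewrite !big_ord_recl !big_ord0 !addr0.
Qed.

Lemma mCP_0 x : K x -> g 0 x = 0.
Proof. by move=> hx; apply: mCP_ker => //; exact: (sc0 hp). Qed.

Lemma mCPZ c a x : K x -> g (c *: a) x = c *: g a x.
Proof. by move=> hx; rewrite -[c *: a]addr0 mCP_lin // mCP_0 // addr0. Qed.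

Lemma mCPD a b x : K x -> g (a + b) x = g a x + g b x.
Proof. by move=> hx; rewrite -{1}[a]scale1r mCP_lin // scale1r. Qed.

Lemma mCP_r0 a : g a 0 = 0.
Proof.
have := mCP_rlin (-1) a (subsp0 hK) (subsp0 hK).
by rewrite scaleN1r addr0 oppr0 scaleN1r addNr.
Qed.

Lemma mCP_rZ c a x : K x -> g a (c *: x) = c *: g a x.
Proof.
move=> hx; rewrite -[c *: x]addr0 mCP_rlin ?mCP_r0 ?addr0 //; exact: subsp0 hK.
Qed.

(** Positivity for the pair (a, 1) at the vectors (x, z) makes the sum of the two inner products
    real; z = y and z = i y give both parts of the identity. *)
Lemma mCP_herm a x y : K x -> K y -> ip (g (star a) y) x = cj (ip (g a x) y).
Proof.
move=> hx hy.
have key z : K z -> complex.Im (ip (g (star a) z) x + ip (g a x) z) = 0.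
  move=> hz; pose aa (k : 'I_2) := if k == 0 then a else 1.
  pose h (k : 'I_2) := if k == 0 then x else z.
  have := @mCP_psd 1 aa h; rewrite !big_ord_recl !big_ord0 /aa /h /= star1 !mulr1 !mul1r !addr0.
  move=> /(_ _) h1; have : 0 <= ip (g (star a * a) x) x + ip (g (star a) z) x +
     (ip (g a x) z + ip (g 1 z) z) by apply: h1 => k; case: ifP.
  have := mCP_psd1 a hx; have := mCP_psd1 1 hz; rewrite star1 mulr1.
  rewrite !lecE /= => /andP[/eqP i1 _] /andP[/eqP i2 _] /andP[/eqP + _].
  rewrite !ImD i1 i2; lra.
have k1 := key y hy; have := key _ (subspZ hK 'i%C hy).
rewrite mCP_rZ // ipZl ipZr cj_i; move: k1.
case: (ip (g (star a) y) x) => r s; case: (ip (g a x) y) => r' s' /= h1 h2.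
by apply: cplx_eq; lra.
Qed.

(** Modulo ker p, the element p a ^+ 2 - star a * a is p a ^+ 2 times [star k * k], by [exact_sqrt],
    and g is positive there. *)
Lemma mCP_sq_le a x : K x ->
  complex.Re (ip (g (star a * a) x) x) <= p a ^+ 2 * complex.Re (ip (g 1 x) x).
Proof.
move=> hx; have [pa|pa] := eqVneq (p a) 0.
  rewrite pa expr0n mul0r mCP_ker ?ip0l //.
  by rewrite (scSM hp) pa expr0n.
have t0 : 0 < p a ^+ 2 by rewrite exprn_gt0 // lt_def pa (sc_ge0 hp).
set t := p a ^+ 2 in t0 *; set c := t^-1%:C *: (star a * a).
have sc : star c = c by rewrite starZR sa_SM.
have c1 : p c <= 1 by rewrite (scZp hp) ?invr_ge0 ?(ltW t0) // (scSM hp) mulVf ?gt_eqF.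
have [k [sk kk _ _]] := exact_sqrt hp cp sc c1.
have e : star a * a = t%:C *: (1 + - (star k * k) + - (1 - c - k * k)).
  have -> : 1 + - (star k * k) + - (1 - c - k * k) = c by rewrite sk; ncring.
  by rewrite /c scalerA -rmorphM mulfV ?gt_eqF // rmorph1 scale1r.
rewrite e mCPZ // !mCPD // -[- (star k * k)]scaleN1r mCPZ // scaleN1r.
rewrite [g (- _) x]mCP_ker ?(scN hp) // addr0 ipZl ReZ ipBl ReD ReN.
rewrite ler_wpM2l ?(ltW t0) // gerBl; exact/ge0_ReP/mCP_psd1.
Qed.

End OneMap.

Lemma rep_mCP (f : A -> H -> H) : prerep K (@ip R H) f ->
  (forall a x, K x -> hn (f a x) <= p a * hn x) -> m_CP m K f.
Proof.
move=> hf hb; have st x y : K y -> K (f x y) := prep_st hf x (w := y).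
apply: mCP_intro.
- move=> a; split.
    by split=> [x|c x y] hx => [|hy]; [exact: st|case: hf => _ _ h _ _; exact: h].
  exists (p a)%:C => x hx; rewrite !norm_hn -rmorphM lecR; exact: hb.
- by move=> c a b x hx; case: hf => _ h _ _ _; exact: h.
- move=> a x px hx; apply: hn_eq0; apply/eqP.
  by rewrite eq_le hn_ge0 andbT; apply: le_trans (hb _ _ hx) _; rewrite /p px mul0r.
move=> n a h hh; have -> : \sum_k \sum_l ip (f (star (a k) * a l) (h l)) (h k) =
    ip (\sum_l f (a l) (h l)) (\sum_k f (a k) (h k)).
  rewrite ip_sumr; apply: eq_bigr => k _; rewrite ip_suml; apply: eq_bigr => l _.
  by case: hf => _ _ _ hM hA; rewrite hM // hA ?starK //; exact: st.
by case: (ip_form (setT : set H)) => _ _; apply.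
Qed.

End CPMaps.

Section OrthogonalClosed.
Context (R : realType) (H : hilbertType R).
Implicit Types (K : set H) (x y : H).

Lemma closureE K x (e : R) : closure K x -> 0 < e -> exists2 y, K y & hn (x - y) < e.
Proof.
move=> cx e0; have e0C : 0 < (e%:C : R[i]) by rewrite ltcR.
have [y [Ky]] := cx _ (nbhsx_ballx x _ e0C).
by rewrite -ball_normE /= norm_hn ltcR => h; exists y.
Qed.

Lemma orthogonal_closed K : closed_subspace (orthogonal K).
Proof.
split; first split.
- by move=> y _; exact: ip0l.
- move=> c x y hx hy z Kz; rewrite -[LHS]/(ip _ _) ip_lin.
  by rewrite (hx z Kz : ip x z = 0) (hy z Kz : ip y z = 0) mulr0 addr0.
- move=> x cx y Ky; apply: cabs_eq0; apply: (@small0 _ _ (hn y)).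
  + exact: cabs_ge0.
  + exact: hn_ge0.
  move=> e e0; have [z hz hxz] := closureE cx e0.
  have -> : inner x y = ip (x - z) y.
    by rewrite ipBl (hz y Ky : ip z y = 0) subr0.
  apply: le_trans (ip_cs _ _) _; rewrite mulrC ler_wpM2l ?hn_ge0 //; exact: ltW.
Qed.

End OrthogonalClosed.

(** * The boundary representation attached to a sequence of states *)

Section GammaSpace.
Context (R : realType) (A : frechetLocCStarType R) (T : finType).
Variable phi : nat -> (T -> T -> A) -> R.
Hypothesis hphi : forall m, mstate (@cssn R A m) (phi m).
Local Notation C := R[i].
Local Notation W := (nat -> T -> A).
Implicit Types (v w : W) (b c d : T -> A) (a : A) (l m : nat).

Local Notation Bm m := (Bf (phi m)).
Let hpm m : csn (@cssn R A m) := cssn_csn A m.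
Let hT := @subspT R (T -> A).
Let hBm m : psdform setT (Bm m) := Bf_form (hphi m).

(** The algebraic orthogonal sum of the spaces of rows attached to the states phi m; the m-th
    summand completes to the m-th layer. *)
Definition fsupp : set W := [set w | exists N, forall m, (N <= m)%N -> w m = 0].
Local Notation D := fsupp.

Lemma fsupp_sub : linear_subspace D.
Proof.
split; first by exists 0%N.
move=> z v w [N hN] [M hM]; exists (maxn N M) => m; rewrite geq_max => /andP[h1 h2].
by transitivity (z *: v m + w m); rewrite // hN // hM // scaler0 addr0.
Qed.

(** A choice of bound for the support; by [dsumE] the form does not depend on it. *)
Definition sbound w : nat := xget 0%N [set N | forall m, (N <= m)%N -> w m = 0].
Definition dsum v w : C := \sum_(m < sbound v) Bm m (v m) (w m).

Lemma dsumE N v w : (forall m, (N <= m)%N -> v m = 0) ->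
  dsum v w = \sum_(m < N) Bm m (v m) (w m).
Proof.
move=> hN; have h : forall m, (sbound v <= m)%N -> v m = 0.
  by rewrite /sbound; case: xgetP => [M _ hM|/(_ N)].
have K M M' : (M <= M')%N -> (forall m, (M <= m)%N -> v m = 0) ->
    \sum_(m < M') Bm m (v m) (w m) = \sum_(m < M) Bm m (v m) (w m).
  move=> le hM; rewrite (big_ord_widen M' (fun m => Bm m (v m) (w m)) le).
  rewrite [RHS]big_mkcond; apply: eq_bigr => m _; case: ltnP => // /hM ->.
  by rewrite (form0l hT (hBm m)).
rewrite /dsum -(K _ (sbound v + N)%N) ?leq_addr // -(K N (sbound v + N)%N) ?leq_addl //.
Qed.

Lemma dsum_form : psdform D dsum.
Proof.
split.
- move=> z x y w [N hN] [M hM] _; set K := maxn N M.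
  have hx m : (K <= m)%N -> x m = 0 by rewrite geq_max => /andP[h _]; exact: hN.
  have hy m : (K <= m)%N -> y m = 0 by rewrite geq_max => /andP[_ h]; exact: hM.
  rewrite (dsumE w hx) (dsumE w hy) (@dsumE K) => [|m h]; last first.
    by transitivity (z *: x m + y m); rewrite // hx // hy // scaler0 addr0.
  rewrite mulr_sumr -big_split /=; apply: eq_bigr => m _.
  by case: (hBm m) => H _ _; rewrite -H.
- move=> x y [N hN] [M hM]; set K := maxn N M.
  have hx m : (K <= m)%N -> x m = 0 by rewrite geq_max => /andP[h _]; exact: hN.
  have hy m : (K <= m)%N -> y m = 0 by rewrite geq_max => /andP[_ h]; exact: hM.
  rewrite (dsumE x hy) (dsumE y hx) cj_sum; apply: eq_bigr => m _.
  by rewrite (formC (hBm m)).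
- move=> x _; apply: sumr_ge0 => m _; case: (hBm m) => _ _; exact.
Qed.

Definition gspace := Psdspace fsupp_sub dsum_form.
Local Notation H := (rkhs gspace).
Implicit Types (x y : H).

Definition single l b : W := fun m => if m == l then b else 0.
Definition upto l w : W := fun m => if (m <= l)%N then w m else 0.
Definition lmW a w : W := fun m => lm a (w m).

Lemma D_single l b : D (single l b).
Proof. by exists l.+1 => m h; rewrite /single gtn_eqF. Qed.
Lemma D_upto l w : D (upto l w).
Proof. by exists l.+1 => m h; rewrite /upto leqNgt h. Qed.

Lemma lm0 a : lm a (0 : T -> A) = 0.
Proof. exact: (prep_r0 hT (lm_prep (phi 0%N))). Qed.

Lemma D_lmW a w : D w -> D (lmW a w).
Proof. by move=> [N hN]; exists N => m /hN h; rewrite /lmW h lm0. Qed.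

Definition emb w (hw : D w) : H := Rkhs (introT (antilinP _) (repr_al (P := gspace) hw)).

Lemma ip_emb x w (hw : D w) : ip x (emb hw) = rfun x w.
Proof. by rewrite /ip inner_rkhs dinner_repr //; exact: rkhs_al. Qed.

Lemma embE w (hw : D w) v : D v -> rfun (emb hw) v = dsum w v.
Proof. exact: (reprE (P := gspace)). Qed.

Lemma hn_dnorm x : hn x = dnorm (rfun x).
Proof.
by rewrite /hn /fnorm /sqn /ip inner_rkhs dinner_self //; exact: rkhs_al.
Qed.

Lemma rkhs_eq x y : (forall w, D w -> rfun x w = rfun y w) -> x = y.
Proof.
move=> h; apply: val_inj; apply/funext => w /=; have [hw|hw] := pselect (D w); first exact: h.
by have [_ -> //] := rkhs_al x; have [_ -> //] := rkhs_al y.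
Qed.

(** Closed by construction, as an orthogonal complement. [gE_dense] shows that it is the closure of
    the sequences supported on the indices up to l. *)
Definition gE l : set H :=
  orthogonal [set y : H | exists w (hw : D w), (forall m, (m <= l)%N -> w m = 0) /\ y = emb hw].

Lemma gEP l x : gE l x <-> forall w, D w -> (forall m, (m <= l)%N -> w m = 0) -> rfun x w = 0.
Proof.
split=> [h w hw wl|h y [w [hw [wl ->]]]].
  by rewrite -(ip_emb x hw); apply: (h (emb hw)); exists w, hw.
by rewrite -[LHS]/(ip _ _) ip_emb; exact: h.
Qed.

Lemma gE_sub l : linear_subspace (gE l). Proof. exact: (orthogonal_closed _).1. Qed.

Lemma gE_mono l l' x : (l <= l')%N -> gE l x -> gE l' x.
Proof.
move=> le /gEP h; apply/gEP => w hw w0; apply: h => // m ml; apply: w0.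
exact: leq_trans ml le.
Qed.

Lemma gE_upto l x w : gE l x -> D w -> rfun x w = rfun x (upto l w).
Proof.
move=> /gEP hx hw; have hxa := rkhs_al x; have hu := D_upto l w.
have hv : D (w - upto l w) by apply: subspB fsupp_sub _ _ _ _.
have : rfun x (w - upto l w) = 0.
  by apply: hx => // m ml; rewrite -[LHS]/(w m - upto l w m) /upto ml subrr.
rewrite -scaleN1r (alD hxa) ?(alZ _ hxa) //; last exact: subspZ fsupp_sub _ _ _.
by rewrite cjN cj1 mulN1r => /eqP; rewrite subr_eq0 => /eqP.
Qed.

Lemma gE_emb l w (hw : D w) : (forall m, (l < m)%N -> w m = 0) -> gE l (emb hw).
Proof.
move=> wl; apply/gEP => v hv vl; rewrite embE // (@dsumE l.+1) //.
apply: big1 => m _; rewrite (vl m (ltnSE (ltn_ord m))); exact: (form0r hT (hBm m)).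
Qed.

Lemma sqn_upto l w : sqn dsum (upto l w) = \sum_(m < l.+1) sqn (Bm m) (w m).
Proof.
rewrite /sqn (@dsumE l.+1) => [|m h]; last by rewrite /upto leqNgt h.
by rewrite Re_sum; apply: eq_bigr => m _; rewrite /upto -ltnS ltn_ord.
Qed.

Lemma sqn_upto_le l w : D w -> sqn dsum (upto l w) <= sqn dsum w.
Proof.
move=> hw; rewrite sqn_upto; case: (hw) => N hN; rewrite /sqn (@dsumE (l.+1 + N)) => [|m h].
  rewrite Re_sum (big_ord_widen (l.+1 + N) (fun m => sqn (Bm m) (w m))) ?leq_addr //.
  rewrite big_mkcond; apply: ler_sum => m _; case: ifP => // _.
  exact: (sqn_ge0 (hBm m)).
by apply: hN; apply: leq_trans h; rewrite leq_addl.
Qed.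

Lemma upto_bound l a w : D w -> fnorm dsum (upto l (lmW a w)) <= cssn l a * fnorm dsum w.
Proof.
move=> hw; apply: sqrt_le; first by rewrite mulr_ge0 ?fnorm_ge0 ?(sc_ge0 (hpm l)).
rewrite exprMn (fnorm_sqr dsum_form) //.
apply: (@le_trans _ _ (cssn l a ^+ 2 * sqn dsum (upto l w))); last first.
  by rewrite ler_wpM2l ?sqr_ge0 // sqn_upto_le.
rewrite !sqn_upto mulr_sumr; apply: ler_sum => m _.
rewrite -!(fnorm_sqr (hBm m)) // -exprMn lerXn2r ?nnegrE ?mulr_ge0 ?fnorm_ge0 ?(sc_ge0 (hpm l)) //.
apply: le_trans (Bf_bound (hpm m) _ _ (hphi m)) _.
by rewrite ler_wpM2r ?fnorm_ge0 // cssn_mono // -ltnS.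
Qed.

Lemma gE_dense l x (e : R) : gE l x -> 0 < e ->
  exists2 w, D w & hn (x - emb (D_upto l w)) < e.
Proof.
move=> hx e0; have [w hw h] := repr_dense (rkhs_al x) e0; exists w => //.
apply: le_lt_trans h; rewrite hn_dnorm; apply: dnorm_le; first exact: dnorm_ge0.
move=> v hv; have hu := D_upto l v.
have -> : rfun (x - emb (D_upto l w)) v = (rfun x - repr (P := gspace) w) (upto l v).
  rewrite -[LHS]/(rfun x v - rfun (emb (D_upto l w)) v).
  rewrite -[RHS]/(rfun x (upto l v) - repr (P := gspace) w (upto l v)).
  rewrite (gE_upto hx hv) embE // (reprE (P := gspace)) //; congr (_ - _).
  case: hw => N hN; rewrite (@dsumE l.+1) => [|m h]; last by rewrite /upto leqNgt h.
  rewrite -[RHS]/(dsum w (upto l v)) (@dsumE (l.+1 + N)) => [|m h]; last first.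
    by apply: hN; apply: leq_trans h; rewrite leq_addl.
  rewrite (big_ord_widen (l.+1 + N) (fun m => Bm m (upto l w m) (v m))) ?leq_addr //.
  rewrite big_mkcond; apply: eq_bigr => m _; rewrite /upto ltnS.
  by case: (m <= l)%N => //; rewrite (form0r hT (hBm m)).
have hr := repr_al (P := gspace) hw.
apply: le_trans (dnorm_cs (al_add (rkhs_al x) (al_opp hr)) hu) _.
rewrite ler_wpM2l ?dnorm_ge0 //; apply: ler_wsqrtr; exact: sqn_upto_le.
Qed.

Definition gfun a x : W -> C^o :=
  fun v => if pselect (D v) then rfun x (lmW (star a) v) else 0.

(** The operator is defined by duality. On the union of the [gE l] the functional is bounded
    ([gfun_al]); elsewhere the norms p_m(a) may be unbounded in m, so a default value is
    required. *)
Definition gf a x : H :=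
  if pselect (gfun a x \in @antilin_pred R gspace) is left h then Rkhs h else 0.

Lemma lmW_lin a (z : C) v w : lmW a (z *: v + w) = z *: lmW a v + lmW a w.
Proof.
by apply/funext => m; case: (lm_prep (phi m)) => _ _ h _ _; exact: h.
Qed.

Lemma gfun_bound l a x v : gE l x -> D v ->
  cabs (rfun x (lmW (star a) v)) <= cssn l a * dnorm (rfun x) * fnorm dsum v.
Proof.
move=> hx hv; rewrite (gE_upto hx); last exact: D_lmW.
apply: le_trans (dnorm_cs (rkhs_al x) (D_upto l _)) _.
rewrite mulrAC [leRHS]mulrC ler_wpM2l ?dnorm_ge0 //.
by rewrite -(sc_star (hpm l)); exact: upto_bound.
Qed.

Lemma gfun_al l a x : gE l x -> antilin (P := gspace) (gfun a x).
Proof.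
move=> hx; have [h1 h2 _] := rkhs_al x; split.
- move=> z v w hv hw; have hvw := fsupp_sub.2 z v w hv hw.
  rewrite /gfun; case: pselect => [_|/(_ hvw)//] /=; case: pselect => [_|/(_ hv)//] /=.
  case: pselect => [_|/(_ hw)//] /=.
  by rewrite lmW_lin h1 //; exact: D_lmW.
- by move=> v hv; rewrite /gfun; case: pselect.
- exists ((cssn l a * dnorm (rfun x)) ^+ 2) => [|v hv]; first exact: sqr_ge0.
  rewrite -(fnorm_sqr dsum_form) // -exprMn lerXn2r ?nnegrE ?cabs_ge0 //.
    by rewrite !mulr_ge0 ?fnorm_ge0 ?dnorm_ge0 ?(sc_ge0 (hpm l)).
  by rewrite /gfun; case: pselect => //= _; exact: gfun_bound.
Qed.

Lemma gfE l a x v : gE l x -> D v -> rfun (gf a x) v = rfun x (lmW (star a) v).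
Proof.
move=> hx hv; have /antilinP h := gfun_al a hx; rewrite /gf.
by case: pselect => // h'; rewrite /= /gfun; case: pselect.
Qed.

Lemma gf_bound l a x : gE l x -> hn (gf a x) <= cssn l a * hn x.
Proof.
move=> hx; rewrite !hn_dnorm; apply: dnorm_le.
  by rewrite mulr_ge0 ?dnorm_ge0 ?(sc_ge0 (hpm l)).
move=> v hv; rewrite (gfE _ hx) //; exact: gfun_bound.
Qed.

Lemma gf_st l a x : gE l x -> gE l (gf a x).
Proof.
move=> hx; apply/gEP => w hw wl; rewrite (gfE _ hx) //.
move/gEP: hx; apply; first exact: D_lmW.
by move=> m ml; rewrite /lmW wl // lm0.
Qed.

Lemma dsum_adj a v w : D v -> dsum (lmW a v) w = dsum v (lmW (star a) w).
Proof.
move=> [N hN]; rewrite (dsumE (lmW (star a) w) hN) (@dsumE N) => [|m h].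
  by apply: eq_bigr => m _; case: (lm_prep (phi m)) => _ _ _ _ h; exact: h.
by rewrite /lmW hN // lm0.
Qed.

Lemma gf_emb l a w (hw : D w) (hw' : D (lmW a w)) : gE l (emb hw) ->
  gf a (emb hw) = emb hw'.
Proof.
move=> hl; apply: rkhs_eq => v hv; rewrite (gfE _ hl) // !embE //; last exact: D_lmW.
by rewrite dsum_adj.
Qed.

Lemma gf_prep l : prerep (gE l) (@ip R H) gf.
Proof.
have lin a (z : C) x y : gE l x -> gE l y -> gf a (z *: x + y) = z *: gf a x + gf a y.
  move=> hx hy; have hxy := (gE_sub l).2 z x y hx hy.
  apply: rkhs_eq => v hv; rewrite (gfE _ hxy) //.
  rewrite -[LHS]/(z * rfun x _ + rfun y _) -[RHS]/(z * rfun (gf a x) v + rfun (gf a y) v).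
  by rewrite !(gfE _ hx) // (gfE _ hy).
split=> //.
- by move=> a x; exact: gf_st.
- move=> z a a' x hx; apply: rkhs_eq => v hv.
  rewrite -[RHS]/(z * rfun (gf a x) v + rfun (gf a' x) v) !(gfE _ hx) //.
  have [h1 _ _] := rkhs_al x.
  have -> : lmW (star (z *: a + a')) v = cj z *: lmW (star a) v + lmW (star a') v.
    apply/funext => m; rewrite /lmW starD starZ.
    by case: (lm_prep (phi m)) => _ h _ _ _; exact: h.
  by rewrite h1 ?cjK //; exact: D_lmW.
- move=> a a' x hx; apply: rkhs_eq => v hv; have hf := gf_st a' hx.
  rewrite (gfE _ hx) // (gfE _ hf) // (gfE _ hx) //; last exact: D_lmW.
  congr (rfun x _); apply/funext => m; rewrite /lmW starM.
  by case: (lm_prep (phi m)) => _ _ _ h _; exact: h.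
- move=> a x y hx hy; apply/eqP; rewrite -subr_eq0; apply/eqP/cabs_eq0.
  apply: (@small0 _ _ (2 * (cssn l a * hn x))).
  + exact: cabs_ge0.
  + by rewrite !mulr_ge0 ?hn_ge0 ?(sc_ge0 (hpm l)).
  (* The adjoint relation is clear when one vector is finitely supported; both sides are continuous
     in y on [gE l]. *)
  move=> e e0; have [w hw hyw] := gE_dense hy e0.
  have hu := D_upto l w; pose t := emb hu.
  have ht : gE l t by apply: gE_emb => m ml; rewrite /upto leqNgt ml.
  have et : ip (gf a x) t = ip x (gf (star a) t).
    have hu' : D (lmW (star a) (upto l w)) by exact: D_lmW.
    by rewrite (gf_emb hu' ht) !ip_emb (gfE _ hx).
  have hyt := subspB (gE_sub l) hy ht.
  have -> : ip (gf a x) y - ip x (gf (star a) y) =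
      ip (gf a x) (y - t) - ip x (gf (star a) (y - t)).
    have -> : gf (star a) (y - t) = gf (star a) y - gf (star a) t.
      by rewrite addrC -scaleN1r lin // scaleN1r addrC.
    by rewrite !ipBr et; ring.
  apply: le_trans (cabsD _ _) _; rewrite cabsN.
  have := ip_cs (gf a x) (y - t); have := ip_cs x (gf (star a) (y - t)).
  have := gf_bound a hx; have := gf_bound (star a) hyt; rewrite (sc_star (hpm l)).
  have := hn_ge0 (y - t); have := hn_ge0 x; have := sc_ge0 (hpm l) a; move: hyw.
  rewrite -/t; set p := cssn l a; set u := hn x; set z := hn (y - t).
  set g1 := hn _; set g2 := hn _; move=> zl p0 u0 z0 k1 k2 k3 k4.
  have := ler_wpM2r z0 k2; have := ler_wpM2l u0 k1.
  have : p * u * z <= p * u * e by apply: ler_wpM2l; [exact: mulr_ge0|exact: ltW].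
  lra.
Qed.

(** The m-th summand, described by test vectors; [layer_gE] identifies it with the layer. *)
Definition gAt m : set H := [set x : H | forall w, D w -> w m = 0 -> rfun x w = 0].
Definition io m b : H := emb (D_single m b).

Lemma gAt_gE m x : gAt m x -> gE m x.
Proof. by move=> h; apply/gEP => w hw wl; apply: h => //; exact: wl. Qed.

Lemma gAt_sub m : linear_subspace (gAt m).
Proof.
split=> [w _ _|z x y hx hy w hw wm] //.
by rewrite -[LHS]/(z * rfun x w + rfun y w) hx // hy // mulr0 addr0.
Qed.

Lemma layer_gE m : layer gE m = gAt m.
Proof.
case: m => [|m]; apply/seteqP; split=> x /=.
- by move=> /gEP h w hw w0; apply: h => // k; rewrite leqn0 => /eqP ->.
- exact: gAt_gE.
- move=> [ox hx] w hw w0; rewrite (gE_upto hx hw).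
  have -> : upto m.+1 w = upto m w.
    apply/funext => k; rewrite /upto leq_eqVlt ltnS.
    by case: eqP => [->|_] //=; rewrite w0 ltnn.
  have hu := D_upto m w; rewrite -(ip_emb x hu); apply: ox; apply: gE_emb => k mk.
  by rewrite /upto leqNgt mk.
- move=> hx; split; last exact: gAt_gE.
  move=> y hy; apply: cabs_eq0; apply: (@small0 _ _ (hn x)); rewrite ?cabs_ge0 ?hn_ge0 //.
  move=> e e0; have [w hw he] := gE_dense hy e0.
  have -> : inner x y = ip x (y - emb (D_upto m w)).
    rewrite ipBr ip_emb hx ?subr0 //; first exact: D_upto.
    by rewrite /upto ltnn.
  by apply: le_trans (ip_cs _ _) _; rewrite ler_wpM2l ?hn_ge0 // ltW.
Qed.

Lemma gf_gAt m a x : gAt m x -> gAt m (gf a x).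
Proof.
move=> hx w hw wm; rewrite (gfE _ (gAt_gE hx)) //; apply: hx; first exact: D_lmW.
by rewrite /lmW wm lm0.
Qed.

Lemma io_gAt m b : gAt m (io m b).
Proof.
move=> w hw wm; rewrite embE // (@dsumE m.+1) => [|k h]; last by rewrite /single gtn_eqF.
rewrite big1 // => k _; rewrite /single; case: eqP => [->|_].
  by rewrite wm (form0r hT (hBm m)).
exact: (form0l hT (hBm k)).
Qed.

Lemma ip_io x m b : ip x (io m b) = rfun x (single m b).
Proof. exact: ip_emb. Qed.

Lemma ip_io_io m b c : ip (io m b) (io m c) = Bm m b c.
Proof.
rewrite ip_io embE; last exact: D_single.
rewrite (@dsumE m.+1) => [|k h]; last by rewrite /single gtn_eqF.
rewrite big_ord_recr /= /single !eqxx big1 ?add0r // => k _.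
by rewrite ltn_eqF // (form0l hT (hBm k)).
Qed.

Lemma gAt_eq m x y : gAt m x -> gAt m y ->
  (forall b, ip x (io m b) = ip y (io m b)) -> x = y.
Proof.
move=> hx hy h; apply: rkhs_eq => w hw.
have K z : gAt m z -> rfun z w = rfun z (single m (w m)).
  move=> hz; have hs := D_single m (w m); have za := rkhs_al z.
  have hv : D (w - single m (w m)) by apply: subspB fsupp_sub _ _ _ _.
  have : rfun z (w - single m (w m)) = 0.
    by apply: hz => //; rewrite -[LHS]/(w m - single m (w m) m) /single eqxx subrr.
  rewrite -scaleN1r (alD za) ?(alZ _ za) //; last exact: subspZ fsupp_sub _ _ _.
  by rewrite cjN cj1 mulN1r => /eqP; rewrite subr_eq0 => /eqP.
by rewrite (K x) // (K y) // -!ip_io.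
Qed.

Lemma io_lin m (z : C) b c : io m (z *: b + c) = z *: io m b + io m c.
Proof.
apply: (@gAt_eq m); [exact: io_gAt| |move=> d].
  by apply: (gAt_sub m).2; exact: io_gAt.
by rewrite ip_lin !ip_io_io; case: (hBm m) => h _ _; exact: h.
Qed.

Lemma gf_io m a b : gf a (io m b) = io m (lm a b).
Proof.
apply: rkhs_eq => w hw; rewrite (gfE _ (gAt_gE (@io_gAt m b))) // !embE //; last exact: D_lmW.
rewrite -dsum_adj; last exact: D_single.
congr (dsum _ w); apply/funext => k; rewrite /lmW /single.
by case: ifP; rewrite ?lm0.
Qed.

Lemma gf_bounded l a : bounded_op (gE l) (gf a).
Proof. by have [h _ _] := rep_mCP (gf_prep l) (fun a x hx => gf_bound a hx); exact: h. Qed.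

Lemma gdomainP x y : domain gE x -> domain gE y -> exists l, gE l x /\ gE l y.
Proof.
move=> [l _ hx] [l' _ hy]; exists (maxn l l').
by split; [apply: gE_mono hx; rewrite leq_maxl|apply: gE_mono hy; rewrite leq_maxr].
Qed.

Lemma gquantized : quantized_domain gE.
Proof.
split=> [m|m x|O [x Ox] oO]; first exact: orthogonal_closed.
  exact: gE_mono.
have /nbhs_ballP [e /= e0 he] : nbhs x O by apply: open_nbhs_nbhs.
have er : 0 < complex.Re e by move: e0; rewrite ltcE => /andP[].
have [w hw h] := repr_dense (rkhs_al x) er; exists (emb hw); split.
  apply: he; rewrite -ball_normE /= norm_hn (ge0_Re (ltW e0)) ltcR hn_dnorm.
  exact: h.
by case: (hw) => N hN; exists N => //; apply: gE_emb => m /ltnW; exact: hN.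
Qed.

Lemma glocal : local_rep gE gf.
Proof.
have pd l := gf_prep l; have st a x : domain gE x -> domain gE (gf a x).
  by move=> [l _ hx]; exists l => //; exact: gf_st.
split.
- move=> a; split.
    split=> [x|z x y hx hy]; first exact: st.
    by have [l [hx' hy']] := gdomainP hx hy; case: (pd l) => _ _ h _ _; exact: h.
  move=> m; split; first exact: gf_bounded.
  move=> x [ox hx]; split; last exact: st.
  move=> y hy; have [l [hx' hy']] : exists l, gE l x /\ gE l y.
    by apply: gdomainP => //; exists m.
  rewrite -[LHS]/(ip _ _); case: (pd l) => _ _ _ _ -> //.
  by apply: ox; exact: gf_st.
- split.
  + by move=> z a b x [l _ hx]; case: (pd l) => _ h _ _ _; exact: h.
  + by move=> a b x [l _ hx]; case: (pd l) => _ _ _ h _; exact: h.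
  + move=> a x y hx hy; have [l [hx' hy']] := gdomainP hx hy.
    by case: (pd l) => _ _ _ _ h; exact: h.
- move=> l; exists l => a; apply: ge_sup.
    by exists (complex.Re `|gf a 0|), 0 => //; split; [exact: subsp0 (gE_sub l)|rewrite normr0 ler01].
  move=> _ [x [hx x1] <-]; rewrite norm_hn /=; apply: le_trans (gf_bound a hx) _.
  by rewrite ler_piMr ?(sc_ge0 (hpm l)) //; move: x1; rewrite norm_hn lecR.
Qed.

Lemma gunital x : domain gE x -> gf 1 x = x.
Proof.
move=> [l _ hx]; apply: rkhs_eq => w hw; rewrite (gfE _ hx) //; congr (rfun x _).
by apply/funext => m; apply/funext => u; rewrite /lmW /lm star1 mul1r.
Qed.

Section Level.
Variables (S : set A) (m : nat).
Hypothesis opS : local_operator_system S.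
Hypothesis extr : forall psi, msRel S m (phi m) psi -> psi = phi m.
Hypothesis rigid : forall G, dilation (@cssn R A m) S (phi m) G ->
  forall a b d, G a b d = Bm m (lm a b) d.
Local Notation K := (gAt m).
Let p : A -> R := cssn m.

Lemma level_prep : prerep K (@ip R H) gf.
Proof.
have sub x : K x -> gE m x := @gAt_gE m x.
case: (gf_prep m) => h1 h2 h3 h4 h5; split; try by move=> *; auto.
by move=> a x; exact: gf_gAt.
Qed.

Lemma level_bound a x : K x -> hn (gf a x) <= p a * hn x.
Proof. by move=> /gAt_gE; exact: gf_bound. Qed.

Lemma level_unital x : K x -> gf 1 x = x.
Proof. by move=> hx; apply: gunital; exists m => //; exact: gAt_gE. Qed.

Lemma level_mCP : m_CP m K gf.
Proof. exact: (rep_mCP level_prep level_bound). Qed.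

(** The matrix coefficients of g at the vectors [io m b] form a dilation of phi m, so [rigid]
    determines g on these vectors. *)
Lemma level_unique g : m_CP m K g -> unital K g ->
  (forall s x, S s -> K x -> g s x = gf s x) -> forall a x, K x -> g a x = gf a x.
Proof.
move=> hg g1 gS; have hK := gAt_sub m; have iK b := @io_gAt m b.
pose G a b d : C := ip (g a (io m b)) (io m d).
have hG : dilation (@cssn R A m) S (phi m) G.
  split; first split.
  - by move=> z a a' b d; rewrite /G (mCP_lin hg) // ip_lin.
  - by move=> z a b b' d; rewrite /G io_lin (mCP_rlin hg) // ip_lin.
  - by move=> a b d; rewrite /G (mCP_herm hK hg).
  - case=> [a b|n a b]; first by rewrite big_ord0.
    exact: (mCP_psd hg a (h := fun k => io m (b k)) (fun k => iK (b k))).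
  - by move=> a b; exact: (mCP_sq_le hg).
  - by move=> s b d Ss; rewrite /G gS // gf_io ip_io_io.
have gio a b : g a (io m b) = gf a (io m b).
  apply: (@gAt_eq m); [exact: (mCP_st hg)|exact: gf_gAt|move=> d].
  by rewrite gf_io ip_io_io -(rigid hG).
(* The vectors [io m b] only separate the points of K; for general x the operator is moved onto them
   by taking adjoints. *)
move=> a x hx; apply: (@gAt_eq m); [exact: (mCP_st hg)|exact: gf_gAt|move=> d].
case: level_prep => _ _ _ _ ->; rewrite // -gio [RHS]ipC.
by rewrite (mCP_herm hK hg) // cjK.
Qed.

Lemma io_sum b : io m b = \sum_u gf (b u) (io m (eu u)).
Proof.
under eq_bigr => u _ do rewrite gf_io.
rewrite {1}(lm_eu b); elim: (index_enum T) => [|u r IH].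
  rewrite !big_nil; have := io_lin m (-1) 0 0.
  by rewrite scaleN1r addr0 oppr0 scaleN1r addNr.
by rewrite !big_cons -[lm _ _]scale1r io_lin IH !scale1r.
Qed.

Lemma level_eu x : K x -> (forall a u, ip (gf a (io m (eu u))) x = 0) -> x = 0.
Proof.
move=> hx h; apply: (gAt_eq hx (subsp0 (gAt_sub m))) => b; rewrite ip0l ipC.
by rewrite io_sum ip_suml big1 ?cj0 // => u _; exact: h.
Qed.

(** Splitting the vectors xi along L and its orthogonal complement writes phi m as a convex
    combination with weights t and s. Unless a weight vanishes, [extr] makes the component in L
    equal to phi m; this forces x u = t xi u, so xi u lies in L and its part y u, lying in L and
    orthogonal to it, is zero. *)
Lemma level_irr (L : set H) : closed_subspace L -> L `<=` K ->
  (forall a x, L x -> L (gf a x)) -> L = [set 0] \/ L = K.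
Proof.
move=> hL LK Lf; have hLs := hL.1; have hK := gAt_sub m.
have [hP1 hP2 hP3 hP4 hP5] := level_prep.
pose xi u : H := io m (eu u); have xiK u : K (xi u) by exact: io_gAt.
have [x hx] : exists x : T -> H, forall u, L (x u) /\ forall z, L z -> ip z (xi u - x u) = 0.
  apply: (choice_ex (P := fun u (y : H) => L y /\ forall z, L z -> ip z (xi u - y) = 0)) => u.
  by have [y Ly hy] := projection (xi u) hL; exists y.
pose y u := xi u - x u.
have xL u : L (x u) by case: (hx u).
have xK u := LK _ (xL u).
have KB (z z' : H) : K z -> K z' -> K (z - z') by move=> h h'; exact: (subspB hK h h').
have KZ (c : C) (z : H) : K z -> K (c *: z) by move=> h; exact: (subspZ hK c h).
have yK u : K (y u) by exact: KB.
have yp u z : L z -> ip z (y u) = 0 by case: (hx u) => _; apply.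
have py u z : L z -> ip (y u) z = 0 by move=> Lz; rewrite ipC yp // cj0.
have fy a u z : L z -> ip (gf a (y u)) z = 0.
  by move=> Lz; rewrite hP5 ?py //; [exact: Lf|exact: LK].
have xie u : xi u = x u + y u by rewrite addrC subrK.
clearbody y.
have full : (forall u, xi u = x u) -> L = K.
  move=> xx; apply/seteqP; split=> // z Kz.
  have [z' Lz' hz] := projection z hL.
  suff : z - z' = 0 by move/eqP; rewrite subr_eq0 => /eqP ->.
  apply: level_eu => [|a u]; first by apply: KB => //; exact: LK.
  by apply: hz; apply: Lf; rewrite -/(xi u) xx.
pose t := \sum_u sqn (@ip R H) (x u); pose s := \sum_u sqn (@ip R H) (y u).
have q0 (z : H) : 0 <= sqn (@ip R H) z by exact: (sqn_ge0 (ip_form setT)).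
have ts : t + s = 1.
  rewrite -(eu_norm1 (hphi m)) -big_split /=; apply: eq_bigr => u _.
  rewrite /sqn -ip_io_io -/(xi u) xie !ipDl !ipDr yp // py // !ReD /=; lra.
have t0 : 0 <= t by apply: sumr_ge0.
have s0 : 0 <= s by apply: sumr_ge0.
have sum0 (z : T -> H) : \sum_u sqn (@ip R H) (z u) = 0 -> forall u, z u = 0.
  move=> /eqP; rewrite psumr_eq0 // => /allP h u; apply: hn_eq0.
  by apply/eqP; rewrite -sqrf_eq0 hn_sqr; exact: h (mem_index_enum u).
have [tz|tn] := eqVneq t 0.
  left; apply/seteqP; split=> [z Lz|_ ->]; last exact: subsp0 hLs.
  apply: level_eu => [|a u]; first exact: LK.
  rewrite -/(xi u) xie (sum0 x tz u) add0r fy //.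
right; have [sz|sn] := eqVneq s 0.
  by apply: full => u; rewrite xie (sum0 y sz u) addr0.
have tp : 0 < t by rewrite lt_def tn.
have sp : 0 < s by rewrite lt_def sn.
have vec (z : T -> H) (r : R) : (forall u, K (z u)) -> 0 < r ->
    r = \sum_u sqn (@ip R H) (z u) ->
    mstate (@cssn R A m) (fun q : T -> T -> A => r^-1 * vecf (@ip R H) gf z q).
  move=> zK r0 re; pose k : C := (Num.sqrt r^-1)%:C.
  have kz u : K (k *: z u) by exact: KZ.
  have ck : cabs k ^+ 2 = r^-1.
    by rewrite cabsR real_normK ?num_real // sqr_sqrtr // invr_ge0 ltW.
  have := vec_mstate (hpm m) hK (ip_form K) level_prep level_unital level_bound kz.
  have -> : vecf (@ip R H) gf (fun u => k *: z u) = fun q : T -> T -> A => r^-1 * vecf (@ip R H) gf z q.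
    apply/funext => q; rewrite /vecf -ck -ReZ -cabs_sqr mulr_sumr; congr (complex.Re _).
    apply: eq_bigr => u _; rewrite mulr_sumr; apply: eq_bigr => w _.
    by rewrite (prep_rZ hK level_prep) // ipZl ipZr mulrA.
  apply; have -> : \sum_u sqn (@ip R H) (k *: z u) = r^-1 * \sum_u sqn (@ip R H) (z u).
    by rewrite mulr_sumr; apply: eq_bigr => u _; rewrite (sqnZ (@subspT R H) (ip_form setT)) // ck.
  by rewrite -re mulVf ?gt_eqF.
have phiE (v : T -> T -> A) : phi m v = vecf (@ip R H) gf x v + vecf (@ip R H) gf y v.
  have [h1 _ _ _ _] := hphi m.
  have e (u w : T) : complex.Re (Bm m (lm (v u w) (eu w)) (eu u)) =
      complex.Re (ip (gf (v u w) (x w)) (x u)) + complex.Re (ip (gf (v u w) (y w)) (y u)).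
    rewrite -ReD -ip_io_io -gf_io -/(xi w) -/(xi u) [xi w]xie [xi u]xie.
    rewrite (prep_rD level_prep) // !ipDl !ipDr fy // yp; last exact: Lf.
    by rewrite addr0 add0r.
  rewrite (mst_entries v h1) /vecf; under eq_bigr => u _ do under eq_bigr => w _ do rewrite e.
  rewrite !Re_sum -big_split; apply: eq_bigr => u _; rewrite !Re_sum; exact: big_split.
have xe : (fun q : T -> T -> A => t^-1 * vecf (@ip R H) gf x q) = phi m.
  apply: extr; left; exists t, (fun q : T -> T -> A => s^-1 * vecf (@ip R H) gf y q); split.
  - by apply/andP; split=> //; lra.
  - exact: vec.
  - exact: vec.
  - have -> : 1 - t = s by lra.
    by move=> v; rewrite !mulrA !mulfV ?mul1r.
have xt u : x u = t%:C *: xi u.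
  apply/eqP; rewrite -subr_eq0; apply/eqP/level_eu.
    by apply: KB => //; exact: KZ.
  move=> a w; rewrite -/(xi w) ipBr ipZr cjR.
  have vE (z : T -> H) (c : A) : (forall u, K (z u)) -> vecf (@ip R H) gf z (outer (eu u) (lm c (eu w))) =
      complex.Re (ip (gf c (z w)) (z u)).
    move=> zK.
    rewrite /vecf (bigD1 u) //= [X in _ + X]big1 ?addr0; last first.
      move=> k ku; rewrite big1 // => l _.
      by rewrite /outer /lm /eu (negbTE ku) star0 mul0r (prep0 level_prep) // ?ip0l.
    rewrite (bigD1 w) //= [X in _ + X]big1 ?addr0; last first.
      by move=> l lw; rewrite /outer /lm /eu (negbTE lw) !mulr0 (prep0 level_prep) // ?ip0l.
    by rewrite /outer /lm /eu !eqxx star1 mul1r mulr1.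
  have key (c : A) : complex.Re (ip (gf c (xi w)) (x u)) = t * complex.Re (ip (gf c (xi w)) (xi u)).
    have h : t^-1 * vecf (@ip R H) gf x (outer (eu u) (lm c (eu w))) =
        phi m (outer (eu u) (lm c (eu w))) by rewrite -xe.
    rewrite vE // in h.
    have -> : ip (gf c (xi w)) (x u) = ip (gf c (x w)) (x u).
      by rewrite [xi w]xie (prep_rD level_prep) // ipDl fy // addr0.
    have -> : complex.Re (ip (gf c (xi w)) (xi u)) = phi m (outer (eu u) (lm c (eu w))).
      by rewrite gf_io ip_io_io.
    by rewrite -h mulrA mulfV // mul1r.
  (* [key] compares real parts only; i a supplies the imaginary parts. *)
  have k1 := key a; have := key ('i%C *: a); rewrite (prepZ level_prep) // !ipZl.
  case: (ip (gf a (xi w)) (x u)) k1 => r1 i1; case: (ip (gf a (xi w)) (xi u)) => r2 i2 /=.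
  by move=> k1 k2; apply/eqP; rewrite eq_complex /=; apply/andP; split; apply/eqP; lra.
apply: full => u; suff yz : y u = 0 by rewrite xie yz addr0.
have Lxi : L (xi u).
  have -> : xi u = t^-1%:C *: x u by rewrite xt scalerA -rmorphM mulVf // rmorph1 scale1r.
  exact: (subspZ hLs).
apply: ip_self0; rewrite yp //.
have -> : y u = xi u - x u by rewrite xie addrC addKr.
exact: (subspB hLs).
Qed.

Lemma level_boundary : m_boundary_rep m S (layer gE m) gf.
Proof.
rewrite layer_gE; split.
- split.
  + by have [h _ _] := level_mCP.
  + by case: level_prep => h1 h2 h3 h4 h5; split.
  + move=> K0; have := eu_norm1 (hphi m); rewrite big1 => [/eqP|u _].
      by rewrite eq_sym oner_eq0.
    have : K (io m (eu u)) by exact: io_gAt.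
    by rewrite K0 /= => h; rewrite /sqn -ip_io_io h ip0l.
  + exact: level_irr.
- exact: level_mCP.
- by move=> x; exact: level_unital.
- exact: level_unique.
Qed.

End Level.
End GammaSpace.

(** * Arveson extension *)

Section Shift.
Context (R : realType) (A : frechetLocCStarType R) (W : lmodType R[i]) (D : set W).
Context (B : W -> W -> R[i]) (f : A -> W -> W) (bnd : A -> R).
Hypotheses (hD : linear_subspace D) (hB : psdform D B) (hf : prerep D B f).
Hypothesis bnd0 : forall a, 0 <= bnd a.
Hypothesis hbnd : forall a w, D w -> fnorm B (f a w) <= bnd a * fnorm B w.
Hypothesis f1 : forall w, D w -> f 1 w = w.
Local Notation C := R[i].
Variable n : nat.
Implicit Types (x : 'M[A]_n) (v w : 'I_n -> W).
Local Notation Dv := (Dn D (n := n)).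
Local Notation Bv := (Bn B (n := n)).
Local Notation nn := (fnorm Bv).

Definition tsub (t : R) x : 'M[A]_n :=
  \matrix_(i, j) ((if i == j then t%:C *: 1 else 0) - x i j).

Lemma act_tsub t x v : Dv v -> act f (tsub t x) v = t%:C *: v - act f x v.
Proof.
move=> hv; apply/funext => i; rewrite /act -[RHS]/(t%:C *: v i - act f x v i) /act.
under eq_bigr => j _ do rewrite mxE -scaleN1r (prepD hf) // (prepZ hf) // scaleN1r.
rewrite big_split /= sumrN (bigD1 i) //= eqxx (prepZ hf) // f1 // big1 ?addr0 // => j ji.
by rewrite eq_sym (negbTE ji) (prep0 hf).
Qed.

Lemma Bv_tsub t x v : Dv v -> complex.Re (Bv (act f (tsub t x) v) v) =
  t * sqn Bv v - complex.Re (Bv (act f x v) v).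
Proof.
move=> hv; have hx := act_st hD hf x hv; have nd := Dn_sub hD n; have nf := Bn_form hB n.
have htv := subspZ nd t%:C hv.
rewrite act_tsub // (formDl nf) // ?(formNl nd nf) // ?(formZl nd nf) //; last exact: (subspN nd).
by rewrite ReD ReN ReZ.
Qed.

(** Cauchy-Schwarz for the form <x v, w> gives |x v|^2 <= t <x v, v>, and expanding |t v - x v|^2
    finishes. Positivity is thereby expressed through norms, the only thing a complete isometry on S
    preserves. *)
Lemma opq_shift x (t : R) : mxstar x = x ->
  (forall v, Dv v -> 0 <= complex.Re (Bv (act f x v) v)) -> opq D B f x <= t ->
  opq D B f (tsub t x) <= t.
Proof.
move=> sx xpos xt; have nd := Dn_sub hD n; have nf := Bn_form hB n.
have t0 : 0 <= t by apply: le_trans (opq_ge0 hD hB hf bnd0 hbnd x) xt.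
have hx v : Dv v -> Dv (act f x v) by move=> hv; exact: (act_st hD hf).
pose th v w := Bv (act f x v) w.
have adj v w : Dv v -> Dv w -> th v w = Bv v (act f x w).
  by move=> hv hw; rewrite /th (act_adj hD hB hf) // sx.
have hth : psdform Dv th.
  split=> [c v w u hv hw hu|v w hv hw|v hv].
  - have e : act f x (c *: v + w) = c *: act f x v + act f x w.
      apply/funext => i; rewrite -[RHS]/(c *: act f x v i + act f x w i) /act.
      rewrite scaler_sumr -big_split /=.
      apply: eq_bigr => j _; case: hf => _ _ h _ _; exact: h.
    by case: nf => h _ _; rewrite /th e h //; exact: hx.
  - by rewrite adj // -(formC nf) //; exact: hx.
  - rewrite lecE /= xpos // andbT; have := adj v v hv hv.
    rewrite (formC nf (hx v hv) hv) /th; case: (Bv _ v) => a b [e]; apply/eqP => /=.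
    lra.
apply: (le_opq hD hB hf bnd0 hbnd) => // v hv.
have hxv := hx v hv; have htv := subspZ nd t%:C hv.
have key : sqn Bv (act f x v) <= t * sqn th v.
  have [z|nz] := eqVneq (sqn Bv (act f x v)) 0.
    by rewrite z mulr_ge0 // (sqn_ge0 hth).
  have np : 0 < sqn Bv (act f x v) by rewrite lt_def nz (sqn_ge0 nf).
  have cs := cauchy_schwarz nd hth hv hxv.
  have e : cabs (th v (act f x v)) = sqn Bv (act f x v).
    by rewrite /th (form_sqn nf) // cabsR ger0_norm // (sqn_ge0 nf).
  have b : sqn th (act f x v) <= t * sqn Bv (act f x v).
    apply: le_trans (cabs_Re _) _; apply: le_trans (cauchy_schwarz nd nf (hx _ hxv) hxv) _.
    rewrite -(fnorm_sqr nf hxv) expr2 mulrA ler_wpM2r ?fnorm_ge0 //.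
    apply: le_trans (opq_le hD hB hf bnd0 hbnd _ hxv) _.
    by rewrite ler_wpM2r ?fnorm_ge0.
  have c : cabs (th v (act f x v)) ^+ 2 <= sqn th v * sqn th (act f x v).
    rewrite -(fnorm_sqr hth hv) -(fnorm_sqr hth hxv) -exprMn lerXn2r ?nnegrE ?cabs_ge0 //.
    by rewrite mulr_ge0 ?fnorm_ge0.
  rewrite -(ler_pM2r np) -expr2 -e; apply: le_trans c _.
  by rewrite e [t * _]mulrC -mulrA ler_wpM2l // (sqn_ge0 hth).
apply: sqrt_le; first by rewrite mulr_ge0 ?fnorm_ge0.
rewrite act_tsub // exprMn (fnorm_sqr nf hv).
rewrite (sqnD nd nf) //; last exact: (subspN nd).
rewrite (sqnZ nd nf) // (formNr nd nf) // (formZl nd nf) // cabsR ReN ReZ real_normK ?num_real //.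
have -> : sqn Bv (- act f x v) = sqn Bv (act f x v).
  by rewrite /sqn (formNl nd nf) ?(formNr nd nf) ?opprK //; exact: (subspN nd).
have -> : complex.Re (Bv v (act f x v)) = sqn th v by rewrite -adj.
have := sqn_ge0 nf hxv; lra.
Qed.

End Shift.

Section Free.
Context (R : realType) (T : choiceType) (P : set T) (A : lmodType R[i]).
Local Notation C := R[i].
Implicit Types (v w : T -> A) (s : seq T).

Definition supported s v := (forall t, t \in s -> P t) /\ forall t, t \notin s -> v t = 0.
(** Formal sums of elements of A attached to points of P; [Fsum] is the linear extension of a family
    of functionals on A. *)
Definition fs : set (T -> A) := [set v | exists2 s, uniq s & supported s v].

Definition dl t (a : A) : T -> A := fun u => if u == t then a else 0.

Lemma fs_common v w : fs v -> fs w -> exists s, [/\ uniq s, supported s v & supported s w].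
Proof.
move=> [s _ [s1 s2]] [r _ [r1 r2]]; exists (undup (s ++ r)); split.
- exact: undup_uniq.
- split=> t; rewrite mem_undup mem_cat.
    by case/orP; [exact: s1|exact: r1].
  by rewrite negb_or => /andP[h _]; exact: s2.
- split=> t; rewrite mem_undup mem_cat.
    by case/orP; [exact: s1|exact: r1].
  by rewrite negb_or => /andP[_ h]; exact: r2.
Qed.

Lemma supported_lin s (c : C) v w : supported s v -> supported s w -> supported s (c *: v + w).
Proof.
move=> [h1 h2] [_ h3]; split=> // t ts.
by transitivity (c *: v t + w t); rewrite // h2 // h3 // scaler0 addr0.
Qed.

Lemma fs_sub : linear_subspace fs.
Proof.
split; first by exists [::].
move=> c v w hv hw; have [s [us s1 s2]] := fs_common hv hw.
by exists s => //; exact: supported_lin.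
Qed.

Lemma fs_dl t a : P t -> fs (dl t a).
Proof.
move=> Pt; exists [:: t] => //; split=> u; rewrite inE; first by move/eqP->.
by rewrite /dl => /negbTE ->.
Qed.

Lemma dl_lin t (c : C) a b : dl t (c *: a + b) = c *: dl t a + dl t b.
Proof.
apply/funext => u; transitivity (c *: dl t a u + dl t b u) => //.
by rewrite /dl; case: ifP; rewrite // scaler0 addr0.
Qed.

Lemma fs_ind (Q : (T -> A) -> Prop) : Q 0 -> (forall v w, fs v -> fs w -> Q v -> Q w -> Q (v + w)) ->
  (forall t a, P t -> Q (dl t a)) -> forall v, fs v -> Q v.
Proof.
move=> Q0 QD Qd v [s _]; elim: s v => [|t s IH] v [s1 s2].
  by have -> : v = 0 by apply/funext => t; exact: s2.
pose v' : T -> A := fun u => if u == t then 0 else v u.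
have -> : v = dl t (v t) + v'.
  apply/funext => u; transitivity (dl t (v t) u + v' u) => //.
  by rewrite /dl /v'; case: eqP => [->|_]; rewrite ?addr0 ?add0r.
have Pt : P t by apply: s1; rewrite mem_head.
have hv' : supported s v'.
  split=> u us; first by apply: s1; rewrite inE us orbT.
  by rewrite /v'; case: eqP => // /eqP ut; apply: s2; rewrite inE negb_or ut.
have fv' : fs v'.
  exists (undup s); first exact: undup_uniq.
  by case: hv' => a b; split=> u; rewrite mem_undup; [exact: a|exact: b].
by apply: QD => //; [exact: fs_dl|exact: Qd|exact: IH].
Qed.

Variable phi : T -> A -> C.
Hypothesis phi_lin : forall t c a b, P t -> phi t (c *: a + b) = c * phi t a + phi t b.

Definition Fsum v : C := \sum_(t <- xget [::] [set s | uniq s /\ supported s v]) phi t (v t).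

Lemma phi0 t : P t -> phi t 0 = 0.
Proof.
move=> Pt; have := phi_lin (-1) 0 0 Pt.
by rewrite scaleN1r addr0 oppr0 mulN1r addNr.
Qed.

Lemma FsumE s v : uniq s -> supported s v -> Fsum v = \sum_(t <- s) phi t (v t).
Proof.
move=> us hs; rewrite /Fsum; set r := xget _ _.
have [ur hr] : uniq r /\ supported r v.
  by rewrite /r; case: xgetP => [r' _ []//|/(_ s)]; case.
have K a b : uniq a -> uniq b -> supported a v -> supported b v ->
    \sum_(t <- a) phi t (v t) = \sum_(t <- [seq t <- a | t \in b]) phi t (v t).
  move=> ua ub [a1 a2] [b1 b2]; rewrite big_filter [LHS]big_seq [RHS]big_mkcond [RHS]big_seq.
  by apply: eq_bigr => t ta; case: ifP => // /negbT /b2 ->; rewrite phi0 //; exact: a1.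
rewrite (K r s) // (K s r) //; apply: perm_big; apply: uniq_perm; rewrite ?filter_uniq // => t.
by rewrite !mem_filter andbC.
Qed.

Lemma Fsum_lin (c : C) v w : fs v -> fs w -> Fsum (c *: v + w) = c * Fsum v + Fsum w.
Proof.
move=> hv hw; have [s [us s1 s2]] := fs_common hv hw.
rewrite !(@FsumE s) //; last exact: supported_lin.
rewrite mulr_sumr -big_split /= big_seq [RHS]big_seq; apply: eq_bigr => t ts.
by rewrite -phi_lin //; case: s1 => h _; exact: h.
Qed.

Lemma Fsum_dl t a : P t -> Fsum (dl t a) = phi t a.
Proof.
move=> Pt; rewrite (@FsumE [:: t]) ?big_seq1 /dl ?eqxx //.
by split=> u; rewrite inE; [move/eqP->|move/negbTE->].
Qed.

End Free.

Lemma rlin_sum (R : realType) (V : lmodType R[i]) (D : set V) (phi : V -> R) I (r : seq I)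
  (F : I -> V) : linear_subspace D -> rlin D phi -> (forall i, D (F i)) ->
  D (\sum_(i <- r) F i) /\ phi (\sum_(i <- r) F i) = \sum_(i <- r) phi (F i).
Proof.
move=> hD h hF; elim/big_rec2: _ => [|i x y _ [h1 <-]].
  by split; [exact: subsp0|exact: (rlin0 hD)].
by split; [exact: subspD|rewrite h.1].
Qed.

Section Arveson.
Context (R : realType) (A : frechetLocCStarType R) (S : set A) (m : nat).
Context (H : hilbertType R) (K : set H) (f : A -> H -> H) (q : A -> R).
Local Notation C := R[i].
Let p : A -> R := cssn m.
Let hp : csn p := cssn_csn A m.
Let p1 : p 1 = 1 := cssn1 m.
Let cp : qcomplete p := csn_qcomplete hp (fun a => lexx (p a)).
Hypotheses (opS : local_operator_system S) (hK : linear_subspace K).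
Hypotheses (hf : prerep K (@ip R H) f) (f1 : forall x, K x -> f 1 x = x).
Hypothesis hbnd : forall a x, K x -> hn (f a x) <= p a * hn x.
Hypotheses (hq : csn q) (q1 : q 1 = 1) (qp : forall a, q a <= p a).
Hypothesis qS : forall n (s : 'M[A]_n.+1), (forall i j, S (s i j)) -> mxcsn q s = mxcsn p s.
Let cq : qcomplete q := csn_qcomplete hq qp.
Local Notation T := (H * H)%type.
Implicit Types (z : T) (v w : T -> A) (b c : H -> A) (x y : H) (a : A).

Let hS : linear_subspace S. Proof. by case: opS. Qed.
Let Sst a : S a -> S (star a). Proof. by case: opS => _ h _; exact: h. Qed.
Let S1 : S 1. Proof. by case: opS. Qed.

(** A map g into B(K) corresponds to the functional sending v to the sum of <g (v (y, x)) x, y> over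
    pairs, and complete positivity of g to positivity of the functional on [cone]. Arveson's theorem
    becomes the extension of a positive functional from [SD] to all finitely supported v. *)
Definition Kz : set T := [set z | K z.1 /\ K z.2].
Local Notation D := (fs (A := A) Kz).
Definition outer2 c b : T -> A := fun z => star (c z.1) * b z.2.
Definition vst2 v : T -> A := fun z => star (v (z.2, z.1)).
(** Positivity modulo ker q: twice the real part of v is a sum of squares up to q-null entries. As
    null functions and their negatives lie in the cone, a positive functional kills them; this makes
    the extension vanish on ker q. *)
Definition cone : set (T -> A) := [set v | exists (bs : seq (H -> A)) (n : T -> A),
  (forall z, q (n z) = 0) /\ v + vst2 v = \sum_(b <- bs) outer2 b b + n].
Definition Fv v : C := Fsum Kz (fun z a => ip (f a z.2) z.1) v.
Definition SD : set (T -> A) := [set w | D w /\ forall z, S (w z)].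

Let F_lin z (c : C) a a' : Kz z -> ip (f (c *: a + a') z.2) z.1 = c * ip (f a z.2) z.1 + ip (f a' z.2) z.1.
Proof. by move=> [_ h]; case: hf => _ hl _ _ _; rewrite hl // ip_lin. Qed.

Lemma Fv_lin (c : C) v w : D v -> D w -> Fv (c *: v + w) = c * Fv v + Fv w.
Proof. exact: (Fsum_lin F_lin). Qed.

Lemma Fv_matrix v : D v -> exists n (x : 'I_n.+1 -> H), (forall i, K (x i)) /\
  Fv v = \sum_i \sum_j ip (f (v (x i, x j)) (x j)) (x i).
Proof.
move=> [s _ [s1 s2]].
(* 0 is added to make the list nonempty, since matrix sizes are successors. *)
pose X := undup (0 :: [seq z.1 | z <- s] ++ [seq z.2 | z <- s]).
have uX : uniq X by exact: undup_uniq.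
have KX x : x \in X -> K x.
  rewrite mem_undup inE mem_cat => /orP[/eqP->|/orP[]].
  - exact: subsp0 hK.
  - by move=> /mapP[z /s1 [h _] ->].
  - by move=> /mapP[z /s1 [_ h] ->].
have : (0 < size X)%N.
  have : (0 : H) \in X by rewrite mem_undup mem_head.
  by case: X {uX KX}.
case eX : (size X) => [//|n] _.
exists n, (fun i => nth 0 X i); split=> [i|]; first by apply: KX; rewrite mem_nth // eX.
rewrite /Fv (@FsumE _ _ Kz A _ F_lin [seq (x, y) | x <- X, y <- X]).
- rewrite big_allpairs (big_nth 0) eX big_mkord; apply: eq_bigr => i _.
  by rewrite (big_nth 0) eX big_mkord.
- by apply: allpairs_uniq => // -[x y] [x' y'] _ _ [-> ->].
- split=> z.
    by move=> /allpairsP[[x y] [/= hx hy ->]]; split; exact: KX.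
  move=> zX; apply: s2; apply: contra zX => zs; apply/allpairsP; exists z.
  rewrite !mem_undup !inE !mem_cat; split; last by case: z zs.
    by rewrite (map_f fst zs) /= orbT.
  by rewrite (map_f snd zs) /= !orbT.
Qed.

Lemma state_null (phi : A -> R) a : state q phi -> q a = 0 -> phi a = 0.
Proof.
move=> [h1 h2 _ _ _] qa; apply: le_anti; rewrite -{1}qa h2 /=.
by have := h2 (- a); rewrite (rlinN h1) // (scN hq) qa oppr_le0.
Qed.

Definition symmx n (x : 'I_n -> H) v : 'M[A]_n :=
  \matrix_(i, j) (v (x i, x j) + star (v (x j, x i))).

(** In every GNS representation of a q-state the matrix is positive, as a sum of squares plus null
    entries, and of norm at most t, so [opq_shift] applies. *)
Lemma cone_matrix n (x : 'I_n.+1 -> H) v : cone v ->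
  mxcsn q (tsub (mxcsn q (symmx x v)) (symmx x v)) <= mxcsn q (symmx x v).
Proof.
set M := symmx x v => -[bs [nl [qn e]]]; set t := mxcsn q M.
have rq (y : 'M[A]_n.+1) : mxcsn q y = repnorm q y := mxcsn_repnorm hq q1 cq y.
have Me i j : M i j = \sum_(b <- bs) star (b (x i)) * b (x j) + nl (x i, x j).
  rewrite mxE -[LHS]/((v + vst2 v) (x i, x j)) e.
  by rewrite -[LHS]/((\sum_(b <- bs) outer2 b b) (x i, x j) + _) fct_sumE.
have sM : mxstar M = M.
  by apply/matrixP => i j; rewrite !mxE starD starK addrC.
rewrite [leLHS]rq; apply: repnorm_le => // phi hs.
apply: (opq_shift (@subspT R A) (gns_form hs) (gns_prep phi) (sc_ge0 hq)) => //.
- by move=> a w _; exact: (state_bound hq).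
- by move=> w _; rewrite mul1r.
- move=> w _; have [h1 _ h3 _ _] := hs; have hT := @subspT R A.
  have -> : complex.Re (Bn (gns phi) (act (fun a w : A => a * w) M w) w) =
      phi (\sum_i \sum_j star (w i) * (M i j * w j)).
    rewrite Re_sum (rlin_sum _ hT h1 _).2 //; apply: eq_bigr => i _.
    by rewrite /gns Re_cplx mulr_sumr.
  have -> : \sum_i \sum_j star (w i) * (M i j * w j) =
      \sum_(b <- bs) star (\sum_i b (x i) * w i) * (\sum_j b (x j) * w j) +
      \sum_i \sum_j star (w i) * nl (x i, x j) * w j.
    under eq_bigr => i _ do under eq_bigr => j _ do
      rewrite Me mulrDl mulrDr mulr_suml mulr_sumr mulrA.
    under eq_bigr => i _ do rewrite big_split /= exchange_big /=.
    rewrite big_split /= exchange_big /=; congr (_ + _); apply: eq_bigr => b _.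
    rewrite star_sum mulr_suml; apply: eq_bigr => i _.
    rewrite mulr_sumr; apply: eq_bigr => j _; by rewrite starM !mulrA.
  rewrite h1.1 // (rlin_sum _ hT h1 _).2 //; apply: addr_ge0.
    by apply: sumr_ge0 => b _; exact: h3.
  rewrite (rlin_sum _ hT h1 _).2 //; apply: sumr_ge0 => i _.
  rewrite (rlin_sum _ hT h1 _).2 //; apply: sumr_ge0 => j _.
  by rewrite (state_null hs) // -mulrA (kerMl hq) // (kerMr hq).
- by rewrite /t rq; exact: (opphi_repnorm hq q1).
Qed.

(** The matrix t - M has entries in S, so its norm for p equals its norm for q, which is at most t
    by [cone_matrix]. As f is bounded by p, the norm of f (t - M) is at most t, and hence <f(M) x,
    x> is nonnegative. *)
Lemma F_pos w : SD w -> cone w -> 0 <= complex.Re (Fv w).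
Proof.
move=> [Dw Sw] cw; have [n [x [Kx ->]]] := Fv_matrix Dw.
have := cone_matrix x cw; set M := symmx x w; set t := mxcsn q M => ht.
have SM i j : S (M i j).
  by rewrite mxE; apply: (subspD hS); [|apply: Sst]; exact: Sw.
have St i j : S (tsub t M i j).
  rewrite mxE; apply: (subspB hS) => //; case: ifP => _; last exact: subsp0 hS.
  exact: (subspZ hS).
have fb := ip_form K; have hQ := opq_csn hK fb hf (sc_ge0 hp) hbnd n.+1.
have kQ : kills p (opq K (@ip R H) f (n := n.+1)).
  move=> y py; apply: le_anti; rewrite (opq_ge0 hK fb hf (sc_ge0 hp) hbnd) andbT.
  apply: le_trans (opq_le_sum hK fb hf (sc_ge0 hp) hbnd _) _.
  by rewrite big1 // => i _; rewrite big1.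
have Qt : opq K (@ip R H) f (tsub t M) <= t.
  by apply: le_trans (mxcsn_ge hp p1 cp hQ kQ _) _; rewrite -qS.
have t0 : 0 <= t by apply: le_trans Qt; exact: (opq_ge0 hK fb hf (sc_ge0 hp) hbnd).
have hx : Dn K x by [].
have nf := Bn_form fb n.+1; have nd := Dn_sub hK n.+1.
have := Bv_tsub hK fb hf f1 t M hx.
have hax := act_st hK hf (tsub t M) hx.
have h1 : complex.Re (Bn (@ip R H) (act f (tsub t M) x) x) <= t * sqn (Bn (@ip R H) (n := n.+1)) x.
  apply: le_trans (cabs_Re _) _; apply: le_trans (cauchy_schwarz nd nf hax hx) _.
  rewrite -(fnorm_sqr nf hx) expr2 mulrA ler_wpM2r ?fnorm_ge0 //.
  apply: le_trans (opq_le hK fb hf (sc_ge0 hp) hbnd _ hx) _.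
  by rewrite ler_wpM2r ?fnorm_ge0.
have -> : complex.Re (Bn (@ip R H) (act f M x) x) =
    2 * complex.Re (\sum_i \sum_j ip (f (w (x i, x j)) (x j)) (x i)).
  have -> : Bn (@ip R H) (act f M x) x = \sum_i \sum_j ip (f (w (x i, x j)) (x j)) (x i) +
      cj (\sum_i \sum_j ip (f (w (x i, x j)) (x j)) (x i)).
    rewrite cj_sum; under [X in _ = _ + X]eq_bigr => i _ do rewrite cj_sum.
    rewrite [X in _ = _ + X]exchange_big /= -big_split /=; apply: eq_bigr => i _.
    rewrite ip_suml -big_split /=; apply: eq_bigr => j _.
    rewrite mxE (prepD hf) // ipDl; congr (_ + _).
    by case: hf => _ _ _ _ ->; rewrite // starK ipC.
  by rewrite ReD ReJ; lra.
move: h1; lra.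
Qed.

Lemma outer2_dl y x (a b : A) : outer2 (dl y a) (dl x b) = dl ((y, x) : T) (star a * b).
Proof.
apply/funext => -[z1 z2]; rewrite /outer2 /dl /= xpair_eqE.
by case: (z1 == y); case: (z2 == x); rewrite /= ?star0 ?mul0r ?mulr0.
Qed.

Lemma vst2_dl y x a : vst2 (dl ((y, x) : T) a) = dl ((x, y) : T) (star a).
Proof.
apply/funext => -[z1 z2]; rewrite /vst2 /dl /= !xpair_eqE andbC.
by case: ifP; rewrite ?star0.
Qed.

Lemma vst2D v w : vst2 (v + w) = vst2 v + vst2 w.
Proof.
by apply/funext => z; rewrite /vst2 -[RHS]/(star _ + star _) -starD.
Qed.

Lemma vst2Z (c : C) v : vst2 (c *: v) = cj c *: vst2 v.
Proof. by apply/funext => z; rewrite /vst2 -[RHS]/(cj c *: star _) -starZ. Qed.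

Lemma vst2N v : vst2 (- v) = - vst2 v.
Proof. by rewrite -scaleN1r vst2Z cjN cj1 scaleN1r. Qed.

Lemma vst2K v : vst2 (vst2 v) = v.
Proof. by apply/funext => -[z1 z2]; rewrite /vst2 starK. Qed.

Lemma vst2_outer c b : vst2 (outer2 c b) = outer2 b c.
Proof. by apply/funext => z; rewrite /vst2 /outer2 starM starK. Qed.

Lemma outer2_linr (c : C) d b b' : outer2 d (c *: b + b') = c *: outer2 d b + outer2 d b'.
Proof.
apply/funext => z; rewrite /outer2 -[RHS]/(c *: (_ * _) + _ * _).
by rewrite -[(c *: b + b') z.2]/(c *: b z.2 + b' z.2) mulrDr -scalerAr.
Qed.

Lemma outer2Dr d b b' : outer2 d (b + b') = outer2 d b + outer2 d b'.
Proof. by rewrite -[b]scale1r outer2_linr !scale1r. Qed.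

Lemma outer2Dl d b b' : outer2 (b + b') d = outer2 b d + outer2 b' d.
Proof. by rewrite -vst2_outer outer2Dr vst2D !vst2_outer. Qed.

Lemma outer2Zr (c : C) d b : outer2 d (c *: b) = c *: outer2 d b.
Proof.
have z : outer2 d 0 = 0 by apply/funext => z; rewrite /outer2 mulr0.
by rewrite -[c *: b]addr0 outer2_linr z addr0.
Qed.

Lemma outer2Zl (c : C) d b : outer2 (c *: b) d = cj c *: outer2 b d.
Proof. by rewrite -vst2_outer outer2Zr vst2Z vst2_outer. Qed.

Lemma coneD v w : cone v -> cone w -> cone (v + w).
Proof.
move=> [bs [n [hn e]]] [bs' [n' [hn' e']]]; exists (bs ++ bs'), (n + n'); split.
  by move=> z; rewrite -[(n + n') z]/(n z + n' z) (kerD hq).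
by rewrite vst2D addrACA e e' big_cat /= addrACA.
Qed.

Lemma coneZ (t : R) v : 0 <= t -> cone v -> cone (t%:C *: v).
Proof.
move=> t0 [bs [n [hn e]]]; pose r : C := (Num.sqrt t)%:C.
exists [seq r *: b | b <- bs], (t%:C *: n); split.
  by move=> z; rewrite -[(t%:C *: n) z]/(t%:C *: n z) (kerZ hq).
rewrite vst2Z cjR -scalerDr e scalerDr scaler_sumr big_map; congr (_ + _).
apply: eq_bigr => b _; rewrite outer2Zr outer2Zl scalerA /r cjR -rmorphM -expr2 sqr_sqrtr //.
Qed.

Lemma cone_null v : (forall z, q (v z) = 0) -> cone v.
Proof.
move=> h; exists [::], (v + vst2 v); split; last by rewrite big_nil add0r.
move=> z; rewrite -[(v + vst2 v) z]/(v z + star _) (kerD hq) // (sc_star hq); exact: h.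
Qed.

Lemma cone0 : cone 0.
Proof. by apply: cone_null => z; exact: (sc0 hq). Qed.

Lemma cone_outer b : cone (outer2 b b).
Proof.
exists [:: b; b], 0; split; first by move=> z; exact: (sc0 hq).
by rewrite vst2_outer !big_cons big_nil !addr0.
Qed.

Lemma cone_anti v : v + vst2 v = 0 -> cone v.
Proof.
move=> h; exists [::], 0; split; first by move=> z; exact: (sc0 hq).
by rewrite h big_nil addr0.
Qed.

Lemma SD_sub : linear_subspace SD.
Proof.
split; first by split=> [|z]; [exact: subsp0 (fs_sub _ _)|exact: subsp0 hS].
move=> c v w [h1 h2] [h3 h4]; split; first by apply: (fs_sub Kz A).2.
move=> z; exact: hS.2.
Qed.

(** For a at the pair (u, w), expand the square of 1 at u minus a at w, and bound [star a * a] by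
    tau modulo ker q: half of 1 at (u, u) plus tau at (w, w) dominates. The summand 1 makes tau
    invertible. *)
Lemma dominated v : D v -> exists2 w, SD w & cone (w - v).
Proof.
move: v; apply: fs_ind.
- exists 0; first exact: subsp0 SD_sub.
  by rewrite subrr; exact: cone0.
- move=> v v' _ _ [w hw cw] [w' hw' cw']; exists (w + w'); first exact: (subspD SD_sub).
  by rewrite opprD addrACA; exact: coneD.
move=> [u w] a [/= Ku Kw].
pose tau : R := q a ^+ 2 + 1; have t0 : 0 < tau by have := sqr_ge0 (q a); rewrite /tau; lra.
pose c := tau^-1%:C *: (star a * a).
have sc : star c = c by rewrite starZR sa_SM.
have c1 : q c <= 1.
  rewrite (scZp hq) ?invr_ge0 ?(ltW t0) // (scSM hq) mulrC ler_pdivrMr // mul1r.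
  by rewrite /tau; lra.
have [k [sk kk _ _]] := exact_sqrt hq cq sc c1.
pose w0 : T -> A := (2^-1 : R)%:C *: (dl (u, u) 1 + tau%:C *: dl (w, w) 1).
have Sd x (d : A) : K x -> S d -> SD (dl (x, x) d).
  move=> Kx Sd; split; first by apply: fs_dl; split.
  by move=> z; rewrite /dl; case: ifP => // _; exact: subsp0 hS.
exists w0.
  apply: (subspZ SD_sub); apply: (subspD SD_sub); first exact: Sd.
  by apply: (subspZ SD_sub); exact: Sd.
exists [:: dl u 1 - dl w a; (Num.sqrt tau)%:C *: dl w k], (tau%:C *: dl (w, w) (1 - c - k * k)).
split.
  move=> z; rewrite -[(_ *: _) z]/(tau%:C *: dl (w, w) (1 - c - k * k) z).
  by apply: (kerZ hq); rewrite /dl; case: ifP => // _; exact: (sc0 hq).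
have e0 : w0 + vst2 w0 = dl (u, u) 1 + tau%:C *: dl (w, w) 1.
  rewrite /w0 vst2Z cjR vst2D vst2Z cjR !vst2_dl star1.
  by rewrite -scalerDr half_double.
rewrite vst2D vst2N vst2_dl addrACA e0 !big_cons big_nil addr0.
have -> : outer2 ((Num.sqrt tau)%:C *: dl w k) ((Num.sqrt tau)%:C *: dl w k) =
    tau%:C *: dl (w, w) (k * k).
  by rewrite outer2Zr outer2Zl scalerA cjR -rmorphM -expr2 sqr_sqrtr ?(ltW t0) // outer2_dl sk.
have e1 : outer2 (dl u 1 - dl w a) (dl u 1 - dl w a) =
    dl (u, u) 1 - dl (u, w) a - dl (w, u) (star a) + dl (w, w) (star a * a) :> (T -> A).
  rewrite -[- dl w a]scaleN1r outer2Dr !outer2Dl !outer2Zr !outer2Zl !outer2_dl.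
  rewrite cjN cj1 star1 !mul1r !mulr1 !scaleN1r opprK addrA; congr (_ + _).
  by rewrite addrAC.
have dD (x y : A) : dl (w, w) (x + y) = dl (w, w) x + dl (w, w) y :> (T -> A).
  by rewrite -[x]scale1r dl_lin !scale1r.
have dZ (z : C) (x : A) : dl (w, w) (z *: x) = z *: dl (w, w) x :> (T -> A).
  have h0 : dl (w, w) 0 = 0 :> (T -> A) by apply/funext => j; rewrite /dl; case: ifP.
  by rewrite -[z *: x]addr0 dl_lin h0 addr0.
have eT : tau%:C *: dl (w, w) 1 = dl (w, w) (star a * a) + tau%:C *: dl (w, w) (k * k) +
    tau%:C *: dl (w, w) (1 - c - k * k) :> (T -> A).
  rewrite -addrA -scalerDr -dD -2!dZ -dD; congr (dl _ _).
  have -> : k * k + (1 - c - k * k) = 1 - c by rewrite addrC subrK.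
  by rewrite scalerBr /c scalerA -rmorphM mulfV ?gt_eqF // rmorph1 scale1r addrC subrK.
by rewrite e1 -addrA [tau%:C *: dl _ 1 + _]addrC eT !addrA.
Qed.

Lemma SD_D w : SD w -> D w. Proof. by case. Qed.

Lemma Fv0 : Fv 0 = 0.
Proof.
have h0 : D 0 := subsp0 (fs_sub Kz A).
by have := Fv_lin (-1) h0 h0; rewrite scaleN1r addr0 oppr0 mulN1r addNr.
Qed.

Lemma FvZ (c : C) v : D v -> Fv (c *: v) = c * Fv v.
Proof.
by move=> hv; rewrite -[c *: v]addr0 Fv_lin ?Fv0 ?addr0 //; exact: subsp0 (fs_sub Kz A).
Qed.

Lemma FvD v w : D v -> D w -> Fv (v + w) = Fv v + Fv w.
Proof. by move=> hv hw; rewrite -[v]scale1r Fv_lin // mul1r scale1r. Qed.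

(** The M. Riesz extension argument: N v is the infimum of F over the elements of [SD] above v,
    which is finite because both v and - v are dominated. *)
Lemma positive_extension : exists psi : (T -> A) -> R,
  [/\ rlin D psi, forall w, SD w -> psi w = complex.Re (Fv w) &
      forall v, D v -> cone v -> 0 <= psi v].
Proof.
have hD := fs_sub Kz A.
pose I v := [set complex.Re (Fv w) | w in [set w | SD w /\ cone (w - v)]].
pose N v := inf (I v).
have lb v w' : SD w' -> cone (w' - (- v)) -> lbound (I v) (- complex.Re (Fv w')).
  move=> hw' cw' _ [w [hw cw] <-]; rewrite opprK in cw'.
  have cww : cone (w + w') by have := coneD cw cw'; rewrite addrACA addNr addr0.
  have := F_pos (subspD SD_sub hw hw') cww.
  by rewrite FvD ?ReD; [lra|exact: SD_D|exact: SD_D].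
have leN v w : D v -> SD w -> cone (w - v) -> N v <= complex.Re (Fv w).
  move=> hv hw cw; have [w' hw' cw'] := dominated (subspN hD hv).
  by apply: ge_inf; [exists (- complex.Re (Fv w')); exact: lb|exists w].
have Nle v (z : R) : D v -> (forall w, SD w -> cone (w - v) -> z <= complex.Re (Fv w)) -> z <= N v.
  move=> hv h; have [w hw cw] := dominated hv.
  apply: lb_le_inf; first by exists (complex.Re (Fv w)), w.
  by move=> _ [w' [hw' cw'] <-]; exact: h.
have hN : sublin D N.
  split=> [x y hx hy|t x t0 hx].
    rewrite -lerBlDr; apply: (Nle _ _) => // w hw cw; rewrite lerBlDr -lerBlDl.
    apply: (Nle _ _) => // w' hw' cw'; rewrite lerBlDl.
    rewrite -ReD -FvD; try exact: SD_D.
    apply: (leN _ _); [exact: subspD|exact: (subspD SD_sub)|].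
    by rewrite opprD addrACA; exact: coneD.
  have N_le (s : R) (y : T -> A) : 0 < s -> D y -> N (s%:C *: y) <= s * N y.
    move=> s0 hy; rewrite -ler_pdivrMl //; apply: (Nle _ _) => // w hw cw.
    rewrite ler_pdivrMl // -ReZ -FvZ; last exact: SD_D.
    apply: (leN _ _); [exact: subspZ|exact: (subspZ SD_sub)|].
    by rewrite -scalerBr; apply: coneZ => //; exact: ltW.
  have [->|tn] := eqVneq t 0.
    rewrite scale0r mul0r; apply: le_anti; apply/andP; split.
      have := leN 0 0 (subsp0 hD) (subsp0 SD_sub); rewrite Fv0 subrr; apply; exact: cone0.
    apply: (Nle _ _); first exact: subsp0 hD.
    by move=> w hw; rewrite subr0; exact: F_pos.
  have tp : 0 < t by rewrite lt_def tn.
  apply/eqP; rewrite eq_le N_le //= -ler_pdivlMl //.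
  have := N_le t^-1 (t%:C *: x); rewrite invr_gt0 scalerA -rmorphM mulVf ?gt_eqF //.
  by rewrite rmorph1 scale1r; apply => //; apply: subspZ.
have [psi hpsi psiN] := hahn_banach_le hD hN.
have up w : SD w -> psi w <= complex.Re (Fv w).
  move=> hw; apply: le_trans (psiN w (SD_D hw)) _; apply: (leN _ _) => //; first exact: SD_D.
  by rewrite subrr; exact: cone0.
exists psi; split=> //.
- move=> w hw; apply: le_anti; rewrite up //=.
  have := up (- w) (subspN SD_sub hw); rewrite (rlinN hpsi) //; last exact: SD_D.
  have -> : Fv (- w) = - Fv w by rewrite -scaleN1r FvZ ?mulN1r //; exact: SD_D.
  by rewrite ReN lerN2.
- move=> v hv cv; have := psiN (- v) (subspN hD hv); rewrite (rlinN hpsi) // => h.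
  rewrite -oppr_le0; apply: le_trans h _.
  have := leN (- v) 0 (subspN hD hv) (subsp0 SD_sub); rewrite Fv0 sub0r opprK; exact.
Qed.

Local Notation E := (fs (A := A) K : set (H -> A)).

Theorem arveson_extension : closed K -> exists g : A -> H -> H,
  [/\ m_CP m K g, unital K g, forall s x, S s -> K x -> g s x = f s x &
      forall a x, q a = 0 -> K x -> g a x = 0].
Proof.
move=> cK; have hD := fs_sub Kz A.
have [psi [hpsi psiF psi_pos]] := positive_extension.
have hE : linear_subspace E := fs_sub K A.
have outD c b : E c -> E b -> D (outer2 c b).
  move=> [s us [s1 s2]] [r ur [r1 r2]]; exists [seq (y, x) | y <- s, x <- r].
    by apply: allpairs_uniq => // -[x y] [x' y'] _ _ [-> ->].
  split=> -[y x].
    by move=> /allpairsP[[y' x'] [/= h1 h2 [-> ->]]]; split; [exact: s1|exact: r1].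
  move=> h; rewrite /outer2 /=; have [ys|ys] := boolP (y \in s); last first.
    by rewrite s2 // star0 mul0r.
  rewrite r2 ?mulr0 //; apply: contra h => xr; apply/allpairsP; by exists (y, x).
have vstD v : D v -> D (vst2 v).
  move=> [s us [s1 s2]]; exists [seq (z.2, z.1) | z <- s].
    by rewrite map_inj_uniq // => -[x y] [x' y'] [-> ->].
  split=> -[y x]; first by move=> /mapP[z /s1 [h1 h2] [-> ->]]; split.
  move=> h; rewrite /vst2 /= s2 ?star0 //; apply: contra h => xs.
  by apply/mapP; exists (x, y).
have psi_null v : D v -> (forall z, q (v z) = 0) -> psi v = 0.
  move=> hv h; apply: le_anti; rewrite psi_pos ?andbT //; last exact: cone_null.
  have := psi_pos (- v) (subspN hD hv); rewrite (rlinN hpsi) // => h'.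
  rewrite -oppr_ge0; apply: h'; apply: cone_null => z.
  by rewrite -[(- v) z]/(- v z) (scN hq).
have psi_vst v : D v -> psi (vst2 v) = psi v.
  move=> hv; have hv' := vstD v hv.
  have e w : D w -> D (vst2 w) -> 0 <= psi (vst2 w - w).
    move=> hw hw'; apply: psi_pos; first exact: (subspB hD).
    by apply: cone_anti; rewrite vst2D vst2N vst2K addrC addrA subrK subrr.
  have := e v hv hv'; have := e (vst2 v) hv'; rewrite vst2K => /(_ hv).
  by rewrite !(rlinB hD hpsi) //; lra.
pose B b c := cplx psi (outer2 c b).
have hB : psdform E B.
  apply: (cplx_form hD hpsi (pr := fun b c => outer2 c b) (iv := vst2)) => //.
  - by move=> x y hx hy; exact: outD.
  - by move=> c x x' y _ _ _; exact: outer2_linr.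
  - by move=> x y _ _; rewrite vst2_outer.
  - by move=> c v; rewrite vst2Z.
  - by move=> x hx; apply: psi_pos; [exact: outD|exact: cone_outer].
have Edl a x : K x -> E (dl x a) by exact: fs_dl.
have Ddl a x y : K x -> K y -> D (dl ((y, x) : T) a) by move=> hx hy; apply: fs_dl.
pose G a x y : C := B (dl x a) (dl y 1).
have GE a x y : G a x y = cplx psi (dl ((y, x) : T) a).
  by rewrite /G /B outer2_dl star1 mul1r.
have Bdl a a' x y : B (dl x a) (dl y a') = G (star a' * a) x y.
  by rewrite GE /B outer2_dl.
have Glin (c : C) a a' x y : K x -> K y -> G (c *: a + a') x y = c * G a x y + G a' x y.
  move=> hx hy; rewrite !GE dl_lin (cplxD hD hpsi) ?(cplxZ hD hpsi) //; try exact: Ddl.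
  by apply: (subspZ hD); exact: Ddl.
have Gherm a x y : K x -> K y -> G (star a) y x = cj (G a x y).
  by move=> hx hy; rewrite -[star a]mulr1 -Bdl (formC hB (Edl a x hx)) ?Bdl ?star1 ?mul1r //; exact: Edl.
have GS s x y : S s -> K x -> K y -> G s x y = ip (f s x) y.
  move=> Ss hx hy; rewrite GE.
  have hs : SD (dl ((y, x) : T) s).
    split; first exact: Ddl.
    by move=> z; rewrite /dl; case: ifP => // _; exact: subsp0 hS.
  have hz : Kz (y, x) by [].
  rewrite /cplx psiF // psiF; last exact: (subspZ SD_sub).
  rewrite FvZ; last exact: SD_D.
  rewrite /Fv (Fsum_dl F_lin _ hz) /=; case: (ip _ _) => r1 r2.
  by apply: cplx_eq => //=; ring.
have G1 x y : K x -> K y -> G 1 x y = ip x y.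
  by move=> hx hy; rewrite GS // f1.
have nB x : K x -> fnorm B (dl x 1) = hn x.
  by move=> hx; rewrite /fnorm /sqn Bdl star1 mul1r G1.
(* Vectors of K are formal labels here, so linearity in x has to be proved. The defect xi is
   orthogonal to all [dl u 1], where G is the inner product of H; being a combination of such
   elements, it is null, and Cauchy-Schwarz removes it everywhere. *)
have Glinx (c : C) a x x' y : K x -> K x' -> K y -> G a (c *: x + x') y = c * G a x y + G a x' y.
  move=> hx hx' hy; have hxx : K (c *: x + x') := hK.2 c x x' hx hx'.
  pose eta := c *: dl x 1 + dl x' (1 : A).
  have heta : E eta by apply: hE.2; exact: Edl.
  have hd : E (dl (c *: x + x') 1) := Edl 1 _ hxx.
  pose xi := dl (c *: x + x') 1 - eta.
  have hxi : E xi by exact: (subspB hE).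
  have lin (w : H -> A) : E w -> B xi w = B (dl (c *: x + x') 1) w - (c * B (dl x 1) w + B (dl x' 1) w).
    move=> hw; rewrite /xi (formDl hB) // ?(formNl hE hB) //; last exact: (subspN hE).
    by case: (hB) => h _ _; rewrite h //; exact: Edl.
  have xi0 u : K u -> B xi (dl u 1) = 0.
    move=> hu; rewrite lin ?Bdl ?star1 ?mulr1 ?G1 //; last exact: Edl.
    by rewrite ip_lin subrr.
  have xixi : B xi xi = 0.
    rewrite {2}/xi (formDr hE hB) // ?(formNr hE hB) //; last exact: (subspN hE).
    rewrite xi0 // /eta (formDr hE hB) ?(formZr hE hB) ?xi0 //; try exact: Edl.
      by rewrite mulr0 addr0 subrr.
    by apply: (subspZ hE); exact: Edl.
  have hy' := Edl (star a) y hy.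
  have := cauchy_schwarz hE hB hxi hy'.
  rewrite {1}/fnorm /sqn xixi sqrtr0 mul0r => cs.
  have /cabs_eq0 : cabs (B xi (dl y (star a))) = 0 by apply: le_anti; rewrite cs cabs_ge0.
  by rewrite lin // !Bdl starK !mulr1 => /eqP; rewrite subr_eq0 => /eqP.
have Gbound a : exists2 M : R, 0 <= M & forall x y, K x -> K y -> cabs (G a x y) <= M * hn x * hn y.
  pose tau : R := q a ^+ 2 + 1; have t0 : 0 < tau by have := sqr_ge0 (q a); rewrite /tau; lra.
  exists (Num.sqrt tau); first exact: sqrtr_ge0.
  move=> x y hx hy; apply: le_trans (cauchy_schwarz hE hB (Edl a x hx) (Edl 1 y hy)) _.
  rewrite nB // ler_wpM2r ?hn_ge0 //; apply: sqrt_le.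
    by rewrite mulr_ge0 ?hn_ge0 ?sqrtr_ge0.
  rewrite exprMn sqr_sqrtr ?(ltW t0) // hn_sqr -G1 // /sqn Bdl !GE !Re_cplx.
  pose c := tau^-1%:C *: (star a * a).
  have sc : star c = c by rewrite starZR sa_SM.
  have c1 : q c <= 1.
    rewrite (scZp hq) ?invr_ge0 ?(ltW t0) // (scSM hq) mulrC ler_pdivrMr // mul1r.
    by rewrite /tau; lra.
  have [k [sk kk _ _]] := exact_sqrt hq cq sc c1.
  have e : dl ((x, x) : T) 1 = dl (x, x) c + outer2 (dl x k) (dl x k) + dl (x, x) (1 - c - k * k).
    rewrite outer2_dl sk -[dl (x, x) c]scale1r -dl_lin -[dl _ (_ + _)]scale1r -dl_lin !scale1r.
    by congr (dl _ _); ncring.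
  have ok := outD _ _ (Edl k x hx) (Edl k x hx).
  rewrite e hpsi.1 ?hpsi.1 //; try exact: Ddl; last by apply: (subspD hD) => //; exact: Ddl.
  rewrite [psi (dl _ (1 - c - k * k))]psi_null; [|exact: Ddl|]; last first.
    by move=> z; rewrite /dl; case: ifP => // _; exact: (sc0 hq).
  have -> : dl (x, x) c = tau^-1%:C *: dl ((x, x) : T) (star a * a).
    by apply/funext => z; rewrite -[RHS]/(_ *: dl _ _ _) /dl; case: ifP; rewrite ?scaler0.
  rewrite hpsi.2; last exact: Ddl.
  rewrite addr0 mulrDr mulrA mulfV ?gt_eqF // mul1r lerDl mulr_ge0 ?(ltW t0) //.
  by apply: psi_pos => //; exact: cone_outer.
(* G a x y is antilinear in y, so the Riesz theorem is applied to G (star a) y x. *)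
have [g hg] : exists g : A * H -> H, forall ax, K ax.2 ->
    K (g ax) /\ forall y, K y -> G (star ax.1) y ax.2 = ip y (g ax).
  apply: (choice_ex (P := fun (ax : A * H) y' => K ax.2 ->
    K y' /\ forall y, K y -> G (star ax.1) y ax.2 = ip y y')) => -[a x] /=.
  have [hx|hx] := pselect (K x); last by exists 0.
  have [M M0 hM] := Gbound (star a).
  have [|||y' hy' h] := @riesz _ _ K (fun y => G (star a) y x) (M * hn x) (conj hK cK).
  - by rewrite mulr_ge0 ?hn_ge0.
  - by move=> c y y' hy hy'; exact: Glinx.
  - by move=> y hy; rewrite mulrAC; exact: hM.
  by exists y'.
have gK a x : K x -> K (g (a, x)) by move=> hx; case: (hg (a, x) hx).
have gip a x y : K x -> K y -> ip (g (a, x)) y = G a x y.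
  move=> hx hy; rewrite ipC; have [_ h] := hg (a, x) hx.
  by rewrite -h // -Gherm //= starK.
have ext (u v : H) : K u -> K v -> (forall y, K y -> ip u y = ip v y) -> u = v.
  move=> hu hv h; apply/eqP; rewrite -subr_eq0; apply/eqP/ip_self0.
  by rewrite ipBl h ?subrr //; exact: (subspB hK).
exists (fun a x => g (a, x)); split.
- apply: mCP_intro.
  + move=> a; split; first split=> [x hx|c x y hx hy]; first exact: gK.
      apply: ext => [||u hu].
      * by apply: gK; exact: hK.2.
      * by apply: hK.2; exact: gK.
      by rewrite ip_lin !gip ?Glinx //; exact: hK.2.
    have [M M0 hM] := Gbound a; exists M%:C => x hx.
    rewrite !norm_hn -rmorphM lecR; have gx := gK a x hx.
    have [->|n0] := eqVneq (hn (g (a, x))) 0; first by rewrite mulr_ge0 ?hn_ge0.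
    have np : 0 < hn (g (a, x)) by rewrite lt_def n0 hn_ge0.
    rewrite -(ler_pM2r np) -expr2 hn_sqr; apply: le_trans (cabs_Re _) _.
    by rewrite gip //; exact: hM.
  + move=> c a b x hx; apply: ext => [||u hu]; first exact: gK.
      by apply: hK.2; exact: gK.
    by rewrite ip_lin !gip // Glin.
  + move=> a x pa hx; apply: ext => [||u hu]; [exact: gK|exact: subsp0 hK|].
    rewrite gip // ip0l GE /cplx !psi_null ?oppr0 //; try exact: Ddl.
    * by apply: (subspZ hD); exact: Ddl.
    * move=> z; rewrite -[('i%C *: _) z]/('i%C *: dl _ _ z); apply: (kerZ hq).
      rewrite /dl; case: ifP => _; last exact: (sc0 hq).
      by apply: le_anti; rewrite (sc_ge0 hq) andbT -pa; exact: qp.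
    * move=> z; rewrite /dl; case: ifP => _; last exact: (sc0 hq).
      by apply: le_anti; rewrite (sc_ge0 hq) andbT -pa; exact: qp.
  + move=> n a h hh.
    have hF k : true -> E (dl (h k) (a k)) by move=> _; exact: Edl.
    have [hS' _] := form_suml hE hB (index_enum 'I_n) hF (subsp0 hE).
    suff -> : \sum_k \sum_l ip (g (star (a k) * a l, h l)) (h k) =
        B (\sum_l dl (h l) (a l)) (\sum_l dl (h l) (a l)).
      by case: hB => _ _; apply.
    rewrite (form_suml hE hB (index_enum 'I_n) hF hS').2 exchange_big /=.
    apply: eq_bigr => l _; rewrite (formC hB hS') ?(form_suml hE hB _ hF _).2 ?cj_sum //; try exact: hF.
    apply: eq_bigr => k _; rewrite -(formC hB); try exact: hF.
    by rewrite Bdl gip.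
- by move=> x hx; apply: ext => [||u hu] //; [exact: gK|rewrite gip // G1].
- move=> s x Ss hx; apply: ext => [||u hu]; [exact: gK|exact: (prep_st hf)|].
  by rewrite gip // GS.
- move=> a x qa hx; apply: ext => [||u hu]; [exact: gK|exact: subsp0 hK|].
  rewrite gip // ip0l GE /cplx !psi_null ?oppr0 //; try exact: Ddl.
  + by apply: (subspZ hD); exact: Ddl.
  + move=> z; rewrite -[('i%C *: _) z]/('i%C *: dl _ _ z); apply: (kerZ hq).
    by rewrite /dl; case: ifP => _ //; exact: (sc0 hq).
  + by move=> z; rewrite /dl; case: ifP => _ //; exact: (sc0 hq).
Qed.

End Arveson.

(** * The Shilov boundary ideal *)

Lemma mul_le_half (R : realFieldType) (a b : R) : a ^+ 2 + b ^+ 2 = 1 -> a * b <= 2^-1.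
Proof. move=> ab; have := sqr_ge0 (a - b); rewrite sqrrB -mulr_natl; lra. Qed.

Section BoundaryReps.
Context (R : realType) (A : frechetLocCStarType R) (S : set A) (H : hilbertType R).
Implicit Types (K : set H) (f : A -> H -> H) (E : nat -> set H).

Section OneLevel.
Variables (m : nat) (K : set H) (f : A -> H -> H).
Hypotheses (hK : linear_subspace K) (hb : m_boundary_rep m S K f).

Lemma boundary_prep : prerep K (@ip R H) f.
Proof.
case: hb => -[h1 [h2 h3 h4] _ _] _ _ _; split=> //.
- by move=> a x hx; case: (h1 a) => -[h _] _; exact: h.
- by move=> a c x y hx hy; case: (h1 a) => -[_ h] _; exact: h.
Qed.

Lemma boundary_bound a x : K x -> hn (f a x) <= cssn m a * hn x.
Proof.
move=> hx; case: (hb) => _ hcp hu _; have hp := cssn_csn A m.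
rewrite -ler_sqr ?nnegrE ?mulr_ge0 ?hn_ge0 ?(sc_ge0 hp) // exprMn !hn_sqr.
have := mCP_sq_le hcp a hx; rewrite hu //; apply: le_trans.
case: boundary_prep => st _ _ hM hA.
suff -> : ip (f (star a * a) x) x = ip (f a x) (f a x) by [].
by rewrite hM // hA ?starK //; exact: st.
Qed.

Lemma boundary_unital x : K x -> f 1 x = x.
Proof. by case: hb => _ _ h _; exact: h. Qed.

Lemma boundary_nonzero : exists2 x, K x & hn x != 0.
Proof.
case: hb => -[_ _ K0 _] _ _ _; apply: contrapT => h; apply: K0; apply/seteqP; split=> x /=.
  by move=> hx; apply: hn_eq0; apply/eqP; apply: contrapT => /negP xn; apply: h; exists x.
by move=> ->; exact: subsp0 hK.
Qed.

Lemma boundary_quot (I : set A) a x : closed_star_ideal I ->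
  (forall b y, I b -> K y -> f b y = 0) -> K x ->
  hn (f a x) <= quot_csn (cssn m) I a * hn x.
Proof.
move=> hI fI hx; have [x0|x0] := eqVneq (hn x) 0.
  by have := boundary_bound a hx; rewrite x0 !mulr0.
have xp : 0 < hn x by rewrite lt_def x0 hn_ge0.
rewrite -ler_pdivrMr //; apply: (le_quot hI) => b Ib; rewrite ler_pdivrMr //.
have := boundary_bound (a + b) hx.
by rewrite (prepD boundary_prep) // (fI b x) // addr0.
Qed.

End OneLevel.

Lemma layer_closed E m : quantized_domain E -> closed_subspace (layer E m).
Proof.
case=> hE _ _; case: m => [|m]; first exact: hE.
have [h1 h2] := orthogonal_closed (E m); have [h3 h4] := hE m.+1.
split; last exact: closedI.
split; first by split; [exact: subsp0 h1|exact: subsp0 h3].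
by move=> c x y [a b] [a' b']; split; [exact: h1.2|exact: h3.2].
Qed.

(** Otherwise the quotient seminorm would vanish identically, and isometry would fail at the 1 by 1
    matrix 1. *)
Lemma quot_csn1 m (I : set A) : closed_star_ideal I ->
  (forall n (s : 'M[A]_n.+1), (forall i j, S (s i j)) ->
    mxcsn (quot_csn (cssn m) I) s = mxcsn (cssn m) s) -> S 1 -> S 0 ->
  quot_csn (cssn m) I 1 = 1.
Proof.
move=> hI hs S1 S0; have hp := cssn_csn A m; have hq := quot_csn_csn hp hI.
set q := quot_csn _ _ in hs hq *.
have [q1|q1] := eqVneq (q 1) 0; last first.
  apply: (mulfI q1); rewrite mulr1 -expr2 -(sc_sqr hq) ?mulr1 //; exact: star1.
have q0 a : q a = 0.
  apply: le_anti; rewrite (sc_ge0 hq) andbT -[a]mul1r.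
  by apply: le_trans (scM hq _ _) _; rewrite q1 mul0r.
pose s : 'M[A]_1 := const_mx 1.
have Ss i j : S (s i j) by rewrite mxE.
have e := hs 0%N s Ss.
have : mxcsn (cssn m) s = 0.
  (* [mxcsn_spec] requires q 1 = 1; for the zero seminorm the zero function is the witness. *)
  rewrite -e /mxcsn; set Q := [set _ | _].
  have [_ h] : Q (xget (fun=> 0) Q); last by apply/h.
  apply: xgetPex; exists (fun=> 0); split; last by move=> x; split.
  by split=> *; rewrite ?addr0 ?mulr0 ?expr0n.
move=> /(mxcsn_eq0 hp (cssn1 m) _) /(_ ord0 ord0); rewrite mxE (cssn1 m) => /eqP.
by rewrite oner_eq0.
Qed.

Theorem boundary_ideal_ker E f (I : set A) : local_operator_system S ->
  boundary_ideal S I -> Gamma_boundary_rep S E f -> I `<=` rep_ker E f.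
Proof.
move=> opS [hI hbI] [qE lf hbr] a Ia.
have [hS Sst S1] := opS; have S0 := subsp0 hS.
have lay m x : layer E m x -> f a x = 0.
  have [hK cK] := layer_closed m qE; have hb := hbr m.
  have hp := cssn_csn A m; have hq := quot_csn_csn hp hI.
  have q1 := quot_csn1 hI (hbI m) S1 S0.
  have [g [g1 g2 g3 g4]] := arveson_extension opS hK (boundary_prep hb) (boundary_unital hb)
    (boundary_bound hb) hq q1 (quot_le_self hp hI) (hbI m) cK.
  move=> hx; case: hb => _ _ _ /(_ g g1 g2 g3 a x hx) <-.
  by apply: g4 => //; exact: (quot_ideal hp hI).
have [hE Emono _] := qE; have [hC _ _] := lf.
have linf x y : domain E x -> domain E y -> f a (x + y) = f a x + f a y.
  by move=> hx hy; case: (hC a) => -[_ h] _; rewrite -{1}[x]scale1r h // scale1r.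
(* E (m+1) is the orthogonal sum of E m and the layer m + 1, so vanishing on the layers is
   enough. *)
have lev m x : E m x -> f a x = 0.
  elim: m x => [|m IH] x hx; first exact: (lay 0%N).
  have [y Ey hy] := projection x (hE m).
  have Ey' := Emono _ _ Ey.
  have hxy : E m.+1 (x - y) by apply: subspB (hE m.+1).1 _ _ _ _.
  rewrite -(subrK y x) linf; [|by exists m.+1|by exists m].
  rewrite (IH y) // addr0; apply: (lay m.+1); split=> // z Ez.
  by rewrite -[LHS]/(ip _ _) ipC hy // cj0.
by move=> x [m _ hx]; exact: lev hx.
Qed.

Lemma opnorm_bound K (T : H -> H) x : linear_subspace K -> bounded_op K T -> K x ->
  hn (T x) <= opnorm K T * hn x.
Proof.
move=> hK [[Tst Tl] [M hM]] hx.
have hTb y : K y -> hn (T y) <= cabs M * hn y.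
  move=> hy; have := hM y hy; rewrite !norm_hn lecE => /andP[_ h].
  apply: (le_trans (h : hn (T y) <= _)); apply: le_trans (cabs_Re _) _.
  by rewrite cabsM cabsR ger0_norm ?hn_ge0.
have hs : has_sup [set complex.Re `|T x| | x in [set x | K x /\ `|x| <= 1]].
  split; first by exists (complex.Re `|T 0|), 0 => //; split; [exact: subsp0 hK|rewrite normr0 ler01].
  exists (cabs M) => _ [y [hy y1] <-]; rewrite norm_hn /=; apply: le_trans (hTb y hy) _.
  by rewrite ler_piMr ?cabs_ge0 //; move: y1; rewrite norm_hn lecR.
have [x0|x0] := eqVneq (hn x) 0; first by have := hTb x hx; rewrite x0 !mulr0.
have xp : 0 < hn x by rewrite lt_def x0 hn_ge0.
have T0 : T 0 = 0.
  have := Tl (-1) 0 0 (subsp0 hK) (subsp0 hK).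
  by rewrite scaleN1r addr0 oppr0 scaleN1r addNr.
rewrite -ler_pdivrMr //; apply: (sup_upper_bound hs).
exists ((hn x)^-1%:C *: x).
  split; first exact: (subspZ hK).
  by rewrite norm_hn lecR hnZ cabsR ger0_norm ?invr_ge0 ?hn_ge0 // mulVf.
rewrite norm_hn /= -[_ *: x]addr0 Tl ?T0 ?addr0 //; last exact: subsp0 hK.
by rewrite hnZ cabsR ger0_norm ?invr_ge0 ?hn_ge0 // mulrC.
Qed.

Lemma rep_ker_ideal E f : quantized_domain E -> local_rep E f -> closed_star_ideal (rep_ker E f).
Proof.
move=> [hE _ _] [hC [fl fM fs] hl].
have st a x : domain E x -> domain E (f a x) by case: (hC a) => -[h _] _; exact: h.
have dom0 : domain E 0 by exists 0%N => //; exact: subsp0 (hE 0%N).1.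
have f0 a : f a 0 = 0.
  case: (hC a) => -[_ h] _; have := h (-1) 0 0 dom0 dom0.
  by rewrite scaleN1r addr0 oppr0 scaleN1r addNr.
split.
- split=> [x hx|c a b ha hb x hx].
    by have := fl (-1) 0 0 x hx; rewrite scaleN1r addr0 oppr0 scaleN1r addNr.
  by rewrite fl // ha // hb // scaler0 addr0.
- move=> a b hb; split=> x hx; rewrite fM //; first by rewrite hb // f0.
  by rewrite hb //; exact: st.
- move=> b hb x hx; apply: ip_self0; rewrite /ip fs ?starK //; last exact: st.
  by rewrite hb ?[inner _ _]ip0r //; exact: st.
- move=> a ca x [l _ hx]; have [m hm] := hl l.
  apply: hn_eq0; apply: (@small0 _ _ (hn x)); rewrite ?hn_ge0 // => e e0.
  have [b [hb /= hab]] := ca _ (cssn_ball m a e0).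
  have hx' : domain E x by exists l.
  have -> : f a x = f (a - b) x.
    have := fl (-1) b a x hx'; rewrite hb // scaler0 add0r => <-.
    by rewrite scaleN1r addrC.
  have bo : bounded_op (E l) (f (a - b)) by case: (hC (a - b)) => _ /(_ l) [].
  apply: le_trans (opnorm_bound (hE l).1 bo hx) _; rewrite mulrC ler_wpM2l ?hn_ge0 //.
  by apply: le_trans (hm _) _; exact: ltW.
Qed.

End BoundaryReps.

Section Existence.
Context (R : realType) (A : frechetLocCStarType R) (S : set A).
Hypotheses (opS : local_operator_system S) (genS : generates S).
Local Notation C := R[i].

Section Corner.
Variables (n : nat) (s : 'M[A]_n.+1).
Local Notation T := ('I_n.+1 + 'I_n.+1)%type.

Definition corner (u w : T) : A :=
  match u, w with inl i, inr j => s i j | _, _ => 0 end.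

Lemma vecf_corner (W : lmodType C) (D : set W) (B : W -> W -> C) (f : A -> W -> W)
    (x : T -> W) : linear_subspace D -> psdform D B -> prerep D B f -> (forall u, D (x u)) ->
  vecf B f x corner =
  complex.Re (Bn B (act f s (fun j => x (inr j))) (fun i => x (inl i))).
Proof.
move=> hD hB hf hx; rewrite /vecf big_sumType /= [X in _ + X]big1 ?addr0 => [|i _].
  congr (complex.Re _); rewrite /Bn; apply: eq_bigr => i _.
  rewrite big_sumType /= big1 ?add0r => [|j _]; last by rewrite (prep0 hf) // (form0l hD hB).
  have hF j : true -> D (f (s i j) (x (inr j))) by move=> _; apply: (prep_st hf).
  by rewrite (form_suml hD hB (index_enum 'I_n.+1) hF (hx _)).2.
by apply: big1 => j _; rewrite (prep0 hf) // (form0l hD hB).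
Qed.

End Corner.

Lemma mstate_exists m (T : finType) (t0 : T) : exists phi, mstate (T := T) (@cssn R A m) phi.
Proof.
have hp := cssn_csn A m; have [phi hs _] := state_exists 1 hp (cssn1 m).
have hT := @subspT R A; have hB := gns_form hs.
exists (vecf (gns phi) (fun a w : A => a * w) (fun u => if u == t0 then 1 else 0)).
apply: (vec_mstate hp hT hB (gns_prep phi)) => //.
- by move=> w _; rewrite mul1r.
- by move=> a w _; exact: (state_bound hp).
rewrite (bigD1 t0) //= eqxx big1 ?addr0 => [|u /negbTE ->]; last by rewrite /sqn (form0l hT hB).
by rewrite /sqn /gns star1 mul1r Re_cplx; case: hs.
Qed.

Theorem Gamma_boundary_exists m n (s : 'M[A]_n.+1) : (forall i j, S (s i j)) ->
  exists (H : hilbertType R) (E : nat -> set H) (f : A -> H -> H),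
    Gamma_boundary_rep S E f /\
    mxcsn (cssn m) s <= opq (layer E m) (@ip R H) f s.
Proof.
move=> Ss; have S0 : S 0 by case: opS => h _ _; exact: subsp0 h.
pose T := ('I_n.+1 + 'I_n.+1)%type.
have Sc (u w : T) : S (corner s u w) by case: u => i; case: w => j //=; exact: Ss.
have [phi hphi] := choice_ex (P := fun k (phi : (T -> T -> A) -> R) =>
  [/\ mstate (@cssn R A k) phi, forall psi, mstate (@cssn R A k) psi -> psi (corner s) <= phi (corner s),
     forall psi, msRel S k phi psi -> psi = phi &
     forall G, dilation (@cssn R A k) S phi G -> forall a b d, G a b d = Bf phi (lm a b) d])
  (fun k => extremal_mstate opS genS (mstate_exists k (inl ord0 : T)) Sc).
have hm k : mstate (@cssn R A k) (phi k) by case: (hphi k).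
pose H : hilbertType R := rkhs (gspace hm).
pose E : nat -> set H := gE (hphi := hm); pose f : A -> H -> H := gf (hphi := hm).
have hbr k : m_boundary_rep k S (layer E k) f.
  by apply: level_boundary; case: (hphi k).
have hG : Gamma_boundary_rep S E f.
  by split; [exact: gquantized|exact: glocal|].
exists H, E, f; split=> //.
have [hK _] := layer_closed m (gquantized hm); have hb := hbr m.
have hp := cssn_csn A m; have p1 := @cssn1 R A m.
have cp := csn_qcomplete hp (fun a => lexx (cssn m a)).
have hf := boundary_prep hb; have fb := ip_form (layer E m).
have hbd := boundary_bound hb; have p0 := sc_ge0 hp.
set Q := opq _ _ _ _; have Q0 : 0 <= Q := opq_ge0 hK fb hf p0 hbd s.
(* The value is Re <s x_r, x_l> for two vectors whose squared norms sum to 1, and then the product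
   of their norms is at most 1/2. *)
have top : phi m (corner s) <= Q / 2.
  pose xi (u : T) : H := io hm m (eu u).
  have Kxi u : layer E m (xi u) by rewrite layer_gE; exact: io_gAt.
  have -> : phi m (corner s) = vecf (@ip R H) f xi (corner s).
    have [h1 _ _ _ _] := hm m; rewrite (mst_entries _ h1) /vecf Re_sum.
    apply: eq_bigr => u _; rewrite Re_sum; apply: eq_bigr => w _.
    by rewrite /f /xi gf_io ip_io_io.
  rewrite (vecf_corner s hK fb hf Kxi); apply: le_trans (cabs_Re _) _.
  have nd := Dn_sub hK n.+1; have nf := Bn_form fb n.+1.
  set xr := fun j => xi (inr j); set xl := fun i => xi (inl i).
  have hr : Dn (layer E m) xr by move=> j; exact: Kxi.
  have hl : Dn (layer E m) xl by move=> j; exact: Kxi.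
  apply: le_trans (cauchy_schwarz nd nf (act_st hK hf s hr) hl) _.
  have := opq_le hK fb hf p0 hbd s hr; rewrite -/Q => h.
  have nl0 := fnorm_ge0 (Bn (@ip R H) (n := n.+1)) xl.
  apply: le_trans (ler_wpM2r nl0 h) _; rewrite -mulrA ler_wpM2l //.
  have : fnorm (Bn (@ip R H) (n := n.+1)) xr ^+ 2 + fnorm (Bn (@ip R H) (n := n.+1)) xl ^+ 2 = 1.
    have e1 := etrans (fnorm_sqr nf hr) (sqn_Bn _ _).
    have e2 := etrans (fnorm_sqr nf hl) (sqn_Bn _ _).
    have e3 : \sum_u sqn (@ip R H) (xi u) = 1.
      by apply: etrans (eu_norm1 (hm m)); apply: eq_bigr => u _; rewrite /sqn /xi ip_io_io.
    rewrite big_sumType /= addrC in e3.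
    exact: etrans (congr2 +%R e1 e2) e3.
  exact: mul_le_half.
rewrite (mxcsn_repnorm hp p1 cp); apply: repnorm_le => // psi hs.
have hT := @subspT R A; have hB := gns_form hs; have hg := gns_prep psi.
have sb a w : setT w -> fnorm (gns psi) (a * w) <= cssn m a * fnorm (gns psi) w.
  by move=> _; exact: (state_bound hp).
apply: (le_opq hT hB hg p0 sb) => // v hv.
have nd := Dn_sub hT n.+1; have nf := Bn_form hB n.+1.
pose B := Bn (gns psi) (n := n.+1).
set y := act _ s v; have hy : Dn setT y by [].
have [y0|y0] := eqVneq (fnorm B y) 0.
  by rewrite -/B y0 mulr_ge0 ?fnorm_ge0.
have [v0|v0] := eqVneq (fnorm B v) 0.
  have := opq_le hT hB hg p0 sb s hv; rewrite -/y -/B v0 mulr0 => h.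
  by rewrite mulr0.
have yp : 0 < fnorm B y by rewrite lt_def y0 fnorm_ge0.
have vp : 0 < fnorm B v by rewrite lt_def v0 fnorm_ge0.
(* Both y and v are scaled to squared norm 1/2, so together they form a state whose value at the
   corner is half of |y| / |v|. *)
pose r : R := Num.sqrt (2^-1).
have r2 : r ^+ 2 = 2^-1 by rewrite sqr_sqrtr // invr_ge0.
have r0 : 0 <= r by exact: sqrtr_ge0.
pose al : C := (r / fnorm B y)%:C; pose be : C := (r / fnorm B v)%:C.
pose x (u : T) : A := match u with inl i => (al *: y) i | inr j => (be *: v) j end.
have sal : sqn B (al *: y) = 2^-1.
  rewrite (sqnZ nd nf) // -(fnorm_sqr nf) // cabsR real_normK ?num_real // expr_div_n r2 divfK //.
  by rewrite expf_neq0.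
have sbe : sqn B (be *: v) = 2^-1.
  rewrite (sqnZ nd nf) // -(fnorm_sqr nf) // cabsR real_normK ?num_real // expr_div_n r2 divfK //.
  by rewrite expf_neq0.
have xs : \sum_u sqn (gns psi) (x u) = 1.
  rewrite big_sumType /= -!sqn_Bn sal sbe; lra.
have hx (u : T) : setT (x u) by [].
have mx : mstate (@cssn R A m) (vecf (gns psi) (fun a w : A => a * w) x).
  by apply: (vec_mstate hp hT hB hg) => // w _; rewrite mul1r.
have := le_trans (let: And4 _ h _ _ := hphi m in h _ mx) top.
rewrite (vecf_corner s hT hB hg hx).
have -> : act (fun a w : A => a * w) s (fun j => x (inr j)) = be *: y.
  exact: (actZr hT hg s be hv).
have -> : (fun i => x (inl i)) = al *: y by [].
rewrite (formZl nd nf) // (formZr nd nf) // cjR mulrA (form_sqn nf) //.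
rewrite -!rmorphM /= -(fnorm_sqr nf) // -/B.
have -> : r / fnorm B v * (r / fnorm B y) * fnorm B y ^+ 2 = r ^+ 2 * (fnorm B y / fnorm B v).
  by field; rewrite y0 v0.
rewrite r2 mulrC ler_pM2r ?invr_gt0 // ler_pdivrMr //.
Qed.

(** The quotient norm is at most p_m because q <= p_m. Conversely, the norm of s is at most its
    operator norm on the layer m of some boundary representation; that layer kills J, so its
    operator norm is a C*-seminorm controlled by q. *)
Theorem Ch_ker_inter_boundary : boundary_ideal S (Ch_ker_inter S).
Proof.
have [hS Sst S1] := opS; have S0 := subsp0 hS.
set J := Ch_ker_inter S.
have ker (H : hilbertType R) (E : nat -> set H) f : Gamma_boundary_rep S E f ->
    closed_star_ideal (rep_ker E f) by case=> qE lf _; exact: rep_ker_ideal.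
have hJ : closed_star_ideal J.
  split; first split.
  - by move=> H E f /ker [[]].
  - move=> c a b ha hb H E f hf; have [[_ h] _ _ _] := ker _ _ _ hf.
    by apply: h; [exact: ha|exact: hb].
  - move=> a b hb; split=> H E f hf; have [_ h _ _] := ker _ _ _ hf.
      by have [] := h a b (hb _ _ _ hf).
    by have [] := h a b (hb _ _ _ hf).
  - by move=> b hb H E f hf; have [_ _ h _] := ker _ _ _ hf; exact: h (hb _ _ _ hf).
  - move=> a ca H E f hf; have [_ _ _ h] := ker _ _ _ hf; apply: h.
    by move=> U /ca [b [Jb Ub]]; exists b; split=> //; exact: Jb.
split=> // m n s Ss; have hp := cssn_csn A m; have p1 := @cssn1 R A m.
have cp := csn_qcomplete hp (fun a => lexx (cssn m a)).
have hq := quot_csn_csn hp hJ; have qp := quot_le_self hp hJ.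
set q := quot_csn (cssn m) J in hq qp *.
have cq := csn_qcomplete hq qp.
have [H [E [f [hG hQ]]]] := Gamma_boundary_exists m Ss.
have [qE lf hbr] := hG; have hb := hbr m; have [hK _] := layer_closed m qE.
have fJ b y : J b -> layer E m y -> f b y = 0.
  move=> Jb hy; apply: (Jb _ _ _ hG); exists m => //.
  by case: m hy {hp p1 cp hq qp q cq hQ hb hK} => [|m] //= [].
have fq a x : layer E m x -> hn (f a x) <= q a * hn x.
  by move=> hx; exact: (boundary_quot hb a hJ fJ hx).
have q1 : q 1 = 1.
  apply: le_anti; have := qp 1; rewrite p1 => -> /=.
  have [x hx x0] := boundary_nonzero hK hb.
  have xp : 0 < hn x by rewrite lt_def x0 hn_ge0.
  by have := fq 1 x hx; rewrite (boundary_unital hb) // -[leLHS]mul1r ler_pM2r.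
have [hmq kq] := mxcsn_spec n.+1 hq q1.
apply: le_anti; apply/andP; split.
  apply: (mxcsn_ge hp p1 cp hmq) => y py; apply/kq => i j.
  by apply: le_anti; rewrite (sc_ge0 hq) andbT -(py i j); exact: qp.
apply: le_trans hQ _; apply: (mxcsn_ge hq q1 cq).
  exact: (opq_csn hK (ip_form _) (boundary_prep hb) (sc_ge0 hq) fq).
move=> y qy; apply: le_anti.
rewrite (opq_ge0 hK (ip_form _) (boundary_prep hb) (sc_ge0 hq) fq) andbT.
apply: le_trans (opq_le_sum hK (ip_form _) (boundary_prep hb) (sc_ge0 hq) fq _) _.
by rewrite big1 // => i _; rewrite big1.
Qed.

End Existence.

Theorem theorem3p15 (R : realType) (A : frechetLocCStarType R) (S : set A)
    (sepA : separable A) (opS : local_operator_system S)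
    (genS : generates S) :
  shilov_boundary_ideal S (Ch_ker_inter S).
Proof.
split; first exact: Ch_ker_inter_boundary.
move=> I hI a Ia H E f hf; exact: (boundary_ideal_ker opS hI hf).
Qed.
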